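(* Let $C>0$, $a_1\ge1$, $a_2>0$, $A>0$, $N\in\mathbb N_0$ and $\nu$ be such that for all $\xi\in\Gamma_0$ $$\sum_{x\in\xi}\int_{\Gamma_0}\bigl|K^{-1}d(x,\cdot\cup\xi\setminus x)\bigr|(\eta)\,C^{|\eta|}\,d\lambda(\eta)\le a_1 D(\xi),\qquad \sum_{x\in\xi}\int_{\Gamma_0}\bigl|K^{-1}b(x,\cdot\cup\xi\setminus x)\bigr|(\eta)\,C^{|\eta|}\,d\lambda(\eta)\le a_2 D(\xi),$$ $$d(x,\xi)\le A(1+|\xi|)^N\nu^{|\xi|}\quad\text{for } \xi\in\Gamma_0,\ x\notin\xi,$$ and $$1\le\nu<\frac{C}{a_2}\Bigl(\frac32-a_1\Bigr).$$ Let $\alpha$ satisfy $$\frac{a_2}{C\bigl(\frac32-a_1\bigr)}<\alpha<\frac1\nu .$$ Then for any $k_0\in\overline{\mathcal K_{\alpha C}}$ there exists a unique classical solution to the initial value problem $$\frac{\partial}{\partial t}k_t=\widehat L^*k_t,\quad t>0,\qquad k_t\big|_{t=0}=k_0$$ in the space $\overline{\mathcal K_{\alpha C}}$, and this solution is given by $k_t=\widehat T^{\odot\alpha}(t)k_0$. Moreover, $k_0\in\mathcal K_{\alpha C}$ implies $k_t\in\mathcal K_{\alpha C}$.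
   Context: Configurations. $\Gamma$ is the set of all locally finite subsets of $\mathbb R^d$ and $\Gamma_0=\bigsqcup_{n\ge0}\Gamma^{(n)}$ is the set of all finite subsets, where $\Gamma^{(n)}$ is the set of $n$-point subsets (identified with the symmetrization of $\{(x_1,\dots,x_n): x_i\ne x_j\}$, with the corresponding Borel $\sigma$-algebra; $\Gamma^{(0)}=\{\emptyset\}$). $|\eta|$ is the cardinality. Braces of one-point sets are omitted: $\eta\setminus x$, $\eta\cup x$; and $\cdot\cup\xi\setminus x$ means $\cdot\cup(\xi\setminus x)$. The Lebesgue–Poisson measure $\lambda$ on $\Gamma_0$ is given by $\int_{\Gamma_0}G\,d\lambda=G(\emptyset)+\sum_{n\ge1}\frac1{n!}\int_{(\mathbb R^d)^n}G(\{x_1,\dots,x_n\})\,dx_1\cdots dx_n$. A set $M\in\mathcal B(\Gamma_0)$ is bounded if $M\subset\bigsqcup_{n=0}^N\{\eta\subset\Lambda:|\eta|=n\}$ for some $N\in\mathbb N$ and some bounded Borel $\Lambda\subset\mathbb R^d$. For a function $F$ finite on $\Gamma_0$, $(K^{-1}F)(\eta)=\sum_{\xi\subset\eta}(-1)^{|\eta\setminus\xi|}F(\xi)$, and $|K^{-1}F|(\eta)$ denotes $|(K^{-1}F)(\eta)|$. Rates. $d,b:\mathbb R^d\times\Gamma\to[0,+\infty]$ are measurable (death and birth rates) and satisfy the standing assumptions: $d(x,\eta),b(x,\eta)>0$ for $\eta\in\Gamma_0\setminus\{\emptyset\}$, $x\in\mathbb R^d\setminus\eta$; $d(x,\eta),b(x,\eta)<\infty$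 for $\eta\in\Gamma_0$, $x\in\mathbb R^d\setminus\eta$; $\int_M(d(x,\eta)+b(x,\eta))\,d\lambda(\eta)<\infty$ for every bounded $M\in\mathcal B(\Gamma_0)$ and a.a. $x\in\mathbb R^d$; $\int_\Lambda(d(x,\eta)+b(x,\eta))\,dx<\infty$ for every $\eta\in\Gamma_0$ and bounded Borel $\Lambda$. Spaces and operators. $D(\eta)=\sum_{x\in\eta}d(x,\eta\setminus x)$. $\mathcal L_C=L^1(\Gamma_0,C^{|\cdot|}d\lambda)$ with norm $\|\cdot\|_C$. $\mathcal D=\{G\in\mathcal L_C: D(\cdot)G\in\mathcal L_C\}$. For $G\in\mathcal D$ and $\lambda$-a.a. $\eta$, $$(\widehat LG)(\eta)=-\sum_{\xi\subset\eta}G(\xi)\sum_{x\in\xi}\bigl(K^{-1}d(x,\cdot\cup\xi\setminus x)\bigr)(\eta\setminus\xi)+\sum_{\xi\subset\eta}\int_{\mathbb R^d}G(\xi\cup x)\bigl(K^{-1}b(x,\cdot\cup\xi)\bigr)(\eta\setminus\xi)\,dx.$$ Under the hypotheses, $(\widehat L,\mathcal D)$ generates a (holomorphic) $C_0$-semigroup $\widehat T(t)$ on $\mathcal L_C$. Dual objects. $\mathcal K_C=\{k:\Gamma_0\to\mathbb R \mid k\,C^{-|\cdot|}\in L^\infty(\Gamma_0,\lambda)\}$ with norm $\|k\|_{\mathcal K_C}=\|C^{-|\cdot|}k\|_{L^\infty(\lambda)}$; it is identified with the dual of $\mathcal L_C$ through the pairing $\langle\!\langle G,k\rangle\!\rangle=\int_{\Gamma_0}Gk\,d\lambda$.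 $\widehat L^*$ with domain $\mathrm{Dom}(\widehat L^* )\subset\mathcal K_C$ is the adjoint of $(\widehat L,\mathcal D)$ and $\widehat T^*(t)$ is the adjoint semigroup on $\mathcal K_C$, both with respect to this pairing. All closures (overlines) are taken in the norm of $\mathcal K_C$. $\widehat T^\odot(t)$ is the restriction of $\widehat T^*(t)$ to the invariant subspace $\overline{\mathrm{Dom}(\widehat L^* )}$, where it is a $C_0$-semigroup. Under the hypotheses $\overline{\mathcal K_{\alpha C}}\subset\overline{\mathrm{Dom}(\widehat L^* )}$ is $\widehat T^\odot(t)$-invariant, and $\widehat T^{\odot\alpha}(t)$ denotes the restriction of $\widehat T^\odot(t)$ to $\overline{\mathcal K_{\alpha C}}$ (equipped with $\|\cdot\|_{\mathcal K_C}$); its generator is $\widehat L^{\odot\alpha}k=\widehat L^*k$ with domain $\{k\in\mathrm{Dom}(\widehat L^* )\cap\overline{\mathcal K_{\alpha C}}:\widehat L^*k\in\overline{\mathcal K_{\alpha C}}\}$. A classical solution in $\overline{\mathcal K_{\alpha C}}$ is a function $t\mapsto k_t\in\overline{\mathcal K_{\alpha C}}$, continuous on $[0,\infty)$ and continuously differentiable on $(0,\infty)$ in $\|\cdot\|_{\mathcal K_C}$, with $k_t\in\mathrm{Dom}(\widehat L^{\odot\alpha})$ for $t>0$, satisfying the equation for $t>0$ and the initial condition. *)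

(* Defs.v *)
From HB Require Import structures.
From mathcomp Require Import all_boot all_order all_algebra finmap.
From mathcomp Require Import all_classical all_reals all_analysis.
From mathcomp Require Import measurable_realfun.

Set Implicit Arguments.
Unset Strict Implicit.
Unset Printing Implicit Defensive.

Import Order.TTheory GRing.Theory Num.Theory.
Import numFieldNormedType.Exports.

Local Open Scope classical_set_scope.
Local Open Scope ring_scope.

Section tuple_measure.
Context d (T : measurableType d) (R : realType).
Variable mu : {sigma_finite_measure set T -> \bar R}.

Section cons.
Variables (n : nat) (nu : {sigma_finite_measure set (n.-tuple T) -> \bar R}).

Definition tcons (p : T * n.-tuple T) : n.+1.-tuple T := [tuple of p.1 :: p.2].

Lemma measurable_tcons : measurable_fun setT tcons.
Proof.
exact: (@measurable_cons _ _ _ _ fst n snd).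
Qed.

Definition cons_measure : set (n.+1.-tuple T) -> \bar R :=
  pushforward (mu \x nu)%E tcons.

Let cons_measure0 : cons_measure set0 = 0%E.
Proof. by rewrite /cons_measure /pushforward preimage_set0 measure0. Qed.

Let cons_measure_ge0 A : (0 <= cons_measure A)%E.
Proof.
by rewrite /cons_measure /pushforward; apply: integral_ge0.
Qed.

Let cons_measure_sigma_additive : semi_sigma_additive cons_measure.
Proof.
move=> F mF tF mUF; rewrite /cons_measure /pushforward preimage_bigcup.
have mt A : measurable A -> measurable (tcons @^-1` A).
  by move=> mA; rewrite -[X in measurable X]setTI; exact: measurable_tcons.
apply: measure_semi_sigma_additive.
- by move=> k; exact: mt.
- apply/trivIsetP => /= i j _ _ ij; rewrite -preimage_setI.
  by move/trivIsetP : tF => /(_ _ _ _ _ ij) ->//; rewrite preimage_set0.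
- by rewrite -preimage_bigcup; exact: mt.
Qed.

HB.instance Definition _ := isMeasure.Build _ _ _ cons_measure
  cons_measure0 cons_measure_ge0 cons_measure_sigma_additive.

Let cons_measure_sigma_finite : sigma_finite setT cons_measure.
Proof.
have /sigma_finiteP[F [TF ndF Foo]] := sigma_finiteT mu.
have /sigma_finiteP[G [TG ndG Goo]] := sigma_finiteT nu.
pose g (t : n.+1.-tuple T) : T * n.-tuple T :=
  (tnth t ord0, [tuple of behead t]).
have mg : measurable_fun setT g.
  by apply: measurable_fun_pair; [exact: measurable_tnth|exact: measurable_behead].
have gK p : g (tcons p) = p.
  by case: p => x t; congr pair; apply: val_inj.
exists (fun i => g @^-1` (F i `*` G i)).
  rewrite predeqE => t; split=> // _.
  have [k _ Fk] : (\bigcup_i F i) (g t).1 by rewrite -TF.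
  have [l _ Gl] : (\bigcup_i G i) (g t).2 by rewrite -TG.
  exists (maxn k l) => //; split.
  - by move: Fk; exact/subsetPset/ndF/leq_maxl.
  - by move: Gl; exact/subsetPset/ndG/leq_maxr.
move=> i; have [mFi Fi] := Foo i; have [mGi Gi] := Goo i; split.
  by rewrite -[X in measurable X]setTI; apply: mg => //; exact: measurableX.
rewrite /cons_measure /pushforward -comp_preimage.
rewrite (_ : g \o tcons = id); last by apply/funext => p; exact: gK.
by rewrite preimage_id product_measure1E// lte_mul_pinfty// ge0_fin_numE.
Qed.

HB.instance Definition _ := Measure_isSigmaFinite.Build _ _ _ cons_measure
  cons_measure_sigma_finite.

End cons.

Fixpoint tuple_measure n : {sigma_finite_measure set (n.-tuple T) -> \bar R} :=
  match n with
  | 0%N => dirac ([tuple] : 0.-tuple T)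
  | n'.+1 => cons_measure (tuple_measure n')
  end.

End tuple_measure.

(* R^m with its Borel sigma-algebra. The alias measurableTypeR is the carrier
   of the library's Lebesgue measure. *)
Notation Rspace R m := (m.-tuple (measurableTypeR R)).

Definition lebesgueRm (R : realType) (m : nat) :
    {sigma_finite_measure set (Rspace R m) -> \bar R} :=
  tuple_measure
    (@lebesgue_measure R : {sigma_finite_measure set (measurableTypeR R) -> \bar R}) m.

Definition bounded_region (R : realType) (m : nat) (L : set (Rspace R m)) : Prop :=
  exists M : R, forall x, L x -> forall i : 'I_m, `|tnth x i : R| <= M.

Section configurations.
Variables (R : realType) (m : nat).

Record config := Config {
  config_set :> set (Rspace R m);
  config_locally_finite : forall L, bounded_region L -> finite_set (config_set `&` L) }.

Lemma set0_locally_finite (L : set (Rspace R m)) :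
  bounded_region L -> finite_set (set0 `&` L).
Proof. by rewrite set0I. Qed.

HB.instance Definition _ := gen_eqMixin config.
HB.instance Definition _ := gen_choiceMixin config.
HB.instance Definition _ := isPointed.Build config (Config set0_locally_finite).

(* Generators of the Borel sigma-algebra of the vague topology: the counting
   maps g |-> |g `&` L| for bounded Borel L. *)
Definition config_counting : set (set config) :=
  [set E | exists L (n : nat), [/\ measurable L, bounded_region L
    & E = [set g : config | (g `&` L #= `I_n)%card]]].

HB.instance Definition _ := @isMeasurable.Build (sigma_display config_counting)
  config <<s config_counting >> (@sigma_algebra0 _ setT config_counting)
  (@sigma_algebraC _ config_counting)
  (@sigma_algebra_bigcup _ setT config_counting).

Definition fconfig := {fset (Rspace R m)}.

HB.instance Definition _ := Choice.on fconfig.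
HB.instance Definition _ := isPointed.Build fconfig (fset0 : {fset _}).

Lemma fconfig_locally_finite (eta : fconfig) (L : set (Rspace R m)) :
  bounded_region L -> finite_set ([set` eta] `&` L).
Proof. by move=> _; apply: finite_setIl; exact: finite_fset. Qed.

Definition config_of (eta : fconfig) : config :=
  Config (@fconfig_locally_finite eta).

Definition fconfig_of n (t : n.-tuple (Rspace R m)) : fconfig :=
  [fset x in tval t]%fset.

Definition ordered n (A : set fconfig) : set (n.-tuple (Rspace R m)) :=
  [set t : n.-tuple (Rspace R m) | uniq t /\ A (fconfig_of t)].
Arguments ordered : clear implicits.

Lemma measurable_uniq_tuple n :
  measurable [set t : n.-tuple (Rspace R m) | uniq t].
Proof.
have meq (i j : 'I_n) : measurable
    [set t : n.-tuple (Rspace R m) | tnth t i = tnth t j].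
  have mt (a : 'I_n) (l : 'I_m) : measurable_fun setT
      (fun t : n.-tuple (Rspace R m) => tnth (tnth t a) l : R).
    apply: (@measurableT_comp _ _ _ _ _ _ (fun x : Rspace R m => tnth x l)).
      exact: measurable_tnth.
    exact: measurable_tnth.
  rewrite [X in measurable X](_ : _ = \bigcap_(l in [set: 'I_m])
    [set t : n.-tuple (Rspace R m) | tnth (tnth t i) l == tnth (tnth t j) l]).
    apply: fin_bigcap_measurable; first exact: finite_finset.
    move=> l _; have := measurable_fun_eqr (mt i l) (mt j l).
    by move=> /(_ measurableT [set true] I); rewrite setTI.
  apply/seteqP; split => t /=; first by move=> ij l _ /=; rewrite ij.
  by move=> tij; apply: eq_from_tnth => l; exact/eqP/tij.
rewrite [X in measurable X](_ : _ =
  \bigcap_(ij in [set ij : 'I_n * 'I_n | ij.1 != ij.2])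
    ~` [set t : n.-tuple (Rspace R m) | tnth t ij.1 = tnth t ij.2]).
  apply: fin_bigcap_measurable; first exact: finite_finset.
  by move=> ij _; apply: measurableC; exact: meq.
apply/seteqP; split => t /=.
  by move=> /tuple_uniqP tu [i j] /= /eqP ij /tu.
move=> tn; apply/tuple_uniqP => i j tij; apply/eqP/negPn/negP => ij.
exact: (tn (i, j)).
Qed.

(* The n-point part is the symmetrization of the n-tuples of distinct points,
   so a set of configurations is Borel when, for every n, the ordered tuples
   over it form a Borel set. *)
Definition fconfig_measurable : set (set fconfig) :=
  [set A | forall n, measurable (ordered n A)].

Let fconfig_measurable0 : fconfig_measurable set0.
Proof.
move=> n; rewrite (_ : ordered n set0 = set0)//.
by apply/seteqP; split => // t [].
Qed.

Let fconfig_measurableC A : fconfig_measurable A -> fconfig_measurable (~` A).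
Proof.
move=> mA n; rewrite (_ : ordered n (~` A) =
  [set t : n.-tuple (Rspace R m) | uniq t] `\` ordered n A).
  by apply: measurableD; [exact: measurable_uniq_tuple|exact: mA].
apply/seteqP; split => t [/= ut nA]; split => //; first by case.
by move=> At; apply: nA.
Qed.

Let ordered_bigcup n (F : (set fconfig)^nat) :
  ordered n (\bigcup_i F i) = \bigcup_i ordered n (F i).
Proof.
apply/seteqP; split => t /=; first by move=> [ut [i _ Fi]]; exists i.
by move=> [i _ [ut Fi]]; split => //; exists i.
Qed.

Let fconfig_measurable_bigcup (F : (set fconfig)^nat) :
  (forall i, fconfig_measurable (F i)) -> fconfig_measurable (\bigcup_i F i).
Proof.
move=> mF n; rewrite ordered_bigcup.
by apply: bigcupT_measurable => i; exact: mF.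
Qed.

HB.instance Definition _ := @isMeasurable.Build default_measure_display fconfig
  fconfig_measurable fconfig_measurable0 fconfig_measurableC
  fconfig_measurable_bigcup.

(* The tuples excluded by uniq in ordered are Lebesgue-null as soon as m > 0. *)
Definition npoint_measure n : set fconfig -> \bar R :=
  fun A => tuple_measure (lebesgueRm R m) n (ordered n A).

Let npoint_measure0 n : npoint_measure n set0 = 0%E.
Proof.
rewrite /npoint_measure (_ : ordered n set0 = set0) ?measure0//.
by apply/seteqP; split => // t [].
Qed.

Let npoint_measure_ge0 n A : (0 <= npoint_measure n A)%E.
Proof. exact: measure_ge0. Qed.

Let npoint_measure_sigma_additive n : semi_sigma_additive (npoint_measure n).
Proof.
move=> F mF tF mUF; rewrite /npoint_measure ordered_bigcup.
apply: measure_semi_sigma_additive.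
- by move=> i; exact: mF.
- apply/trivIsetP => /= i j _ _ ij.
  move/trivIsetP : tF => /(_ _ _ I I ij) Fij.
  apply/seteqP; split => // t [[_ Fi] [_ Fj]].
  by have : (F i `&` F j) (fconfig_of t) by []; rewrite Fij.
- by rewrite -ordered_bigcup; exact: mUF.
Qed.

HB.instance Definition _ n := isMeasure.Build _ _ _ (npoint_measure n)
  (@npoint_measure0 n) (@npoint_measure_ge0 n) (@npoint_measure_sigma_additive n).

Definition lebesgue_poisson : {measure set fconfig -> \bar R} :=
  mseries (fun n => mscale ((n`!)%:R^-1 : R)%:nng (npoint_measure n)) 0.

Definition bounded_event (M : set fconfig) : Prop :=
  exists (n : nat) (L : set (Rspace R m)), [/\ measurable L, bounded_region L
    & forall eta, M eta -> (#|` eta| <= n)%N /\ [set` eta] `<=` L].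

End configurations.

Arguments ordered {R m} n A.
Arguments lebesgue_poisson : clear implicits.

Definition rate (R : realType) (m : nat) := Rspace R m -> config R m -> \bar R.

Record standing_rates (R : realType) (m : nat) (d b : rate R m) : Prop := {
  death_measurable :
    measurable_fun setT (fun p : Rspace R m * config R m => d p.1 p.2);
  birth_measurable :
    measurable_fun setT (fun p : Rspace R m * config R m => b p.1 p.2);
  rates_ge0 : forall x g, (0 <= d x g)%E /\ (0 <= b x g)%E;
  rates_gt0 : forall x (eta : fconfig R m), eta != fset0 -> x \notin eta ->
    (0 < d x (config_of eta))%E /\ (0 < b x (config_of eta))%E;
  rates_fin : forall x (eta : fconfig R m), x \notin eta ->
    (d x (config_of eta) < +oo)%E /\ (b x (config_of eta) < +oo)%E;
  rates_integrable_config : forall M : set (fconfig R m),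
    measurable M -> bounded_event M ->
    {ae lebesgueRm R m, forall x, (\int[lebesgue_poisson R m]_(eta in M)
      (d x (config_of eta) + b x (config_of eta)) < +oo)%E};
  rates_integrable_space : forall (eta : fconfig R m) (L : set (Rspace R m)),
    measurable L -> bounded_region L ->
    (\int[lebesgueRm R m]_(x in L)
      (d x (config_of eta) + b x (config_of eta)) < +oo)%E }.

Section operators.
Variables (R : realType) (m : nat).
Local Notation LP := (lebesgue_poisson R m).
Implicit Types (F G k : fconfig R m -> R) (eta xi : fconfig R m).

Definition Kinv F eta : R :=
  \sum_(xi <- fpowerset eta) (-1) ^+ #|` (eta `\` xi)%fset| * F xi.

(* Under standing_rates an infinite value r x eta occurs only when x \in eta;
   fine sends it to 0. In the integrals below such points are null. *)
Definition frate (r : rate R m) (x : Rspace R m) eta : R :=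
  fine (r x (config_of eta)).

Definition Dtot (d : rate R m) eta : R :=
  \sum_(x <- eta) frate d x (eta `\ x)%fset.

Definition Kinv_sum (r : rate R m) (C : R) xi : \bar R :=
  (\sum_(x <- xi) \int[LP]_eta
    (`|Kinv (fun zeta => frate r x (zeta `|` (xi `\ x))%fset) eta|
      * C ^+ #|` eta|)%:E)%E.

(* L_C and K_C are sets of representatives, as Lfun is: their elements are to
   be compared up to lebesgue_poisson-a.e. equality. *)

Definition LC (C : R) : set (fconfig R m -> R) :=
  [set G | (fun eta => C ^+ #|` eta| * G eta) \in Lfun LP 1].

Definition normLC (C : R) G : \bar R :=
  'N[LP]_1[(fun eta => (C ^+ #|` eta| * G eta)%:E)]%E.

Definition KC (C : R) : set (fconfig R m -> R) :=
  [set k | (fun eta => C ^- #|` eta| * k eta) \in Lfun LP +oo%E].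

Definition normKC (C : R) k : \bar R :=
  'N[LP]_+oo[(fun eta => (C ^- #|` eta| * k eta)%:E)]%E.

Definition pairing G k : R := \int[LP]_eta (G eta * k eta).

Definition closureKC (C : R) (S : set (fconfig R m -> R)) :
    set (fconfig R m -> R) :=
  [set k | KC C k /\ forall e : R, 0 < e ->
    exists2 k', S k' & (normKC C (k \- k')%R < e%:E)%E].

Definition Ddom (d : rate R m) (C : R) : set (fconfig R m -> R) :=
  [set G | LC C G /\ LC C (fun eta => Dtot d eta * G eta)].

Definition Lhat (d b : rate R m) G eta : R :=
  - (\sum_(xi <- fpowerset eta) G xi * \sum_(x <- xi)
      Kinv (fun zeta => frate d x (zeta `|` (xi `\ x))%fset) (eta `\` xi)%fset)
  + \sum_(xi <- fpowerset eta) \int[lebesgueRm R m]_x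
      (G (x |` xi)%fset
        * Kinv (fun zeta => frate b x (zeta `|` xi)%fset) (eta `\` xi)%fset).

(* T t is only constrained for 0 <= t. *)
Record C0_semigroup (C : R) (T : R -> (fconfig R m -> R) -> fconfig R m -> R) :
    Prop := {
  semigroup_stable : forall t G, 0 <= t -> LC C G -> LC C (T t G);
  semigroup_linear : forall t (a : R) G H, 0 <= t -> LC C G -> LC C H ->
    T t (fun eta => a * G eta + H eta)
      = (fun eta => a * T t G eta + T t H eta) %[ae LP];
  semigroup_bounded : forall t, 0 <= t -> exists M : R, forall G, LC C G ->
    (normLC C (T t G) <= M%:E * normLC C G)%E;
  semigroup0 : forall G, LC C G -> T 0 G = G %[ae LP];
  semigroupD : forall s t G, 0 <= s -> 0 <= t -> LC C G ->
    T (s + t) G = T s (T t G) %[ae LP];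
  semigroup_cont : forall G, LC C G ->
    normLC C (T t G \- G) @[t --> 0^'+] --> 0%E }.

Definition right_derivative0 (C : R)
    (T : R -> (fconfig R m -> R) -> fconfig R m -> R) G H : Prop :=
  normLC C (fun eta => t^-1 * (T t G eta - G eta) - H eta) @[t --> 0^'+] --> 0%E.

(* T is a C0-semigroup on L_C whose generator is (L, dom). *)
Definition generates (C : R) (L : (fconfig R m -> R) -> fconfig R m -> R)
    (dom : set (fconfig R m -> R))
    (T : R -> (fconfig R m -> R) -> fconfig R m -> R) : Prop :=
  [/\ C0_semigroup C T,
      forall G, dom G <->
        LC C G /\ exists2 H, LC C H & right_derivative0 C T G H
    & forall G, dom G -> LC C (L G) /\ right_derivative0 C T G (L G)].

(* Graph of the adjoint of (S, dom) with respect to the pairing: when dom is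
   dense, k' is determined by k up to a.e. equality. *)
Definition adjoint (C : R) (dom : set (fconfig R m -> R))
    (S : (fconfig R m -> R) -> fconfig R m -> R) k k' : Prop :=
  [/\ KC C k, KC C k' & forall G, dom G -> pairing (S G) k = pairing G k'].

Section dual.
Variables (d b : rate R m) (C alpha : R).
Variable T : R -> (fconfig R m -> R) -> fconfig R m -> R.

Definition Lstar := adjoint C (Ddom d C) (Lhat d b).

Definition dom_Lstar : set (fconfig R m -> R) :=
  [set k | exists k', Lstar k k'].

Definition Kalpha : set (fconfig R m -> R) := closureKC C (KC (alpha * C)).

Definition Tstar (t : R) := adjoint C (LC C) (T t).

(* Graphs of the restrictions of Tstar t, first to the closure of the domain of
   Lstar, then to Kalpha. *)
Definition Tsun (t : R) k k' : Prop := closureKC C dom_Lstar k /\ Tstar t k k'.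

Definition Tsun_alpha (t : R) k k' : Prop := Kalpha k /\ Tsun t k k'.

(* Graph of the generator of the semigroup Tsun_alpha: the part of Lstar in
   Kalpha. *)
Definition Lsun_alpha k k' : Prop := [/\ Lstar k k', Kalpha k & Kalpha k'].

Record classical_solution (k0 : fconfig R m -> R) (u : R -> fconfig R m -> R) :
    Prop := {
  sol_space : forall t, 0 <= t -> Kalpha (u t);
  sol_continuous : forall t, 0 <= t ->
    normKC C (u s \- u t) @[s --> within [set s | 0 <= s] (nbhs t)] --> 0%E;
  sol_dom : forall t, 0 < t -> exists k', Lsun_alpha (u t) k';
  sol_equation : exists v : R -> fconfig R m -> R,
    [/\ forall t, 0 < t -> Kalpha (v t),
        forall t, 0 < t ->
          normKC C (fun eta => h^-1 * (u (t + h) eta - u t eta) - v t eta)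
            @[h --> 0^'] --> 0%E,
        forall t, 0 < t -> normKC C (v s \- v t) @[s --> t] --> 0%E
      & forall t, 0 < t -> Lstar (u t) (v t)];
  sol_init : u 0 = k0 %[ae LP] }.

End dual.
End operators.

(* Main.v *)
(** By the bounds on K^-1 d and K^-1 b, the part of Lhat off the diagonal -D has
    D-bound q = a1 - 1 + a2 / (alpha C) < 1/2 in the L1-norm with weight C^|eta|
    and also in the one with weight (alpha C)^|eta|. Since the norms are of L1
    type, this gives |G| + h (1 - q) |D G| <= |G - h Lhat G| for h > 0: Lhat is
    dissipative, its resolvent is a Neumann series, backward Euler steps build the
    semigroup (Hille-Yosida), and the extra term yields t |Lhat T(t) G| <= c |G|,
    hence the smoothness of the orbits for t > 0. The same inequality in the
    second weight makes K_(alpha C) invariant under the adjoint semigroup. As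
    alpha nu < 1, the growth condition bounds alpha^|.| D, so that K_(alpha C)
    lies in the domain of the adjoint and the dual orbit is continuous at 0.
    Orbits of the adjoint are realised by densities through the duality of L1
    and L-infinity. A solution k is unique because s |-> <<T(t - s) G, k_s>> is
    constant. *)

(* The theorem quantifies over every semigroup [T] generated by [Lhat], not only over the
   constructed one, so contractivity and smoothing are read off the resolvent inequality along an
   arbitrary orbit. [T] acts on representatives; [iota] carries it to the quotient [L1], where
   operators are genuine linear maps. Multiplication by $C^{|\eta|}$ removes the weight: $\mathcal
   L_C$ becomes $L^1(\lambda)$, $\mathcal K_C$ becomes $L^\infty(\lambda)$, and $\mathcal K_{\alpha
   C}$ consists of the functions bounded by a multiple of [rho], that is $\alpha^{|\eta|}\le 1$. The
   adjoint semigroup need not be strongly continuous, and no vector-valued integral is used: an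
   estimate in $\mathcal K_C$ is one for real functions $s\mapsto\langle\!\langle
   T(s)G,k\rangle\!\rangle$, uniform over $G$ in a dense domain. The smoothing constant is
   $\kappa=(1-q)/(1+q)$, because $\|\widehat LG\|\le(1+q)\|DG\|$ turns the surplus $h(1-q)\|DG\|$
   into $h\kappa\|\widehat LG\|$. Integrals over $\Gamma_0$ are computed on lists of points, where
   recursion on the head reduces the combinatorics of subsets to Tonelli's theorem. *)
From HB Require Import structures.
Require Import Defs.
From mathcomp Require Import all_boot all_order all_algebra finmap.
From mathcomp Require Import all_classical all_reals all_analysis.
From mathcomp Require Import measurable_realfun ess_sup_inf.
From mathcomp Require Import ring lra.

Set Implicit Arguments.
Unset Strict Implicit.
Unset Printing Implicit Defensive.

Import Order.TTheory GRing.Theory Num.Theory.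
Import numFieldNormedType.Exports.

Local Open Scope classical_set_scope.
Local Open Scope ring_scope.

(** * Module identities *)

(* The square-zero extension of R by V is a commutative ring containing both,
   so the ring tactic decides identities between elements of V. *)
Section square_zero_extension.
Variables (R : comNzRingType) (V : lmodType R).

Definition sqz : Type := (R * V)%type.
HB.instance Definition _ := GRing.Zmodule.on sqz.

Let one : sqz := (1, 0).
Let mul (u v : sqz) : sqz := (u.1 * v.1, u.1 *: v.2 + v.1 *: u.2).

Let mulA : associative mul.
Proof.
move=> [a x] [b y] [c z]; rewrite /mul /=; congr pair; first exact: mulrA.
by rewrite !scalerDr !scalerA addrA (mulrC c a) (mulrC c b).
Qed.

Let mulC : commutative mul.
Proof. by move=> [a x] [b y]; rewrite /mul /= mulrC addrC. Qed.

Let mul1 : left_id one mul.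
Proof. by move=> [a x]; rewrite /mul /= mul1r scale1r scaler0 addr0. Qed.

Let mulD : left_distributive mul +%R.
Proof.
move=> [a x] [b y] [c z]; rewrite /mul /=; congr pair; first exact: mulrDl.
by rewrite scalerDl scalerDr addrACA.
Qed.

Let one0 : one != 0.
Proof. by apply/eqP => -[] /eqP; rewrite oner_eq0. Qed.

HB.instance Definition _ :=
  GRing.Zmodule_isComNzRing.Build sqz mulA mulC mul1 mulD one0.

Definition sqz_scalar (a : R) : sqz := (a, 0).
Definition sqz_vector (x : V) : sqz := (0, x).

Let scalar_additive : zmod_morphism sqz_scalar.
Proof. by move=> a b; congr pair; rewrite /= subr0. Qed.
Let scalar_multiplicative : monoid_morphism sqz_scalar.
Proof. by split=> // a b; congr pair; rewrite /= !scaler0 addr0. Qed.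
HB.instance Definition _ :=
  GRing.isZmodMorphism.Build R sqz sqz_scalar scalar_additive.
HB.instance Definition _ :=
  GRing.isMonoidMorphism.Build R sqz sqz_scalar scalar_multiplicative.

Let vector_additive : zmod_morphism sqz_vector.
Proof. by move=> a b; congr pair; rewrite /= subr0. Qed.
HB.instance Definition _ :=
  GRing.isZmodMorphism.Build V sqz sqz_vector vector_additive.

Lemma sqz_vectorZ a x : sqz_vector (a *: x) = sqz_scalar a * sqz_vector x.
Proof. by congr pair; rewrite /= ?mulr0// scale0r addr0. Qed.

Lemma sqz_vector_inj x y : sqz_vector x = sqz_vector y -> x = y.
Proof. by case. Qed.

End square_zero_extension.

Ltac lmod R := apply: (@sqz_vector_inj R);
  rewrite ?(raddf0, raddfD, raddfB, raddfN, raddfMn) /=;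
  rewrite ?(@sqz_vectorZ R) ?(raddf0, raddfD, raddfB, raddfN, raddfMn) /=; ring.

(** * Contraction semigroups *)

Lemma le_of_eq (R : realType) (a b : R) : a = b -> a <= b.
Proof. by move->. Qed.

Section semigroup.
Variables (R : realType) (X : completeNormedModType R).
Variables (dom : set X) (A : X -> X).

Definition operator_on : Prop := [/\ dom 0,
  forall a x y, dom x -> dom y -> dom (a *: x + y) &
  forall a x y, dom x -> dom y -> A (a *: x + y) = a *: A x + A y].

(** Limits of difference quotients are cleared of denominators: the error is at most [e * h].
    [semi_domE] and [semi_gen] together say that [A] on [dom] is the full generator and not merely a
    restriction of it. *)
Record semigroup_of (T : R -> X -> X) : Prop := {
  semi_lin : forall (t a : R) x y, 0 <= t -> T t (a *: x + y) = a *: T t x + T t y;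
  semi_bnd : forall t : R, 0 <= t -> exists M : R, forall x, `|T t x| <= M * `|x|;
  semi_id : forall x, T 0 x = x;
  semi_add : forall (s t : R) x, 0 <= s -> 0 <= t -> T (s + t) x = T s (T t x);
  semi_cont : forall x (e : R), 0 < e -> exists2 d : R, 0 < d &
    forall h : R, 0 < h -> h < d -> `|T h x - x| <= e;
  semi_domE : forall x, dom x <-> exists y, forall e : R, 0 < e ->
    exists2 d : R, 0 < d &
    forall h : R, 0 < h -> h < d -> `|T h x - x - h *: y| <= e * h;
  semi_gen : forall x, dom x -> forall e : R, 0 < e -> exists2 d : R, 0 < d &
    forall h : R, 0 < h -> h < d -> `|T h x - x - h *: A x| <= e * h }.

Hypothesis Aop : operator_on.

Lemma op_domD x y : dom x -> dom y -> dom (x + y).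
Proof. by case: Aop => _ h _ dx dy; have := h 1 x y dx dy; rewrite scale1r. Qed.
Lemma op_domZ a x : dom x -> dom (a *: x).
Proof. by case: Aop => d0 h _ dx; have := h a x 0 dx d0; rewrite addr0. Qed.
Lemma op_domB x y : dom x -> dom y -> dom (x - y).
Proof. by move=> dx dy; rewrite -scaleN1r; apply: op_domD => //; exact: op_domZ. Qed.
Lemma opD x y : dom x -> dom y -> A (x + y) = A x + A y.
Proof. by case: Aop => _ _ h dx dy; have := h 1 x y dx dy; rewrite !scale1r. Qed.
Lemma op0 : A 0 = 0.
Proof.
case: Aop => d0 _ _; apply: (@addrI _ (A 0)).
by rewrite -opD// !addr0.
Qed.
Lemma opZ a x : dom x -> A (a *: x) = a *: A x.
Proof.
by case: Aop => d0 _ h dx; have := h a x 0 dx d0; rewrite op0 !addr0.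
Qed.
Lemma opB x y : dom x -> dom y -> A (x - y) = A x - A y.
Proof.
move=> dx dy; rewrite -scaleN1r opD//; last exact: op_domZ.
by rewrite opZ// scaleN1r.
Qed.

Section properties.
Variable T : R -> X -> X.
Hypothesis ST : semigroup_of T.

Lemma semi_D (t : R) x y : 0 <= t -> T t (x + y) = T t x + T t y.
Proof. by move=> t0; have := semi_lin ST 1 x y t0; rewrite !scale1r. Qed.
Lemma semi_0 (t : R) : 0 <= t -> T t 0 = 0.
Proof.
move=> t0; apply: (@addrI _ (T t 0)).
by rewrite -semi_D// !addr0.
Qed.
Lemma semi_Z (t : R) a x : 0 <= t -> T t (a *: x) = a *: T t x.
Proof. by move=> t0; have := semi_lin ST a x 0 t0; rewrite semi_0// !addr0. Qed.
Lemma semi_B (t : R) x y : 0 <= t -> T t (x - y) = T t x - T t y.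
Proof. by move=> t0; rewrite -scaleN1r semi_D// semi_Z// scaleN1r. Qed.

Lemma generator_unique x y z :
  (forall e : R, 0 < e -> exists2 d : R, 0 < d &
    forall h : R, 0 < h -> h < d -> `|T h x - x - h *: y| <= e * h) ->
  (forall e : R, 0 < e -> exists2 d : R, 0 < d &
    forall h : R, 0 < h -> h < d -> `|T h x - x - h *: z| <= e * h) -> y = z.
Proof.
move=> hy hz; apply/eqP; rewrite -subr_eq0 -normr_le0; apply/ler_addgt0Pl => e e0.
rewrite addr0; have e2 : 0 < e / 2 by lra.
have [d1 d10 h1] := hy _ e2; have [d2 d20 h2] := hz _ e2.
pose h := Num.min d1 d2 / 2.
have m0 : 0 < Num.min d1 d2 by rewrite lt_min d10 d20.
have h0 : 0 < h by rewrite /h; lra.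
have hd1 : h < d1 by apply: (@lt_le_trans _ _ (Num.min d1 d2)); rewrite ?ge_min ?lexx// /h; lra.
have hd2 : h < d2.
  by apply: (@lt_le_trans _ _ (Num.min d1 d2)); rewrite ?ge_min ?lexx ?orbT// /h; lra.
rewrite -(ler_pM2l h0) -[X in X * _ <= _](ger0_norm (ltW h0)) -normrZ.
have -> : h *: (y - z) = (T h x - x - h *: z) - (T h x - x - h *: y) by lmod R.
apply: (le_trans (ler_normB _ _)).
apply: (le_trans (lerD (h2 _ h0 hd2) (h1 _ h0 hd1))); lra.
Qed.

(** The bounded map [T t] commutes with [T h], so it carries the difference quotients of [x] to
    those of [T t x]; these converge, and [semi_domE] places the point in the domain. *)
Lemma semi_dom_comm (t : R) x : 0 <= t -> dom x -> dom (T t x) /\ A (T t x) = T t (A x).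
Proof.
move=> t0 dx.
have key : forall e : R, 0 < e -> exists2 d : R, 0 < d &
    forall h : R, 0 < h -> h < d -> `|T h (T t x) - T t x - h *: T t (A x)| <= e * h.
  move=> e e0; have [M hM] := semi_bnd ST t0.
  pose M1 := `|M| + 1; have M10 : 0 < M1 by rewrite /M1 ltr_wpDl.
  have hM1 y : `|T t y| <= M1 * `|y|.
    apply: (le_trans (hM y)); apply: ler_wpM2r => //.
    by rewrite /M1; apply: (le_trans (ler_norm M)); lra.
  have eM : 0 < e / M1 by rewrite divr_gt0.
  have [d d0 hd] := semi_gen ST dx eM; exists d => // h h0 hlt.
  have -> : T h (T t x) = T t (T h x).
    by rewrite -!(semi_add ST) ?(ltW h0)// addrC.
  rewrite -semi_Z// -!semi_B//; apply: (le_trans (hM1 _)).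
  by rewrite mulrC -ler_pdivlMr// mulrAC; exact: hd.
have dTx : dom (T t x) by apply/(semi_domE ST); exists (T t (A x)).
split=> //; exact: generator_unique (semi_gen ST dTx) key.
Qed.

Lemma semi_dom (t : R) x : 0 <= t -> dom x -> dom (T t x).
Proof. by move=> t0 /(semi_dom_comm t0)[]. Qed.
Lemma semi_comm (t : R) x : 0 <= t -> dom x -> A (T t x) = T t (A x).
Proof. by move=> t0 /(semi_dom_comm t0)[]. Qed.

(** Strong continuity at 0 bounds each orbit near 0, and Banach-Steinhaus makes the bound uniform.
    Otherwise there are times $t_n\le 1/(n+1)$ with $\|T(t_n)\|>n+1$, although the family $T(t_n)$
    is pointwise bounded. *)
Lemma semi_locally_bounded : exists2 d : R, 0 < d & exists2 M : R, 1 <= M &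
  forall (t : R) x, 0 <= t -> t <= d -> `|T t x| <= M * `|x|.
Proof.
have inv0 n : 0 < n.+1%:R^-1 :> R by [].
apply: contrapT => H.
have bad n : exists tx : R * X, [/\ 0 <= tx.1, tx.1 <= n.+1%:R^-1 &
    n.+1%:R * `|tx.2| < `|T tx.1 tx.2|].
  apply: contrapT => Hn; apply: H; exists n.+1%:R^-1; first exact: inv0.
  exists n.+1%:R => [|t x t0 tn]; first by rewrite ler1n.
  by rewrite leNgt; apply/negP => lt; apply: Hn; exists (t, x).
have [u hu] := choice bad.
have lin n : linear (T (u n).1).
  by move=> a x y; apply: (semi_lin ST); case: (hu n).
have := @Banach_Steinhauss R X X [set f | exists n, f = T (u n).1].
case/(_ _ _ 1).
- move=> _ [n ->]; split; last exact: lin.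
  have [M hM] := semi_bnd ST (let: And3 h _ _ := hu n in h).
  move=> r; exists (`|M| * `|r|) => x xr.
  apply: (le_trans (hM x)); apply: (le_trans (ler_norm _)).
  by rewrite normrM ler_pM// normr_id (le_trans xr)// ler_norm.
- move=> x; have [d d0 hd] := semi_cont ST x ltr01.
  have [N hN] : exists N : nat, d^-1 < N%:R.
    by exists (Num.trunc d^-1).+1; exact: truncnS_gt.
  (* The sum covers the finitely many times before [N]; later times are below [d], where the orbit
     stays within 1 of [x]. *)
  exists (`|x| + 1 + \sum_(i < N) `|T (u i).1 x|) => _ [n ->].
  have S0 : 0 <= \sum_(i < N) `|T (u i).1 x| by exact: sumr_ge0.
  have [nN|Nn] := ltnP n N.
    rewrite (bigD1 (Ordinal nN)) //=.
    have : 0 <= \sum_(i < N | i != Ordinal nN) `|T (u i).1 x| by exact: sumr_ge0.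
    by have := normr_ge0 x; lra.
  case: (hu n); rewrite le_eqVlt => /predU1P[<- _ _|t0 tn _].
    by rewrite (semi_id ST); lra.
  have td : (u n).1 < d.
    apply: (le_lt_trans tn); rewrite invf_plt ?posrE//.
    by apply: (lt_le_trans hN); rewrite ler_nat; exact: leqW.
  rewrite -[T _ x](subrK x); apply: (le_trans (ler_normD _ _)).
  by have := hd _ t0 td; lra.
move=> M hM.
have [n hn] : exists n : nat, M < n%:R.
  by exists (Num.trunc M).+1; exact: truncnS_gt.
have [t0 _] := hu n; set x := (u n).2 => hx.
have x0 : 0 < `|x|.
  rewrite normr_gt0; apply/eqP => x0.
  by move: hx; rewrite x0 semi_0// !normr0 mulr0 ltxx.
have : `|T (u n).1 (`|x|^-1 *: x)| <= M.
  by apply: hM; [exists n|rewrite normrZ normrV ?unitfE ?gt_eqF// normr_id mulVf ?gt_eqF].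
rewrite semi_Z// normrZ normrV ?unitfE ?gt_eqF// normr_id mulrC ler_pdivrMr//.
move=> /(lt_le_trans hx); rewrite ltr_pM2r// -natr1 => ?.
lra.
Qed.

Lemma semi_bounded_on (t0 : R) : 0 <= t0 -> exists2 M : R, 1 <= M &
  forall (t : R) x, 0 <= t -> t <= t0 -> `|T t x| <= M * `|x|.
Proof.
have [d d0 [M M1 hM]] := semi_locally_bounded.
have key n : exists2 M : R, 1 <= M &
    forall (t : R) x, 0 <= t -> t <= n%:R * d -> `|T t x| <= M * `|x|.
  elim: n => [|n [K K1 hK]].
    exists 1 => // t x t0' tle; have -> : t = 0 by apply/le_anti; rewrite t0'; lra.
    by rewrite (semi_id ST) mul1r.
  exists (M * K) => [|t x t0' tle]; first by nra.
  have [td|td] := leP t d.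
    apply: (le_trans (hM _ _ t0' td)); rewrite -mulrA; apply: ler_wpM2l; first lra.
    by rewrite ler_peMl.
  have -> : t = d + (t - d) by lra.
  rewrite (semi_add ST); [|lra|lra].
  apply: (le_trans (hM _ _ _ _)) => //; first exact: ltW.
  rewrite -mulrA; apply: ler_wpM2l; first lra.
  by apply: hK; [lra|move: tle; rewrite -natr1; lra].
move=> t00; have [n hn] : exists n : nat, t0 / d <= n%:R.
  by exists (Num.trunc (t0 / d)).+1; apply/ltW/truncnS_gt.
have [K K1 hK] := key n; exists K => // t x t0' tle; apply: hK => //.
by apply: (le_trans tle); rewrite -ler_pdivrMr.
Qed.


Definition dense_in : Prop := forall x (e : R), 0 < e -> exists2 y, dom y & `|x - y| < e.

(** Abstracts the two functionals followed along orbits: the norm and the weighted norm [wnorm]. *)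
Record seminorm_le (q : X -> R) (c : R) : Prop := {
  semn_tri : forall x y, q (x + y) <= q x + q y;
  semn_le : forall x, q x <= c * `|x|}.

(* Backward Euler steps along the orbit: the bound M on [0, t] makes the
   one-step error uniformly o(h). *)
Lemma semi_euler (q p : X -> R) (c : R) x t : seminorm_le q c -> 0 <= c ->
  (forall (h : R) y, 0 < h -> dom y -> q y + h * p y <= q (y - h *: A y)) ->
  dom x -> 0 < t -> forall e : R, 0 < e -> exists N : nat,
  forall n : nat, (N <= n)%N -> forall k, (k <= n.+1)%N ->
    q (T (k%:R * (t / n.+1%:R)) x) +
    \sum_(0 <= i < k) t / n.+1%:R * p (T (i.+1%:R * (t / n.+1%:R)) x) <= q x + e.
Proof.
move=> qc c0 hq dx t0 e e0.
have [M M1 hM] := semi_bounded_on (ltW t0).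
(* Each step costs at most [c * (2 * M * e' * h)] and the steps cover a time at most [t], so the
   total cost is at most [e]; [c + 1] keeps the denominator positive when [c = 0]. *)
pose e' := e / (2 * (c + 1) * M * t).
have D0 : 0 < 2 * (c + 1) * M * t by rewrite !mulr_gt0//; lra.
have e'0 : 0 < e' by rewrite divr_gt0.
have [d1 d10 h1] := semi_gen ST dx e'0.
have [d2 d20 h2] := semi_cont ST (A x) e'0.
pose dl := Num.min d1 d2.
have dl0 : 0 < dl by rewrite lt_min d10 d20.
have [N hN] : exists N : nat, t / dl < N%:R.
  by exists (Num.trunc (t / dl)).+1; exact: truncnS_gt.
exists N => n Nn.
set h := t / n.+1%:R.
have h0 : 0 < h by rewrite divr_gt0.
have hdl : h < dl.
  rewrite /h ltr_pdivrMr// mulrC -ltr_pdivrMr//; apply: (lt_le_trans hN).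
  by rewrite ler_nat leqW.
have hd1 : h < d1 by apply: (lt_le_trans hdl); rewrite ge_min lexx.
have hd2 : h < d2 by apply: (lt_le_trans hdl); rewrite ge_min lexx orbT.
have step s : 0 <= s -> s <= t ->
    q (T (s + h) x) + h * p (T (s + h) x) <= q (T s x) + e / t * h.
  move=> s0 st.
  have sh0 : 0 <= s + h by lra.
  apply: (le_trans (hq _ _ h0 (semi_dom sh0 dx))).
  rewrite semi_comm// !(semi_add ST) ?(ltW h0)//.
  (* The backward Euler step from $T(s+h)x$ returns to $T(s)x$ up to $T(s)$ applied to two small
     terms: the generator remainder of $x$ and $h$ times the continuity defect of $Ax$. *)
  have -> : T s (T h x) - h *: T s (T h (A x)) = T s x +
      (T s (T h x - x - h *: A x) - h *: T s (T h (A x) - A x)).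
    by rewrite !semi_B// semi_Z//; lmod R.
  apply: (le_trans (semn_tri qc _ _)); rewrite lerD2l.
  apply: (le_trans (semn_le qc _)).
  have b1 : `|T s (T h x - x - h *: A x)| <= M * (e' * h).
    apply: (le_trans (hM _ _ s0 st)); rewrite ler_wpM2l//; first lra.
    exact: h1.
  have b2 : `|h *: T s (T h (A x) - A x)| <= M * (e' * h).
    rewrite normrZ gtr0_norm// [leRHS]mulrA [leRHS]mulrC ler_wpM2l//; first lra.
    apply: (le_trans (hM _ _ s0 st)); rewrite ler_wpM2l//; first lra.
    exact: h2.
  apply: (@le_trans _ _ (c * (M * (e' * h) + M * (e' * h)))).
    rewrite ler_wpM2l//; apply: (le_trans (ler_normB _ _)); exact: lerD.
  have -> : e / t * h = (c + 1) * (M * (e' * h) + M * (e' * h)).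
    by rewrite /e'; field; rewrite !gt_eqF//; lra.
  rewrite ler_wpM2r//; last lra.
  have : 0 <= M * (e' * h) by apply: mulr_ge0; [lra|apply: mulr_ge0; exact: ltW].
  by lra.
move=> k kn; apply: (@le_trans _ _ (q x + k%:R * (e / t * h))).
  elim: k kn => [_|k IH kn].
    by rewrite big_nil !mul0r (semi_id ST) !addr0.
  have kh0 : 0 <= k%:R * h by rewrite mulr_ge0// ltW.
  have kht : k%:R * h <= t.
    rewrite /h mulrA ler_pdivrMr// mulrC ler_wpM2l ?(ltW t0)// ler_nat.
    exact: ltnW.
  have E y : k.+1%:R * y = k%:R * y + y :> R by rewrite -natr1 mulrDl mul1r.
  rewrite big_nat_recr//= !E.
  have := step _ kh0 kht; have := IH (ltnW kn).
  by set S := \sum_(0 <= i < k) _; lra.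
rewrite lerD2l.
apply: (@le_trans _ _ (n.+1%:R * (e / t * h))).
  rewrite ler_wpM2r ?ler_nat//; rewrite !mulr_ge0 ?invr_ge0 ?(ltW t0) ?(ltW h0)//; exact: ltW.
by rewrite /h; apply: le_of_eq; field; rewrite (gt_eqF t0) addrC natr1 pnatr_eq0.
Qed.

Lemma semi_seminorm_le (q : X -> R) (c : R) (t : R) x : seminorm_le q c -> 0 <= c ->
  (forall (h : R) y, 0 < h -> dom y -> q y <= q (y - h *: A y)) ->
  dom x -> 0 <= t -> q (T t x) <= q x.
Proof.
move=> qc c0 hq dx; rewrite le_eqVlt => /predU1P[<-|t0].
  by rewrite (semi_id ST).
apply/ler_addgt0Pl => e e0.
have hq' (h : R) y : 0 < h -> dom y -> q y + h * 0 <= q (y - h *: A y).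
  by move=> h0 dy; rewrite mulr0 addr0; exact: hq.
have [N hN] := semi_euler qc c0 hq' dx t0 e0.
have := hN N (leqnn _) N.+1 (leqnn _).
by rewrite big1 ?addr0 => [|i _]; rewrite ?mulr0// mulrCA divff ?pnatr_eq0// mulr1 addrC.
Qed.

Hypothesis dissip : forall (h : R) y, 0 < h -> dom y -> `|y| <= `|y - h *: A y|.
Hypothesis dense : dense_in.

Lemma norm_seminorm : seminorm_le (fun x : X => `|x|) 1.
Proof. by split=> [x y|x]; rewrite ?mul1r// ler_normD. Qed.

Lemma semi_contraction (t : R) x : 0 <= t -> `|T t x| <= `|x|.
Proof.
move=> t0; apply/ler_addgt0Pl => e e0.
have [M hM] := semi_bnd ST t0.
pose M1 := `|M| + 1; have M10 : 0 < M1 by rewrite /M1 ltr_wpDl.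
have hM1 y : `|T t y| <= M1 * `|y|.
  apply: (le_trans (hM y)); apply: ler_wpM2r => //.
  by rewrite /M1; apply: (le_trans (ler_norm M)); lra.
have [|y dy xy] := dense x (e := e / (M1 + 1)); first by rewrite divr_gt0//; lra.
rewrite -[in T t x](subrK y x) semi_D//.
apply: (le_trans (ler_normD _ _)).
have h1 := hM1 (x - y).
have h2 := semi_seminorm_le norm_seminorm ler01 dissip dy t0.
have h3 : `|y| <= `|x| + `|x - y|.
  by rewrite -[in leLHS](subKr x y) (le_trans (ler_normB _ _)).
have h4 : (M1 + 1) * `|x - y| <= e by rewrite mulrC -ler_pdivlMr ?ltW//; lra.
by nra.
Qed.

(** Replaces $T(h)x-x=\int_0^hT(s)Ax\,ds$: the increment is telescoped over short steps, and
    contractivity bounds each of them by the one at time 0. *)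
Lemma semi_lip (h : R) x : 0 <= h -> dom x -> `|T h x - x| <= h * `|A x|.
Proof.
rewrite le_eqVlt => /predU1P[<-|h0] dx; first by rewrite (semi_id ST) subrr normr0 mul0r.
apply/ler_addgt0Pl => e e0.
have eh : 0 < e / h by rewrite divr_gt0.
have [d d0 hd] := semi_gen ST dx eh.
have [N hN] : exists N : nat, h / d < N%:R.
  by exists (Num.trunc (h / d)).+1; exact: truncnS_gt.
set s := h / N.+1%:R.
have s0 : 0 < s by rewrite divr_gt0.
have sd : s < d.
  rewrite /s ltr_pdivrMr// mulrC -ltr_pdivrMr//; apply: (lt_le_trans hN).
  by rewrite ler_nat.
have key k : `|T (k%:R * s) x - x| <= k%:R * (s * (`|A x| + e / h)).
  elim: k => [|k IH]; first by rewrite !mul0r (semi_id ST) subrr normr0.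
  have ks0 : 0 <= k%:R * s by rewrite mulr_ge0// ltW.
  rewrite -natr1 !mulrDl !mul1r (semi_add ST)// ?(ltW s0)//.
  have -> : T (k%:R * s) (T s x) - x = T (k%:R * s) (T s x - x) + (T (k%:R * s) x - x).
    by rewrite semi_B// addrA subrK.
  apply: (le_trans (ler_normD _ _)); rewrite addrC lerD//.
  apply: (le_trans (semi_contraction _ ks0)).
  have := hd _ s0 sd.
  have -> : T s x - x = (T s x - x - s *: A x) + s *: A x by rewrite subrK.
  move=> hh; apply: (le_trans (ler_normD _ _)).
  rewrite addrK in hh.
  by rewrite normrZ (gtr0_norm s0); lra.
have := key N.+1.
have -> : N.+1%:R * s = h by rewrite /s mulrCA divff ?pnatr_eq0// mulr1.
move=> /le_trans; apply.
rewrite mulrA; have -> : N.+1%:R * s = h by rewrite /s mulrCA divff ?pnatr_eq0// mulr1.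
by rewrite mulrDr mulrCA divff ?gt_eqF// mulr1 addrC.
Qed.

(** Replaces $T(h)x-x-hAx=\int_0^h(T(s)Ax-Ax)\,ds$, by the same telescoping. *)
Lemma semi_taylor (h K : R) x : 0 <= h -> dom x ->
  (forall s : R, 0 <= s -> s <= h -> `|T s (A x) - A x| <= K) ->
  `|T h x - x - h *: A x| <= h * K.
Proof.
rewrite le_eqVlt => /predU1P[<-|h0] dx hK.
  by rewrite (semi_id ST) subrr scale0r subr0 normr0 mul0r.
apply/ler_addgt0Pl => e e0.
have eh : 0 < e / h by rewrite divr_gt0.
have [d d0 hd] := semi_gen ST dx eh.
have [N hN] : exists N : nat, h / d < N%:R.
  by exists (Num.trunc (h / d)).+1; exact: truncnS_gt.
set s := h / N.+1%:R.
have s0 : 0 < s by rewrite divr_gt0.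
have sN : N.+1%:R * s = h by rewrite /s mulrCA divff ?pnatr_eq0// mulr1.
have sd : s < d.
  rewrite /s ltr_pdivrMr// mulrC -ltr_pdivrMr//; apply: (lt_le_trans hN).
  by rewrite ler_nat.
have key k : (k <= N.+1)%N ->
    `|T (k%:R * s) x - x - (k%:R * s) *: A x| <= k%:R * (s * (K + e / h)).
  elim: k => [_|k IH kN].
    by rewrite !mul0r (semi_id ST) subrr scale0r subr0 normr0.
  have ks0 : 0 <= k%:R * s by rewrite mulr_ge0// ltW.
  have ksh : k%:R * s <= h by rewrite -sN ler_wpM2r ?(ltW s0)// ler_nat ltnW.
  rewrite -natr1 !mulrDl !mul1r (semi_add ST)// ?(ltW s0)//.
  have -> : T (k%:R * s) (T s x) - x - (k%:R * s + s) *: A x =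
     (T (k%:R * s) x - x - (k%:R * s) *: A x) +
     (T (k%:R * s) (T s x - x - s *: A x) + s *: (T (k%:R * s) (A x) - A x)).
    by rewrite !semi_B// semi_Z//; lmod R.
  apply: (le_trans (ler_normD _ _)); rewrite lerD//; first exact: IH (ltnW kN).
  apply: (le_trans (ler_normD _ _)).
  have h1 := le_trans (semi_contraction (T s x - x - s *: A x) ks0) (hd _ s0 sd).
  have h2 : `|s *: (T (k%:R * s) (A x) - A x)| <= s * K.
    by rewrite normrZ (gtr0_norm s0) ler_wpM2l ?(ltW s0)// hK.
  by lra.
have := key N.+1 (leqnn _); rewrite mulrA sN => /le_trans; apply.
by rewrite mulrDr mulrCA divff ?gt_eqF// mulr1 addrC.
Qed.

Variable kap : R.
Hypothesis kap0 : 0 < kap.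
Hypothesis analytic : forall (h : R) y, 0 < h -> dom y ->
  `|y| + h * (kap * `|A y|) <= `|y - h *: A y|.

Lemma semi_A_decr (s t : R) x : 0 <= s -> s <= t -> dom x ->
  `|A (T t x)| <= `|A (T s x)|.
Proof.
move=> s0 st dx.
have -> : t = (t - s) + s by rewrite subrK.
rewrite (semi_add ST)// ?subr_ge0// semi_comm ?subr_ge0//; last exact: semi_dom.
by apply: semi_contraction; rewrite subr_ge0.
Qed.

(** Along the Euler steps the second term of [analytic] adds up to $t\kappa$ times the mean of
    $|AT(s)x|$ over grid times $s$ in $(0,t]$. Since $|AT(s)x|$ decreases in $s$, the mean is at
    least the value at $t$. *)
Lemma semi_analytic (t : R) x : 0 < t -> dom x ->
  t * kap * `|A (T t x)| <= `|x|.
Proof.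
move=> t0 dx; apply/ler_addgt0Pl => e e0.
have [N hN] := semi_euler norm_seminorm ler01 analytic dx t0 e0.
have := hN N (leqnn _) N.+1 (leqnn _); rewrite addrC => h1; rewrite [leRHS]addrC.
apply: le_trans h1; rewrite ler_wpDr//.
apply: (@le_trans _ _ (\sum_(0 <= i < N.+1) t / N.+1%:R * (kap * `|A (T t x)|))).
  rewrite sumr_const_nat subn0 -[leRHS]mulr_natl.
  by apply: le_of_eq; field; rewrite addrC natr1 pnatr_eq0.
rewrite !big_nat; apply: ler_sum => i /andP[_ iN].
rewrite ler_wpM2l ?divr_ge0 ?(ltW t0)// ler_wpM2l ?(ltW kap0)//.
apply: semi_A_decr => //; first by rewrite mulr_ge0// divr_ge0// ltW.
by rewrite mulrCA -[leRHS]mulr1 ler_wpM2l ?(ltW t0)// ler_pdivrMr// mul1r ler_nat.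
Qed.

Lemma semi_lip_pos (t h : R) x : 0 < t -> 0 <= h -> dom x ->
  `|T (t + h) x - T t x| <= h / (t * kap) * `|x|.
Proof.
move=> t0 h0 dx; rewrite [t + h]addrC (semi_add ST)//; last exact: ltW.
apply: (le_trans (semi_lip h0 (semi_dom (ltW t0) dx))).
rewrite -mulrA ler_wpM2l// ler_pdivlMl ?mulr_gt0//.
exact: semi_analytic.
Qed.

(** Half of the time is spent on each smoothing: the difference is $AT(t/2)w$ with
    $w=T(t/2+h)x-T(t/2)x$, so [semi_analytic] and [semi_lip_pos] both apply at time $t/2$. This
    produces the factor 4. *)
Lemma semi_A_lip (t h : R) x : 0 < t -> 0 <= h -> dom x ->
  `|A (T (t + h) x) - A (T t x)| <= h * (4 / (t * kap) ^+ 2) * `|x|.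
Proof.
move=> t0 h0 dx.
have t20 : 0 < t / 2 by lra.
have w2 := ltW t20.
have dt : dom (T (t / 2) x) by exact: semi_dom.
set w := T (t / 2 + h) x - T (t / 2) x.
have dw : dom w by apply: op_domB => //; apply: semi_dom => //; lra.
have -> : A (T (t + h) x) - A (T t x) = A (T (t / 2) w).
  rewrite /w semi_B// opB; [|by do 2?[apply: semi_dom => //]; lra..].
  by rewrite -!(semi_add ST)//; [congr (A (T _ _) - A (T _ _)); lra|lra].
have h1 := semi_analytic t20 dw.
have h2 := semi_lip_pos t20 h0 dx.
have tk : 0 < t / 2 * kap by rewrite mulr_gt0.
have : t / 2 * kap * `|A (T (t / 2) w)| <= h / (t / 2 * kap) * `|x| by apply: le_trans h2.
rewrite -ler_pdivlMl// => /le_trans; apply; apply: le_of_eq.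
by field; rewrite !gt_eqF.
Qed.

Lemma semi_deriv_right (t h : R) x : 0 < t -> 0 <= h -> dom x ->
  `|T (t + h) x - T t x - h *: A (T t x)| <= h ^+ 2 * (4 / (t * kap) ^+ 2) * `|x|.
Proof.
move=> t0 h0 dx; rewrite [t + h]addrC (semi_add ST)//; last exact: ltW.
rewrite expr2 -2!mulrA [X in _ * X]mulrA.
apply: semi_taylor => //; first by apply: semi_dom => //; exact: ltW.
move=> s s0 sh; rewrite -semi_comm//; last by apply: semi_dom => //; exact: ltW.
rewrite -(semi_add ST)// ?(ltW t0)// [s + t]addrC.
apply: (le_trans (semi_A_lip t0 s0 dx)).
by rewrite !ler_wpM2r// divr_ge0// exprn_ge0// mulr_ge0// ltW.
Qed.

End properties.
End semigroup.
Lemma subB_subB (V : zmodType) (a b c d : V) :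
  a - b = (c - d) - ((c - a) - (d - b)).
Proof.
have -> : c - a - (d - b) = c - d - (a - b).
  by rewrite !opprB addrACA [RHS]addrACA [- a - d]addrC.
by rewrite subKr.
Qed.

(** * The Hille-Yosida construction by dyadic backward Euler steps *)

Section hille_yosida.
Variables (R : realType) (X : completeNormedModType R).

(** Telescoping of $P^n-Q^n$ for commuting nonexpansive maps: each of the $n$ summands is the single
    difference $Px-Qx$ seen through nonexpansive maps. *)
Lemma iter_compare (P Q : X -> X) n x :
  (forall a b, `|P a - P b| <= `|a - b|) -> (forall a b, `|Q a - Q b| <= `|a - b|) ->
  (forall a, P (Q a) = Q (P a)) ->
  `|iter n P x - iter n Q x| <= n%:R * `|P x - Q x|.
Proof.
move=> hP hQ PQ.
have hPn k a b : `|iter k P a - iter k P b| <= `|a - b|.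
  by elim: k => // k IH; exact: le_trans (hP _ _) IH.
have PnQ k a : iter k P (Q a) = Q (iter k P a).
  by elim: k => // k IH; rewrite !iterS IH PQ.
elim: n => [|n IH]; first by rewrite /= subrr normr0 mul0r.
have -> : iter n.+1 P x - iter n.+1 Q x =
    (iter n P (P x) - iter n P (Q x)) + (iter n P (Q x) - Q (iter n Q x)).
  by rewrite iterSr addrA subrK.
rewrite -natr1 mulrDl mul1r addrC; apply: (le_trans (ler_normD _ _)).
by apply: lerD; [rewrite PnQ; exact: le_trans (hQ _ _) IH|exact: hPn].
Qed.

Lemma cauchy_limit (u : nat -> X) :
  (forall e : R, 0 < e -> exists N, forall n, (N <= n)%N -> `|u n - u N| <= e) ->
  exists l, forall e : R, 0 < e -> exists N, forall n, (N <= n)%N -> `|u n - l| <= e.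
Proof.
move=> hu; have /cauchy_cvgP cu : cauchy (u @ \oo).
  apply: cauchy_exP => e e0; have e2 : 0 < e / 2 by lra.
  have [N hN] := hu _ e2; exists (u N); exists N => // n /= Nn.
  by rewrite -ball_normE /= distrC; apply: (le_lt_trans (hN _ Nn)); lra.
exists (lim (u @ \oo)) => e e0.
have /cvgrPdist_le/(_ _ e0)[N _ hN] := cu.
by exists N => n Nn; rewrite distrC; exact: hN.
Qed.

Variables (dom : set X) (A : X -> X).
Hypothesis Aop : operator_on dom A.
Hypothesis dense : dense_in dom.
Hypothesis dissip : forall (h : R) y, 0 < h -> dom y -> `|y| <= `|y - h *: A y|.
Hypothesis surj : forall (h : R) y, 0 < h -> exists2 x, dom x & x - h *: A x = y.

(** The resolvent $(1-hA)^{-1}$. By [surj] the default 0 of [xget] is never taken for [h > 0]. *)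
Let J (h : R) (y : X) : X := xget 0 [set x | dom x /\ x - h *: A x = y].

Let JP (h : R) y : 0 < h -> dom (J h y) /\ J h y - h *: A (J h y) = y.
Proof.
by move=> h0; rewrite /J; case: xgetP => // /(_ _) H; have [x dx hx] := surj y h0; case: (H x).
Qed.
Let Jdom (h : R) y : 0 < h -> dom (J h y). Proof. by move=> /(JP y)[]. Qed.
Let JE (h : R) y : 0 < h -> J h y - h *: A (J h y) = y. Proof. by move=> /(JP y)[]. Qed.

Let Jinj (h : R) x z : 0 < h -> dom x -> dom z -> x - h *: A x = z - h *: A z -> x = z.
Proof.
move=> h0 dx dz xz; apply/eqP; rewrite -subr_eq0 -normr_le0.
apply: (le_trans (dissip h0 (op_domB Aop dx dz))).
rewrite (opB Aop)//.
have -> : x - z - h *: (A x - A z) = (x - h *: A x) - (z - h *: A z) by lmod R.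
by rewrite xz subrr normr0.
Qed.

Let J_unique (h : R) x y : 0 < h -> dom x -> x - h *: A x = y -> J h y = x.
Proof. by move=> h0 dx xy; apply: (Jinj h0) => //; [exact: Jdom|rewrite JE]. Qed.

Let J_lin (h a : R) x y : 0 < h -> J h (a *: x + y) = a *: J h x + J h y.
Proof.
move=> h0; case: (Aop) => _ dl Al; have dx := Jdom x h0; have dy := Jdom y h0.
apply: J_unique => //; first exact: dl.
rewrite Al// -[in RHS](JE x h0) -[in RHS](JE y h0); lmod R.
Qed.

Let J_B (h : R) x y : 0 < h -> J h (x - y) = J h x - J h y.
Proof. by move=> h0; rewrite addrC -scaleN1r J_lin// scaleN1r addrC. Qed.

Let J_contr (h : R) y : 0 < h -> `|J h y| <= `|y|.
Proof. by move=> h0; rewrite -[in leRHS](JE y h0); apply: dissip => //; exact: Jdom. Qed.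

Let J_ne (h : R) x y : 0 < h -> `|J h x - J h y| <= `|x - y|.
Proof. by move=> h0; rewrite -J_B//; exact: J_contr. Qed.

Let J_A (h : R) x : 0 < h -> dom x -> A (J h x) = J h (A x).
Proof.
move=> h0 dx; have dJ := Jdom x h0; have E := JE x h0.
have AJ : A (J h x) = h^-1 *: (J h x - x).
  by rewrite -[X in _ - X]E opprB addrC subrK scalerA mulVf ?gt_eqF// scale1r.
have dAJ : dom (A (J h x)).
  by rewrite AJ; apply: (op_domZ Aop); exact: (op_domB Aop).
apply/esym/J_unique => //.
rewrite -(opZ Aop)// -(opB Aop)//; first by rewrite E.
exact: (op_domZ Aop).
Qed.

Let J_comm (s t : R) x : 0 < s -> 0 < t -> J s (J t x) = J t (J s x).
Proof.
move=> s0 t0; apply: J_unique => //; first exact: Jdom.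
rewrite J_A//; last exact: Jdom.
have -> : J t (J s x) - s *: J t (A (J s x)) = J t (- s *: A (J s x) + J s x).
  by rewrite J_lin//; lmod R.
by rewrite scaleNr addrC JE.
Qed.

(** The exponential formula $(1-\frac{t}{2^k}A)^{-2^k}$. With dyadic step numbers, passing from [k]
    to [k.+1] replaces each step by two half steps, which [J_half] compares. *)
Let E k (t : R) x := iter (2 ^ k) (J (t / 2 ^+ k)) x.

Let h_gt0 (t : R) k : 0 < t -> 0 < t / 2 ^+ k.
Proof. by move=> t0; rewrite divr_gt0// exprn_gt0. Qed.

Let E_ne k (t : R) x y : 0 < t -> `|E k t x - E k t y| <= `|x - y|.
Proof.
move=> t0; rewrite /E; elim: (2 ^ k)%N => //= n IH.
exact: le_trans (J_ne _ _ (h_gt0 _ t0)) IH.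
Qed.

Let E_lin k (t a : R) x y : 0 < t -> E k t (a *: x + y) = a *: E k t x + E k t y.
Proof.
move=> t0; rewrite /E; elim: (2 ^ k)%N => //= n ->.
by rewrite J_lin//; exact: h_gt0.
Qed.

Let E_comm k l (s t : R) x : 0 < s -> 0 < t -> E k s (E l t x) = E l t (E k s x).
Proof.
move=> s0 t0; rewrite /E.
have h m y : iter m (J (t / 2 ^+ l)) (J (s / 2 ^+ k) y)
    = J (s / 2 ^+ k) (iter m (J (t / 2 ^+ l)) y).
  by elim: m => //= m ->; rewrite J_comm//; exact: h_gt0.
by elim: (2 ^ k)%N => //= m IH; rewrite h -IH.
Qed.

(** With $g=h/2$ and $w=J_g^2x$ one has $x=(1-gA)^2w=(1-hA)w+g^2A^2w$, hence
    $(1-hA)(J_hx-w)=g^2A^2w$. Dissipativity inverts $1-hA$, and $A^2w=J_g^2A^2x$. *)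
Let J_half (h : R) x : 0 < h -> dom x -> dom (A x) ->
  `|J h x - J (h / 2) (J (h / 2) x)| <= (h / 2) ^+ 2 * `|A (A x)|.
Proof.
move=> h0 dx dAx; set g := h / 2; have g0 : 0 < g by rewrite /g; lra.
set v := J g x; set w := J g v.
have dv : dom v by exact: Jdom.
have dw : dom w by exact: Jdom.
have Aw : A w = J g (J g (A x)) by rewrite /w J_A// /v J_A.
have dAw : dom (A w) by rewrite Aw; exact: Jdom.
have AAw : A (A w) = J g (J g (A (A x))) by rewrite Aw J_A ?J_A//; exact: Jdom.
have dz : dom (J h x - w) by apply: (op_domB Aop) => //; exact: Jdom.
apply: (le_trans (dissip h0 dz)); rewrite (opB Aop)//; last exact: Jdom.
have Ev : v = w - g *: A w by rewrite /w JE.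
have Ex : x = w - g *: A w - g *: (A w - g *: A (A w)).
  have Av : A v = A w - g *: A (A w).
    by rewrite {1}Ev (opB Aop) ?(opZ Aop)//; exact: (op_domZ Aop).
  by rewrite -Ev -Av /v JE.
have -> : J h x - w - h *: (A (J h x) - A w) = (J h x - h *: A (J h x)) - w + h *: A w.
  by lmod R.
rewrite JE// [in X in X - _]Ex.
have -> : w - g *: A w - g *: (A w - g *: A (A w)) - w + h *: A w = g ^+ 2 *: A (A w).
  by have -> : h = g + g; [rewrite /g; lra|lmod R].
rewrite normrZ ger0_norm ?sqr_ge0// ler_wpM2l ?sqr_ge0// AAw.
exact: le_trans (J_contr _ g0) (J_contr _ g0).
Qed.

Let E_step k (t : R) x : 0 < t -> dom x -> dom (A x) ->
  `|E k t x - E k.+1 t x| <= t ^+ 2 / 4 * `|A (A x)| / 2 ^+ k.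
Proof.
move=> t0 dx dAx; have h0 := h_gt0 k t0; set h := t / 2 ^+ k in h0.
have h20 : 0 < h / 2 by lra.
have -> : E k.+1 t x = iter (2 ^ k) (fun y => J (h / 2) (J (h / 2) y)) x.
  rewrite /E expnS mulnC; have -> : t / 2 ^+ k.+1 = h / 2.
    by rewrite /h exprSr; field; rewrite expf_neq0.
  by elim: (2 ^ k)%N => //= m <-; rewrite !mulnS.
have c2 a b : `|J (h / 2) (J (h / 2) a) - J (h / 2) (J (h / 2) b)| <= `|a - b|.
  exact: le_trans (J_ne _ _ h20) (J_ne _ _ h20).
have cm a : J h (J (h / 2) (J (h / 2) a)) = J (h / 2) (J (h / 2) (J h a)).
  by rewrite J_comm// (J_comm a).
apply: (le_trans (iter_compare (2 ^ k) x (fun a b => J_ne a b h0) c2 cm)).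
apply: (le_trans (ler_wpM2l _ (J_half h0 dx dAx))) => //.
by apply: le_of_eq; rewrite /h natrX; field; rewrite expf_neq0.
Qed.

(** The resolvent gains one power of the domain: for $y$ in the domain, $J_hy$ lies in that of
    $A^2$, and $y-J_hy=-hJ_hAy$ is small. *)
Let dense2 x (e : R) : 0 < e -> exists y, [/\ dom y, dom (A y) & `|x - y| < e].
Proof.
move=> e0; have e2 : 0 < e / 2 by lra.
have [y dy xy] := dense x e2.
pose h := e / 2 / (`|A y| + 1); have A1 : 0 < `|A y| + 1 by rewrite ltr_wpDl.
have h0 : 0 < h by rewrite divr_gt0.
exists (J h y); split; [exact: Jdom|by rewrite J_A//; exact: Jdom|].
have -> : x - J h y = (x - y) + (y - J h y) by rewrite addrA subrK.
apply: (le_lt_trans (ler_normD _ _)).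
have -> : y - J h y = - (h *: J h (A y)).
  by rewrite -J_A// -[X in X - _](JE y h0) addrC addKr.
rewrite normrN normrZ (gtr0_norm h0).
have h1 : h * `|J h (A y)| <= h * (`|A y| + 1).
  rewrite ler_wpM2l ?(ltW h0)//; apply: (le_trans (J_contr _ h0)); lra.
have h2 : h * (`|A y| + 1) = e / 2 by rewrite /h divfK// gt_eqF.
by lra.
Qed.

Let tends (u : nat -> X) l := forall e : R, 0 < e ->
  exists N, forall n, (N <= n)%N -> `|u n - l| <= e.

Let tends_unique u l l' : tends u l -> tends u l' -> l = l'.
Proof.
move=> h h'; apply/eqP; rewrite -subr_eq0 -normr_le0; apply/ler_addgt0Pl => e e0.
have e2 : 0 < e / 2 by lra.
have [N hN] := h _ e2; have [N' hN'] := h' _ e2.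
have h1 := hN _ (leq_maxl N N'); have h2 := hN' _ (leq_maxr N N').
have -> : l - l' = (u (maxn N N') - l') - (u (maxn N N') - l) by lmod R.
by apply: (le_trans (ler_normB _ _)); lra.
Qed.

Let tends_le u l w (c : R) : tends u l -> (forall n, `|u n - w| <= c) -> `|l - w| <= c.
Proof.
move=> h hw; apply/ler_addgt0Pl => e /h[N /(_ N (leqnn _)) hN].
have -> : l - w = (u N - w) - (u N - l) by lmod R.
by apply: (le_trans (ler_normB _ _)); have := hw N; lra.
Qed.

Let E_tends (t : R) x : 0 < t -> exists l, tends (fun k => E k t x) l.
Proof.
move=> t0; apply: cauchy_limit => e e0; have e4 : 0 < e / 4 by lra.
have [y [dy dAy xy]] := dense2 x e4.
pose c := t ^+ 2 / 4 * `|A (A y)|.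
have c0 : 0 <= c.
  by apply: mulr_ge0 => //; apply: divr_ge0 => //; exact: sqr_ge0.
(* Finite geometric sum of the increments $c/2^k$ for $N\le k<N+m$ given by [E_step]. *)
have tail N m : `|E (N + m) t y - E N t y| <= c * 2 / 2 ^+ N * (1 - 1 / 2 ^+ m).
  elim: m => [|m IH]; first by rewrite addn0 subrr normr0 expr0 divr1 subrr mulr0.
  have -> : E (N + m.+1) t y - E N t y =
      (E (N + m) t y - E N t y) - (E (N + m) t y - E (N + m).+1 t y).
    by rewrite addnS; lmod R.
  apply: (le_trans (ler_normB _ _)).
  have := E_step (N + m) t0 dy dAy; rewrite -/c => hs.
  apply: (le_trans (lerD IH hs)); apply: le_of_eq.
  by rewrite exprD exprS; field; rewrite !expf_neq0.
have [N hN] : exists N : nat, c * 2 / (e / 4) < N%:R.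
  by exists (Num.trunc (c * 2 / (e / 4))).+1; exact: truncnS_gt.
exists N => n Nn.
have h1 : `|E n t y - E N t y| <= e / 4.
  rewrite -(subnKC Nn); apply: (le_trans (tail _ _)).
  apply: (@le_trans _ _ (c * 2 / 2 ^+ N)).
    rewrite -[leRHS]mulr1 ler_wpM2l//; first by apply: divr_ge0; [lra|exact: exprn_ge0].
  rewrite ltr_pdivrMr// in hN.
  rewrite ler_pdivrMr ?exprn_gt0//; apply: (le_trans (ltW hN)).
  rewrite mulrC ler_wpM2l ?(ltW e4)//.
  by rewrite -natrX ler_nat ltnW// ltn_expl.
have -> : E n t x - E N t x = (E n t x - E n t y) + (E n t y - E N t y) - (E N t x - E N t y).
  by lmod R.
apply: (le_trans (ler_normB _ _)); apply: (le_trans (lerD (ler_normD _ _) (lexx _))).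
by have := E_ne n x y t0; have := E_ne N x y t0; lra.
Qed.

Let T (t : R) x := if 0 < t then xget 0 [set l | tends (fun k => E k t x) l] else x.

Let T0 x : T 0 x = x. Proof. by rewrite /T ltxx. Qed.

Let TP (t : R) x : 0 < t -> tends (fun k => E k t x) (T t x).
Proof.
move=> t0; rewrite /T t0; case: xgetP => // H.
by have [l hl] := E_tends x t0; have := H l.
Qed.

Let T_ne (t : R) x y : 0 <= t -> `|T t x - T t y| <= `|x - y|.
Proof.
rewrite le_eqVlt => /predU1P[<-|t0]; first by rewrite !T0.
apply/ler_addgt0Pl => e e0; have e2 : 0 < e / 2 by lra.
have [N hN] := TP x t0 e2; have [N' hN'] := TP y t0 e2.
have h1 := hN _ (leq_maxl N N'); have h2 := hN' _ (leq_maxr N N').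
have h3 := E_ne (maxn N N') x y t0.
set k := maxn N N' in h1 h2 h3.
rewrite (subB_subB (T t x) (T t y) (E k t x) (E k t y)).
apply: (le_trans (ler_normB _ _)).
by apply: (le_trans (lerD (lexx _) (ler_normB _ _))); lra.
Qed.

Let T_lin (t a : R) x y : 0 <= t -> T t (a *: x + y) = a *: T t x + T t y.
Proof.
rewrite le_eqVlt => /predU1P[<-|t0]; first by rewrite !T0.
apply: (tends_unique (TP _ t0)) => e e0.
have a1 : 0 < `|a| + 1 by rewrite ltr_wpDl.
have e2 : 0 < e / 2 / (`|a| + 1) by rewrite divr_gt0//; lra.
have [N hN] := TP x t0 e2; have [N' hN'] := TP y t0 e2.
exists (maxn N N') => n; rewrite geq_max => /andP[/hN h1 /hN' h2].
rewrite E_lin//.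
have -> : a *: E n t x + E n t y - (a *: T t x + T t y) =
    a *: (E n t x - T t x) + (E n t y - T t y).
  have lm (u v w z : X) : a *: u + v - (a *: w + z) = a *: (u - w) + (v - z) by lmod R.
  exact: lm.
apply: (le_trans (ler_normD _ _)); rewrite normrZ.
have h3 : `|a| * `|E n t x - T t x| <= `|a| * (e / 2 / (`|a| + 1)) by rewrite ler_wpM2l.
have h4 : (`|a| + 1) * (e / 2 / (`|a| + 1)) = e / 2 by rewrite mulrC divfK// gt_eqF.
have := normr_ge0 a; nra.
Qed.

Let T_comm (s t : R) x : 0 <= s -> 0 <= t -> T s (T t x) = T t (T s x).
Proof.
rewrite le_eqVlt => /predU1P[<-|s0]; first by rewrite !T0.
rewrite le_eqVlt => /predU1P[<-|t0]; first by rewrite !T0.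
have ET k y : E k s (T t y) = T t (E k s y).
  apply: (@tends_unique (fun l => E k s (E l t y))).
    move=> e /(TP y t0)[N hN]; exists N => n /hN.
    exact: le_trans (E_ne _ _ _ s0).
  move=> e e0; have [N hN] := TP (E k s y) t0 e0.
  by exists N => n /hN; rewrite E_comm.
apply: (tends_unique (TP _ s0)) => e /(TP x s0)[N hN]; exists N => n /hN.
by rewrite ET; apply: le_trans; apply: T_ne; exact: ltW.
Qed.

(** Here [y] need not lie in the domain. Replacing it by an approximant [z] costs $|y-z|$ once at
    each end, and for [z] every step moves by at most $h|Az|$. *)
Let J_iter_lip m (h : R) y z : 0 < h -> dom z ->
  `|iter m (J h) y - y| <= 2 * `|y - z| + m%:R * h * `|A z|.
Proof.
move=> h0 dz.
have hz : `|iter m (J h) z - z| <= m%:R * h * `|A z|.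
  elim: m => [|m IH]; first by rewrite /= subrr normr0 !mul0r.
  have -> : iter m.+1 (J h) z - z = (J h (iter m (J h) z) - J h z) + (J h z - z).
    by rewrite iterS addrA subrK.
  apply: (le_trans (ler_normD _ _)).
  have h1 := le_trans (J_ne (iter m (J h) z) z h0) IH.
  have h2 : `|J h z - z| <= h * `|A z|.
    have -> : J h z - z = h *: J h (A z).
      by rewrite -J_A// -[X in _ - X](JE z h0) opprB addrC subrK.
    by rewrite normrZ (gtr0_norm h0) ler_wpM2l ?(ltW h0)// J_contr.
  by rewrite -natr1; lra.
have hyz : `|iter m (J h) y - iter m (J h) z| <= `|y - z|.
  by elim: (m) => //= n IH; exact: le_trans (J_ne _ _ h0) IH.
have -> : iter m (J h) y - y =
    (iter m (J h) y - iter m (J h) z) + (iter m (J h) z - z) - (y - z) by lmod R.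
apply: (le_trans (ler_normB _ _)); apply: (le_trans (lerD (ler_normD _ _) (lexx _))).
by lra.
Qed.

Let dyadic (t : R) k : (2 ^ k)%:R * (t / 2 ^+ k) = t.
Proof. by rewrite natrX mulrC divfK// expf_neq0. Qed.

Let T_lip (t : R) y z : 0 <= t -> dom z -> `|T t y - y| <= 2 * `|y - z| + t * `|A z|.
Proof.
rewrite le_eqVlt => /predU1P[<-|t0] dz.
  by rewrite !T0 subrr normr0 mul0r addr0 mulr_ge0.
apply: (tends_le (TP y t0)) => k.
by have := J_iter_lip (2 ^ k) y (h_gt0 k t0) dz; rewrite dyadic.
Qed.

(** Discrete Taylor formula: $J^{j+1}x=J^jx+hJ^{j+1}Ax$, so the remainder is a sum of terms
    $h(J^{j+1}Ax-Ax)$, each controlled by [J_iter_lip] with [z] approximating $Ax$. The bound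
    survives the limit in [k]. *)
Let T_taylor (t : R) x z : 0 <= t -> dom x -> dom z ->
  `|T t x - x - t *: A x| <= t * (2 * `|A x - z| + t * `|A z|).
Proof.
rewrite le_eqVlt => /predU1P[<-|t0] dx dz.
  by rewrite !T0 subrr scale0r subr0 normr0 mul0r.
rewrite -addrA -opprD; apply: (tends_le (TP x t0)) => k.
rewrite /E; set h := t / 2 ^+ k; have h0 : 0 < h by exact: h_gt0.
have key j : (j <= 2 ^ k)%N -> `|iter j (J h) x - x - (j%:R * h) *: A x| <=
    j%:R * (h * (2 * `|A x - z| + t * `|A z|)).
  elim: j => [_|j IH jk].
    by rewrite /= subrr !mul0r scale0r subr0 normr0.
  have dj m : dom (iter m (J h) x) /\ A (iter m (J h) x) = iter m (J h) (A x).
    by elim: m => //= m [dm <-]; split; [exact: Jdom|exact: J_A].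
  have -> : iter j.+1 (J h) x - x - (j.+1%:R * h) *: A x =
      (iter j (J h) x - x - (j%:R * h) *: A x) + h *: (iter j.+1 (J h) (A x) - A x).
    have -> : iter j.+1 (J h) x = iter j (J h) x + h *: iter j.+1 (J h) (A x).
      by rewrite -(dj j.+1).2 -[X in X + _](JE (iter j (J h) x) h0) subrK.
    by rewrite -natr1; lmod R.
  apply: (le_trans (ler_normD _ _)); rewrite -natr1 mulrDl mul1r lerD//.
    by apply: IH; exact: ltnW.
  rewrite normrZ (gtr0_norm h0) ler_wpM2l ?(ltW h0)//.
  apply: (le_trans (J_iter_lip _ _ h0 dz)); rewrite lerD2l ler_wpM2r//.
  by rewrite -[leRHS](dyadic t k) ler_wpM2r ?(ltW h0)// ler_nat.
have := key _ (leqnn _); rewrite mulrA !dyadic.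
by rewrite -addrA -opprD.
Qed.

(** The approximations obey the halving rule exactly: $2^{k+1}$ steps of size $t/2^{k+1}$ are twice
    $2^k$ steps for time $t/2$. Unrelated times [s] and [t] have no common grid, so [T_add] argues
    differently. *)
Let T_half (t : R) x : 0 < t -> T t x = T (t / 2) (T (t / 2) x).
Proof.
move=> t0; have t20 : 0 < t / 2 by lra.
have EE k : E k.+1 t x = E k (t / 2) (E k (t / 2) x).
  rewrite /E expnS mul2n -addnn iterD; have -> // : t / 2 ^+ k.+1 = t / 2 / 2 ^+ k.
  by rewrite exprS; field; rewrite expf_neq0.
apply: (@tends_unique (fun k => E k.+1 t x)).
  by move=> e /(TP x t0)[N hN]; exists N => n Nn; apply: hN; exact: leqW.
move=> e e0; have e2 : 0 < e / 2 by lra.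
have [N hN] := TP x t20 e2; have [N' hN'] := TP (T (t / 2) x) t20 e2.
exists (maxn N N') => n; rewrite geq_max => /andP[/hN h1 /hN' h2].
rewrite EE; set w := E n (t / 2) x in h1 *.
have -> : E n (t / 2) w - T (t / 2) (T (t / 2) x) =
   (E n (t / 2) w - E n (t / 2) (T (t / 2) x)) +
   (E n (t / 2) (T (t / 2) x) - T (t / 2) (T (t / 2) x)) by rewrite addrA subrK.
apply: (le_trans (ler_normD _ _)).
by have := E_ne n w (T (t / 2) x) t20; lra.
Qed.

Let T_iter (t : R) k x : 0 < t -> T t x = iter (2 ^ k) (T (t / 2 ^+ k)) x.
Proof.
move=> t0; elim: k x => [|k IH] x; first by rewrite expr0 divr1.
rewrite IH expnS mulnC; set h := t / 2 ^+ k.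
have -> : t / 2 ^+ k.+1 = h / 2 by rewrite /h exprS; field; rewrite expf_neq0.
elim: (2 ^ k)%N => //= m ->; rewrite !mulnS /= T_half//; exact: h_gt0.
Qed.

(** By [T_iter] both sides are $2^k$-th iterates, of $T((s+t)/2^k)$ and of $T(s/2^k)T(t/2^k)$. On
    the domain of $A^2$ these maps differ by $O(4^{-k})$ according to [T_taylor], so the iterates
    differ by $O(2^{-k})$; density covers the other vectors. *)
Let T_add (s t : R) x : 0 <= s -> 0 <= t -> T (s + t) x = T s (T t x).
Proof.
rewrite le_eqVlt => /predU1P[<-|s0]; first by rewrite add0r {2}/T ltxx.
rewrite le_eqVlt => /predU1P[<-|t0]; first by rewrite addr0 {3}/T ltxx.
have st0 : 0 < s + t by lra.
have ne2 (a b : R) u v : 0 <= a -> 0 <= b -> `|T a (T b u) - T a (T b v)| <= `|u - v|.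
  by move=> a0 b0; exact: le_trans (T_ne _ _ a0) (T_ne _ _ b0).
have nice y : dom y -> dom (A y) -> T (s + t) y = T s (T t y).
  move=> dy dAy; apply/eqP; rewrite -subr_eq0 -normr_le0; apply/ler_addgt0Pl => e e0.
  rewrite addr0.
  have step (a b : R) : 0 < a -> 0 < b ->
      `|T (a + b) y - T a (T b y)| <= 2 * (a + b) ^+ 2 * `|A (A y)|.
    move=> a0 b0; have ab0 : 0 <= a + b by lra.
    have h1 := T_taylor ab0 dy dAy; have h2 := T_taylor (ltW a0) dy dAy.
    have h3 := T_taylor (ltW b0) dy dAy; have h4 := T_lip (A y) (ltW a0) dAy.
    rewrite subrr normr0 mulr0 add0r in h1 h2 h3 h4.
    have h5 := T_ne (T b y) (y + b *: A y) (ltW a0).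
    have h6 : T a (y + b *: A y) = b *: T a (A y) + T a y.
      by rewrite addrC T_lin// ltW.
    rewrite h6 opprD addrA in h5.
    have -> : T (a + b) y - T a (T b y) = (T (a + b) y - y - (a + b) *: A y) -
       ((T a (T b y) - b *: T a (A y) - T a y) + ((T a y - y - a *: A y)
        + b *: (T a (A y) - A y))).
      have lm (u v w z q : X) : u - v = (u - y - (a + b) *: z) -
        ((v - b *: w - q) + ((q - y - a *: z) + b *: (w - z))) by lmod R.
      exact: lm.
    apply: (le_trans (ler_normB _ _)).
    apply: (le_trans (lerD (lexx _) (ler_normD _ _))).
    apply: (le_trans (lerD (lexx _) (lerD (lexx _) (ler_normD _ _)))).
    rewrite [X in _ + (_ + (_ + X))]normrZ (gtr0_norm b0).
    have E5 : T b y - (y + b *: A y) = T b y - y - b *: A y by rewrite opprD addrA.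
    rewrite E5 in h5.
    have h7 : b * `|T a (A y) - A y| <= b * (a * `|A (A y)|).
      by rewrite add0r in h4; rewrite ler_wpM2l ?(ltW b0).
    have abN : 0 <= a * b * `|A (A y)| by rewrite !mulr_ge0// ltW.
    by lra.
  pose c := 2 * (s + t) ^+ 2 * `|A (A y)|.
  have [k hk] : exists k : nat, c / e < k%:R.
    by exists (Num.trunc (c / e)).+1; exact: truncnS_gt.
  have TT : T s (T t y) = iter (2 ^ k) (fun w => T (s / 2 ^+ k) (T (t / 2 ^+ k) w)) y.
    rewrite (T_iter k _ s0) (T_iter k _ t0).
    set a := s / 2 ^+ k; set b := t / 2 ^+ k.
    have a0 : 0 <= a by rewrite ltW// h_gt0.
    have b0 : 0 <= b by rewrite ltW// h_gt0.
    have cm m w : iter m (T a) (T b w) = T b (iter m (T a) w).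
      by elim: m => //= m ->; rewrite T_comm.
    by elim: (2 ^ k)%N => //= m <-; rewrite cm.
  rewrite TT (T_iter k _ st0) mulrDl.
  have a0 := h_gt0 k s0; have b0 := h_gt0 k t0.
  set a := s / 2 ^+ k in a0 *; set b := t / 2 ^+ k in b0 *.
  have ab0 : 0 <= a + b by lra.
  apply: (le_trans (iter_compare _ _ _ _ _)).
  - by move=> u v; exact: T_ne.
  - by move=> u v; apply: ne2; exact: ltW.
  - move=> w; have cc u := T_comm u ab0.
    by rewrite cc ?ltW// cc ?ltW.
  apply: (@le_trans _ _ (c / 2 ^+ k)).
    apply: (le_trans (ler_wpM2l _ (step _ _ a0 b0))) => //.
    by apply: le_of_eq; rewrite /c /a /b natrX; field; rewrite expf_neq0.
  rewrite ler_pdivrMr ?exprn_gt0// mulrC -ler_pdivrMr//; apply: (le_trans (ltW hk)).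
  by rewrite -natrX ler_nat ltnW// ltn_expl.
apply/eqP; rewrite -subr_eq0 -normr_le0; apply/ler_addgt0Pl => e e0.
have e2 : 0 < e / 2 by lra.
have [y [dy dAy xy]] := dense2 x e2.
have -> : T (s + t) x - T s (T t x) =
   (T (s + t) x - T (s + t) y) - (T s (T t x) - T s (T t y)).
  have lm (a b c : X) : a - b = (a - c) - (b - c) by lmod R.
  by rewrite -(nice _ dy dAy); exact: lm.
apply: (le_trans (ler_normB _ _)).
have := T_ne x y (ltW st0); have := ne2 _ _ x y (ltW s0) (ltW t0); lra.
Qed.

Let T_gen x : dom x -> forall e : R, 0 < e -> exists2 d : R, 0 < d &
  forall h : R, 0 < h -> h < d -> `|T h x - x - h *: A x| <= e * h.
Proof.
move=> dx e e0; have e4 : 0 < e / 4 by lra.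
have [z dz xz] := dense (A x) e4.
have A1 : 0 < `|A z| + 1 by rewrite ltr_wpDl.
exists (e / 2 / (`|A z| + 1)) => [|h h0 hd]; first by rewrite divr_gt0//; lra.
apply: (le_trans (T_taylor (ltW h0) dx dz)); rewrite mulrC ler_wpM2r ?(ltW h0)//.
have : h * (`|A z| + 1) <= e / 2 by rewrite -ler_pdivlMr// ltW.
by nra.
Qed.

Lemma hille_yosida : exists T, semigroup_of dom A T.
Proof.
exists T; split.
- by move=> t a x y; exact: T_lin.
- move=> t t0; exists 1 => x; rewrite mul1r.
  by have := T_ne x 0 t0; rewrite (_ : T t 0 = 0) ?subr0//; have := T_lin (-1) 0 0 t0;
    rewrite scaler0 addr0 scaleN1r addNr.
- by move=> x; rewrite !T0.
- by move=> s t x; exact: T_add.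
- move=> x e e0; have e4 : 0 < e / 4 by lra.
  have [z dz xz] := dense x e4.
  have A1 : 0 < `|A z| + 1 by rewrite ltr_wpDl.
  exists (e / 2 / (`|A z| + 1)) => [|h h0 hd]; first by rewrite divr_gt0//; lra.
  apply: (le_trans (T_lip _ (ltW h0) dz)).
  have : h * (`|A z| + 1) <= e / 2 by rewrite -ler_pdivlMr// ltW.
  by nra.
- move=> x; split=> [dx|[y hy]]; first by exists (A x); exact: T_gen.
  (* Maximality of the domain: if $x$ has right derivative $y$ at 0, the resolvent at step 1 gives a
     domain vector $z$ with $z-Az=x-y$, and the aim is $x=z$. *)
  have [z dz hz] := surj (x - y) (@ltr01 R).
  suff -> : x = z by [].
  (* x - z lies in the kernel of 1 - B, where B is the generator of T. *)
  pose u := x - z; pose v := y - A z.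
  have uv : u = v.
    move: hz; rewrite scale1r => hz; rewrite /u /v.
    by apply/eqP; rewrite subr_eq; apply/eqP; rewrite addrAC -[y](subKr x) -hz;
      lmod R.
  have hu : forall e : R, 0 < e -> exists2 d : R, 0 < d &
    forall h : R, 0 < h -> h < d -> `|T h u - u - h *: v| <= e * h.
    move=> e e0; have e2 : 0 < e / 2 by lra.
    have [d1 d10 h1] := hy _ e2; have [d2 d20 h2] := T_gen dz e2.
    exists (Num.min d1 d2) => [|h h0]; first by rewrite lt_min d10 d20.
    rewrite lt_min => /andP[/(h1 _ h0) b1 /(h2 _ h0) b2].
    have -> : T h u = T h x - T h z.
      by rewrite /u addrC -scaleN1r T_lin ?(ltW h0)// scaleN1r addrC.
    have -> : T h x - T h z - u - h *: v =
        (T h x - x - h *: y) - (T h z - z - h *: A z).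
      have lm (a b c : X) : a - b - (x - z) - h *: (y - c) =
        (a - x - h *: y) - (b - z - h *: c) by lmod R.
      exact: lm.
    by apply: (le_trans (ler_normB _ _)); lra.
  suff : u = 0 by move=> /eqP; rewrite subr_eq0 => /eqP.
  apply/eqP; rewrite -normr_le0; apply/ler_addgt0Pl => e e0; rewrite addr0.
  have [d d0 hd] := hu _ e0; pose h := d / 2.
  have h0 : 0 < h by rewrite /h; lra.
  have /hd := h0; rewrite -uv => /(_ ltac:(rewrite /h; lra)) b.
  have c : `|T h u| <= `|u|.
    by have := T_ne u 0 (ltW h0); rewrite (_ : T h 0 = 0) ?subr0//;
      have := T_lin (-1) 0 0 (ltW h0); rewrite scaler0 addr0 scaleN1r addNr.
  (* If the derivative of the orbit of $u$ at 0 is $u$ itself, then $T(h)u$ is close to $(1+h)u$;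
     since $|T(h)u|\le|u|$, only $u=0$ remains. *)
  have : `|(1 + h) *: u| <= `|T h u| + `|T h u - u - h *: u|.
    have -> : (1 + h) *: u = T h u - (T h u - u - h *: u).
      have lm (p q : X) : (1 + h) *: p = q - (q - p - h *: p) by lmod R.
      exact: lm.
    exact: ler_normB.
  rewrite normrZ gtr0_norm; last lra.
  move=> b2; rewrite -(ler_pM2l h0); have := normr_ge0 u; nra.
- exact: T_gen.
Qed.

End hille_yosida.

(** * The Banach space of integrable functions *)

Lemma nneseries_geometric_half (R : realType) n :
  (\sum_(0 <= k <oo) (1 / 2 ^+ (n + k))%:E = (2 / 2 ^+ n)%:E :> \bar R)%E.
Proof.
apply/cvg_lim => //.
have -> : (fun m => \sum_(0 <= k < m) (1 / 2 ^+ (n + k))%:E)%E =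
    EFin \o series (geometric (1 / 2 ^+ n) (1 / 2)) :> (nat -> \bar R).
  apply/funext => m; rewrite /= /series/= -sumEFin; apply: eq_bigr => k _.
  by rewrite /geometric/= exprD expr_div_n expr1n; congr EFin; field; rewrite !expf_neq0.
apply: cvg_EFin; first exact: nearW.
have := @cvg_geometric_series R (1 / 2 ^+ n) (1 / 2).
rewrite ger0_norm// => /(_ ltac:(lra)).
have -> // : 1 / 2 ^+ n * (1 - 1 / 2)^-1 = 2 / 2 ^+ n :> R.
  by field; rewrite expf_neq0.
Qed.

Section integrable_functions.
Context d (T : measurableType d) (R : realType).
Variable mu : {measure set T -> \bar R}.
Implicit Types f g : T -> R.

Definition integ f : Prop := mu.-integrable setT (EFin \o f).
Definition norm1 f : R := \int[mu]_x `|f x|.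

Lemma integ_mfun f : integ f -> measurable_fun setT f.
Proof. by move=> /integrableP[/measurable_EFinP]. Qed.

Lemma integP f : integ f <->
  measurable_fun setT f /\ (\int[mu]_x `|f x|%:E < +oo)%E.
Proof.
split=> [|[mf foo]]; first by move=> /integrableP[/measurable_EFinP].
by apply/integrableP; split=> //; exact/measurable_EFinP.
Qed.

Lemma integ0 : integ (cst 0). Proof. exact: integrable0. Qed.
Lemma integD f g : integ f -> integ g -> integ (fun x => f x + g x).
Proof. by move=> If Ig; exact: integrableD If Ig. Qed.
Lemma integZ a f : integ f -> integ (fun x => a * f x).
Proof. by move=> If; exact: integrableZl If. Qed.
Lemma integN f : integ f -> integ (fun x => - f x).
Proof. by move=> If; exact: integrableN If. Qed.
Lemma integB f g : integ f -> integ g -> integ (fun x => f x - g x).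
Proof. by move=> If Ig; exact: integrableB If Ig. Qed.
Lemma integ_norm f : integ f -> integ (fun x => `|f x|).
Proof. by move=> If; exact: integrable_norm If. Qed.

Lemma integ_le f g : measurable_fun setT f -> (forall x, `|f x| <= g x) ->
  integ g -> integ f.
Proof.
move=> mf fg; apply: le_integrable => //; first exact/measurable_EFinP.
by move=> x _; rewrite /= lee_fin (le_trans (fg x))// ler_norm.
Qed.

Lemma norm1E f : integ f -> (norm1 f)%:E = (\int[mu]_x `|f x|%:E)%E.
Proof.
by move=> /integ_norm If; rewrite fineK//; exact: integrable_fin_num If.
Qed.

Lemma norm1_ge0 f : 0 <= norm1 f. Proof. exact: Rintegral_ge0. Qed.

Lemma norm1D f g : integ f -> integ g ->
  norm1 (fun x => f x + g x) <= norm1 f + norm1 g.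
Proof.
move=> If Ig; rewrite -RintegralD//; [|exact: integ_norm..].
apply: le_Rintegral => //; [exact/integ_norm/integD| |by move=> x _; exact: ler_normD].
by apply: integD; exact: integ_norm.
Qed.

Lemma norm1Z a f : integ f -> norm1 (fun x => a * f x) = `|a| * norm1 f.
Proof.
move=> If; rewrite -RintegralZl//; last exact: integ_norm.
by apply: eq_Rintegral => x _; rewrite normrM.
Qed.

Lemma eq_ae_Rintegral f g : measurable_fun setT f -> measurable_fun setT g ->
  f = g %[ae mu] -> \int[mu]_x f x = \int[mu]_x g x.
Proof.
move=> mf mg fg; congr fine; apply: ae_eq_integral => //; [exact/measurable_EFinP..|].
by apply: filterS fg => x /= + _ => ->.
Qed.

Lemma norm1_ae f g : integ f -> integ g -> f = g %[ae mu] -> norm1 f = norm1 g.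
Proof.
move=> /integ_norm/integ_mfun mf /integ_norm/integ_mfun mg fg.
by apply: eq_ae_Rintegral => //; apply: filterS fg => x /= + _ => ->.
Qed.

Lemma norm1_eq0 f : integ f -> norm1 f = 0 -> f = cst 0 %[ae mu].
Proof.
move=> If f0; have := norm1E If; rewrite f0 => /esym.
have mf : measurable_fun setT (EFin \o f) by exact/measurable_EFinP/integ_mfun.
move=> /(ae_eq_integral_abs mu measurableT mf); apply: filterS => x /= + _.
by move=> /(_ I) [].
Qed.

Lemma norm1_le f g : measurable_fun setT f -> integ g ->
  {ae mu, forall x, `|f x| <= `|g x|} -> integ f /\ norm1 f <= norm1 g.
Proof.
move=> mf Ig fg.
have le : (\int[mu]_x `|f x|%:E <= \int[mu]_x `|g x|%:E)%E.
  apply: ae_ge0_le_integral => //.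
  - by apply/measurable_EFinP; exact: measurableT_comp.
  - by apply/measurable_EFinP; apply: measurableT_comp => //; exact: integ_mfun.
  - by apply: filterS fg => x; rewrite lee_fin.
have If : integ f.
  apply/integP; split=> //; apply: (le_lt_trans le).
  by move: Ig => /integP[].
by split=> //; rewrite -lee_fin !norm1E.
Qed.

Lemma integ_ae f g : integ f -> measurable_fun setT g -> f = g %[ae mu] -> integ g.
Proof.
move=> If mg fg; apply: (proj1 (norm1_le mg If _)).
by apply: filterS fg => x /= ->.
Qed.

(* Riesz-Fischer: a fast Cauchy sequence converges almost everywhere because the
   sum of the increments is integrable. *)
Lemma riesz_fischer (u : nat -> T -> R) : (forall n, integ (u n)) ->
  (forall n, norm1 (fun x => u n.+1 x - u n x) <= 1 / 2 ^+ n) ->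
  exists2 g, integ g & forall n, norm1 (fun x => g x - u n x) <= 2 / 2 ^+ n.
Proof.
move=> Iu hu.
pose D k x := `|u k.+1 x - u k x|.
have D0 k x : 0 <= D k x by exact: normr_ge0.
have ID k : integ (D k) by apply/integ_norm/integB.
have mD k : measurable_fun setT (fun x => (D k x)%:E).
  exact/measurable_EFinP/integ_mfun.
pose S n x := (\sum_(0 <= k <oo) (D (n + k)%N x)%:E)%E.
have mS n : measurable_fun setT (S n).
  apply: (@ge0_emeasurable_sum _ _ _ setT (fun k x => (D (n + k)%N x)%:E) xpredT) => //.
  by move=> k x _ _; rewrite lee_fin.
have S_ge0 n x : (0 <= S n x)%E by apply: nneseries_ge0 => k _ _; rewrite lee_fin.
have geo := @nneseries_geometric_half R.
have intS n : (\int[mu]_x S n x <= (2 / 2 ^+ n)%:E)%E.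
  rewrite integral_nneseries//; last by move=> k x _; rewrite lee_fin.
  rewrite -geo; apply: lee_nneseries => [k _ _|k _].
    by apply: integral_ge0 => x _; rewrite lee_fin.
  have -> : (\int[mu]_x (D (n + k)%N x)%:E =
             (norm1 (fun x => u (n + k).+1 x - u (n + k)%N x))%:E)%E.
    by rewrite norm1E//; exact: integB.
  by rewrite lee_fin.
have S0fin : {ae mu, forall x, (S 0%N x < +oo)%E}.
  have IS : mu.-integrable setT (S 0%N).
    apply/integrableP; split=> //.
    under eq_integral do rewrite gee0_abs//.
    by apply: (le_lt_trans (intS _)); rewrite ltry.
  have := integrable_ae measurableT IS; apply: filterS => x /(_ I).
  by rewrite ge0_fin_numE.
(* The upper limit is measurable without any convergence; it is the limit at every point where [S 0]
   is finite, hence almost everywhere. *)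
pose g x := fine (limn_esup (fun n => (u n x)%:E)).
have mg : measurable_fun setT g.
  apply: measurableT_comp => //; apply: measurable_fun_limn_esup => n.
  exact/measurable_EFinP/integ_mfun.
have key x : (S 0%N x < +oo)%E -> forall n, (`|g x - u n x|%:E <= S n x)%E.
  move=> Sx n.
  have cu : u ^~ x @ \oo --> g x.
    have cs : cvgn (series (fun k => u k.+1 x - u k x)).
      apply: normed_cvg.
      apply: nondecreasing_is_cvgn; first by apply: nondecreasing_series => *; exact: normr_ge0.
      exists (fine (S 0%N x)) => _ [m _ <-].
      have Sfin : S 0%N x \is a fin_num by rewrite ge0_fin_numE.
      rewrite -lee_fin fineK// /series/= -sumEFin.
      by apply: nneseries_lim_ge => k _ _; rewrite lee_fin.
    have cu : cvgn (u ^~ x).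
      have -> : u ^~ x = fun n => u 0%N x + series (fun k => u k.+1 x - u k x) n.
        by apply/funext => m; rewrite /series/= telescope_sumr// addrC subrK.
      by apply: is_cvgD => //; exact: is_cvg_cst.
    suff -> : g x = lim (u ^~ x @ \oo) by [].
    have ce : (u m x)%:E @[m --> \oo] --> (lim (u ^~ x @ \oo))%:E.
      by apply: cvg_EFin => //; exact: nearW.
    by rewrite /g is_cvg_limn_esupE ?(cvg_lim _ ce)//; apply/cvg_ex; eexists; exact: ce.
  have bnd m : (`|u (n + m)%N x - u n x|%:E <= S n x)%E.
    apply: (@le_trans _ _ (\sum_(0 <= k < m) (D (n + k)%N x)%:E)%E); last first.
      by apply: nneseries_lim_ge => k _ _; rewrite lee_fin.
    rewrite sumEFin lee_fin; elim: m => [|m IH].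
      by rewrite addn0 subrr normr0 big_nil.
    rewrite big_nat_recr//= addnS.
    apply: le_trans (lerD IH (lexx _)).
    have -> : u (n + m).+1 x - u n x =
        (u (n + m)%N x - u n x) + (u (n + m).+1 x - u (n + m)%N x).
      by rewrite [RHS]addrC addrA subrK.
    exact: ler_normD.
  have [->|Sn] := eqVneq (S n x) +oo%E; first by rewrite leey.
  have Sfin : S n x \is a fin_num by rewrite ge0_fin_numE// lt_neqAle Sn leey.
  rewrite -(fineK Sfin) lee_fin.
  apply/ler_addgt0Pl => e e0; have /cvgrPdist_le/(_ _ e0)[N _ hN] := cu.
  have -> : g x - u n x = (g x - u (n + N)%N x) + (u (n + N)%N x - u n x).
    by rewrite addrA subrK.
  apply: (le_trans (ler_normD _ _)); rewrite lerD//; first by apply: hN; exact: leq_addl.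
  by rewrite -lee_fin fineK.
have Ig0 n : integ (fun x => g x - u n x) /\ norm1 (fun x => g x - u n x) <= 2 / 2 ^+ n.
  have le : (\int[mu]_x `|g x - u n x|%:E <= (2 / 2 ^+ n)%:E)%E.
    apply: le_trans (intS n); apply: ae_ge0_le_integral => //.
    - apply/measurable_EFinP; apply: measurableT_comp => //.
      by apply: measurable_funB => //; exact: integ_mfun.
    - by apply: filterS S0fin => x /key h _; exact: h.
  have Ig : integ (fun x => g x - u n x).
    apply/integP; split; first by apply: measurable_funB => //; exact: integ_mfun.
    by apply: (le_lt_trans le); rewrite ltry.
  by split=> //; rewrite -lee_fin norm1E.
exists g => [|n]; last by have [] := Ig0 n.
have := integD (proj1 (Ig0 0%N)) (Iu 0%N); congr integ.
by apply/funext => x; rewrite subrK.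
Qed.

End integrable_functions.

Lemma filterS4 T (F : set_system T) (FF : Filter F) (P Q U V W : set T) :
  (forall x, P x -> Q x -> U x -> V x -> W x) -> F P -> F Q -> F U -> F V -> F W.
Proof.
move=> h fP fQ fU fV; apply: filterS2 (filterI fP fQ) (filterI fU fV) => x [? ?] [? ?].
exact: h.
Qed.

Lemma filterS5 T (F : set_system T) (FF : Filter F) (P Q U V W Y : set T) :
  (forall x, P x -> Q x -> U x -> V x -> W x -> Y x) ->
  F P -> F Q -> F U -> F V -> F W -> F Y.
Proof.
move=> h fP fQ fU fV fW.
apply: filterS3 (filterI fP fQ) (filterI fU fV) fW => x [? ?] [? ?] ?; exact: h.
Qed.

(** * The complete normed module of integrable classes *)

Section L1_type.
Context d (T : measurableType d) (R : realType).
Variable mu : {measure set T -> \bar R}.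
Implicit Types f g : T -> R.

(* A canonical representative of each class of almost everywhere equal
   functions makes the quotient a subtype with Leibniz equality. *)
Definition L1_repr f : T -> R := xget (cst 0) [set g | integ mu g /\ f = g %[ae mu]].

Lemma L1_reprP f : integ mu f -> integ mu (L1_repr f) /\ f = L1_repr f %[ae mu].
Proof.
move=> If; rewrite /L1_repr; case: xgetP => [g _ //|/(_ f)[]].
by split=> //; exact: ae_eq_refl.
Qed.

Lemma L1_repr_ae f g : f = g %[ae mu] -> L1_repr f = L1_repr g.
Proof.
move=> fg; congr xget; apply/funext => h; apply/propext; split=> -[Ih e]; split=> //.
  exact: ae_eq_trans (ae_eq_sym fg) e.
exact: ae_eq_trans fg e.
Qed.

Record L1 := MkL1 { L1_fun :> T -> R; L1_funP : integ mu L1_fun /\ L1_repr L1_fun = L1_fun }.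

HB.instance Definition _ := gen_eqMixin L1.
HB.instance Definition _ := gen_choiceMixin L1.

Lemma L1_integ (x : L1) : integ mu x. Proof. by case: (L1_funP x). Qed.

Lemma L1_ext (x y : L1) : ae_eq mu setT (L1_fun x) (L1_fun y) -> x = y.
Proof.
move=> xy; have e : L1_fun x = L1_fun y.
  by case: (L1_funP x) => _ <-; case: (L1_funP y) => _ <-; exact: L1_repr_ae.
case: x y xy e => [f Pf] [g Pg] /= _ e; subst g.
by congr MkL1; exact: Prop_irrelevance.
Qed.

(** The implication under the existential makes [L1_of] a total function: for a nonintegrable [f]
    any class will do. *)
Lemma L1_of_exists f : exists x : L1, integ mu f -> ae_eq mu setT f (L1_fun x).
Proof.
have main g : integ mu g -> exists x : L1, ae_eq mu setT g (L1_fun x).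
  move=> Ig; have [Ir gr] := L1_reprP Ig.
  have P : integ mu (L1_repr g) /\ L1_repr (L1_repr g) = L1_repr g.
    by split=> //; exact/esym/L1_repr_ae.
  by exists (MkL1 P).
have [If|nIf] := pselect (integ mu f).
  by have [x hx] := main _ If; exists x.
by have [x _] := main _ (integ0 mu); exists x.
Qed.

Definition L1_of f : L1 := sval (cid (L1_of_exists f)).

Lemma L1_ofP f : integ mu f -> ae_eq mu setT f (L1_of f).
Proof. by rewrite /L1_of; case: cid. Qed.

Lemma L1_of_fun (x : L1) : L1_of x = x.
Proof. by apply: L1_ext; apply: ae_eq_sym; apply: L1_ofP; exact: L1_integ. Qed.

Lemma L1_of_ae f g : integ mu f -> integ mu g -> f = g %[ae mu] -> L1_of f = L1_of g.
Proof.
move=> If Ig fg; apply: L1_ext.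
exact: ae_eq_trans (ae_eq_sym (L1_ofP If)) (ae_eq_trans fg (L1_ofP Ig)).
Qed.

Lemma L1_of_inj f g : integ mu f -> integ mu g -> L1_of f = L1_of g -> f = g %[ae mu].
Proof.
move=> If Ig fg; apply: ae_eq_trans (L1_ofP If) _.
by rewrite fg; exact: ae_eq_sym (L1_ofP Ig).
Qed.

Let add (x y : L1) := L1_of (fun t => x t + y t).
Let zero := L1_of (cst 0).
Let opp (x : L1) := L1_of (fun t => - x t).
Let scale (a : R) (x : L1) := L1_of (fun t => a * x t).

Let addP (x y : L1) : ae_eq mu setT (fun t => x t + y t) (add x y).
Proof. by apply: L1_ofP; apply: integD; exact: L1_integ. Qed.
Let oppP (x : L1) : ae_eq mu setT (fun t => - x t) (opp x).
Proof. by apply: L1_ofP; apply: integN; exact: L1_integ. Qed.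
Let scaleP a (x : L1) : ae_eq mu setT (fun t => a * x t) (scale a x).
Proof. by apply: L1_ofP; apply: integZ; exact: L1_integ. Qed.
Let zeroP : ae_eq mu setT (cst 0) zero.
Proof. by apply: L1_ofP; exact: integ0. Qed.

Let addA : associative add.
Proof.
move=> x y z; apply: L1_ext.
move: (addP x (add y z)) (addP y z) (addP x y) (addP (add x y) z).
by apply: filterS4 => t /= <- // <- // + + _ => <- // <- //; rewrite addrA.
Qed.
Let addC : commutative add.
Proof.
move=> x y; apply: L1_ext; move: (addP x y) (addP y x).
by apply: filterS2 => t /= <- // <- // _; rewrite addrC.
Qed.
Let add0 : left_id zero add.
Proof.
move=> x; apply: L1_ext; move: (addP zero x) zeroP.
by apply: filterS2 => t /= <- // <- // _; rewrite add0r.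
Qed.
Let addN : left_inverse zero opp add.
Proof.
move=> x; apply: L1_ext; move: (addP (opp x) x) zeroP (oppP x).
by apply: filterS3 => t /= <- // <- // <- // _; rewrite addNr.
Qed.

HB.instance Definition _ := GRing.isZmodule.Build L1 addA addC add0 addN.

Let scaleA a b x : scale a (scale b x) = scale (a * b) x.
Proof.
apply: L1_ext; move: (scaleP a (scale b x)) (scaleP b x) (scaleP (a * b) x).
by apply: filterS3 => t /= <- // <- // <- // _; rewrite mulrA.
Qed.
Let scale1 : left_id 1 scale.
Proof.
by move=> x; apply: L1_ext; move: (scaleP 1 x); apply: filterS => t /= <- // _; rewrite mul1r.
Qed.
Let scaleDr : right_distributive scale +%R.
Proof.
move=> a x y; apply: L1_ext.
move: (scaleP a (add x y)) (addP x y) (addP (scale a x) (scale a y)) (scaleP a x) (scaleP a y).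
by apply: filterS5 => t /= <- // <- // <- // <- // <- // _; rewrite mulrDr.
Qed.
Let scaleDl x : {morph scale^~ x : a b / a + b}.
Proof.
move=> a b; apply: L1_ext.
move: (scaleP (a + b) x) (addP (scale a x) (scale b x)) (scaleP a x) (scaleP b x).
by apply: filterS4 => t /= <- // <- // <- // <- // _; rewrite mulrDl.
Qed.

HB.instance Definition _ := GRing.Zmodule_isLmodule.Build R L1 scaleA scale1 scaleDr scaleDl.

Lemma L1_addE (x y : L1) : ae_eq mu setT (fun t => x t + y t) (x + y : L1).
Proof. exact: addP. Qed.
Lemma L1_0E : ae_eq mu setT (cst 0) (0 : L1).
Proof. exact: zeroP. Qed.

Let norm (x : L1) := norm1 mu x.

Let normD x y : norm (x + y) <= norm x + norm y.
Proof.
rewrite /norm -(norm1_ae (integD (L1_integ x) (L1_integ y)) (L1_integ _) (addP x y)).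
by apply: norm1D; exact: L1_integ.
Qed.
Let normZ (a : R) x : norm (a *: x) = `|a| * norm x.
Proof.
rewrite /norm -(norm1_ae (integZ a (L1_integ x)) (L1_integ _) (scaleP a x)).
by apply: norm1Z; exact: L1_integ.
Qed.
Let norm0 x : norm x = 0 -> x = 0.
Proof.
move=> x0; apply: L1_ext.
exact: ae_eq_trans (norm1_eq0 (L1_integ x) x0) zeroP.
Qed.

HB.instance Definition _ := @Lmodule_isNormed.Build R L1 norm normD normZ norm0.

Lemma L1_normE (x : L1) : `|x| = norm1 mu x. Proof. by []. Qed.

Lemma L1_of_norm f : integ mu f -> `|L1_of f| = norm1 mu f.
Proof.
by move=> If; apply/esym/norm1_ae; [|exact: L1_integ|exact: L1_ofP].
Qed.

Lemma L1_ofD f g : integ mu f -> integ mu g ->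
  L1_of (fun t => f t + g t) = L1_of f + L1_of g.
Proof.
move=> If Ig; apply: L1_ext.
move: (L1_ofP (integD If Ig)) (L1_ofP If) (L1_ofP Ig) (addP (L1_of f) (L1_of g)).
by apply: filterS4 => t /= <- // -> // -> // <-.
Qed.
Lemma L1_ofZ a f : integ mu f -> L1_of (fun t => a * f t) = a *: L1_of f.
Proof.
move=> If; apply: L1_ext.
move: (L1_ofP (integZ a If)) (L1_ofP If) (scaleP a (L1_of f)).
by apply: filterS3 => t /= <- // -> // <-.
Qed.
Lemma L1_ofB f g : integ mu f -> integ mu g ->
  L1_of (fun t => f t - g t) = L1_of f - L1_of g.
Proof.
move=> If Ig; have -> : (fun t => f t - g t) = (fun t => f t + (-1) * g t).
  by apply/funext => t; rewrite mulN1r.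
by rewrite L1_ofD//; [rewrite L1_ofZ// scaleN1r|exact: integZ].
Qed.

Let complete (F : set_system L1) : ProperFilter F -> cauchy F -> cvg F.
Proof.
move=> FF /cauchyP cF.
(* Two balls that belong to the filter meet, so radii $2^{-n}/2$ force consecutive centres within
   $2^{-n}$, the rate required by [riesz_fischer]. *)
have small n : (0 < 1 / 2 ^+ n / 2 :> R) by rewrite !divr_gt0// exprn_gt0.
have [u hu] : exists u : nat -> L1, forall n, F (ball (u n) (1 / 2 ^+ n / 2)).
  have [u hu] := choice (fun n => cF _ (small n)); by exists u.
have close n : `|u n.+1 - u n| <= 1 / 2 ^+ n.
  have [x [x1 x2]] := filter_ex (filterI (hu n) (hu n.+1)).
  rewrite -ball_normE /= in x1; rewrite -ball_normE /= in x2.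
  have -> : u n.+1 - u n = (u n.+1 - x) - (u n - x) by rewrite opprB addrA subrK.
  apply: (le_trans (ler_normB _ _)).
  have : 1 / 2 ^+ n.+1 / 2 <= 1 / 2 ^+ n / 2 :> R.
    rewrite ler_wpM2r// !mul1r lef_pV2 ?posrE ?exprn_gt0//.
    by rewrite ler_weXn2l// ler1n.
  by lra.
have [g Ig hg] : exists2 g, integ mu g &
    forall n, norm1 mu (fun x => g x - u n x) <= 2 / 2 ^+ n.
  apply: riesz_fischer => n; first exact: L1_integ.
  rewrite -L1_of_norm; last by apply: integB; exact: L1_integ.
  by rewrite L1_ofB ?L1_of_fun//; exact: L1_integ.
apply/cvg_ex; exists (L1_of g); apply/cvgrPdist_le => e e0.
have [n hn] : exists n : nat, 3 / e < n%:R.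
  by exists (Num.trunc (3 / e)).+1; exact: truncnS_gt.
apply: filterS (hu n) => x; rewrite -ball_normE /= => xn.
have -> : L1_of g - x = (L1_of g - u n) + (u n - x) by rewrite addrA subrK.
apply: (le_trans (ler_normD _ _)).
have gn : `|L1_of g - u n| <= 2 / 2 ^+ n.
  apply: le_trans (hg n); rewrite -L1_of_norm; last by apply: integB => //; exact: L1_integ.
  by rewrite L1_ofB ?L1_of_fun//; exact: L1_integ.
have p0 : 0 < 2 ^+ n :> R by rewrite exprn_gt0.
have np : n%:R <= 2 ^+ n :> R by rewrite -natrX ler_nat ltnW// ltn_expl.
have : 3 / 2 ^+ n <= e.
  rewrite ler_pdivrMr// mulrC -ler_pdivrMr//; exact: le_trans (ltW hn) np.
have : 1 / 2 ^+ n / 2 <= 1 / 2 ^+ n :> R by have := divr_ge0 ler01 (ltW p0); lra.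
lra.
Qed.

HB.instance Definition _ := Uniform_isComplete.Build L1 complete.

End L1_type.

Arguments L1 {d T R} mu.
Arguments L1_of {d T R} mu f.

(** * The dual of the space of integrable functions *)

Lemma extend_from_dense (R : realType) (X : completeNormedModType R) (dom : set X)
    (L : X -> R) (M : R) : 0 <= M -> dense_in dom -> dom 0 ->
  (forall a x y, dom x -> dom y -> dom (a *: x + y)) ->
  (forall a x y, dom x -> dom y -> L (a *: x + y) = a * L x + L y) ->
  (forall x, dom x -> `|L x| <= M * `|x|) ->
  exists L' : X -> R, [/\ forall a x y, L' (a *: x + y) = a * L' x + L' y,
    forall x, `|L' x| <= M * `|x| & forall x, dom x -> L' x = L x].
Proof.
move=> M0 dns d0 dlin Llin LM.
have LB y z : dom y -> dom z -> `|L y - L z| <= M * `|y - z|.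
  move=> dy dz; have -> : L y - L z = L ((-1) *: z + y).
    by rewrite Llin// mulN1r addrC.
  have -> : y - z = (-1) *: z + y by rewrite scaleN1r addrC.
  by apply: LM; exact: dlin.
(* The value of the extension at [x] is characterised by its distance to all values on the domain.
   Density makes it unique, and linearity then follows from uniqueness, without choosing
   sequences. *)
pose P x (l : R) := forall y, dom y -> `|L y - l| <= M * `|y - x|.
have uniq x l l' : P x l -> P x l' -> l = l'.
  move=> Pl Pl'; apply/eqP; rewrite -subr_eq0 -normr_le0; apply/ler_addgt0Pl => e e0.
  have e2 : 0 < e / 2 / (M + 1) by rewrite !divr_gt0//; lra.
  have [y dy xy] := dns x _ e2; rewrite addr0.
  have -> : l - l' = (L y - l') - (L y - l) by lra.
  apply: (le_trans (ler_normB _ _)); rewrite distrC in xy.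
  have h : M * `|y - x| <= M * (e / 2 / (M + 1)) by rewrite ler_wpM2l// ltW.
  have h2 : (M + 1) * (e / 2 / (M + 1)) = e / 2 by rewrite mulrC divfK// gt_eqF//; lra.
  have := Pl _ dy; have := Pl' _ dy; lra.
have exP x : exists l, P x l.
  (* The admissible values lie between the lower bounds $L(y)-M|y-x|$ and the upper bounds
     $L(z)+M|z-x|$. Each of the former is below each of the latter, so the supremum is
     admissible. *)
  pose S := [set r | exists2 y, dom y & r = L y - M * `|y - x|].
  have ub z : dom z -> ubound S (L z + M * `|z - x|).
    move=> dz _ [y dy ->]; rewrite lerBlDr -lerBlDl.
    have h1 := le_trans (ler_norm _) (LB y z dy dz).
    have h2 : `|y - z| <= `|y - x| + `|z - x|.
      have -> : y - z = (y - x) - (z - x) by rewrite opprB addrA subrK.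
      exact: ler_normB.
    have := ler_wpM2l M0 h2; lra.
  have hS : has_sup S by split; [exists (L 0 - M * `|0 - x|), 0|exists (L 0 + M * `|0 - x|); exact: ub].
  exists (sup S) => y dy; rewrite ler_distl; apply/andP; split.
    by have := ge_sup (proj1 hS) (ub y dy); lra.
  by have := sup_upper_bound hS (ex_intro2 _ _ y dy erefl : S (L y - M * `|y - x|)); lra.
have [L' hL'] := choice exP; exists L'; split.
- move=> a x y; apply: (uniq (a *: x + y)); first exact: hL'.
  move=> w dw; apply/ler_addgt0Pl => e e0.
  have e2 : 0 < e / 4 / ((M + 1) * (`|a| + 1)).
    apply: divr_gt0; first lra.
    by apply: mulr_gt0; [lra|have := normr_ge0 a; lra].
  have [x' dx' xx'] := dns x _ e2; have [y' dy' yy'] := dns y _ e2.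
  have h1 := hL' x _ dx'; have h2 := hL' y _ dy'; have h3 := LB _ _ dw (dlin a _ _ dx' dy').
  rewrite Llin// in h3; rewrite distrC in xx'; rewrite distrC in yy'.
  set q := e / 4 / _ in xx' yy' e2.
  have q0 : 0 <= q by exact: ltW.
  have a0 := normr_ge0 a.
  have qe : (M + 1) * (`|a| + 1) * q = e / 4.
    by rewrite /q mulrC divfK// gt_eqF// mulr_gt0//; lra.
  have h4 : `|a * (L x' - L' x)| <= `|a| * (M * q).
    rewrite normrM ler_wpM2l//; apply: (le_trans h1); rewrite ler_wpM2l//; exact: ltW.
  have h5 : `|L y' - L' y| <= M * q by apply: (le_trans h2); rewrite ler_wpM2l//; exact: ltW.
  have h6 : `|w - (a *: x' + y')| <= `|w - (a *: x + y)| + (`|a| * q + q).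
    have -> : w - (a *: x' + y') = (w - (a *: x + y)) - (a *: (x' - x) + (y' - y)).
      by lmod R.
    apply: (le_trans (ler_normB _ _)); rewrite lerD2l.
    apply: (le_trans (ler_normD _ _)); rewrite normrZ.
    by rewrite lerD ?(ltW yy')// ler_wpM2l// ltW.
  have h7 := ler_wpM2l M0 h6.
  have -> : L w - (a * L' x + L' y) = (L w - (a * L x' + L y')) +
    (a * (L x' - L' x) + (L y' - L' y)) by ring.
  apply: (le_trans (ler_normD _ _)); apply: (le_trans (lerD (lexx _) (ler_normD _ _))).
  have : 0 <= M * q by rewrite mulr_ge0.
  have : 0 <= `|a| * q by rewrite mulr_ge0.
  by lra.
- move=> x; apply/ler_addgt0Pl => e e0.
  have e2 : 0 < e / 2 / (M + 1) by rewrite !divr_gt0//; lra.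
  have [y dy xy] := dns x _ e2; have h1 := hL' x _ dy; have h2 := LM _ dy.
  rewrite distrC in xy; set q := e / 2 / _ in xy e2.
  have qe : (M + 1) * q = e / 2 by rewrite /q mulrC divfK// gt_eqF//; lra.
  have h3 : `|y| <= `|x| + `|y - x| by rewrite -[in leLHS](subrK x y) addrC ler_normD.
  have h4 : `|L' x| <= `|L y| + `|L y - L' x|.
    by rewrite -[in leLHS](subKr (L y) (L' x)) ler_normB.
  have h5 := ler_wpM2l M0 h3; have h6 := ler_wpM2l M0 (ltW xy); lra.
- move=> x dx; have := hL' x x dx; rewrite subrr normr0 mulr0 normr_le0 subr_eq0.
  by move=> /eqP.
Qed.

Lemma int_scale d (T : measurableType d) (R : realType) (mu : {measure set T -> \bar R})
    (a : R) (f : T -> R) : integ mu f -> \int[mu]_x (a * f x) = a * \int[mu]_x f x.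
Proof. by move=> If; rewrite RintegralZl. Qed.

Lemma measurable_fun_inv_pos d (T : measurableType d) (R : realType) (h : T -> R) :
  (forall x, 0 < h x) -> measurable_fun setT h -> measurable_fun setT (fun x => (h x)^-1).
Proof.
move=> h0 mh.
have -> : (fun x => (h x)^-1) = (fun x => expR (- ln (h x))).
  by apply/funext => x; rewrite expRN lnK// posrE.
apply: measurableT_comp => //; apply: measurableT_comp => //.
by apply: measurableT_comp => //; exact: measurable_ln.
Qed.

Section sigma_finite_weight.
Context d (T : measurableType d) (R : realType).
Variable mu : {measure set T -> \bar R}.

(** A strictly positive integrable density condenses an exhaustion by sets of finite measure into
    one function. It makes the charge below finite and provides test functions supported on
    arbitrary measurable sets. *)
Lemma sigma_finite_weight : sigma_finite setT mu ->
  exists h : T -> R, integ mu h /\ forall x, 0 < h x.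
Proof.
move=> [F TF Foo].
have mF n : measurable (F n) by case: (Foo n).
pose c n : R := 1 / 2 ^+ n / (1 + fine (mu (F n))).
have f0 n : 0 <= fine (mu (F n)) by exact: fine_ge0.
have c0 n : 0 < c n.
  by rewrite /c !divr_gt0 ?exprn_gt0//; have := f0 n; lra.
have c1 n : c n <= 1 / 2 ^+ n.
  rewrite /c ler_pdivrMr; last by have := f0 n; lra.
  by rewrite ler_peMr ?divr_ge0 ?exprn_ge0//; have := f0 n; lra.
pose g n x : R := c n * \1_(F n) x.
have g0 n x : 0 <= g n x by rewrite mulr_ge0// ltW.
have mg n : measurable_fun setT (fun x => (g n x)%:E).
  by apply/measurable_EFinP; apply: measurable_funM => //; exact: measurable_indic.
pose H x := (\sum_(0 <= n <oo) (g n x)%:E)%E.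
have H0 x : (0 <= H x)%E by apply: nneseries_ge0 => n _ _; rewrite lee_fin.
have mH : measurable_fun setT H.
  apply: (@ge0_emeasurable_sum _ _ _ setT (fun k x => (g k x)%:E) xpredT) => //.
  by move=> k x _ _; rewrite lee_fin.
have geo := @nneseries_geometric_half R 0; rewrite expr0 divr1 in geo.
have H2 x : (H x <= 2%:E)%E.
  rewrite -geo; apply: lee_nneseries => n; first by rewrite lee_fin.
  move=> _; rewrite lee_fin add0n; apply: le_trans (c1 n); rewrite /g ler_piMr ?(ltW (c0 n))//.
have Hfin x : H x \is a fin_num by rewrite ge0_fin_numE// (le_lt_trans (H2 x))// ltry.
exists (fine \o H); split; last first.
  move=> x; have [n _ Fn] : (\bigcup_n F n) x by rewrite -TF.
  rewrite -lte_fin fineK//; apply: (@lt_le_trans _ _ (\sum_(0 <= k < n.+1) (g k x)%:E)%E).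
    rewrite sumEFin lte_fin big_nat_recr//= ltr_wpDl ?sumr_ge0//.
    by rewrite /g indicE mem_set// mulr1.
  by apply: nneseries_lim_ge => k _ _; rewrite lee_fin.
apply/integP; split; first by apply: measurableT_comp.
have -> : (\int[mu]_x `|(fine \o H) x|%:E = \int[mu]_x H x)%E.
  by apply: eq_integral => x _; rewrite /= ger0_norm ?fine_ge0// fineK.
apply: (@le_lt_trans _ _ 2%:E%E); last exact: ltry.
rewrite /H integral_nneseries//; last by move=> n x _; rewrite lee_fin.
rewrite -geo; apply: lee_nneseries => n.
  by move=> _ _; apply: integral_ge0 => x _; rewrite lee_fin.
move=> _; rewrite add0n.
under eq_integral do rewrite /g EFinM.
rewrite ge0_integralZl//; last by rewrite lee_fin ltW.
  rewrite integral_indic// setIT -[mu (F n)]fineK; last first.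
    by rewrite ge0_fin_numE//; case: (Foo n).
  have : c n * (1 + fine (mu (F n))) = 1 / 2 ^+ n.
    by rewrite /c divfK// gt_eqF//; have := f0 n; lra.
  by rewrite -EFinM lee_fin; have := c0 n; lra.
by apply/measurable_EFinP; exact: measurable_indic.
Qed.

End sigma_finite_weight.

Lemma dominated_norm1 d (T : measurableType d) (R : realType)
    (mu : {measure set T -> \bar R}) (f_ : nat -> T -> R) (f g : T -> R) :
  (forall n, measurable_fun setT (f_ n)) -> measurable_fun setT f -> integ mu g ->
  (forall n x, `|f_ n x| <= g x) ->
  (forall x, (f_ n x)%:E @[n --> \oo] --> (f x)%:E) ->
  forall e : R, 0 < e -> exists N, forall n, (N <= n)%N ->
    norm1 mu (fun x => f_ n x - f x) <= e.
Proof.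
move=> mf_ mf Ig fg cf e e0.
have [If _ _] := @dominated_convergence _ _ _ mu setT measurableT
  (fun n => EFin \o f_ n) (EFin \o f) (EFin \o g)
  (fun n => proj2 (measurable_EFinP _ _) (mf_ n)) (proj2 (measurable_EFinP _ _) mf)
  (aeW _ (fun x _ => cf x)) Ig (aeW _ (fun x n _ => fg n x)).
have [_ c _] := @dominated_convergence _ _ _ mu setT measurableT
  (fun n => EFin \o f_ n) (EFin \o f) (EFin \o g)
  (fun n => proj2 (measurable_EFinP _ _) (mf_ n)) (proj2 (measurable_EFinP _ _) mf)
  (aeW _ (fun x _ => cf x)) Ig (aeW _ (fun x n _ => fg n x)).
have If_ n : integ mu (f_ n) by exact: integ_le (fg n) Ig.
move/fine_cvg/cvgrPdist_le : c => /(_ _ e0)[N _ hN].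
exists N => n /hN /=; rewrite sub0r normrN; apply: le_trans.
by rewrite /norm1 /Rintegral ler_norm.
Qed.

Import HBNNSimple.

(** * Bounded functionals on integrable functions are given by bounded densities *)

Section dual.
Context d (T : measurableType d) (R : realType).
Variable mu : {sigma_finite_measure set T -> \bar R}.
Variables (L : L1 mu -> R) (M : R).
Hypothesis Llin : forall a x y, L (a *: x + y) = a * L x + L y.
Hypothesis LM : forall x, `|L x| <= M * `|x|.

Let ell (f : T -> R) : R := L (L1_of mu f).

Let L0 : L 0 = 0.
Proof. by apply/eqP; rewrite -normr_le0; have := LM 0; rewrite normr0 mulr0. Qed.

Let ell_lin a f g : integ mu f -> integ mu g ->
  ell (fun x => a * f x + g x) = a * ell f + ell g.
Proof.
by move=> If Ig; rewrite /ell L1_ofD ?L1_ofZ// ?Llin//; exact: integZ.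
Qed.

Let ell_le f : integ mu f -> `|ell f| <= M * norm1 mu f.
Proof. by move=> If; rewrite -L1_of_norm//; exact: LM. Qed.

Let ell_ae f g : integ mu f -> integ mu g -> f = g %[ae mu] -> ell f = ell g.
Proof. by move=> If Ig fg; rewrite /ell (L1_of_ae If Ig fg). Qed.

Let ell0 : ell (cst 0) = 0.
Proof.
have I0 := integ0 mu; have := ell_lin (-1) I0 I0.
rewrite mulN1r addNr => <-; congr ell; apply/funext => x /=; by rewrite mulr0 addr0.
Qed.

Variable h : T -> R.
Hypothesis Ih : integ mu h.
Hypothesis h_gt0 : forall x, 0 < h x.

Let hA (A : set T) x := h x * \1_A x.

Let hA_le A x : `|hA A x| <= h x.
Proof.
rewrite /hA normrM (gtr0_norm (h_gt0 x)) ler_piMr ?(ltW (h_gt0 x))//.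
by rewrite indicE; case: (_ \in _); rewrite ?normr1 ?normr0.
Qed.

Let IhA A : measurable A -> integ mu (hA A).
Proof.
move=> mA; apply: (integ_le _ (hA_le A) Ih).
by apply: measurable_funM; [exact: integ_mfun Ih|exact: measurable_indic].
Qed.

(** Indicators need not be integrable, but $h1_A$ always is, so this is a finite charge on all
    measurable sets. Its Radon-Nikodym density [r] is $h$ times the density looked for. *)
Let nu (A : set T) : \bar R := (ell (hA A))%:E.

Let nu0 : nu set0 = 0%E.
Proof.
rewrite /nu (_ : hA set0 = cst 0) ?ell0//.
by apply/funext => x; rewrite /hA indic0 mulr0.
Qed.

Let nu_fin A : measurable A -> nu A \is a fin_num. Proof. by []. Qed.

Let ell_cvg (f_ : nat -> T -> R) f :
  (forall n, integ mu (f_ n)) -> integ mu f ->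
  (forall e : R, 0 < e -> exists N, forall n, (N <= n)%N ->
    norm1 mu (fun x => f_ n x - f x) <= e) ->
  forall e : R, 0 < e -> exists N, forall n, (N <= n)%N -> `|ell (f_ n) - ell f| <= e.
Proof.
move=> If_ If fcvg e e0; have M1 : 0 < `|M| + 1 by rewrite ltr_wpDl.
have eM : 0 < e / (`|M| + 1) by rewrite divr_gt0.
have [N hN] := fcvg _ eM; exists N => n Nn.
have -> : ell (f_ n) - ell f = ell (fun x => f_ n x - f x).
  have -> : (fun x => f_ n x - f x) = (fun x => (-1) * f x + f_ n x).
    by apply/funext => x; rewrite mulN1r addrC.
  by rewrite ell_lin// mulN1r addrC.
apply: (le_trans (ell_le (integB (If_ n) If))).
apply: (@le_trans _ _ ((`|M| + 1) * norm1 mu (fun x => f_ n x - f x))).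
  by rewrite ler_wpM2r ?norm1_ge0// (le_trans (ler_norm M))// lerDl.
by have := ler_wpM2l (ltW M1) (hN n Nn); rewrite mulrCA divff ?mulr1// gt_eqF.
Qed.

Let nu_sigma : semi_sigma_additive nu.
Proof.
move=> F mF tF mUF.
pose f_ n x := \sum_(0 <= i < n) hA (F i) x.
have If_ n : integ mu (f_ n).
  rewrite /f_; elim: n => [|n IH].
    by under eq_fun do rewrite big_nil; exact: integ0.
  by under eq_fun do rewrite big_nat_recr//=; apply: integD => //; exact: IhA.
have partial n : (\sum_(0 <= i < n) nu (F i) = (ell (f_ n))%:E)%E.
  elim: n => [|n IH].
    rewrite big_nil (_ : f_ 0%N = cst 0) ?ell0//.
    by apply/funext => x; rewrite /f_ big_nil.
  rewrite big_nat_recr//= IH /nu -EFinD; congr EFin.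
  rewrite -[ell (f_ n)]mul1r -ell_lin//; last exact: IhA.
  by congr ell; apply/funext => x; rewrite mul1r /f_ big_nat_recr.
have ptw x : (f_ n x)%:E @[n --> \oo] --> (hA (\bigcup_n F n) x)%:E.
  have -> : (fun n => (f_ n x)%:E) = (fun n => ((h x)%:E * \sum_(0 <= i < n) (\1_(F i) x)%:E)%E).
    by apply/funext => n; rewrite sumEFin -EFinM /f_ mulr_sumr.
  rewrite /hA EFinM; apply: cvgeZl => //.
  rewrite indic_bigcup//; apply: is_cvg_nneseries => n _ _.
  by rewrite lee_fin.
have fle n x : `|f_ n x| <= h x.
  have f0 m : 0 <= f_ m x.
    by apply: sumr_ge0 => i _; rewrite /hA mulr_ge0 ?(ltW (h_gt0 x))// indicE.
  rewrite ger0_norm// -lee_fin.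
  have : ((f_ n x)%:E <= (hA (\bigcup_n F n) x)%:E)%E.
    rewrite -(cvg_lim _ (ptw x))//; apply: lime_ge; first by apply/cvg_ex; eexists; exact: ptw.
    exists n => // m /= nm; rewrite lee_fin -(subnKC nm).
    elim: (m - n)%N => [|k]; first by rewrite addn0.
    rewrite addnS /f_ big_nat_recr//= => /le_trans; apply; rewrite lerDl.
    by rewrite /hA mulr_ge0 ?(ltW (h_gt0 x))// indicE.
  by move=> /le_trans; apply; rewrite lee_fin (le_trans (ler_norm _)).
have key := ell_cvg If_ (IhA mUF) (dominated_norm1
  (fun n => integ_mfun (If_ n)) (integ_mfun (IhA mUF)) Ih fle ptw).
rewrite (_ : (fun n => _) = (fun n => (ell (f_ n))%:E)); last exact/funext.
apply: cvg_EFin; first exact: nearW.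
apply/cvgrPdist_le => e e0; have [N hN] := key e e0; exists N => // n Nn.
by rewrite distrC; exact: hN.
Qed.

HB.instance Definition _ := isCharge.Build _ _ _ nu nu0 nu_fin nu_sigma.

Let nu_mu : nu `<< mu.
Proof.
move=> A A0 B mB BA; have B0 : mu B = 0%E by exact: A0.
rewrite /nu (@ell_ae _ (cst 0)) ?ell0//; [exact: IhA|exact: integ0|].
exists B; split=> // x /= /not_implyP[_]; rewrite /hA indicE.
by case: (boolP (x \in B)) => [|_]; [rewrite inE|rewrite mulr0 => /(_ erefl)].
Qed.

Let r (x : T) : R := fine (Radon_Nikodym nu mu x).

Let rE : EFin \o r = Radon_Nikodym nu mu.
Proof. by apply/funext => x; rewrite /r/= fineK//; apply: Radon_Nikodym_fin_num nu_mu. Qed.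

Let Ir : integ mu r.
Proof. by rewrite /integ rE; exact: Radon_Nikodym_integrable nu_mu. Qed.

Let ell_hA A : measurable A -> ell (hA A) = \int[mu]_(x in A) r x.
Proof.
move=> mA; apply: EFin_inj; rewrite -/(nu A).
rewrite (Radon_Nikodym_integral nu_mu mA) -rE fineK//.
by apply: integrable_fin_num => //; exact: integrableS Ir.
Qed.

(** Testing on the set where the inequality fails: the integral of $sr-|M|h$ over it is
    $s\,\ell(h1_A)-|M|\,\|h1_A\|\le0$, while the integrand is positive there. The signs $\pm1$
    together bound $|r|$. *)
Let r_le (s : R) : `|s| = 1 -> {ae mu, forall x, s * r x <= `|M| * h x}.
Proof.
move=> s1; pose g x := s * r x - `|M| * h x.
have Ig : integ mu g by apply: integB; exact: integZ.
have mg := integ_mfun Ig.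
pose A := [set x | 0 < g x].
have mA : measurable A.
  have := mg measurableT `]0, +oo[%classic (measurable_itv _); rewrite setTI.
  by congr measurable; apply/seteqP; split=> x /=; rewrite in_itv/= andbT.
have IgA : integ mu (fun x => g x * \1_A x).
  apply: (@integ_le _ _ _ _ _ (fun x => `|g x|)) (integ_norm Ig).
    by apply: measurable_funM => //; exact: measurable_indic.
  by move=> x; rewrite normrM ler_piMr// indicE; case: (_ \in _); rewrite ?normr1 ?normr0.
have gA0 x : 0 <= g x * \1_A x.
  rewrite indicE; case: (boolP (x \in A)) => [|_]; last by rewrite mulr0.
  by rewrite inE /A/= mulr1 => /ltW.
have IrA : integ mu (fun x => r x * \1_A x).
  apply: (@integ_le _ _ _ _ _ (fun x => `|r x|)) (integ_norm Ir).
    by apply: measurable_funM; [exact: integ_mfun Ir|exact: measurable_indic].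
  by move=> x; rewrite normrM ler_piMr// indicE; case: (_ \in _); rewrite ?normr1 ?normr0.
have gA1 : norm1 mu (fun x => g x * \1_A x) = s * ell (hA A) - `|M| * norm1 mu (hA A).
  rewrite ell_hA// Rintegral_mkcond.
  have -> : r \_ A = (fun x => r x * \1_A x).
    by apply/funext => x; rewrite patchE indicE; case: ifPn; rewrite ?mulr1 ?mulr0.
  rewrite -(int_scale s IrA) -(int_scale `|M| (integ_norm (IhA mA))).
  rewrite -RintegralB//; [|exact: integZ|exact/integZ/integ_norm/IhA].
  apply: eq_Rintegral => x _; rewrite ger0_norm// /g /hA.
  rewrite [X in _ = _ - _ * X]ger0_norm; first by ring.
  by rewrite mulr_ge0 ?(ltW (h_gt0 x))// indicE.
have g0 : norm1 mu (fun x => g x * \1_A x) = 0.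
  apply/le_anti; rewrite norm1_ge0 andbT gA1 subr_le0.
  apply: (le_trans (ler_norm _)); rewrite normrM s1 mul1r.
  apply: (le_trans (ell_le (IhA mA))).
  by rewrite ler_wpM2r ?norm1_ge0// ler_norm.
apply: filterS (norm1_eq0 IgA g0) => x /(_ I) /=.
rewrite indicE; case: (boolP (x \in A)) => [|xA _].
  by rewrite inE /A/= mulr1 => + gx0; rewrite gx0 ltxx.
by move: xA; rewrite notin_setE /A /= => /negP; rewrite -leNgt subr_le0.
Qed.

Let r_bnd : {ae mu, forall x, `|r x| <= `|M| * h x}.
Proof.
apply: filterS2 (r_le (normr1 R)) (r_le (normrN1 R)) => x.
by rewrite mul1r mulN1r ler_norml => h1 h2; rewrite h1 andbT lerNl.
Qed.

(** Clipping makes the bound by $|M|$ hold at every point; by [r_bnd] it changes $r/h$ only on a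
    null set. *)
Let k x : R := Num.max (- `|M|) (Num.min `|M| (r x / h x)).

Let k_le x : `|k x| <= `|M|.
Proof.
by rewrite /k ler_norml le_max lexx ge_max ge_min lexx ge0_cp.
Qed.

Let mk : measurable_fun setT k.
Proof.
apply: measurable_maxr => //; apply: measurable_minr => //.
apply: measurable_funM; first exact: integ_mfun Ir.
apply: measurable_fun_inv_pos => //.
exact: integ_mfun Ih.
Qed.

Let kh : {ae mu, forall x, h x * k x = r x}.
Proof.
apply: filterS r_bnd => x; have hx := h_gt0 x.
move=> /ler_normlP[h1 h2].
have {}h1 : - `|M| <= r x / h x by rewrite ler_pdivlMr// mulNr lerNl.
have {}h2 : r x / h x <= `|M| by rewrite ler_pdivrMr.
by rewrite /k min_r// max_r// mulrC divfK// gt_eqF.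
Qed.

Let IMk f : integ mu f -> integ mu (fun x => f x * k x).
Proof.
move=> If; apply: (@integ_le _ _ _ _ _ (fun x => `|M| * `|f x|)).
- by apply: measurable_funM => //; exact: integ_mfun If.
- by move=> x; rewrite normrM mulrC ler_wpM2r.
- exact/integZ/integ_norm.
Qed.

(** The defect of the representation. It is shown to vanish on $h1_A$, then on $h$ times simple
    functions, on nonnegative functions and on differences of these. *)
Let Phi f := ell f - \int[mu]_x (f x * k x).

Let Phi_lin a f g : integ mu f -> integ mu g ->
  Phi (fun x => a * f x + g x) = a * Phi f + Phi g.
Proof.
move=> If Ig; rewrite /Phi ell_lin//.
have -> : \int[mu]_x ((a * f x + g x) * k x) =
    a * \int[mu]_x (f x * k x) + \int[mu]_x (g x * k x).
  rewrite -(int_scale a (IMk If)) -RintegralD//; [|exact/integZ/IMk|exact: IMk].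
  by apply: eq_Rintegral => x _; ring.
ring.
Qed.

Let Phi_le f : integ mu f -> `|Phi f| <= 2 * `|M| * norm1 mu f.
Proof.
move=> If; apply: (le_trans (ler_normB _ _)).
have h1 : `|ell f| <= `|M| * norm1 mu f.
  apply: (le_trans (ell_le If)); by rewrite ler_wpM2r ?norm1_ge0// ler_norm.
have h2 : `|\int[mu]_x (f x * k x)| <= `|M| * norm1 mu f.
  apply: (le_trans (le_normr_Rintegral _ (IMk If))) => //.
  rewrite -(int_scale `|M| (integ_norm If)).
  apply: le_Rintegral => //; [exact/integ_norm/IMk|exact/integZ/integ_norm|].
  by move=> x _; rewrite normrM mulrC ler_wpM2r.
lra.
Qed.

Let Phi_hA A : measurable A -> Phi (hA A) = 0.
Proof.
move=> mA; apply/eqP; rewrite subr_eq0 ell_hA// Rintegral_mkcond; apply/eqP.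
apply: eq_ae_Rintegral.
- by apply/(measurable_restrictT _ mA)/measurable_funTS; exact: integ_mfun Ir.
- exact: integ_mfun (IMk (IhA mA)).
- apply: filterS kh => x /= khx _; rewrite patchE /hA indicE.
  by case: ifPn => _; rewrite ?mulr1 ?mulr0 ?mul0r ?khx.
Qed.

Let Phi_sfun (s : {nnsfun T >-> R}) : Phi (fun x => h x * s x) = 0.
Proof.
have -> : (fun x => h x * s x) = (fun x => \sum_(i < #|` fset_set (range s)|)
    ((fset_set (range s))`_i * hA (s @^-1` [set (fset_set (range s))`_i]) x)).
  apply/funext => x; rewrite [s x]fimfunEord mulr_sumr; apply: eq_bigr => i _.
  by rewrite /hA mulrCA.
set n := #|` _|; set c := fun i : nat => (fset_set (range s))`_i.
have IhAi i : integ mu (hA (s @^-1` [set c i])).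
  by apply: IhA; rewrite -[X in measurable X]setTI; exact: measurable_funPT.
have P0 : Phi (cst 0) = 0.
  have I0 := integ0 mu; have := Phi_lin (-1) I0 I0.
  rewrite mulN1r addNr.
  by have -> : (fun x : T => -1 * cst 0 x + cst 0 x) = cst 0 :> (T -> R)
    by apply/funext => x /=; rewrite mulr0 addr0.
suff [] : integ mu (fun x => \sum_(i < n) (c i * hA (s @^-1` [set c i]) x)) /\
    Phi (fun x => \sum_(i < n) (c i * hA (s @^-1` [set c i]) x)) = 0 by [].
elim: n => [|n [IH1 IH2]].
  have -> : (fun x => \sum_(i < 0) (c i * hA (s @^-1` [set c i]) x)) = cst 0.
    by apply/funext => x; rewrite big_ord0.
  by split; [exact: integ0|].
have -> : (fun x => \sum_(i < n.+1) (c i * hA (s @^-1` [set c i]) x)) =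
    (fun x => c n * hA (s @^-1` [set c n]) x + \sum_(i < n) (c i * hA (s @^-1` [set c i]) x)).
  by apply/funext => x; rewrite big_ord_recr addrC.
split; first by apply: integD => //; exact: integZ.
by rewrite Phi_lin// IH2 addr0 Phi_hA ?mulr0// -[X in measurable X]setTI; exact: measurable_funPT.
Qed.

(** Simple functions increasing to $f/h$, multiplied by $h$, converge to $f$ in norm by dominated
    convergence with $f$ as majorant, and [Phi] is continuous. *)
Let Phi_ge0 f : integ mu f -> (forall x, 0 <= f x) -> Phi f = 0.
Proof.
move=> If f0; pose phi x := (f x / h x)%:E.
have mphi : measurable_fun setT phi.
  apply/measurable_EFinP; apply: measurable_funM; first exact: integ_mfun If.
  apply: measurable_fun_inv_pos => //.
  exact: integ_mfun Ih.
have phi0 x : setT x -> (0 <= phi x)%E by move=> _; rewrite lee_fin divr_ge0// ltW.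
pose s n : {nnsfun T >-> R} := nnsfun_approx measurableT mphi n.
have cs x : (s n x)%:E @[n --> \oo] --> phi x by exact: cvg_nnsfun_approx.
have sle n x : s n x <= f x / h x.
  rewrite -lee_fin -[leRHS]/(phi x) -(cvg_lim _ (cs x))//; apply: lime_ge.
    by apply/cvg_ex; eexists; exact: cs.
  by exists n => // m /= nm; rewrite lee_fin; apply/lefP/nd_nnsfun_approx.
have hsle n x : `|h x * s n x| <= f x.
  rewrite ger0_norm; last by rewrite mulr_ge0// ltW.
  by rewrite mulrC -ler_pdivlMr.
have mhs n : measurable_fun setT (fun x => h x * s n x).
  by apply: measurable_funM; [exact: integ_mfun Ih|exact: measurable_funPT].
have chs x : (h x * s n x)%:E @[n --> \oo] --> (f x)%:E.
  have -> : (f x)%:E = ((h x)%:E * phi x)%E.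
    by rewrite -EFinM mulrC divfK// gt_eqF.
  by under eq_fun do rewrite EFinM; apply: cvgeZl.
apply/eqP; rewrite -normr_le0; apply/ler_addgt0Pl => e e0.
have M1 : 0 < 2 * `|M| + 1 by have := normr_ge0 M; lra.
have eM : 0 < e / (2 * `|M| + 1) by rewrite divr_gt0.
have [N /(_ N (leqnn _)) hN] := dominated_norm1 mhs (integ_mfun If) If hsle chs eM.
have Ihs : integ mu (fun x => h x * s N x) by exact: integ_le If.
have -> : Phi f = - Phi (fun x => (-1) * f x + h x * s N x).
  by rewrite Phi_lin// Phi_sfun mulN1r addr0 opprK.
rewrite normrN addr0; apply: (le_trans (Phi_le _)); first by apply: integD => //; exact: integZ.
have -> : norm1 mu (fun x => -1 * f x + h x * s N x) = norm1 mu (fun x => h x * s N x - f x).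
  by apply: eq_Rintegral => x _; rewrite mulN1r addrC.
have h1 : (2 * `|M| + 1) * norm1 mu (fun x => h x * s N x - f x) <= e.
  by rewrite mulrC -ler_pdivlMr.
have := norm1_ge0 mu (fun x => h x * s N x - f x); lra.
Qed.

Lemma L1_dual_weight : exists k : T -> R, [/\ measurable_fun setT k,
  forall x, `|k x| <= `|M| & forall f, integ mu f -> L (L1_of mu f) = \int[mu]_t (f t * k t)].
Proof.
exists k; split=> // f If; apply/eqP; rewrite -subr_eq0 -/(ell f) -/(Phi f).
have mf := integ_mfun If.
have Ip : integ mu (fun x => Num.max (f x) 0).
  apply: (@integ_le _ _ _ _ _ (fun x => `|f x|)) (integ_norm If).
    exact: measurable_maxr.
  by move=> x; rewrite /Num.max; case: ifPn => _; rewrite ?normr0.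
have In : integ mu (fun x => Num.max (- f x) 0).
  apply: (@integ_le _ _ _ _ _ (fun x => `|f x|)) (integ_norm If).
    by apply: measurable_maxr => //; exact: measurableT_comp.
  by move=> x; rewrite /Num.max; case: ifPn => _; rewrite ?normr0 ?normrN.
have -> : f = (fun x => (-1) * Num.max (- f x) 0 + Num.max (f x) 0).
  apply/funext => x; have [fx|fx] := lerP (f x) 0.
    by rewrite max_l ?oppr_ge0//; lra.
  by rewrite max_r ?oppr_le0 ?(ltW fx)//; lra.
by rewrite Phi_lin// !Phi_ge0 ?mulr0 ?addr0// => x; rewrite le_max lexx orbT.
Qed.

End dual.

Lemma L1_dual d (T : measurableType d) (R : realType)
    (mu : {sigma_finite_measure set T -> \bar R}) (L : L1 mu -> R) (M : R) :
  (forall a x y, L (a *: x + y) = a * L x + L y) -> (forall x, `|L x| <= M * `|x|) ->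
  exists k : T -> R, [/\ measurable_fun setT k,
  forall x, `|k x| <= `|M| & forall f, integ mu f -> L (L1_of mu f) = \int[mu]_t (f t * k t)].
Proof.
move=> Llin LM; have [h [Ih h0]] := sigma_finite_weight (sigma_finiteT mu).
exact: (L1_dual_weight Llin LM Ih h0).
Qed.

(** * Finite sequences as a measurable space *)

Section fseq.
Context d (T : measurableType d).

(** Lists of all lengths in one measurable space, with the sigma-algebra of the disjoint union of
    the powers of [T], so that list recursions such as [splits], [dels] and [undup] become
    measurable maps. *)
Definition fseq : Type := seq T.
HB.instance Definition _ := Choice.on fseq.
HB.instance Definition _ := isPointed.Build fseq ([::] : seq T).

Definition fseq_measurable : set (set fseq) :=
  [set A | forall n, measurable [set t : n.-tuple T | A (tval t)]].

Let fseq_measurable0 : fseq_measurable set0. Proof. by move=> n; exact: measurable0. Qed.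
Let fseq_measurableC A : fseq_measurable A -> fseq_measurable (~` A).
Proof. by move=> mA n; exact: (measurableC (mA n)). Qed.
Let fseq_measurable_bigcup (F : (set fseq)^nat) :
  (forall i, fseq_measurable (F i)) -> fseq_measurable (\bigcup_i F i).
Proof.
move=> mF n; rewrite [X in measurable X](_ : _ = \bigcup_i [set t : n.-tuple T | F i (tval t)])//.
by apply: bigcupT_measurable => i; exact: mF.
Qed.

HB.instance Definition _ := @isMeasurable.Build default_measure_display fseq
  fseq_measurable fseq_measurable0 fseq_measurableC fseq_measurable_bigcup.

Lemma fseq_measurableP (A : set fseq) :
  (forall n, measurable [set t : n.-tuple T | A (tval t)]) -> measurable A.
Proof. by []. Qed.

Lemma measurable_tval n : measurable_fun setT (fun t : n.-tuple T => tval t : fseq).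
Proof. by move=> _ A mA; rewrite setTI; exact: mA. Qed.

Lemma measurable_fseq_size n : measurable [set s : fseq | size s = n].
Proof.
move=> k; have [->|kn] := eqVneq k n.
  by rewrite [X in measurable X](_ : _ = setT)//; apply/seteqP; split=> t //= _; rewrite size_tuple.
rewrite [X in measurable X](_ : _ = set0)//; apply/seteqP; split=> t //=.
by rewrite size_tuple => /eqP; rewrite (negbTE kn).
Qed.

(* The sequences of length n form a measurable piece isomorphic to n.-tuple T,
   which reduces measurability on a product with fseq to tuples. *)
Let retr n (s : fseq) : n.-tuple T := insubd (nseq_tuple n point) s.

Let retrK n s : size s = n -> tval (retr n s) = s.
Proof. by move=> sn; rewrite /retr val_insubd sn eqxx. Qed.

Let measurable_retr n : measurable_fun setT (retr n).
Proof.
move=> _ A mA; rewrite setTI; apply: fseq_measurableP => k.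
have [kn|kn] := eqVneq k n; last first.
  have E (t : k.-tuple T) : retr n t = nseq_tuple n point.
    by apply: val_inj; rewrite /retr val_insubd size_tuple (negbTE kn).
  rewrite [X in measurable X](_ : _ = [set t : k.-tuple T | A (nseq_tuple n point)]).
    have [An|An] := pselect (A (nseq_tuple n point)).
      by rewrite [X in measurable X](_ : _ = setT)//; apply/seteqP; split.
    by rewrite [X in measurable X](_ : _ = set0)//; apply/seteqP; split.
  by apply/seteqP; split=> t /=; rewrite E.
subst k; rewrite [X in measurable X](_ : _ = A)//.
by apply/seteqP; split=> t /=; have -> : retr n t = t by apply: val_inj; apply: retrK; exact: size_tuple.
Qed.

Lemma measurable_fun_fseq d1 (Z : measurableType d1) d2 (Y : measurableType d2)
    (F : Z * fseq -> Y) :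
  (forall n, measurable_fun setT (fun p : Z * n.-tuple T => F (p.1, tval p.2))) ->
  measurable_fun setT F.
Proof.
move=> mF _ B mB; rewrite setTI.
rewrite [X in measurable X](_ : _ = \bigcup_n ((setT `*` [set s : fseq | size s = n]) `&`
    (fun p => F (p.1, tval (retr n p.2))) @^-1` B)).
  apply: bigcupT_measurable => n; apply: measurableI.
    by apply: measurableX => //; exact: measurable_fseq_size.
  have mg : measurable_fun setT (fun p : Z * fseq => (p.1, retr n p.2)).
    apply: measurable_fun_pair; first exact: measurable_fst.
    by apply: measurableT_comp; [exact: measurable_retr|exact: measurable_snd].
  have := measurableT_comp (mF n) mg => /(_ measurableT B mB).
  by rewrite setTI.
apply/seteqP; split=> [[z s] /= Bs|[z s] /= [n _ [[_ sn] Bs]]].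
  by exists (size s) => //; split=> //=; rewrite retrK.
by move: Bs; rewrite /= retrK.
Qed.

Lemma measurable_fun_fseq1 d2 (Y : measurableType d2) (F : fseq -> Y) :
  (forall n, measurable_fun setT (fun t : n.-tuple T => F (tval t))) ->
  measurable_fun setT F.
Proof.
move=> mF _ B mB; rewrite setTI; apply: fseq_measurableP => n.
by have := mF n measurableT B mB; rewrite setTI.
Qed.

Lemma measurable_cons_fseq : measurable_fun setT (fun p : T * fseq => p.1 :: p.2 : fseq).
Proof.
apply: measurable_fun_fseq => n /=.
have := measurableT_comp (@measurable_tval n.+1) (@measurable_tcons _ T n).
by apply: eq_measurable_fun => -[x t].
Qed.

End fseq.

Ltac mproj := repeat first
  [ exact: measurable_id | exact: measurable_fst | exact: measurable_snd
  | apply: measurable_fun_pair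
  | apply: (measurableT_comp measurable_fst)
  | apply: (measurableT_comp measurable_snd) ].

Section fseq_theory.
Context d (T : measurableType d).

Lemma measurable_fun_cons d1 (Z : measurableType d1) (f : Z -> T) (g : Z -> fseq T) :
  measurable_fun setT f -> measurable_fun setT g ->
  measurable_fun setT (fun z => f z :: g z : fseq T).
Proof.
move=> mf mg.
exact: (measurableT_comp (@measurable_cons_fseq _ T) (measurable_fun_pair mf mg)).
Qed.

Definition thead_behead n (t : n.+1.-tuple T) : T * n.-tuple T := (thead t, behead_tuple t).

Lemma measurable_thead_behead n : measurable_fun setT (@thead_behead n).
Proof.
by apply: measurable_fun_pair; [exact: measurable_tnth|exact: measurable_behead].
Qed.

Lemma measurable_cat : measurable_fun setT (fun p : fseq T * fseq T => p.1 ++ p.2 : fseq T).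
Proof.
(* The parameter space [Z] is generalised because the induction moves the head of the tuple into
   it. *)
have main n : forall d1 (Z : measurableType d1) (f : Z -> fseq T), measurable_fun setT f ->
    measurable_fun setT (fun p : Z * n.-tuple T => tval p.2 ++ f p.1 : fseq T).
  elim: n => [|n IH] d1 Z f mf.
    have -> : (fun p : Z * 0.-tuple T => tval p.2 ++ f p.1 : fseq T) = f \o fst.
      by apply/funext => -[z t] /=; rewrite tuple0.
    by apply: measurableT_comp => //; exact: measurable_fst.
  have -> : (fun p : Z * n.+1.-tuple T => tval p.2 ++ f p.1 : fseq T) =
      (fun q : (Z * T) * n.-tuple T => q.1.2 :: (tval q.2 ++ f q.1.1) : fseq T) \o
      (fun p : Z * n.+1.-tuple T =>
        ((p.1, (thead_behead p.2).1), (thead_behead p.2).2)).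
    by apply/funext => -[z t] /=; rewrite [in LHS](tuple_eta t).
  apply: measurableT_comp.
    apply: measurable_fun_cons; first by mproj.
    apply: (IH _ _ (fun q => f q.1)); apply: measurableT_comp => //; exact: measurable_fst.
  have m2 : measurable_fun setT (fun p : Z * n.+1.-tuple T => thead_behead p.2).
    by apply: measurableT_comp; [exact: measurable_thead_behead|exact: measurable_snd].
  apply: measurable_fun_pair; first apply: measurable_fun_pair; first by mproj.
    exact: (measurableT_comp measurable_fst m2).
  exact: (measurableT_comp measurable_snd m2).
have swap : measurable_fun setT (fun p : fseq T * fseq T => p.2 ++ p.1 : fseq T).
  by apply: measurable_fun_fseq => n; exact: (main n _ _ id).
by have := measurableT_comp swap (measurable_fun_pair measurable_snd measurable_fst); apply.
Qed.

Lemma measurable_fun_cat d1 (Z : measurableType d1) (f g : Z -> fseq T) :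
  measurable_fun setT f -> measurable_fun setT g ->
  measurable_fun setT (fun z => f z ++ g z : fseq T).
Proof.
by move=> mf mg; exact: (measurableT_comp measurable_cat (measurable_fun_pair mf mg)).
Qed.

(** List version of the pairs $(\xi,\eta\setminus\xi)$ with $\xi\subset\eta$: each entry goes to one
    of the two sides. *)
Fixpoint splits (s : seq T) : seq (seq T * seq T) :=
  if s is x :: s' then [seq (x :: p.1, p.2) | p <- splits s'] ++ [seq (p.1, x :: p.2) | p <- splits s']
  else [:: ([::], [::])].

(** List version of the pairs $(x,\eta\setminus x)$ with $x\in\eta$. *)
Fixpoint dels (s : seq T) : seq (T * seq T) :=
  if s is x :: s' then (x, s') :: [seq (p.1, x :: p.2) | p <- dels s'] else [::].

Section bigop.
Context d2 (Y : measurableType d2) (idx : Y) (op : Monoid.law idx).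
Hypothesis mop : forall d1 (Z : measurableType d1) (f g : Z -> Y),
  measurable_fun setT f -> measurable_fun setT g -> measurable_fun setT (fun z => op (f z) (g z)).

Lemma measurable_splits d1 (Z : measurableType d1) (F : (Z * fseq T) * fseq T -> Y) :
  measurable_fun setT F ->
  measurable_fun setT (fun p : Z * fseq T => \big[op/idx]_(q <- splits p.2) F (p.1, q.1, q.2)).
Proof.
move=> mF; apply: measurable_fun_fseq => n /=; elim: n d1 Z F mF => [|n IH] d1 Z F mF.
  have -> : (fun p : Z * 0.-tuple T => \big[op/idx]_(q <- splits p.2) F (p.1, q.1, q.2)) =
      (fun p => F (p.1, [::] : fseq T, [::] : fseq T)).
    by apply/funext => -[z t] /=; rewrite tuple0 /= big_seq1.
  apply: measurableT_comp => //; apply: measurable_fun_pair => //.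
  by apply: measurable_fun_pair => //; exact: measurable_fst.
pose F1 (q : ((Z * T) * fseq T) * fseq T) := F (q.1.1.1, q.1.1.2 :: q.1.2 : fseq T, q.2).
pose F2 (q : ((Z * T) * fseq T) * fseq T) := F (q.1.1.1, q.1.2, q.1.1.2 :: q.2 : fseq T).
have mF1 : measurable_fun setT F1.
  apply: measurableT_comp => //; apply: measurable_fun_pair; last by mproj.
  apply: measurable_fun_pair; first by mproj.
  by apply: measurable_fun_cons; mproj.
have mF2 : measurable_fun setT F2.
  apply: measurableT_comp => //; apply: measurable_fun_pair; first by mproj.
  by apply: measurable_fun_cons; mproj.
have m2 : measurable_fun setT (fun p : Z * n.+1.-tuple T => thead_behead p.2).
  by apply: measurableT_comp; [exact: measurable_thead_behead|exact: measurable_snd].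
have mz : measurable_fun setT (fun p : Z * n.+1.-tuple T =>
        ((p.1, (thead_behead p.2).1), (thead_behead p.2).2)).
  apply: measurable_fun_pair; first apply: measurable_fun_pair; first by mproj.
    exact: (measurableT_comp measurable_fst m2).
  exact: (measurableT_comp measurable_snd m2).
have -> : (fun p : Z * n.+1.-tuple T => \big[op/idx]_(q <- splits p.2) F (p.1, q.1, q.2)) =
   (fun q : (Z * T) * n.-tuple T =>
      op (\big[op/idx]_(p <- splits q.2) F1 (q.1, p.1, p.2))
         (\big[op/idx]_(p <- splits q.2) F2 (q.1, p.1, p.2))) \o
   (fun p : Z * n.+1.-tuple T => ((p.1, (thead_behead p.2).1), (thead_behead p.2).2)).
  by apply/funext => -[z t] /=; rewrite [in LHS](tuple_eta t) /= big_cat !big_map.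
apply: measurableT_comp => //; apply: mop; [exact: (IH _ _ F1)|exact: (IH _ _ F2)].
Qed.

Lemma measurable_dels d1 (Z : measurableType d1) (F : (Z * T) * fseq T -> Y) :
  measurable_fun setT F ->
  measurable_fun setT (fun p : Z * fseq T => \big[op/idx]_(q <- dels p.2) F (p.1, q.1, q.2)).
Proof.
move=> mF; apply: measurable_fun_fseq => n /=; elim: n d1 Z F mF => [|n IH] d1 Z F mF.
  have -> : (fun p : Z * 0.-tuple T => \big[op/idx]_(q <- dels p.2) F (p.1, q.1, q.2)) = cst idx.
    by apply/funext => -[z t] /=; rewrite tuple0 /= big_nil.
  exact: measurable_cst.
pose F2 (q : ((Z * T) * T) * fseq T) := F (q.1.1.1, q.1.2, q.1.1.2 :: q.2 : fseq T).
have mF2 : measurable_fun setT F2.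
  apply: measurableT_comp => //; apply: measurable_fun_pair; first by mproj.
  by apply: measurable_fun_cons; mproj.
have m2 : measurable_fun setT (fun p : Z * n.+1.-tuple T => thead_behead p.2).
  by apply: measurableT_comp; [exact: measurable_thead_behead|exact: measurable_snd].
have mz : measurable_fun setT (fun p : Z * n.+1.-tuple T =>
        ((p.1, (thead_behead p.2).1), (thead_behead p.2).2)).
  apply: measurable_fun_pair; first apply: measurable_fun_pair; first by mproj.
    exact: (measurableT_comp measurable_fst m2).
  exact: (measurableT_comp measurable_snd m2).
have -> : (fun p : Z * n.+1.-tuple T => \big[op/idx]_(q <- dels p.2) F (p.1, q.1, q.2)) =
   (fun q : (Z * T) * n.-tuple T => op (F (q.1, tval q.2 : fseq T))
         (\big[op/idx]_(p <- dels q.2) F2 (q.1, p.1, p.2))) \o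
   (fun p : Z * n.+1.-tuple T => ((p.1, (thead_behead p.2).1), (thead_behead p.2).2)).
  by apply/funext => -[z t] /=; rewrite [in LHS](tuple_eta t) /= big_cons !big_map.
apply: measurableT_comp => //; apply: mop; last exact: (IH _ _ F2).
apply: measurableT_comp => //; apply: measurable_fun_pair; first by mproj.
by apply: measurableT_comp; [exact: measurable_tval|exact: measurable_snd].
Qed.

End bigop.

Section real_sums.
Context (R : realType) d1 (Z : measurableType d1).

Lemma emeasurable_splits (F : Z * (fseq T * fseq T) -> \bar R) : measurable_fun setT F ->
  measurable_fun setT (fun p : Z * fseq T => \sum_(q <- splits p.2) F (p.1, q))%E.
Proof.
move=> mF; have mF2 : measurable_fun setT (fun p : (Z * fseq T) * fseq T => F (p.1.1, (p.1.2, p.2))).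
  by apply: (measurableT_comp mF); do !apply: measurable_fun_pair; mproj.
have := measurable_splits (op := [the Monoid.law 0%E of +%E : \bar R -> _ -> _]) _ mF2.
move=> /(_ (fun _ _ _ _ => @emeasurable_funD _ _ _ _ _ _)).
by apply: eq_measurable_fun => p _ /=; apply: eq_bigr => -[].
Qed.

Lemma measurable_splitsR (F : Z * (fseq T * fseq T) -> R) : measurable_fun setT F ->
  measurable_fun setT (fun p : Z * fseq T => \sum_(q <- splits p.2) F (p.1, q)).
Proof.
move=> mF; have mF2 : measurable_fun setT (fun p : (Z * fseq T) * fseq T => F (p.1.1, (p.1.2, p.2))).
  by apply: (measurableT_comp mF); do !apply: measurable_fun_pair; mproj.
have := measurable_splits (op := [the Monoid.law 0 of +%R : R -> _ -> _]) _ mF2.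
move=> /(_ (fun _ _ _ _ => @measurable_funD _ _ _ _ _ _)).
by apply: eq_measurable_fun => p _ /=; apply: eq_bigr => -[].
Qed.

Lemma emeasurable_dels (F : Z * (T * fseq T) -> \bar R) : measurable_fun setT F ->
  measurable_fun setT (fun p : Z * fseq T => \sum_(q <- dels p.2) F (p.1, q))%E.
Proof.
move=> mF; have mF2 : measurable_fun setT (fun p : (Z * T) * fseq T => F (p.1.1, (p.1.2, p.2))).
  by apply: (measurableT_comp mF); do !apply: measurable_fun_pair; mproj.
have := measurable_dels (op := [the Monoid.law 0%E of +%E : \bar R -> _ -> _]) _ mF2.
move=> /(_ (fun _ _ _ _ => @emeasurable_funD _ _ _ _ _ _)).
by apply: eq_measurable_fun => p _ /=; apply: eq_bigr => -[].
Qed.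

Lemma measurable_delsR (F : Z * (T * fseq T) -> R) : measurable_fun setT F ->
  measurable_fun setT (fun p : Z * fseq T => \sum_(q <- dels p.2) F (p.1, q)).
Proof.
move=> mF; have mF2 : measurable_fun setT (fun p : (Z * T) * fseq T => F (p.1.1, (p.1.2, p.2))).
  by apply: (measurableT_comp mF); do !apply: measurable_fun_pair; mproj.
have := measurable_dels (op := [the Monoid.law 0 of +%R : R -> _ -> _]) _ mF2.
move=> /(_ (fun _ _ _ _ => @measurable_funD _ _ _ _ _ _)).
by apply: eq_measurable_fun => p _ /=; apply: eq_bigr => -[].
Qed.

End real_sums.

Hypothesis diag : measurable [set p : T * T | p.1 = p.2].

Lemma measurable_mem_fseq : measurable_fun setT (fun p : T * fseq T => p.1 \in p.2).
Proof.
apply: measurable_fun_fseq => n /=; apply: (measurable_fun_bool true).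
rewrite setTI [X in measurable X](_ : _ = \bigcup_(i in [set: 'I_n])
    ((fun p : T * n.-tuple T => (p.1, tnth p.2 i)) @^-1` [set p : T * T | p.1 = p.2])).
  apply: fin_bigcup_measurable; first exact: finite_finset.
  move=> i _; rewrite -[X in measurable X]setTI.
  have m : measurable_fun setT (fun p : T * n.-tuple T => (p.1, tnth p.2 i)).
    apply: measurable_fun_pair; first by mproj.
    exact: (measurableT_comp (measurable_tnth i) measurable_snd).
  exact: m.
by apply/seteqP; split=> -[x t] /= => [/tnthP[i ->]|[i _ /= ->]]; [exists i|exact: mem_tnth].
Qed.

Lemma measurable_undup : measurable_fun setT (fun s : fseq T => undup s : fseq T).
Proof.
apply: measurable_fun_fseq1; elim=> [|n IH].
  have -> : (fun t : 0.-tuple T => undup t : fseq T) = cst [::].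
    by apply/funext => t; rewrite tuple0.
  exact: measurable_cst.
have -> : (fun t : n.+1.-tuple T => undup t : fseq T) =
   (fun p : T * n.-tuple T => if p.1 \in tval p.2 then undup p.2 : fseq T
      else p.1 :: undup p.2) \o @thead_behead n.
  by apply/funext => t; rewrite [in LHS](tuple_eta t).
apply: measurableT_comp; last exact: measurable_thead_behead.
have m2 : measurable_fun setT (fun p : T * n.-tuple T => undup p.2 : fseq T).
  exact: (measurableT_comp IH measurable_snd).
apply: measurable_fun_ifT => //; last by apply: measurable_fun_cons => //; mproj.
have mt : measurable_fun setT (fun p : T * n.-tuple T => (p.1, tval p.2 : fseq T)).
  apply: measurable_fun_pair; first by mproj.
  by apply: measurableT_comp; [exact: measurable_tval|exact: measurable_snd].
exact: (measurableT_comp measurable_mem_fseq mt).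
Qed.

Lemma measurable_uniq : measurable_fun setT (fun s : fseq T => uniq s).
Proof.
apply: measurable_fun_fseq1; elim=> [|n IH].
  have -> : (fun t : 0.-tuple T => uniq t) = cst true by apply/funext => t; rewrite tuple0.
  exact: measurable_cst.
have -> : (fun t : n.+1.-tuple T => uniq t) =
   (fun p : T * n.-tuple T => if p.1 \in tval p.2 then false else uniq p.2) \o @thead_behead n.
  by apply/funext => t; rewrite [in LHS](tuple_eta t) /=; case: (_ \in _).
apply: measurableT_comp; last exact: measurable_thead_behead.
apply: measurable_fun_ifT => //; last exact: (measurableT_comp IH measurable_snd).
have mt : measurable_fun setT (fun p : T * n.-tuple T => (p.1, tval p.2 : fseq T)).
  apply: measurable_fun_pair; first by mproj.
  by apply: measurableT_comp; [exact: measurable_tval|exact: measurable_snd].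
exact: (measurableT_comp measurable_mem_fseq mt).
Qed.

End fseq_theory.

(** * Integration over finite sequences *)

Section seq_poisson.
Context d (T : measurableType d) (R : realType).
Variable mu : {sigma_finite_measure set T -> \bar R}.
Local Open Scope ereal_scope.

Definition seq_int n (f : fseq T -> \bar R) : \bar R :=
  \int[tuple_measure mu n]_t f (tval t).

Lemma seq_int_ge0 n f : (forall s, 0 <= f s) -> 0 <= seq_int n f.
Proof. by move=> f0; apply: integral_ge0 => t _. Qed.

Lemma eq_seq_int n f g : (forall s, size s = n -> f s = g s) -> seq_int n f = seq_int n g.
Proof. by move=> fg; apply: eq_integral => t _; apply: fg; rewrite size_tuple. Qed.

Lemma measurable_fun_tval n (f : fseq T -> \bar R) : measurable_fun setT f ->
  measurable_fun setT (fun t : n.-tuple T => f (tval t)).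
Proof. by move=> mf; apply: (measurableT_comp mf); exact: measurable_tval. Qed.

Lemma seq_int0 f : measurable_fun setT f -> seq_int 0 f = f [::].
Proof.
move=> mf; rewrite /seq_int /= integral_dirac//.
  by rewrite diracT mul1e.
exact: (@measurable_fun_tval 0).
Qed.

Lemma seq_intS n f : measurable_fun setT f -> (forall s, 0 <= f s) ->
  seq_int n.+1 f = \int[mu]_x seq_int n (fun s => f (x :: s)).
Proof.
move=> mf f0; rewrite /seq_int /=.
have mft := @measurable_fun_tval n.+1 _ mf.
rewrite (ge0_integral_pushforward (@measurable_tcons _ T n) _ _ _)//.
have mp : measurable_fun setT (fun p : T * n.-tuple T => f (tcons p)).
  exact: (measurableT_comp mft (@measurable_tcons _ T n)).
by rewrite preimage_setT; exact: (@fubini_tonelli1 _ _ _ _ _ mu (tuple_measure mu n)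
  (fun p : T * n.-tuple T => f (tcons p)) mp).
Qed.

Lemma measurable_seq_int d1 (Z : measurableType d1) n (F : Z * fseq T -> \bar R) :
  measurable_fun setT F -> (forall z, 0 <= F z) ->
  measurable_fun setT (fun z => seq_int n (fun s => F (z, s))).
Proof.
move=> mF F0; apply: (@measurable_fun_fubini_tonelli_F _ _ _ _ _ (tuple_measure mu n)
  (fun p : Z * n.-tuple T => F (p.1, tval p.2))) => //.
apply: (measurableT_comp mF); apply: measurable_fun_pair; first by mproj.
by apply: measurableT_comp; [exact: measurable_tval|exact: measurable_snd].
Qed.

Lemma measurable_mu_int d1 (Z : measurableType d1) (F : Z * T -> \bar R) :
  measurable_fun setT F -> (forall z, 0 <= F z) ->
  measurable_fun setT (fun z => \int[mu]_x F (z, x)).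
Proof. by move=> mF F0; exact: measurable_fun_fubini_tonelli_F. Qed.

Lemma seq_int_exchange n (F : T * fseq T -> \bar R) :
  measurable_fun setT F -> (forall z, 0 <= F z) ->
  seq_int n (fun s => \int[mu]_x F (x, s)) = \int[mu]_x seq_int n (fun s => F (x, s)).
Proof.
move=> mF F0; rewrite /seq_int.
have mp : measurable_fun setT (fun p : T * n.-tuple T => F (p.1, tval p.2)).
  apply: (measurableT_comp mF); apply: measurable_fun_pair; first by mproj.
  by apply: measurableT_comp; [exact: measurable_tval|exact: measurable_snd].
by rewrite -(@fubini_tonelli _ _ _ _ _ mu (tuple_measure mu n) _ mp).
Qed.

Let c k j : R := (k`!%:R^-1 * j`!%:R^-1)%R.

Let c_ge0 k j : (0 <= c k j)%R. Proof. by rewrite mulr_ge0// invr_ge0. Qed.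

Let cSl k j : (k.+1%:R * c k.+1 j)%R = c k j.
Proof.
by rewrite /c factS natrM; field; rewrite !pnatr_eq0 -!lt0n !fact_gt0 addrC natr1 pnatr_eq0.
Qed.

Let cSr k j : (j.+1%:R * c k j.+1)%R = c k j.
Proof.
by rewrite /c factS natrM; field; rewrite !pnatr_eq0 -!lt0n !fact_gt0 addrC natr1 pnatr_eq0.
Qed.

(** Pascal's rule for the weights $1/(k!\,j!)$: on $k+j=n+1$ the factor $n+1$ is written $k+j$, and
    each of its two parts cancels one factor of a factorial. *)
Let pascal n (A : nat -> nat -> \bar R) : (forall k j, 0 <= A k j) ->
  n.+1%:R%:E * \sum_(k < n.+2) (c k (n.+1 - k))%:E * A k (n.+1 - k)%N =
  \sum_(k < n.+1) (c k (n - k))%:E * A k.+1 (n - k)%N +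
  \sum_(k < n.+1) (c k (n - k))%:E * A k (n - k).+1.
Proof.
move=> A0; rewrite ge0_sume_distrr; last by move=> k _; rewrite mule_ge0 ?lee_fin.
transitivity (\sum_(k < n.+2) (k%:R * c k (n.+1 - k))%:E * A k (n.+1 - k)%N +
    \sum_(k < n.+2) ((n.+1 - k)%:R * c k (n.+1 - k))%:E * A k (n.+1 - k)%N).
  rewrite -big_split /=; apply: eq_bigr => k _.
  rewrite -ge0_muleDl ?lee_fin ?mulr_ge0// -EFinD -mulrDl muleA -EFinM.
  by rewrite -natrD subnKC// -ltnS.
congr (_ + _).
  rewrite big_ord_recl /= mul0r mul0e add0e; apply: eq_bigr => k _.
  by rewrite /bump /= add1n subSS cSl.
rewrite big_ord_recr /= subnn mul0r mul0e adde0; apply: eq_bigr => k _.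
by rewrite subSn ?cSr// -ltnS.
Qed.

(** The $n$-point layer of Minlos's lemma. By induction the first variable goes to the left or to
    the right part; [pascal] reassembles the two halves, Tonelli moving the variable inside for the
    right one. *)
Lemma seq_int_splits n (H : fseq T * fseq T -> \bar R) :
  measurable_fun setT H -> (forall z, 0 <= H z) ->
  (n`!%:R^-1)%:E * seq_int n (fun s => \sum_(p <- splits s) H p) =
  \sum_(k < n.+1) (c k (n - k))%:E *
     seq_int k (fun s1 => seq_int (n - k) (fun s2 => H (s1, s2))).
Proof.
have msec (H' : fseq T * fseq T -> \bar R) s1 : measurable_fun setT H' ->
    measurable_fun setT (fun s2 => H' (s1, s2)).
  by move=> mH'; exact: (measurableT_comp mH' (pair1_measurable s1)).
have mspl (H' : fseq T * fseq T -> \bar R) : measurable_fun setT H' ->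
    measurable_fun setT (fun s : fseq T => \sum_(p <- splits s) H' p).
  move=> mH'; have := measurableT_comp (emeasurable_splits (F := fun q : unit * _ => H' q.2)
    (measurableT_comp mH' measurable_snd)) (pair1_measurable tt).
  exact: eq_measurable_fun.
have spl0 (H' : fseq T * fseq T -> \bar R) s : (forall z, 0 <= H' z) ->
    0 <= \sum_(p <- splits s) H' p by move=> H0; exact: sume_ge0.
elim: n H => [|n IH] H mH H0.
  rewrite big_ord_recl big_ord0 adde0 /= subn0 /c fact0 invr1 mulr1 !mul1e.
  rewrite !seq_int0//.
  - by rewrite /= big_seq1.
  - exact: msec.
  - by apply: measurable_seq_int => //; case.
  - exact: mspl.
have c1 : (n.+1%:R%:E * ((n.+1)`!%:R^-1)%:E = (n`!%:R^-1)%:E :> \bar R).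
  rewrite -EFinM factS natrM; congr EFin; field.
  by rewrite !pnatr_eq0 -!lt0n !fact_gt0 addrC natr1 pnatr_eq0.
have n1 : (n.+1%:R^-1%:E * n.+1%:R%:E = 1 :> \bar R).
  by rewrite -EFinM mulVf ?pnatr_eq0.
suff : n.+1%:R%:E * (((n.+1)`!%:R^-1)%:E * seq_int n.+1 (fun s => \sum_(p <- splits s) H p)) =
    n.+1%:R%:E * \sum_(k < n.+2) (c k (n.+1 - k))%:E *
     seq_int k (fun s1 => seq_int (n.+1 - k) (fun s2 => H (s1, s2))).
  move=> /(congr1 (fun z => n.+1%:R^-1%:E * z)).
  by rewrite !(muleA (n.+1%:R^-1)%:E) n1 !mul1e.
rewrite muleA c1.
have A0 k j : 0 <= seq_int k (fun s1 => seq_int j (fun s2 => H (s1, s2))).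
  by apply: seq_int_ge0 => s1; exact: seq_int_ge0.
rewrite (@pascal n (fun k j => seq_int k (fun s1 => seq_int j (fun s2 => H (s1, s2)))))//.
rewrite seq_intS//; [|exact: mspl|by move=> s; exact: spl0].
pose H1 (q : T * (fseq T * fseq T)) := H (q.1 :: q.2.1 : fseq T, q.2.2).
pose H2 (q : T * (fseq T * fseq T)) := H (q.2.1, q.1 :: q.2.2 : fseq T).
have H10 z : 0 <= H1 z by exact: H0.
have H20 z : 0 <= H2 z by exact: H0.
have mH1 : measurable_fun setT H1.
  apply: (measurableT_comp mH); apply: measurable_fun_pair; last by mproj.
  by apply: measurable_fun_cons; mproj.
have mH2 : measurable_fun setT H2.
  apply: (measurableT_comp mH); apply: measurable_fun_pair; first by mproj.
  by apply: measurable_fun_cons; mproj.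
have mS (H' : T * (fseq T * fseq T) -> \bar R) : measurable_fun setT H' ->
    measurable_fun setT (fun p : T * fseq T => \sum_(q <- splits p.2) H' (p.1, q)).
  exact: emeasurable_splits.
have step1 x : seq_int n (fun s => \sum_(p <- splits (x :: s)) H p) =
    seq_int n (fun s => \sum_(p <- splits s) H1 (x, p)) +
    seq_int n (fun s => \sum_(p <- splits s) H2 (x, p)).
  rewrite -ge0_integralD//.
  - by apply: eq_integral => t _; rewrite /= big_cat !big_map.
  - by move=> t _; apply: sume_ge0 => q _; exact: H0.
  - apply: (@measurable_fun_tval _ (fun s => \sum_(p <- splits s) H1 (x, p))).
    exact: (measurableT_comp (mS _ mH1) (pair1_measurable x)).
  - by move=> t _; apply: sume_ge0 => q _; exact: H0.
  - apply: (@measurable_fun_tval _ (fun s => \sum_(p <- splits s) H2 (x, p))).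
    exact: (measurableT_comp (mS _ mH2) (pair1_measurable x)).
under eq_integral do rewrite step1.
have mI (H' : T * (fseq T * fseq T) -> \bar R) : measurable_fun setT H' -> (forall z, 0 <= H' z) ->
    measurable_fun setT (fun x => seq_int n (fun s => \sum_(p <- splits s) H' (x, p))).
  move=> mH' H'0; apply: (@measurable_seq_int _ _ n (fun q : T * fseq T =>
    \sum_(p <- splits q.2) H' (q.1, p))); first exact: mS.
  by move=> z; exact: sume_ge0.
have mA (H' : T * (fseq T * fseq T) -> \bar R) j : measurable_fun setT H' -> (forall z, 0 <= H' z) ->
    measurable_fun setT (fun p : T * fseq T => seq_int j (fun s2 => H' (p.1, (p.2, s2)))).
  move=> mH' H'0; apply: (@measurable_seq_int _ _ j (fun q : (T * fseq T) * fseq T =>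
    H' (q.1.1, (q.1.2, q.2)))) => //.
  by apply: (measurableT_comp mH'); do !apply: measurable_fun_pair; mproj.
have mAA (H' : T * (fseq T * fseq T) -> \bar R) k j : measurable_fun setT H' -> (forall z, 0 <= H' z) ->
    measurable_fun setT (fun x => seq_int k (fun s1 => seq_int j (fun s2 => H' (x, (s1, s2))))).
  move=> mH' H'0; apply: (@measurable_seq_int _ _ k (fun p : T * fseq T =>
    seq_int j (fun s2 => H' (p.1, (p.2, s2))))); first exact: mA.
  by move=> z; exact: seq_int_ge0.
have AA0 (H' : T * (fseq T * fseq T) -> \bar R) k j x : (forall z, 0 <= H' z) ->
    0 <= seq_int k (fun s1 => seq_int j (fun s2 => H' (x, (s1, s2)))).
  by move=> H'0; do 2 apply: seq_int_ge0 => ?.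
rewrite ge0_integralD//; [|by move=> x _; apply: seq_int_ge0 => s; exact: sume_ge0|exact: mI
  |by move=> x _; apply: seq_int_ge0 => s; exact: sume_ge0|exact: mI].
rewrite ge0_muleDr; [|by apply: integral_ge0 => x _; apply: seq_int_ge0 => s; exact: sume_ge0..].
have half (H' : T * (fseq T * fseq T) -> \bar R) : measurable_fun setT H' -> (forall z, 0 <= H' z) ->
    (n`!%:R^-1)%:E * (\int[mu]_x seq_int n (fun s => \sum_(p <- splits s) H' (x, p))) =
    \sum_(k < n.+1) (c k (n - k))%:E * (\int[mu]_x
      seq_int k (fun s1 => seq_int (n - k) (fun s2 => H' (x, (s1, s2))))).
  move=> mH' H'0; rewrite -ge0_integralZl//; [|exact: mI
    |by move=> x _; apply: seq_int_ge0 => s; exact: sume_ge0].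
  under eq_integral => x _.
    rewrite (IH (fun p => H' (x, p)))//; last first.
      exact: (measurableT_comp mH' (pair1_measurable x)).
    over.
  rewrite ge0_integral_sum//.
  - apply: eq_bigr => k _; rewrite ge0_integralZl//; [exact: mAA|by move=> x _; exact: AA0|].
    by rewrite lee_fin.
  - by move=> k; apply: measurable_funeM; exact: mAA.
  - by move=> k x _; rewrite mule_ge0 ?lee_fin//; exact: AA0.
rewrite (half H1)// (half H2)//; congr (_ + _); apply: eq_bigr => k _; congr (_ * _).
  rewrite seq_intS//; last by move=> s; exact: seq_int_ge0.
  by apply: measurable_seq_int => //; case.
under [RHS]eq_seq_int => s1 _.
  rewrite seq_intS//; last exact: msec.
  over.
rewrite (@seq_int_exchange k (fun q : T * fseq T => seq_int (n - k)
  (fun s2 => H2 (q.1, (q.2, s2)))))//; first exact: mA.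
by move=> z; exact: seq_int_ge0.
Qed.

(** All $n+1$ deletions contribute the same integral. Deleting the head gives one copy directly;
    deleting a point of the tail gives the others by induction, once Tonelli has exchanged that
    point with the head. *)
Lemma seq_int_dels n (F : T * fseq T -> \bar R) :
  measurable_fun setT F -> (forall z, 0 <= F z) ->
  seq_int n.+1 (fun s => \sum_(q <- dels s) F q) =
  n.+1%:R%:E * (\int[mu]_x seq_int n (fun s => F (x, s))).
Proof.
have mD (F' : T * (T * fseq T) -> \bar R) : measurable_fun setT F' ->
    measurable_fun setT (fun p : T * fseq T => \sum_(q <- dels p.2) F' (p.1, q)).
  exact: emeasurable_dels.
elim: n F => [|n IH] F mF F0.
  rewrite mul1e seq_intS//; last 2 first.
  - have := measurableT_comp (mD (fun q => F q.2) (measurableT_comp mF measurable_snd))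
      (pair1_measurable point).
    exact: eq_measurable_fun.
  - by move=> s; exact: sume_ge0.
  apply: eq_integral => x _; apply: eq_seq_int => s /size0nil ->.
  by rewrite /= big_seq1.
rewrite seq_intS//; last 2 first.
- have := measurableT_comp (mD (fun q => F q.2) (measurableT_comp mF measurable_snd))
      (pair1_measurable point).
  exact: eq_measurable_fun.
- by move=> s; exact: sume_ge0.
pose F2 (q : T * (T * fseq T)) := F (q.2.1, q.1 :: q.2.2 : fseq T).
have F20 z : 0 <= F2 z by exact: F0.
have mF2 : measurable_fun setT F2.
  apply: (measurableT_comp mF); apply: measurable_fun_pair; first by mproj.
  by apply: measurable_fun_cons; mproj.
have step x : seq_int n.+1 (fun s => \sum_(q <- dels (x :: s)) F q) =
   seq_int n.+1 (fun s => F (x, s)) + seq_int n.+1 (fun s => \sum_(q <- dels s) F2 (x, q)).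
  rewrite -ge0_integralD//.
  - by apply: eq_integral => t _; rewrite /= big_cons big_map.
  - apply: (@measurable_fun_tval n.+1 (fun s => F (x, s))).
    exact: (measurableT_comp mF (pair1_measurable x)).
  - by move=> t _; apply: sume_ge0 => q _; exact: F0.
  - apply: (@measurable_fun_tval n.+1 (fun s => \sum_(q <- dels s) F2 (x, q))).
    exact: (measurableT_comp (mD _ mF2) (pair1_measurable x)).
under eq_integral do rewrite step.
rewrite ge0_integralD//; last 4 first.
- by move=> x _; exact: seq_int_ge0.
- exact: measurable_seq_int.
- by move=> x _; apply: seq_int_ge0 => s; exact: sume_ge0.
- apply: (@measurable_seq_int _ _ n.+1 (fun p : T * fseq T => \sum_(q <- dels p.2) F2 (p.1, q))).
    exact: mD.
  by move=> z; exact: sume_ge0.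
have mF2x x : measurable_fun setT (fun q => F2 (x, q)).
  exact: (measurableT_comp mF2 (pair1_measurable x)).
under [X in _ + X]eq_integral => x _.
  rewrite (IH (fun q => F2 (x, q)))//.
  over.
have mI : measurable_fun setT (fun x => \int[mu]_y seq_int n (fun s => F2 (x, (y, s)))).
  apply: (@measurable_mu_int _ _ (fun p : T * T => seq_int n (fun s => F2 (p.1, (p.2, s))))).
    apply: (@measurable_seq_int _ _ n (fun q : (T * T) * fseq T => F2 (q.1.1, (q.1.2, q.2)))) => //.
    by apply: (measurableT_comp mF2); do !apply: measurable_fun_pair; mproj.
  by move=> z; exact: seq_int_ge0.
rewrite ge0_integralZl//; last by move=> x _; apply: integral_ge0 => y _; exact: seq_int_ge0.
have -> : \int[mu]_x \int[mu]_y seq_int n (fun s => F2 (x, (y, s))) =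
          \int[mu]_y seq_int n.+1 (fun s => F (y, s)).
  have mp : measurable_fun setT (fun p : T * T => seq_int n (fun s => F2 (p.1, (p.2, s)))).
    apply: (@measurable_seq_int _ _ n (fun q : (T * T) * fseq T => F2 (q.1.1, (q.1.2, q.2)))) => //.
    by apply: (measurableT_comp mF2); do !apply: measurable_fun_pair; mproj.
  rewrite (@fubini_tonelli _ _ _ _ _ mu mu (fun p : T * T => seq_int n (fun s => F2 (p.1, (p.2, s)))))//;
    last by move=> z; exact: seq_int_ge0.
  apply: eq_integral => y _; rewrite seq_intS//.
  exact: (measurableT_comp mF (pair1_measurable y)).
set I := \int[mu]_x _; have I0 : 0 <= I by apply: integral_ge0 => x _; exact: seq_int_ge0.
by rewrite -[X in X + _]mul1e -ge0_muleDl// -EFinD -[in RHS]natr1 addrC.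
Qed.

End seq_poisson.

(** * Finite configurations as images of sequences *)

Section fconfig_of_seq.
Variables (R : realType) (m : nat).
Local Notation E := (Rspace R m).
Local Notation mu := (lebesgueRm R m).

Lemma measurable_diagonal : measurable [set p : E * E | p.1 = p.2].
Proof.
have mt (l : 'I_m) : measurable_fun setT (fun x : E => tnth x l : R) by exact: measurable_tnth.
rewrite [X in measurable X](_ : _ = \bigcap_(l in [set: 'I_m])
    [set p : E * E | tnth p.1 l == tnth p.2 l]).
  apply: fin_bigcap_measurable; first exact: finite_finset.
  move=> l _; have := measurable_fun_eqr (measurableT_comp (mt l) measurable_fst)
    (measurableT_comp (mt l) measurable_snd).
  by move=> /(_ measurableT [set true] I); rewrite setTI.
apply/seteqP; split => -[x y] /=; first by move=> -> l _ /=.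
by move=> xy; apply: eq_from_tnth => l; exact/eqP/xy.
Qed.

Definition fc (s : seq E) : fconfig R m := [fset x in s]%fset.

Lemma in_fc s x : (x \in fc s) = (x \in s). Proof. by rewrite inE. Qed.
Lemma fc_cons x s : fc (x :: s) = (x |` fc s)%fset.
Proof. by apply/fsetP => y; rewrite !inE. Qed.
Lemma fc_cat s1 s2 : fc (s1 ++ s2) = (fc s1 `|` fc s2)%fset.
Proof. by apply/fsetP => y; rewrite in_fsetU !in_fc mem_cat. Qed.
Lemma fc_undup s : fc (undup s) = fc s.
Proof. by apply/fsetP => y; rewrite !in_fc mem_undup. Qed.
Lemma fc_fset (eta : fconfig R m) : fc eta = eta.
Proof. by apply/fsetP => y; rewrite in_fc. Qed.
Lemma perm_fc s : uniq s -> perm_eq (fc s) s.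
Proof. by move=> us; apply: uniq_perm => // x; rewrite in_fc. Qed.
Lemma card_fc s : uniq s -> #|` fc s| = size s.
Proof. by move=> us; rewrite (perm_size (perm_fc us)). Qed.

(** The sigma-algebra on configurations only speaks of duplicate-free tuples. The measurable map
    [undup] brings an arbitrary list to that case without changing its set of points. *)
Lemma measurable_fc : measurable_fun setT (fc : fseq E -> fconfig R m).
Proof.
move=> _ A mA; rewrite setTI.
have mU : measurable ([set s | uniq s /\ A (fc s)] : set (fseq E)).
  by apply: fseq_measurableP => n; exact: mA.
have := measurable_undup measurable_diagonal measurableT mU; rewrite setTI.
congr measurable; apply/seteqP; split=> s /=; first by rewrite fc_undup => -[].
by rewrite undup_uniq fc_undup.
Qed.

Lemma fconfig_measurableP (A : set (fconfig R m)) :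
  (forall n, measurable (ordered n A)) -> measurable A.
Proof. by []. Qed.

Lemma measurable_fun_fconfig d2 (Y : measurableType d2) (f : fconfig R m -> Y) :
  measurable_fun setT (fun s : fseq E => f (fc s)) -> measurable_fun setT f.
Proof.
move=> mf _ B mB; rewrite setTI; apply: fconfig_measurableP => n.
have mU : measurable [set t : n.-tuple E | uniq t] by exact: measurable_uniq_tuple.
have := measurableI _ _ mU (measurableT_comp mf (@measurable_tval _ E n) measurableT mB).
by congr measurable; apply/seteqP; split=> t /=; [move=> [? []]|move=> [? ?]; split].
Qed.

Lemma measurable_fun_fc d2 (Y : measurableType d2) (f : fconfig R m -> Y) :
  measurable_fun setT f -> measurable_fun setT (fun s : fseq E => f (fc s)).
Proof. by move=> mf; exact: (measurableT_comp mf measurable_fc). Qed.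

Section bigop.
Context (Y : Type) (idx : Y) (op : Monoid.com_law idx).

Lemma big_fc s (f : E -> Y) : uniq s ->
  \big[op/idx]_(x <- fc s) f x = \big[op/idx]_(x <- s) f x.
Proof. by move=> us; apply: perm_big; exact: perm_fc. Qed.

Lemma big_dels_fc s (f : E -> fconfig R m -> Y) : uniq s ->
  \big[op/idx]_(x <- fc s) f x (fc s `\ x)%fset = \big[op/idx]_(q <- dels s) f q.1 (fc q.2).
Proof.
move=> us; rewrite big_fc//; elim: s f us => [|x s IH] f /=; first by rewrite !big_nil.
move=> /andP[xs us]; rewrite !big_cons big_map /=; congr (op _ _).
  by congr (f x _); apply/fsetP => y; rewrite !inE; case: eqVneq => // ->; rewrite (negbTE xs).
under [RHS]eq_bigr do rewrite fc_cons.
rewrite -(IH (fun y A => f y (x |` A)%fset) us).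
rewrite [in RHS]big_seq big_seq; apply: eq_bigr => y ys; congr (f y _).
apply/fsetP => z; rewrite !inE; case: (eqVneq z x) => [->|//].
by rewrite andbT orTb; apply: contraNneq xs => ->.
Qed.

(** The subsets of $\{x\}\cup A$ with $x\notin A$ are those containing $x$ and those avoiding it,
    which are the two halves in the recursion of [splits]. *)
Lemma big_splits_fc s (H : fconfig R m -> fconfig R m -> Y) : uniq s ->
  \big[op/idx]_(xi <- fpowerset (fc s)) H xi (fc s `\` xi)%fset =
  \big[op/idx]_(p <- splits s) H (fc p.1) (fc p.2).
Proof.
elim: s H => [|x s IH] H /=.
  have -> : fc [::] = fset0 by apply/fsetP => y; rewrite !inE.
  rewrite fpowerset0 big_seq1 /= => _.
  have -> : fc [::] = fset0 by apply/fsetP => y; rewrite !inE.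
  by rewrite big_seq_fset1 fsetD0.
move=> /andP[xs us]; rewrite big_cat !big_map /=.
have xfc : x \notin fc s by rewrite in_fc.
have -> : \big[op/idx]_(xi <- fpowerset (fc (x :: s))) H xi (fc (x :: s) `\` xi)%fset =
    op (\big[op/idx]_(xi <- fpowerset (fc s)) H (x |` xi)%fset (fc (x :: s) `\` (x |` xi))%fset)
       (\big[op/idx]_(xi <- fpowerset (fc s)) H xi (fc (x :: s) `\` xi)%fset).
  rewrite -(big_map (fun xi => x |` xi)%fset xpredT
    (fun A => H A (fc (x :: s) `\` A)%fset)) -big_cat; apply: perm_big.
  apply: uniq_perm => //.
    rewrite cat_uniq fset_uniq andbT map_inj_in_uniq ?fset_uniq; last first.
      move=> A B; rewrite !fpowersetE => /fsubsetP As /fsubsetP Bs AB.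
      apply/fsetP => y; have := congr1 (fun C : fconfig R m => y \in C) AB.
      rewrite !inE; case: (eqVneq y x) => [-> _|//].
      by rewrite (contraNF (As x) xfc) (contraNF (Bs x) xfc).
    apply/hasPn => A; rewrite fpowersetE => /fsubsetP As; apply/mapP => -[B _ AB].
    by move: xfc; rewrite As// AB !inE eqxx.
  move=> A; rewrite fpowersetE mem_cat fpowersetE; apply/idP/orP.
    move=> /fsubsetP As; case: (boolP (x \in A)) => xA; [left|right].
      apply/mapP; exists (A `\ x)%fset; last by rewrite fsetD1K.
      rewrite fpowersetE; apply/fsubsetP => y; rewrite !inE => /andP[yx yA].
      by have := As y yA; rewrite fc_cons !inE (negbTE yx).
    apply/fsubsetP => y yA; have := As y yA; rewrite fc_cons in_fset1U in_fc => /predU1P[yx|//].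
      by move: xA; rewrite -yx yA.
  case=> [/mapP[B] |/fsubsetP As]; last first.
    by apply/fsubsetP => y /As; rewrite fc_cons !inE => ->; rewrite orbT.
  rewrite fpowersetE => /fsubsetP Bs ->; apply/fsubsetP => y.
  by rewrite fc_cons !inE => /predU1P[->|/Bs]; rewrite ?eqxx// in_fc => ->; rewrite orbT.
congr (op _ _).
  under [RHS]eq_bigr do rewrite fc_cons.
  rewrite -(IH (fun A B => H (x |` A)%fset B) us) big_seq [in RHS]big_seq.
  apply: eq_bigr => A; rewrite fpowersetE => /fsubsetP As; congr (H _ _).
  apply/fsetP => y; rewrite fc_cons !inE negb_or; case: (eqVneq y x) => [->|//] /=.
  by rewrite (negbTE xs) andbF.
under [RHS]eq_bigr do rewrite fc_cons.
rewrite -(IH (fun A B => H A (x |` B)%fset) us) big_seq [in RHS]big_seq.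
apply: eq_bigr => A; rewrite fpowersetE => /fsubsetP As; congr (H _ _).
apply/fsetP => y; rewrite fc_cons !inE; case: (eqVneq y x) => [->|//] /=.
by rewrite andbT; apply: contraNN xfc => /As.
Qed.

End bigop.

Lemma measurable_config_of : measurable_fun setT (@config_of R m).
Proof.
apply: (measurability (@config_counting R m)) => //.
move=> _ [_ [L [n [mL bL ->]]] <-]; rewrite setTI; apply: fconfig_measurableP => k.
(* On duplicate-free tuples this measurable sum of indicators counts the points of the configuration
   in [L], so the generating events become its level sets. *)
pose cL (t : k.-tuple E) : R := \sum_(i < k) \1_L (tnth t i).
have mc : measurable_fun setT cL.
  apply: measurable_sum => i.
  exact: (measurableT_comp (measurable_indic mL) (measurable_tnth i)).
have mk : measurable [set t | cL t = n%:R].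
  rewrite [X in measurable X](_ : _ = setT `&` cL @^-1` [set n%:R]); last by rewrite setTI.
  exact: mc.
have := measurableI _ _ (@measurable_uniq_tuple R m k) mk.
congr measurable.
have Ec (t : k.-tuple E) : uniq t ->
    (([set` fc t] `&` L)%classic #= `I_n)%card = (cL t == n%:R).
  move=> ut.
  have -> : ([set` fc t] `&` L)%classic = [set` fc [seq x <- t | x \in L]].
    apply/seteqP; split=> x /=; rewrite !in_fc mem_filter.
      by move=> [-> Lx]; rewrite andbT; exact/mem_set.
    by move=> /andP[/set_mem Lx ->].
  have -> : cL t = (size [seq x <- t | x \in L])%:R.
    rewrite size_filter -sum1_count natr_sum big_mkcond /= /cL -(big_tuple 0 +%R t xpredT (fun x => \1_L x)).
    by apply: eq_bigr => x _; rewrite indicE; case: (x \in L).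
  rewrite eqr_nat -card_fc ?filter_uniq//.
  by apply/card_eq_fsetP/eqP.
apply/seteqP; split=> t.
  by move=> /= [ut /eqP ct]; split=> //; have := Ec t ut; rewrite ct.
by move=> [ut gt]; split=> //=; apply/eqP; rewrite -Ec.
Qed.

Lemma measurable_point (a : E) : measurable [set a].
Proof.
rewrite [X in measurable X](_ : _ = ysection [set p : E * E | p.1 = p.2] a).
  exact: measurable_ysection measurable_diagonal.
by apply/seteqP; split=> x /=; rewrite /ysection /= in_setE.
Qed.

Local Open Scope ereal_scope.
Local Notation LP := (lebesgue_poisson R m).

(** The exhausting sets hold the configurations of at most [N] points, all in [F N]: only the layers
    $n\le N$ charge them, each with tuple measure at most $\mu(F_N)^n$. *)
Lemma sigma_finite_LP : sigma_finite setT LP.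
Proof.
have /sigma_finiteP[F [TF ndF Foo]] := sigma_finiteT mu.
have mF i : measurable (F i) by have [] := Foo i.
pose A N : set (fconfig R m) := [set eta | (#|` eta| <= N)%N /\ {in eta, forall x, F N x}].
have ordA N n : ordered n (A N) = if (n <= N)%N then
    [set t : n.-tuple E | uniq t] `&` \bigcap_(i in [set: 'I_n]) (fun t => tnth t i) @^-1` F N else set0.
  apply/seteqP; split=> t /=.
    move=> [ut [tN tF]]; move: tN; rewrite card_fc// size_tuple => ->; split=> // i _ /=.
    by apply: tF; rewrite in_fc mem_tnth.
  case: ifP => // nN [/= ut tF]; split=> //; split; first by rewrite card_fc// size_tuple.
  by move=> x; rewrite in_fc => /tnthP[i ->]; exact: tF.
have mB N n : measurable (\bigcap_(i in [set: 'I_n]) (fun t : n.-tuple E => tnth t i) @^-1` F N).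
  apply: fin_bigcap_measurable => [|i _]; first exact: finite_finset.
  by rewrite -[X in measurable X]setTI; exact: measurable_tnth.
have mA N : measurable (A N).
  apply: fconfig_measurableP => n; rewrite ordA; case: ifP => // _.
  by apply: measurableI => //; exact: measurable_uniq_tuple.
have Boo N n : tuple_measure mu n (\bigcap_(i in [set: 'I_n]) (fun t : n.-tuple E => tnth t i) @^-1` F N) < +oo.
  elim: n => [|n IH].
    by rewrite /= (le_lt_trans (y := 1))// ?ltry// diracE lee_fin lern1; case: (_ \in _).
  rewrite /= /cons_measure /pushforward.
  have -> : (tcons (n := n)) @^-1` (\bigcap_(i in [set: 'I_n.+1]) (fun t : n.+1.-tuple E => tnth t i) @^-1` F N) =
      F N `*` (\bigcap_(i in [set: 'I_n]) (fun t : n.-tuple E => tnth t i) @^-1` F N).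
    apply/seteqP; split=> -[x t] /=.
      move=> xF; split=> [|i _ /=]; first exact: (xF ord0).
      by have := xF (lift ord0 i) I; rewrite /= /tcons tnthS.
    move=> [Fx Ft] i _ /=; case: (unliftP ord0 i) => [j ->|->//].
    by rewrite /tcons tnthS; exact: Ft.
  rewrite (product_measure1E mu (tuple_measure mu n) (mF N) (mB N n)).
  by apply: lte_mul_pinfty => //; rewrite ge0_fin_numE//; exact: (Foo N).2.
exists A.
  apply/seteqP; split=> // eta _.
  have : exists N, {in (eta : seq E), forall x, F N x}.
    elim: (eta : seq E) => [|x s [N sN]]; first by exists 0%N.
    have [k _ Fx] : (\bigcup_i F i) x by rewrite -TF.
    exists (maxn k N) => y; rewrite in_cons => /predU1P[->|/sN].
      by move: Fx; exact/subsetPset/ndF/leq_maxl.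
    by exact/subsetPset/ndF/leq_maxr.
  move=> [N sN]; exists (maxn #|` eta| N) => //; split; first exact: leq_maxl.
  by move=> x /sN; exact/subsetPset/ndF/leq_maxr.
move=> N; split=> //; rewrite /lebesgue_poisson /= /mseries.
rewrite (nneseries_split 0 N.+1)// add0n [X in _ + X]eseries0 ?adde0.
  apply: lte_sum_pinfty => n _; rewrite /mscale /= lte_mul_pinfty ?lee_fin ?invr_ge0//.
  suff : tuple_measure mu n (ordered n (A N)) < +oo by [].
  rewrite ordA.
  case: ifP => _; last by rewrite measure0.
  have mUB := measurableI _ _ (@measurable_uniq_tuple R m n) (mB N n).
  by apply: le_lt_trans (Boo N n); apply: le_measure; rewrite ?inE//; exact: mB.
move=> n Nn _; transitivity ((n`!%:R^-1)%:E * tuple_measure mu n (ordered n (A N))) => //.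
by rewrite ordA leqNgt Nn measure0 mule0.
Qed.

Definition sfLP : {sigma_finite_measure set (fconfig R m) -> \bar R} :=
  HB.pack (LP : set _ -> \bar R) (Measure.on (LP : set _ -> \bar R))
    (Measure_isSigmaFinite.Build _ _ _ LP sigma_finite_LP).

Hypothesis m_gt0 : (0 < m)%N.

(** Positive dimension enters here: in dimension 0 the space is a single point of mass 1. The first
    coordinate already confines the set to a null slab. *)
Lemma lebesgueRm_set1 (a : E) : mu [set a] = 0.
Proof.
have := measurable_point a; case: m m_gt0 a => // k _ a ma.
apply/eqP; rewrite eq_le measure_ge0 andbT.
rewrite /lebesgueRm /= /cons_measure /pushforward.
set la := lebesgue_measure; set nu := tuple_measure _ k.
apply: (@le_trans _ _ ((la \x nu) ([set thead a] `*` setT))).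
  apply: le_measure; rewrite ?inE.
  - by rewrite -[X in measurable X]setTI; exact: measurable_tcons.
  - by apply: measurableX => //; exact: measurable_set1.
  - by move=> [x t] /= <-; split.
have -> : (la \x nu) ([set thead a] `*` setT) = la [set thead a] * nu setT.
  by apply: product_measure1E => //; exact: measurable_set1.
by rewrite /la lebesgue_measure_set1 mul0e.
Qed.

Lemma measurable_seq_set (s : seq E) : measurable [set x : E | x \in s].
Proof.
apply: countable_measurable; first exact: measurable_point.
exact/finite_set_countable/finite_seq.
Qed.

Lemma lebesgueRm_seq (s : seq E) : mu [set x | x \in s] = 0.
Proof.
elim: s => [|a s IH].
  by rewrite (_ : [set x | _] = set0) ?measure0//; apply/seteqP; split.
have -> : [set x | x \in a :: s] = [set a] `|` [set x | x \in s].
  by apply/seteqP; split=> x /=; rewrite in_cons => /predU1P.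
have := measureU0 (measurable_point a) (measurable_seq_set s) IH.
by move=> ->; exact: lebesgueRm_set1.
Qed.

(** A list $x::s$ has a repetition only if $x\in s$ or $s$ has one. The second event is null by
    induction, the first by Tonelli, since a finite list of points is a null set. *)
Lemma ae_uniq n : {ae tuple_measure mu n, forall t : n.-tuple E, uniq t}.
Proof.
have mnu k : measurable [set t : k.-tuple E | ~~ uniq t].
  have := measurableC (@measurable_uniq_tuple R m k); congr measurable.
  by apply/seteqP; split=> t /= /negP.
exists [set t : n.-tuple E | ~~ uniq t]; split; [exact: mnu| |by move=> t /= /negP].
pose U (s : fseq E) : \bar R := (~~ uniq s)%:R%:E.
have mB (Z : measurableType _) (f : Z -> bool) : measurable_fun setT f ->
    measurable_fun setT (fun z => (f z)%:R%:E : \bar R).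
  by move=> mf; apply/measurable_EFinP; apply: (measurableT_comp (f := fun b : bool => b%:R : R)).
have mU : measurable_fun setT U.
  apply: mB; apply: (measurableT_comp (f := negb)) => //.
  exact: measurable_uniq measurable_diagonal.
have U0 s : 0 <= U s by rewrite lee_fin.
suff {n} H n : seq_int mu n U = 0.
  apply/eqP; rewrite eq_le measure_ge0 andbT -(H n).
  rewrite -[X in tuple_measure mu n X]setIT -(integral_indic (tuple_measure mu n) measurableT (mnu n)).
  suff -> : seq_int mu n U = \int[tuple_measure mu n]_x (\1_[set t | ~~ uniq t] x)%:E by [].
  by apply: eq_integral => t _; rewrite indicE mem_setE.
elim: n => [|n IH]; first by rewrite seq_int0.
pose F (p : E * fseq E) : \bar R := (p.1 \in p.2)%:R%:E.
have mF : measurable_fun setT F by apply: mB; exact: measurable_mem_fseq measurable_diagonal.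
have F0 z : 0 <= F z by rewrite lee_fin.
rewrite seq_intS//; apply/eqP; rewrite eq_le; apply/andP; split; last first.
  by apply: integral_ge0 => x _; exact: seq_int_ge0.
apply: (@le_trans _ _ (\int[mu]_x (seq_int mu n (fun s => F (x, s)) + seq_int mu n U))).
  apply: ge0_le_integral => //.
- by move=> x _; exact: seq_int_ge0.
- apply: (@measurable_seq_int _ _ _ mu _ _ n (fun p => U (p.1 :: p.2))) => //.
  by apply: (measurableT_comp mU); apply: measurable_fun_cons; mproj.
- apply: emeasurable_funD => //; exact: measurable_seq_int.
- move=> x _; rewrite -ge0_integralD//.
  + apply: ge0_le_integral => //.
    * apply: (@measurable_fun_tval _ _ _ n (fun s => U (x :: s))).
      by apply: (measurableT_comp mU); apply: measurable_fun_cons => //; exact: measurable_cst.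
    * by apply: emeasurable_funD; [apply: (@measurable_fun_tval _ _ _ n (fun s => F (x, s)));
        exact: (measurableT_comp mF (pair1_measurable x))|exact: measurable_fun_tval].
    * move=> t _; rewrite /F /U /= lee_fin -natrD ler_nat.
      by case: (x \in _) => /=; case: (uniq t).
  + apply: (@measurable_fun_tval _ _ _ n (fun s => F (x, s))).
    exact: (measurableT_comp mF (pair1_measurable x)).
  + exact: measurable_fun_tval.
rewrite IH; under eq_integral do rewrite adde0.
rewrite -seq_int_exchange//.
have -> : (fun s : fseq E => \int[mu]_x F (x, s)) = cst 0.
  apply/funext => s; rewrite /F /=.
  have -> : (fun x : E => (x \in s)%:R%:E) = (fun x => (\1_[set x | x \in s] x)%:E :> \bar R).
    by apply/funext => x; rewrite indicE mem_setE.
  by rewrite (integral_indic mu measurableT (measurable_seq_set s)) setIT; exact: lebesgueRm_seq.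
by rewrite /seq_int integral0.
Qed.

Lemma eq_seq_int_uniq n (f g : fseq E -> \bar R) :
  measurable_fun setT f -> measurable_fun setT g -> (forall s, 0 <= f s) -> (forall s, 0 <= g s) ->
  (forall s, uniq s -> f s = g s) -> seq_int mu n f = seq_int mu n g.
Proof.
move=> mf mg f0 g0 fg; apply: ge0_ae_eq_integral => //; [exact: measurable_fun_tval..|].
by apply: filterS (ae_uniq n) => t ut _; exact: fg.
Qed.

(** [npoint_measure] counts duplicate-free tuples only, whereas the pushforward by [fc] counts all
    of them; by [ae_uniq] they agree, and the integral becomes a series of integrals over lists. *)
Lemma lebesgue_poissonE (f : fconfig R m -> \bar R) :
  measurable_fun setT f -> (forall eta, 0 <= f eta) ->
  \int[LP]_eta f eta =
    \sum_(0 <= n <oo) (n`!%:R^-1)%:E * seq_int mu n (fun s => f (fc s)).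
Proof.
move=> mf f0; rewrite ge0_integral_measure_series//; apply: eq_eseriesr => n _.
rewrite ge0_integral_mscale//=; congr (_ * _).
have mphi : measurable_fun setT (fun t : n.-tuple E => fc t).
  exact: (measurableT_comp measurable_fc (@measurable_tval _ E n)).
transitivity (\int[pushforward (tuple_measure mu n) (fun t : n.-tuple E => fc t)]_eta f eta).
  apply: eq_measure_integral => A mA _; rewrite /npoint_measure /pushforward /=.
  have mphiA : measurable ((fun t : n.-tuple E => fc t) @^-1` A).
    by rewrite -[X in measurable X]setTI; exact: mphi.
  apply/eqP; rewrite eq_le; apply/andP; split.
    by apply: le_measure; rewrite ?inE//; [exact: mA|move=> t []].
  have [N [mN N0 uN]] := ae_uniq n.
  rewrite -[npoint_measure n A](measureU0 (mA n) mN N0).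
  have mAN : measurable (ordered n A `|` N) by apply: measurableU => //; exact: mA.
  apply: (le_measure (tuple_measure mu n)); rewrite ?inE//.
  move=> t At; have [ut|nut] := boolP (uniq t); first by left.
  by right; apply: uN => /= ut; rewrite ut in nut.
by rewrite ge0_integral_pushforward// preimage_setT.
Qed.

Section measurability.
Context d1 (Z : measurableType d1).

Lemma measurable_undup2 : measurable_fun setT (fun p : Z * fseq E => (p.1, undup p.2 : fseq E)).
Proof.
apply: measurable_fun_pair; first by mproj.
exact: (measurableT_comp (measurable_undup measurable_diagonal) measurable_snd).
Qed.

Lemma emeasurable_fpowerset (F : Z -> fconfig R m -> fconfig R m -> \bar R) :
  measurable_fun setT (fun p : Z * (fseq E * fseq E) => F p.1 (fc p.2.1) (fc p.2.2)) ->
  measurable_fun setT (fun p : Z * fseq E =>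
    \sum_(xi <- fpowerset (fc p.2)) F p.1 xi (fc p.2 `\` xi)%fset).
Proof.
move=> mF; have := measurableT_comp (emeasurable_splits mF) measurable_undup2.
apply: eq_measurable_fun => -[z s] _ /=.
by rewrite -(big_splits_fc _ _ (undup_uniq s)) fc_undup.
Qed.

Lemma measurable_fpowerset (F : Z -> fconfig R m -> fconfig R m -> R) :
  measurable_fun setT (fun p : Z * (fseq E * fseq E) => F p.1 (fc p.2.1) (fc p.2.2)) ->
  measurable_fun setT (fun p : Z * fseq E =>
    (\sum_(xi <- fpowerset (fc p.2)) F p.1 xi (fc p.2 `\` xi)%fset)%R).
Proof.
move=> mF; have := measurableT_comp (measurable_splitsR mF) measurable_undup2.
apply: eq_measurable_fun => -[z s] _ /=.
by rewrite -(big_splits_fc _ _ (undup_uniq s)) fc_undup.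
Qed.

Lemma emeasurable_points (F : Z -> E -> fconfig R m -> \bar R) :
  measurable_fun setT (fun p : Z * (E * fseq E) => F p.1 p.2.1 (fc p.2.2)) ->
  measurable_fun setT (fun p : Z * fseq E => \sum_(x <- fc p.2) F p.1 x (fc p.2 `\ x)%fset).
Proof.
move=> mF; have := measurableT_comp (emeasurable_dels mF) measurable_undup2.
apply: eq_measurable_fun => -[z s] _ /=.
by rewrite -(big_dels_fc _ _ (undup_uniq s)) fc_undup.
Qed.

Lemma measurable_points (F : Z -> E -> fconfig R m -> R) :
  measurable_fun setT (fun p : Z * (E * fseq E) => F p.1 p.2.1 (fc p.2.2)) ->
  measurable_fun setT (fun p : Z * fseq E => (\sum_(x <- fc p.2) F p.1 x (fc p.2 `\ x)%fset)%R).
Proof.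
move=> mF; have := measurableT_comp (measurable_delsR mF) measurable_undup2.
apply: eq_measurable_fun => -[z s] _ /=.
by rewrite -(big_dels_fc _ _ (undup_uniq s)) fc_undup.
Qed.

Lemma measurable_LP_int (F : Z -> fconfig R m -> \bar R) :
  measurable_fun setT (fun p : Z * fseq E => F p.1 (fc p.2)) -> (forall z eta, 0 <= F z eta) ->
  measurable_fun setT (fun z => \int[LP]_eta F z eta).
Proof.
move=> mF F0.
have mFz z : measurable_fun setT (F z).
  apply: measurable_fun_fconfig.
  exact: (measurableT_comp mF (pair1_measurable z)).
have -> : (fun z => \int[LP]_eta F z eta) = (fun z => \sum_(0 <= n <oo)
    (n`!%:R^-1)%:E * seq_int mu n (fun s => F z (fc s))).
  by apply/funext => z; rewrite lebesgue_poissonE.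
apply: ge0_emeasurable_sum.
  by move=> n z _ _; rewrite mule_ge0 ?lee_fin ?invr_ge0//; exact: seq_int_ge0.
move=> n _; apply: measurable_funeM.
by apply: (@measurable_seq_int _ _ _ mu _ _ n (fun p => F p.1 (fc p.2))).
Qed.

End measurability.

(** Each triangular partial sum is a finite part of the double series, and the terms are
    nonnegative. *)
Lemma lee_triangle_series (b : nat -> nat -> \bar R) : (forall k j, 0 <= b k j) ->
  \sum_(0 <= n <oo) \sum_(k < n.+1) b k (n - k)%N <=
  \sum_(0 <= k <oo) \sum_(0 <= j <oo) b k j.
Proof.
move=> b0; apply: lime_le; first by apply: is_cvg_nneseries => n _ _; exact: sume_ge0.
apply: nearW => N.
have -> : \sum_(0 <= n < N) \sum_(k < n.+1) b k (n - k)%N =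
    \sum_(k < N) \sum_(j < N - k) b k j.
  elim: N => [|N IH]; first by rewrite big_geq// big_ord0.
  rewrite big_nat_recr//= IH [RHS]big_ord_recr /= subSnn big_ord1.
  rewrite [X in _ + X = _]big_ord_recr /= subnn addeA; congr (_ + _).
  rewrite -big_split /=; apply: eq_bigr => k _.
  by rewrite subSn ?(ltnW (ltn_ord k))// big_ord_recr.
have s0 k : 0 <= \sum_(0 <= j <oo) b k j by apply: nneseries_ge0.
apply: (@le_trans _ _ (\sum_(k < N) \sum_(0 <= j <oo) b k j)).
  apply: lee_sum => k _; rewrite -(big_mkord xpredT (b k)).
  exact: nneseries_lim_ge.
rewrite -(big_mkord xpredT (fun k => \sum_(0 <= j <oo) b k j)).
exact: nneseries_lim_ge.
Qed.

(** * Minlos's lemma and the Mecke formula, as upper bounds *)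

Section split_le.
Variable H : fconfig R m -> fconfig R m -> \bar R.
Hypothesis mH : measurable_fun setT (fun p : fseq E * fseq E => H (fc p.1) (fc p.2)).
Hypothesis H0 : forall xi eta, 0 <= H xi eta.

(** Layer by layer, [seq_int_splits] turns the weight $1/n!$ into $1/(k!\,(n-k)!)$; summing over $n$
    arranges the terms in triangles of the double series on the right. *)
Lemma LP_split_le : \int[LP]_eta (\sum_(xi <- fpowerset eta) H xi (eta `\` xi)%fset) <=
  \int[LP]_xi \int[LP]_zeta H xi zeta.
Proof.
pose h (p : fseq E * fseq E) := H (fc p.1) (fc p.2).
have mS : measurable_fun setT (fun s : fseq E => \sum_(xi <- fpowerset (fc s)) H xi (fc s `\` xi)%fset).
  have := measurableT_comp (@emeasurable_fpowerset _ E (fun _ => H) (measurableT_comp mH measurable_snd))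
    (pair1_measurable point).
  exact.
have mh1 xi : measurable_fun setT (H xi).
  apply: measurable_fun_fconfig.
  have := measurableT_comp mH (pair1_measurable (xi : fseq E)).
  by apply: eq_measurable_fun => s _ /=; rewrite fc_fset.
rewrite lebesgue_poissonE; last 2 first.
- exact: measurable_fun_fconfig.
- by move=> eta; exact: sume_ge0.
have mI : measurable_fun setT (fun s : fseq E => \int[LP]_zeta H (fc s) zeta).
  exact: (@measurable_LP_int _ (fseq E) (fun s => H (fc s))).
rewrite lebesgue_poissonE; last 2 first.
- exact: measurable_fun_fconfig.
- by move=> xi; exact: integral_ge0.
pose c k j : R := (k`!%:R^-1 * j`!%:R^-1)%R.
pose b k j := (c k j)%:E * seq_int mu k (fun s1 => seq_int mu j (fun s2 => h (s1, s2))).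
have h0 p : 0 <= h p by exact: H0.
have b0 k j : 0 <= b k j.
  by rewrite mule_ge0 ?lee_fin ?mulr_ge0 ?invr_ge0//; do 2 apply: seq_int_ge0 => ?.
have mhj j : measurable_fun setT (fun s1 : fseq E => seq_int mu j (fun s2 => h (s1, s2))).
  exact: measurable_seq_int.
apply: (@le_trans _ _ (\sum_(0 <= k <oo) \sum_(0 <= j <oo) b k j)).
  apply: le_trans (lee_triangle_series b0); apply: lee_nneseries.
    by move=> n _ _; rewrite mule_ge0 ?lee_fin ?invr_ge0//; apply: seq_int_ge0 => s; exact: sume_ge0.
  move=> n _; rewrite -seq_int_splits//.
  rewrite (@eq_seq_int_uniq n _ (fun s => \sum_(p <- splits s) h p))//.
  - have := measurableT_comp (emeasurable_splits (Z := E) (F := fun p => h p.2)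
      (measurableT_comp mH measurable_snd)) (pair1_measurable point).
    exact.
  - by move=> s; exact: sume_ge0.
  - by move=> s; exact: sume_ge0.
  - by move=> s us; rewrite big_splits_fc.
apply: lee_nneseries; first by move=> k _ _; exact: nneseries_ge0.
move=> k _; rewrite /b.
have -> : seq_int mu k (fun s1 => \int[LP]_zeta H (fc s1) zeta) =
    \sum_(0 <= j <oo) (j`!%:R^-1)%:E * seq_int mu k (fun s1 => seq_int mu j (fun s2 => h (s1, s2))).
  rewrite /seq_int; under eq_integral do rewrite lebesgue_poissonE//.
  rewrite integral_nneseries//.
  - apply: eq_eseriesr => j _; rewrite ge0_integralZl//.
    + exact: measurable_fun_tval (mhj j).
    + by move=> t _; exact: seq_int_ge0.
  - move=> j; apply: measurable_funeM; exact: measurable_fun_tval (mhj j).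
  - by move=> j t _; rewrite mule_ge0 ?lee_fin ?invr_ge0//; exact: seq_int_ge0.
rewrite -nneseriesZl; last first.
  by move=> j _; rewrite mule_ge0 ?lee_fin ?invr_ge0//; do 2 apply: seq_int_ge0 => ?.
suff -> : \sum_(0 <= j <oo) b k j = \sum_(0 <= i <oo) (k`!%:R^-1)%:E * ((i`!%:R^-1)%:E *
  seq_int mu k (fun s1 => seq_int mu i (fun s2 => h (s1, s2)))) by [].
by apply: eq_eseriesr => j _; rewrite muleA -EFinM.
Qed.

End split_le.

Section mecke_le.
Variable F : E -> fconfig R m -> \bar R.
Hypothesis mF : measurable_fun setT (fun p : E * fseq E => F p.1 (fc p.2)).
Hypothesis F0 : forall x eta, 0 <= F x eta.

(** By [seq_int_dels] the $n$-th layer on the left is the layer $n+1$ on the right, because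
    $(n+1)/(n+1)!=1/n!$; the remaining layer 0 is nonnegative. *)
Lemma LP_mecke_le : \int[LP]_xi \int[mu]_x F x xi <=
  \int[LP]_zeta (\sum_(x <- zeta) F x (zeta `\ x)%fset).
Proof.
have mI : measurable_fun setT (fun s : fseq E => \int[mu]_x F x (fc s)).
  apply: (@measurable_mu_int _ _ _ mu _ (fseq E) (fun p : fseq E * E => F p.2 (fc p.1))) => //.
  exact: (measurableT_comp mF (measurable_fun_pair measurable_snd measurable_fst)).
rewrite lebesgue_poissonE; last 2 first.
- exact: measurable_fun_fconfig.
- by move=> xi; exact: integral_ge0.
have mS : measurable_fun setT (fun s : fseq E => \sum_(x <- fc s) F x (fc s `\ x)%fset).
  exact: (measurableT_comp (@emeasurable_points _ E (fun _ => F) (measurableT_comp mF measurable_snd))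
    (pair1_measurable point)).
rewrite lebesgue_poissonE; last 2 first.
- exact: measurable_fun_fconfig.
- by move=> zeta; exact: sume_ge0.
have -> : \sum_(0 <= n <oo) (n`!%:R^-1)%:E * seq_int mu n (fun s => \int[mu]_x F x (fc s)) =
    \sum_(0 <= n <oo) (n.+1`!%:R^-1)%:E *
      seq_int mu n.+1 (fun s => \sum_(x <- fc s) F x (fc s `\ x)%fset).
  apply: eq_eseriesr => n _.
  rewrite (@eq_seq_int_uniq n.+1 _ (fun s => \sum_(q <- dels s) F q.1 (fc q.2)))//; last 4 first.
  - exact: (measurableT_comp (emeasurable_dels (Z := E) (F := fun p => F p.2.1 (fc p.2.2))
      (measurableT_comp mF measurable_snd)) (pair1_measurable point)).
  - by move=> s; exact: sume_ge0.
  - by move=> s; exact: sume_ge0.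
  - by move=> s us; rewrite big_dels_fc.
  rewrite (seq_int_dels mu n mF)//= muleA -EFinM.
  have -> : ((n.+1)`!%:R^-1 * n.+1%:R = n`!%:R^-1 :> R)%R.
    by rewrite factS natrM invfM mulrAC mulVf ?mul1r// pnatr_eq0.
  by rewrite -(@seq_int_exchange _ _ _ mu n (fun p => F p.1 (fc p.2))).
set u := fun n => (n`!%:R^-1)%:E * seq_int mu n (fun s => \sum_(x <- fc s) F x (fc s `\ x)%fset).
have u0 n : 0 <= u n.
  by rewrite mule_ge0 ?lee_fin ?invr_ge0//; apply: seq_int_ge0 => s; exact: sume_ge0.
rewrite [leRHS](@nneseries_recl _ _ u)// -(@nneseries_addn _ u 1)//.
have -> : \sum_(0 <= i <oo) u (i + 1)%N = \sum_(0 <= i <oo) u i.+1.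
  by apply: eq_eseriesr => i _; rewrite addn1.
exact: leeDr.
Qed.

End mecke_le.

Local Close Scope ereal_scope.

End fconfig_of_seq.

(** * Measurability of the rates and of the operator *)

Section measurability_of_operators.
Variables (R : realType) (m : nat).
Local Notation E := (Rspace R m).
Local Notation mu := (lebesgueRm R m).
Local Notation LP := (lebesgue_poisson R m).

Lemma measurable_fseq_const d2 (Y : measurableType d2) (f : fseq E -> Y) :
  (forall s s', size s = size s' -> f s = f s') -> measurable_fun setT f.
Proof.
move=> fs; apply: measurable_fun_fseq1 => n.
rewrite (_ : (fun t => _) = cst (f (nseq n point))); first exact: measurable_cst.
by apply/funext => t; apply: fs; rewrite size_tuple size_nseq.
Qed.

Lemma measurable_fun_card d2 (Y : measurableType d2) (f : nat -> Y) :
  measurable_fun setT (fun eta : fconfig R m => f #|` eta|).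
Proof.
apply: measurable_fun_fconfig.
have mf : measurable_fun setT (fun s : fseq E => f (size s)).
  by apply: measurable_fseq_const => s s' ->.
have := measurableT_comp mf (measurable_undup (@measurable_diagonal R m)).
by apply: eq_measurable_fun => s _ /=; rewrite -card_fc ?undup_uniq// fc_undup.
Qed.

Lemma measurable_fun_fc2 d1 (Z : measurableType d1) (g : Z -> fseq E) d2 (Y : measurableType d2)
    (f : fconfig R m -> Y) : measurable_fun setT f -> measurable_fun setT g ->
  measurable_fun setT (fun z => f (fc (g z))).
Proof. by move=> mf mg; exact: (measurableT_comp (measurable_fun_fc mf) mg). Qed.

Section rate.
Variable r : rate R m.
Hypothesis mr : measurable_fun setT (fun p : E * config R m => r p.1 p.2).

Lemma measurable_frate d1 (Z : measurableType d1) (f : Z -> E) (g : Z -> fseq E) :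
  measurable_fun setT f -> measurable_fun setT g ->
  measurable_fun setT (fun z => frate r (f z) (fc (g z))).
Proof.
move=> mf mg; rewrite /frate.
have mc : measurable_fun setT (fun z => config_of (fc (g z))).
  exact: (measurable_fun_fc2 (@measurable_config_of R m) mg).
have := measurableT_comp mr (measurable_fun_pair mf mc) => mrz.
exact: (measurableT_comp (fine_measurable measurableT) mrz).
Qed.

Definition Kshift x xi eta : R := Kinv (fun zeta => frate r x (zeta `|` xi)%fset) eta.

Lemma Kshift0 x xi : Kshift x xi fset0 = frate r x xi.
Proof.
by rewrite /Kshift /Kinv fpowerset0 big_seq_fset1 fsetD0 cardfs0 expr0 mul1r fset0U.
Qed.

Lemma measurable_Kshift d1 (Z : measurableType d1) (f : Z -> E) (g h : Z -> fseq E) :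
  measurable_fun setT f -> measurable_fun setT g -> measurable_fun setT h ->
  measurable_fun setT (fun z => Kshift (f z) (fc (g z)) (fc (h z))).
Proof.
move=> mf mg mh; rewrite /Kshift /Kinv.
have := @measurable_fpowerset R m _ Z (fun z xi eta =>
  (-1) ^+ #|` eta| * frate r (f z) (xi `|` fc (g z))%fset).
have mz : measurable_fun setT (fun z => (z, h z)) by apply: measurable_fun_pair.
move=> /(_ _) mP; apply: (measurableT_comp (mP _) mz) => {mP}.
apply: measurable_funM.
  have m22 : measurable_fun setT (fun p : Z * (fseq E * fseq E) => p.2.2) by mproj.
  exact: (measurable_fun_fc2 (measurable_fun_card (fun k => (-1) ^+ k : R)) m22).
under eq_fun do rewrite -fc_cat.
apply: measurable_frate; first exact: (measurableT_comp mf measurable_fst).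
apply: measurable_fun_cat; first by mproj.
exact: (measurableT_comp mg measurable_fst).
Qed.

Lemma measurable_Dtot : measurable_fun setT (Dtot r).
Proof.
apply: measurable_fun_fconfig.
have mp : measurable_fun setT (fun s : fseq E => (s, s)) by mproj.
apply: (measurableT_comp (@measurable_points R m _ (fseq E) (fun _ x eta => frate r x eta) _) mp).
by apply: measurable_frate; mproj.
Qed.

End rate.

(* The two halves of Lhat, as functions of xi and of the complement eta \ xi. *)
Definition death_part (r : rate R m) (G : fconfig R m -> R) xi eta : R :=
  G xi * \sum_(x <- xi) Kshift r x (xi `\ x)%fset eta.

Definition birth_part (r : rate R m) (G : fconfig R m -> R) xi eta : R :=
  \int[mu]_x (G (x |` xi)%fset * Kshift r x xi eta).

Lemma LhatE d b G eta : Lhat d b G eta =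
  - (\sum_(xi <- fpowerset eta) death_part d G xi (eta `\` xi)%fset)
  + \sum_(xi <- fpowerset eta) birth_part b G xi (eta `\` xi)%fset.
Proof. by []. Qed.

Lemma measurable_parametric_Rintegral d1 (Z : measurableType d1) (F : Z * E -> R) :
  measurable_fun setT F -> measurable_fun setT (fun z => \int[mu]_x F (z, x)).
Proof.
move=> mF; apply: (measurableT_comp (fine_measurable measurableT)).
have -> : (fun z => (\int[mu]_x (F (z, x))%:E)%E) =
   (fun z => (\int[mu]_x ((EFin \o F)^\+%E (z, x)) - \int[mu]_x ((EFin \o F)^\-%E (z, x)))%E).
  by apply/funext => z; rewrite [LHS]integralE; congr (_ - _)%E; apply: eq_integral => x _; rewrite /= ?funeposE ?funenegE.
have mEF : measurable_fun setT (EFin \o F) by exact/measurable_EFinP.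
apply: emeasurable_funB.
  by apply: measurable_mu_int; [exact: measurable_funepos|move=> z; exact: funepos_ge0].
by apply: measurable_mu_int; [exact: measurable_funeneg|move=> z; exact: funeneg_ge0].
Qed.

Section Lhat.
Variables d b : rate R m.
Hypothesis md : measurable_fun setT (fun p : E * config R m => d p.1 p.2).
Hypothesis mb : measurable_fun setT (fun p : E * config R m => b p.1 p.2).
Variable G : fconfig R m -> R.
Hypothesis mG : measurable_fun setT G.

Lemma measurable_death_sum (h : R -> R) : measurable_fun setT h ->
  measurable_fun setT (fun p : fseq E * fseq E =>
    \sum_(x <- fc p.1) h (Kshift d x (fc p.1 `\ x)%fset (fc p.2))).
Proof.
move=> mh.
have mp : measurable_fun setT (fun p : fseq E * fseq E => (p.2, p.1)) by mproj.
apply: (measurableT_comp (@measurable_points R m _ (fseq E)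
  (fun z x eta => h (Kshift d x eta (fc z))) _) mp).
by apply: (measurableT_comp mh); apply: measurable_Kshift => //; mproj.
Qed.

Lemma measurable_death_part :
  measurable_fun setT (fun p : fseq E * fseq E => death_part d G (fc p.1) (fc p.2)).
Proof.
apply: measurable_funM; first by apply: measurable_fun_fc2 => //; mproj.
exact: (measurable_death_sum (h := id)).
Qed.

Lemma measurable_birth_integrand :
  measurable_fun setT (fun p : (fseq E * fseq E) * E =>
    G (p.2 |` fc p.1.1)%fset * Kshift b p.2 (fc p.1.1) (fc p.1.2)).
Proof.
apply: measurable_funM; last by apply: measurable_Kshift => //; mproj.
under eq_fun do rewrite -fc_cons.
by apply: measurable_fun_fc2 => //; apply: measurable_fun_cons; mproj.
Qed.

Lemma measurable_birth_part :
  measurable_fun setT (fun p : fseq E * fseq E => birth_part b G (fc p.1) (fc p.2)).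
Proof. exact: (measurable_parametric_Rintegral measurable_birth_integrand). Qed.

Lemma measurable_Lhat : measurable_fun setT (Lhat d b G).
Proof.
apply: measurable_fun_fconfig.
have mp : measurable_fun setT (fun s : fseq E => (s, s)) by mproj.
have m2 : measurable_fun setT (fun p : fseq E * (fseq E * fseq E) => p.2) by mproj.
apply: measurable_funD; first apply: measurable_funN.
  apply: (measurableT_comp (@measurable_fpowerset R m _ (fseq E)
    (fun _ xi eta => death_part d G xi eta) _) mp).
  exact: (measurableT_comp measurable_death_part m2).
apply: (measurableT_comp (@measurable_fpowerset R m _ (fseq E)
    (fun _ xi eta => birth_part b G xi eta) _) mp).
exact: (measurableT_comp measurable_birth_part m2).
Qed.

End Lhat.

End measurability_of_operators.

(** * Relative boundedness of the off-diagonal part *)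

Section offdiagonal.
Variables (R : realType) (m : nat).
Hypothesis m_gt0 : (0 < m)%N.
Local Notation E := (Rspace R m).
Local Notation mu := (lebesgueRm R m).
Local Notation LP := (lebesgue_poisson R m).

Lemma measurable_eq_fset0 : measurable_fun setT (fun zeta : fconfig R m => zeta == fset0).
Proof.
have := @measurable_fun_card R m _ bool (fun k => k == 0%N).
by apply: eq_measurable_fun => zeta _ /=; rewrite cardfs_eq0.
Qed.

(** The empty configuration is an atom of mass 1. Splitting it off isolates the diagonal part of
    $\widehat L$. *)
Lemma LP_fset0_part (g : fconfig R m -> \bar R) : measurable_fun setT g ->
  (forall zeta, 0 <= g zeta)%E ->
  (\int[LP]_zeta g zeta =
   g fset0 + \int[LP]_zeta (if zeta == fset0 then 0 else g zeta))%E.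
Proof.
move=> mg g0.
have m0 : measurable_fun setT (fun zeta : fconfig R m => if zeta == fset0 then g zeta else 0)%E.
  by apply: measurable_fun_ifT => //; exact: measurable_eq_fset0.
have m1 : measurable_fun setT (fun zeta : fconfig R m => if zeta == fset0 then 0 else g zeta)%E.
  by apply: measurable_fun_ifT => //; exact: measurable_eq_fset0.
have -> : (g fset0 = \int[LP]_zeta (if zeta == fset0 then g zeta else 0))%E.
  rewrite lebesgue_poissonE//; last by move=> zeta; case: ifP.
  rewrite nneseries_recl; last first.
  - by [].
  - by move=> n _; rewrite mule_ge0 ?lee_fin ?invr_ge0//; apply: seq_int_ge0 => s; case: ifP.
  rewrite eseries0 ?adde0.
    rewrite seq_int0; last exact: (measurable_fun_fc m0).
    have -> : fc [::] = fset0 :> fconfig R m by apply/fsetP => y; rewrite !inE.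
    by rewrite eqxx fact0 invr1 mul1e.
  move=> n n1 _; rewrite (@eq_seq_int _ _ _ mu n _ (cst 0%E)).
    by rewrite /seq_int integral0 mule0.
  move=> s sn; case: eqP => // /fsetP; case: s sn n1 => [<-//|x s _ _] /(_ x).
  by rewrite in_fc in_cons eqxx inE.
rewrite -ge0_integralD//; [|by move=> zeta _; case: ifP|by move=> zeta _; case: ifP].
by apply: eq_integral => zeta _; case: ifP; rewrite ?adde0 ?add0e.
Qed.

Lemma LP_mu_exchange (F : E -> fconfig R m -> \bar R) :
  measurable_fun setT (fun p : E * fseq E => F p.1 (fc p.2)) -> (forall x eta, 0 <= F x eta)%E ->
  (\int[LP]_eta \int[mu]_x F x eta = \int[mu]_x \int[LP]_eta F x eta)%E.
Proof.
move=> mF F0.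
have mFx x : measurable_fun setT (F x).
  by apply: measurable_fun_fconfig; exact: (measurableT_comp mF (pair1_measurable x)).
have mI : measurable_fun setT (fun s : fseq E => \int[mu]_x F x (fc s))%E.
  apply: (@measurable_mu_int _ E _ mu _ (fseq E) (fun p : fseq E * E => F p.2 (fc p.1))) => //.
  exact: (measurableT_comp mF (measurable_fun_pair measurable_snd measurable_fst)).
have mS n : measurable_fun setT (fun x => seq_int mu n (fun s => F x (fc s))).
  exact: (measurable_seq_int mu n mF).
have S0 n x : (0 <= seq_int mu n (fun s => F x (fc s)))%E by exact: seq_int_ge0.
rewrite lebesgue_poissonE//; last 2 first.
- exact: measurable_fun_fconfig.
- by move=> xi; exact: integral_ge0.
under [RHS]eq_integral do rewrite lebesgue_poissonE//.
rewrite integral_nneseries//.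
- apply: eq_eseriesr => n _; rewrite ge0_integralZl//.
  by rewrite (seq_int_exchange mu n mF).
- by move=> n; exact: measurable_funeM.
- by move=> n x _; rewrite mule_ge0 ?lee_fin ?invr_ge0.
Qed.

Variables d b : rate R m.
Hypothesis md : measurable_fun setT (fun p : E * config R m => d p.1 p.2).
Hypothesis mb : measurable_fun setT (fun p : E * config R m => b p.1 p.2).
Hypothesis d0 : forall x g, (0 <= d x g)%E.

Lemma Dtot_ge0 xi : 0 <= Dtot d xi.
Proof. by apply: sumr_ge0 => x _; rewrite fine_ge0. Qed.

Variables (c a1 a2 : R).
Hypotheses (c_gt0 : 0 < c) (a1_ge1 : 1 <= a1) (a2_ge0 : 0 <= a2).
Hypothesis d_bound : forall xi : fconfig R m, (Kinv_sum d c xi <= (a1 * Dtot d xi)%:E)%E.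
Hypothesis b_bound : forall xi : fconfig R m, (Kinv_sum b c xi <= (a2 * Dtot d xi)%:E)%E.
Variable G : fconfig R m -> R.
Hypothesis mG : measurable_fun setT G.

Lemma measurable_wt : measurable_fun setT (fun eta : fconfig R m => c ^+ #|` eta|).
Proof. exact: (measurable_fun_card (fun k => c ^+ k)). Qed.

Let wt_ge0 k : 0 <= c ^+ k. Proof. by rewrite exprn_ge0// ltW. Qed.

Lemma fpowerset_card (eta xi : fconfig R m) : xi \in fpowerset eta ->
  #|` eta| = (#|` xi| + #|` (eta `\` xi)%fset|)%N.
Proof. by rewrite fpowersetE => xe; rewrite -(cardfsID xi eta); move/fsetIidPr: xe => ->. Qed.

Let nz (zeta : fconfig R m) : R := (zeta != fset0)%:R.

(** The factor [nz] suppresses the empty complement, that is the term $\xi=\eta$ of $\widehat L$,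
    which is the multiplication by $-D$. *)
Definition death_offdiag (xi eta : fconfig R m) : R :=
  \sum_(x <- xi) nz eta * `|Kshift d x (xi `\ x)%fset eta|.

Lemma measurable_death_offdiag :
  measurable_fun setT (fun p : fseq E * fseq E => death_offdiag (fc p.1) (fc p.2)).
Proof.
under eq_fun do rewrite /death_offdiag -mulr_sumr.
apply: measurable_funM.
  apply: (measurable_fun_fc2 (f := nz)); last by mproj.
  apply: (measurableT_comp (f := fun b : bool => (~~ b)%:R : R)) => //.
  exact: measurable_eq_fset0.
by apply: measurable_death_sum => //; exact: normr_measurable.
Qed.

(** At the empty configuration $K^{-1}d(x,\cdot\cup\xi\setminus x)$ is $d(x,\xi\setminus x)$, so the
    atom contributes exactly $D(\xi)$ to the hypothesis on [d], and the rest is at most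
    $(a_1-1)D(\xi)$. *)
Lemma death_offdiag_int xi :
  (\int[LP]_zeta (c ^+ #|` zeta| * death_offdiag xi zeta)%:E <= ((a1 - 1) * Dtot d xi)%:E)%E.
Proof.
pose S zeta := \sum_(x <- xi) `|Kshift d x (xi `\ x)%fset zeta|.
have mK x A : measurable_fun setT (fun zeta => `|Kshift d x A zeta|).
  apply: (measurableT_comp (@normr_measurable R setT)); apply: measurable_fun_fconfig.
  have := @measurable_Kshift R m d md _ (fseq E) (cst x) (cst (A : seq E)) id
    (@measurable_cst _ _ _ _ _ _) (@measurable_cst _ _ _ _ _ _) (@measurable_id _ _ _).
  by apply: eq_measurable_fun => s _ /=; rewrite fc_fset.
have mg : measurable_fun setT (fun zeta : fconfig R m => (c ^+ #|` zeta| * S zeta)%:E).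
  apply/measurable_EFinP; apply: measurable_funM; first exact: measurable_wt.
  exact: measurable_sum.
have g0 zeta : (0 <= (c ^+ #|` zeta| * S zeta)%:E)%E.
  by rewrite lee_fin mulr_ge0//; exact: sumr_ge0.
have := d_bound xi.
have -> : Kinv_sum d c xi = (\int[LP]_zeta (c ^+ #|` zeta| * S zeta)%:E)%E.
  rewrite /Kinv_sum -ge0_integral_sum//.
  - apply: eq_integral => zeta _; rewrite sumEFin; congr EFin.
    by rewrite mulr_sumr; apply: eq_bigr => x _; rewrite mulrC.
  - move=> x; apply/measurable_EFinP; apply: measurable_funM; [exact: mK|exact: measurable_wt].
  - by move=> x zeta _; rewrite lee_fin mulr_ge0.
rewrite LP_fset0_part// cardfs0 expr0 mul1r.
have -> : S fset0 = Dtot d xi.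
  by apply: eq_bigr => x _; rewrite Kshift0 ger0_norm// fine_ge0.
rewrite (_ : (a1 * _)%:E = (Dtot d xi)%:E + ((a1 - 1) * Dtot d xi)%:E)%E; last first.
  by rewrite -EFinD; congr EFin; ring.
rewrite leeD2lE//; congr (_ <= _)%E; apply: eq_integral => zeta _.
rewrite /death_offdiag -mulr_sumr /nz; case: eqP => _ /=; first by rewrite mul0r mulr0.
by rewrite mul1r.
Qed.

(** The weight is multiplicative, $c^{|\eta|}=c^{|\xi|}c^{|\eta\setminus\xi|}$, so [LP_split_le]
    separates the variables and [death_offdiag_int] bounds the inner integral. *)
Lemma death_offdiag_bound :
  (\int[LP]_eta (\sum_(xi <- fpowerset eta)
    (c ^+ #|` eta| * (`|G xi| * death_offdiag xi (eta `\` xi)%fset))%:E) <=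
  (a1 - 1)%:E * \int[LP]_xi (c ^+ #|` xi| * `|Dtot d xi * G xi|)%:E)%E.
Proof.
have D0 (A B : fconfig R m) : 0 <= death_offdiag A B.
  by apply: sumr_ge0 => x _; rewrite mulr_ge0// ler0n.
pose H (xi zeta : fconfig R m) : \bar R := ((c ^+ #|` xi| * `|G xi|) * (c ^+ #|` zeta| * death_offdiag xi zeta))%:E.
have H0 A B : (0 <= H A B)%E by rewrite lee_fin !mulr_ge0.
have mH : measurable_fun setT (fun p : fseq E * fseq E => H (fc p.1) (fc p.2)).
  apply/measurable_EFinP; apply: measurable_funM.
    apply: (measurable_fun_fc2 (f := fun xi : fconfig R m => c ^+ #|` xi| * `|G xi|)); last by mproj.
    apply: measurable_funM; first exact: measurable_wt.
    exact: (measurableT_comp (@normr_measurable R setT)).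
  apply: measurable_funM; last exact: measurable_death_offdiag.
  by apply: (measurable_fun_fc2 (f := fun xi : fconfig R m => c ^+ #|` xi|)); [exact: measurable_wt|mproj].
rewrite (_ : (\int[LP]_eta _)%E = (\int[LP]_eta \sum_(xi <- fpowerset eta) H xi (eta `\` xi)%fset)%E);
  last first.
  apply: eq_integral => eta _; apply: eq_big_seq => xi xe; rewrite /H (fpowerset_card xe) exprD.
  by congr EFin; ring.
apply: le_trans (LP_split_le m_gt0 mH H0) _.
have mDG : measurable_fun setT (fun xi : fconfig R m => (c ^+ #|` xi| * `|Dtot d xi * G xi|)%:E).
  apply/measurable_EFinP; apply: measurable_funM; first exact: measurable_wt.
  apply: (measurableT_comp (@normr_measurable R setT)).
  by apply: measurable_funM => //; exact: measurable_Dtot.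
have mg xi : measurable_fun setT (fun zeta : fconfig R m => (c ^+ #|` zeta| * death_offdiag xi zeta)%:E).
  apply: measurable_fun_fconfig; apply/measurable_EFinP.
  have mp : measurable_fun setT (fun s : fseq E => ((xi : seq E) : fseq E, s)).
    by apply: measurable_fun_pair.
  have := measurableT_comp measurable_death_offdiag mp => ms.
  have : measurable_fun setT (fun s : fseq E => c ^+ #|` fc s| * death_offdiag (fc xi) (fc s)).
    by apply: measurable_funM => //; exact: (measurable_fun_fc measurable_wt).
  by apply: eq_measurable_fun => s _ /=; rewrite fc_fset.
have mI : measurable_fun setT (fun xi : fconfig R m => \int[LP]_zeta H xi zeta)%E.
  apply: measurable_fun_fconfig.
  exact: (@measurable_LP_int _ _ m_gt0 _ (fseq E) (fun s => H (fc s))).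
rewrite -ge0_integralZl//; [|by move=> xi _; rewrite lee_fin mulr_ge0|by rewrite lee_fin subr_ge0].
apply: ge0_le_integral => //.
- by move=> xi _; exact: integral_ge0.
- exact: measurable_funeM.
move=> xi _; rewrite /H; under eq_integral do rewrite EFinM.
rewrite ge0_integralZl//; [|by move=> zeta _; rewrite lee_fin mulr_ge0|by rewrite lee_fin mulr_ge0].
apply: (@le_trans _ _ ((c ^+ #|` xi| * `|G xi|)%:E * ((a1 - 1) * Dtot d xi)%:E)%E).
  by rewrite lee_wpmul2l// ?lee_fin ?mulr_ge0//; exact: death_offdiag_int.
rewrite -!EFinM lee_fin normrM (ger0_norm (Dtot_ge0 xi)); apply: le_of_eq; ring.
Qed.

Let mBi : measurable_fun setT (fun p : (fseq E * fseq E) * E =>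
  (`|G (p.2 |` fc p.1.1)%fset * Kshift b p.2 (fc p.1.1) (fc p.1.2)|)%:E).
Proof.
apply/measurable_EFinP; apply: (measurableT_comp (@normr_measurable R setT)).
exact: measurable_birth_integrand.
Qed.

(** [LP_split_le] separates $\xi$ from its complement, then [LP_mecke_le] absorbs the added point
    $x$ into $\xi$, turning $G(\xi\cup x)$ into $G(\xi)$. The factor $1/c$ appears because the
    weight now counts $\xi\setminus x$. *)
Lemma birth_bound :
  (\int[LP]_eta (\sum_(xi <- fpowerset eta) ((c ^+ #|` eta|)%:E * \int[mu]_x
    (`|G (x |` xi)%fset * Kshift b x xi (eta `\` xi)%fset|)%:E)) <=
  (a2 / c)%:E * \int[LP]_xi (c ^+ #|` xi| * `|Dtot d xi * G xi|)%:E)%E.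
Proof.
pose H (xi zeta : fconfig R m) : \bar R := ((c ^+ #|` xi| * c ^+ #|` zeta|)%:E *
  \int[mu]_x (`|G (x |` xi)%fset * Kshift b x xi zeta|)%:E)%E.
have H0 A B : (0 <= H A B)%E.
  by rewrite mule_ge0 ?lee_fin ?mulr_ge0//; apply: integral_ge0 => x _; rewrite lee_fin.
have mHi : measurable_fun setT (fun p : fseq E * fseq E =>
    \int[mu]_x (`|G (x |` fc p.1)%fset * Kshift b x (fc p.1) (fc p.2)|)%:E)%E.
  by apply: (measurable_mu_int mu mBi) => z; rewrite lee_fin.
have mw d1 (Z : measurableType d1) (g : Z -> fseq E) : measurable_fun setT g ->
    measurable_fun setT (fun p => c ^+ #|` fc (g p)|).
  exact: (measurable_fun_fc2 measurable_wt).
have mH : measurable_fun setT (fun p : fseq E * fseq E => H (fc p.1) (fc p.2)).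
  apply: emeasurable_funM => //; apply/measurable_EFinP.
  by apply: measurable_funM; apply: mw; mproj.
rewrite (_ : (\int[LP]_eta _)%E = (\int[LP]_eta \sum_(xi <- fpowerset eta) H xi (eta `\` xi)%fset)%E);
  last first.
  by apply: eq_integral => eta _; apply: eq_big_seq => xi xe; rewrite /H (fpowerset_card xe) exprD.
apply: le_trans (LP_split_le m_gt0 mH H0) _.
pose F (x : E) (xi : fconfig R m) : \bar R := (\int[LP]_zeta
  ((c ^+ #|` xi| * c ^+ #|` zeta|) * `|G (x |` xi)%fset * Kshift b x xi zeta|)%:E)%E.
have mF3 : measurable_fun setT (fun p : (E * fseq E) * fseq E =>
   ((c ^+ #|` fc p.1.2| * c ^+ #|` fc p.2|) * `|G (p.1.1 |` fc p.1.2)%fset * Kshift b p.1.1 (fc p.1.2) (fc p.2)|)%:E).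
  apply/measurable_EFinP; apply: measurable_funM.
    by apply: measurable_funM; apply: mw; mproj.
  apply: (measurableT_comp (@normr_measurable R setT)).
  have mp : measurable_fun setT (fun p : (E * fseq E) * fseq E => ((p.1.2, p.2), p.1.1)) by mproj.
  exact: (measurableT_comp (measurable_birth_integrand mb mG) mp).
have F30 x xi zeta : (0 <= ((c ^+ #|` xi| * c ^+ #|` zeta|) *
    `|G (x |` xi)%fset * Kshift b x xi zeta|)%:E)%E.
  by rewrite lee_fin !mulr_ge0.
have mF : measurable_fun setT (fun p : E * fseq E => F p.1 (fc p.2)).
  by apply: (measurable_LP_int m_gt0 (F := fun p : E * fseq E => fun zeta => ((c ^+ #|` fc p.2| *
    c ^+ #|` zeta|) * `|G (p.1 |` fc p.2)%fset * Kshift b p.1 (fc p.2) zeta|)%:E)).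
have F0 x xi : (0 <= F x xi)%E by apply: integral_ge0.
have -> : (\int[LP]_xi \int[LP]_zeta H xi zeta = \int[LP]_xi \int[mu]_x F x xi)%E.
  apply: eq_integral => xi _; rewrite -LP_mu_exchange//; last first.
    have mp : measurable_fun setT (fun p : E * fseq E => ((p.1, (xi : seq E) : fseq E), p.2)).
      by do !apply: measurable_fun_pair => //; mproj.
    by have := measurableT_comp mF3 mp; apply: eq_measurable_fun => p _ /=; rewrite fc_fset.
  apply: eq_integral => zeta _; rewrite /H -ge0_integralZl//.
  - have := measurableT_comp mBi (pair1_measurable ((xi : seq E) : fseq E, (zeta : seq E) : fseq E)).
    by apply: eq_measurable_fun => x _ /=; rewrite !fc_fset.
  - by rewrite lee_fin mulr_ge0.
apply: le_trans (LP_mecke_le m_gt0 mF F0) _.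
have mDG : measurable_fun setT (fun xi : fconfig R m => (c ^+ #|` xi| * `|Dtot d xi * G xi|)%:E).
  apply/measurable_EFinP; apply: measurable_funM; first exact: measurable_wt.
  apply: (measurableT_comp (@normr_measurable R setT)).
  by apply: measurable_funM => //; exact: measurable_Dtot.
have mS : measurable_fun setT (fun zeta : fconfig R m => \sum_(x <- zeta) F x (zeta `\ x)%fset)%E.
  apply: measurable_fun_fconfig.
  exact: (measurableT_comp (@emeasurable_points R m _ E (fun _ => F)
    (measurableT_comp mF measurable_snd)) (pair1_measurable point)).
rewrite -ge0_integralZl//; [|by move=> xi _; rewrite lee_fin mulr_ge0|by rewrite lee_fin divr_ge0// ltW].
apply: ge0_le_integral => //.
- by move=> xi _; exact: sume_ge0.
- exact: measurable_funeM.
move=> xi _.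
apply: (@le_trans _ _ ((c ^+ #|` xi| / c * `|G xi|)%:E * Kinv_sum b c xi)%E).
  rewrite /Kinv_sum ge0_sume_distrr; last first.
    by move=> x _; apply: integral_ge0 => zeta _; rewrite lee_fin mulr_ge0.
  rewrite big_seq [leRHS]big_seq; apply: lee_sum => x xxi; rewrite /F -ge0_integralZl//; last 3 first.
  - apply: measurable_fun_fconfig; apply/measurable_EFinP; apply: measurable_funM; last first.
      exact: (measurable_fun_fc measurable_wt).
    apply: (measurableT_comp (@normr_measurable R setT)).
    have := @measurable_Kshift R m b mb _ (fseq E) (cst x) (cst ((xi `\ x)%fset : seq E)) id
      (@measurable_cst _ _ _ _ _ _) (@measurable_cst _ _ _ _ _ _) (@measurable_id _ _ _).
    by apply: eq_measurable_fun => s _ /=; rewrite fc_fset.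
  - by move=> zeta _; rewrite lee_fin mulr_ge0.
  - by rewrite lee_fin mulr_ge0// divr_ge0// ltW.
  suff -> : (\int[LP]_zeta (c ^+ #|` (xi `\ x)%fset| * c ^+ #|` zeta| *
      `|G (x |` (xi `\ x))%fset * Kshift b x (xi `\ x)%fset zeta|)%:E =
    \int[LP]_zeta ((c ^+ #|` xi| / c * `|G xi|)%:E * (`|Kshift b x (xi `\ x)%fset zeta| * c ^+ #|` zeta|)%:E))%E by [].
  apply: eq_integral => zeta _; rewrite -EFinM; congr EFin.
  rewrite fsetD1K// normrM (cardfsD1 x xi) xxi add1n exprS.
  by rewrite (mulrC c) mulfK ?lt0r_neq0// mulrACA [in LHS](mulrC (c ^+ #|` zeta|)).
apply: (@le_trans _ _ ((c ^+ #|` xi| / c * `|G xi|)%:E * (a2 * Dtot d xi)%:E)%E).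
  by rewrite lee_wpmul2l// lee_fin mulr_ge0// divr_ge0// ltW.
rewrite -!EFinM lee_fin normrM (ger0_norm (Dtot_ge0 xi)); apply: le_of_eq; field.
exact: lt0r_neq0.
Qed.

Lemma Lhat_pointwise eta :
  ((`|Lhat d b G eta + Dtot d eta * G eta|)%:E <=
   (\sum_(xi <- fpowerset eta) (`|G xi| * death_offdiag xi (eta `\` xi)%fset)%:E) +
   \sum_(xi <- fpowerset eta) \int[mu]_x
    (`|G (x |` xi)%fset * Kshift b x xi (eta `\` xi)%fset|)%:E)%E.
Proof.
rewrite LhatE.
(* The term $\xi=\eta$ is exactly $D(\eta)G(\eta)$; it cancels the added $DG$, and the factor [nz]
   leaves every other term unchanged. *)
have -> : \sum_(xi <- fpowerset eta) death_part d G xi (eta `\` xi)%fset =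
  \sum_(xi <- fpowerset eta) nz (eta `\` xi)%fset * death_part d G xi (eta `\` xi)%fset + Dtot d eta * G eta.
  rewrite (bigD1_seq eta) ?fset_uniq//=; last by rewrite fpowersetE fsubset_refl.
  rewrite [in RHS](bigD1_seq eta) ?fset_uniq//=; last by rewrite fpowersetE fsubset_refl.
  rewrite fsetDv /nz eqxx mul0r add0r addrC; congr (_ + _).
    rewrite big_seq_cond [RHS]big_seq_cond; apply: eq_bigr => xi /andP[].
    rewrite fpowersetE => xe ne.
    rewrite (_ : (_ != fset0) = true) ?mul1r//; apply: contra_neq ne => /eqP.
    by rewrite fsetD_eq0 => ex; apply/eqP; rewrite eqEfsubset xe.
  by rewrite /death_part mulrC; congr (_ * _); apply: eq_bigr => x _; rewrite Kshift0.
set S1 := \sum_(xi <- _) nz _ * _; set S2 := \sum_(xi <- _) birth_part _ _ _ _.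
have cancel (s g t : R) : - (s + g) + t + g = t - s by ring.
rewrite cancel.
apply: (@le_trans _ _ (`|S1|%:E + `|S2|%:E)%E).
  by rewrite -EFinD lee_fin [leRHS]addrC ler_normB.
apply: leeD.
  rewrite sumEFin lee_fin; apply: (le_trans (ler_norm_sum _ _ _)); apply: ler_sum => xi _.
  rewrite /death_part /death_offdiag -mulr_sumr normrM normrM (ger0_norm (ler0n _ _)) mulrCA.
  by rewrite ler_wpM2l// ler_wpM2l// ler_norm_sum.
apply: (@le_trans _ _ (\sum_(xi <- fpowerset eta) `|birth_part b G xi (eta `\` xi)%fset|%:E)%E).
  by rewrite sumEFin lee_fin ler_norm_sum.
apply: lee_sum => xi _; rewrite /birth_part.
apply: (@le_trans _ _ `|\int[mu]_x (G (x |` xi)%fset * Kshift b x xi (eta `\` xi)%fset)%:E|%E).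
  by rewrite /Rintegral; case: (\int[mu]_x _)%E => [r| |] //=; rewrite leey.
apply: le_abse_integral => //; apply/measurable_EFinP.
have := measurableT_comp (measurable_birth_integrand mb mG)
  (pair1_measurable ((xi : seq E) : fseq E, ((eta `\` xi)%fset : seq E) : fseq E)).
by apply: eq_measurable_fun => x _ /=; rewrite !fc_fset.
Qed.

Lemma measurable_offdiag_sums :
  measurable_fun setT (fun eta : fconfig R m =>
     \sum_(xi <- fpowerset eta) (`|G xi| * death_offdiag xi (eta `\` xi)%fset)%:E)%E /\
  measurable_fun setT (fun eta : fconfig R m => \sum_(xi <- fpowerset eta)
     \int[mu]_x (`|G (x |` xi)%fset * Kshift b x xi (eta `\` xi)%fset|)%:E)%E.
Proof.
have main (H : fconfig R m -> fconfig R m -> \bar R) :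
    measurable_fun setT (fun p : fseq E * fseq E => H (fc p.1) (fc p.2)) ->
    measurable_fun setT (fun eta : fconfig R m => \sum_(xi <- fpowerset eta) H xi (eta `\` xi)%fset)%E.
  move=> mH; apply: measurable_fun_fconfig.
  exact: (measurableT_comp (@emeasurable_fpowerset R m _ E (fun _ => H)
    (measurableT_comp mH measurable_snd)) (pair1_measurable point)).
split.
  apply: (main (fun xi zeta => (`|G xi| * death_offdiag xi zeta)%:E)); apply/measurable_EFinP; apply: measurable_funM; last exact: measurable_death_offdiag.
  apply: (measurable_fun_fc2 (f := fun xi : fconfig R m => `|G xi|)); last by mproj.
  exact: (measurableT_comp (@normr_measurable R setT)).
apply: (main (fun xi zeta => \int[mu]_x (`|G (x |` xi)%fset * Kshift b x xi zeta|)%:E)%E).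
by apply: (measurable_mu_int mu mBi) => z; rewrite lee_fin.
Qed.

Lemma offdiag_bound :
  (\int[LP]_eta (c ^+ #|` eta| * `|Lhat d b G eta + Dtot d eta * G eta|)%:E <=
  (a1 - 1 + a2 / c)%:E * \int[LP]_xi (c ^+ #|` xi| * `|Dtot d xi * G xi|)%:E)%E.
Proof.
have [m1 m2] := measurable_offdiag_sums.
have D0 (A B : fconfig R m) : 0 <= death_offdiag A B.
  by apply: sumr_ge0 => x _; rewrite mulr_ge0// ler0n.
have mw : measurable_fun setT (fun eta : fconfig R m => (c ^+ #|` eta|)%:E).
  by apply/measurable_EFinP; exact: measurable_wt.
rewrite EFinD ge0_muleDl; [|by rewrite lee_fin subr_ge0|by rewrite lee_fin divr_ge0// ltW].
apply: le_trans (leeD death_offdiag_bound birth_bound).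
have E1 eta : (\sum_(xi <- fpowerset eta)
   (c ^+ #|` eta| * (`|G xi| * death_offdiag xi (eta `\` xi)%fset))%:E =
   (c ^+ #|` eta|)%:E * \sum_(xi <- fpowerset eta) (`|G xi| * death_offdiag xi (eta `\` xi)%fset)%:E)%E.
  by rewrite ge0_sume_distrr// => xi _; rewrite lee_fin mulr_ge0.
have E2 eta : (\sum_(xi <- fpowerset eta) ((c ^+ #|` eta|)%:E * \int[mu]_x
    (`|G (x |` xi)%fset * Kshift b x xi (eta `\` xi)%fset|)%:E) =
   (c ^+ #|` eta|)%:E * \sum_(xi <- fpowerset eta) \int[mu]_x
    (`|G (x |` xi)%fset * Kshift b x xi (eta `\` xi)%fset|)%:E)%E.
  rewrite ge0_sume_distrr// => xi _; apply: integral_ge0 => x _; by rewrite lee_fin.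
have S10 eta : (0 <= \sum_(xi <- fpowerset eta) (`|G xi| * death_offdiag xi (eta `\` xi)%fset)%:E)%E.
  by apply: sume_ge0 => xi _; rewrite lee_fin mulr_ge0.
have S20 eta : (0 <= \sum_(xi <- fpowerset eta) \int[mu]_x
    (`|G (x |` xi)%fset * Kshift b x xi (eta `\` xi)%fset|)%:E)%E.
  by apply: sume_ge0 => xi _; apply: integral_ge0 => x _; rewrite lee_fin.
rewrite -ge0_integralD//; last 4 first.
- by move=> eta _; rewrite E1 mule_ge0// lee_fin.
- by under eq_fun do rewrite E1; exact: emeasurable_funM.
- by move=> eta _; rewrite E2 mule_ge0// lee_fin.
- by under eq_fun do rewrite E2; exact: emeasurable_funM.
apply: ge0_le_integral => //.
- by move=> eta _; rewrite lee_fin mulr_ge0.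
- apply/measurable_EFinP; apply: measurable_funM; first exact: measurable_wt.
  apply: (measurableT_comp (@normr_measurable R setT)); apply: measurable_funD.
    exact: measurable_Lhat.
  by apply: measurable_funM => //; exact: measurable_Dtot.
- under eq_fun do rewrite E1 E2; apply: emeasurable_funD; exact: emeasurable_funM.
- move=> eta _; rewrite E1 E2 -ge0_muleDr// EFinM lee_wpmul2l ?lee_fin//.
  exact: Lhat_pointwise.
Qed.

(** The real integral in [Lhat] is additive only on integrable functions. Finiteness of
    [birth_bound] makes every birth integral converge for almost all [eta], which is why linearity
    of [Lhat] is stated almost everywhere. *)
Lemma ae_birth_integrable : 
  (\int[LP]_xi (c ^+ #|` xi| * `|Dtot d xi * G xi|)%:E < +oo)%E ->
  {ae LP, forall eta, forall xi, xi \in fpowerset eta ->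
    integ mu (fun x => G (x |` xi)%fset * Kshift b x xi (eta `\` xi)%fset)}.
Proof.
move=> Goo; have [_ m2] := measurable_offdiag_sums.
have c0 k : 0 < c ^+ k by exact: exprn_gt0.
pose S (eta : fconfig R m) := (\sum_(xi <- fpowerset eta) ((c ^+ #|` eta|)%:E * \int[mu]_x
    (`|G (x |` xi)%fset * Kshift b x xi (eta `\` xi)%fset|)%:E))%E.
have I0 (eta xi : fconfig R m) : (0 <= \int[mu]_x
    (`|G (x |` xi)%fset * Kshift b x xi (eta `\` xi)%fset|)%:E)%E.
  by apply: integral_ge0 => x _; rewrite lee_fin.
have S0 eta : (0 <= S eta)%E by apply: sume_ge0 => xi _; rewrite mule_ge0// lee_fin.
have SE : S = (fun eta => (c ^+ #|` eta|)%:E * \sum_(xi <- fpowerset eta) \int[mu]_x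
    (`|G (x |` xi)%fset * Kshift b x xi (eta `\` xi)%fset|)%:E)%E.
  by apply/funext => eta; rewrite /S ge0_sume_distrr.
have mS : measurable_fun setT S.
  rewrite SE; apply: emeasurable_funM => //; apply/measurable_EFinP; exact: measurable_wt.
have : LP.-integrable setT S.
  apply/integrableP; split=> //; under eq_integral do rewrite gee0_abs//.
  apply: le_lt_trans birth_bound _; rewrite lte_mul_pinfty ?lee_fin ?divr_ge0//; exact: ltW.
move=> /(integrable_ae measurableT); apply: filterS => eta /(_ I) Sfin xi xie.
apply/integP; split.
  have := measurableT_comp (measurable_birth_integrand mb mG)
    (pair1_measurable ((xi : seq E) : fseq E, ((eta `\` xi)%fset : seq E) : fseq E)).
  by apply: eq_measurable_fun => x _ /=; rewrite !fc_fset.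
have : (S eta < +oo)%E by rewrite -ge0_fin_numE.
rewrite /S (bigD1_seq xi) ?fset_uniq//= => h.
have {}h : ((c ^+ #|` eta|)%:E * \int[mu]_x
    (`|G (x |` xi)%fset * Kshift b x xi (eta `\` xi)%fset|)%:E < +oo)%E.
  by apply: le_lt_trans h; apply: leeDl; apply: sume_ge0 => zeta _; rewrite mule_ge0// lee_fin.
rewrite ltey; apply: contraTneq h => ->.
by rewrite gt0_muley ?lte_fin// ltxx.
Qed.

End offdiagonal.

Section linearity.
Variables (R : realType) (m : nat).
Hypothesis m_gt0 : (0 < m)%N.
Local Notation E := (Rspace R m).
Local Notation mu := (lebesgueRm R m).
Local Notation LP := (lebesgue_poisson R m).
Variables d b : rate R m.
Hypothesis md : measurable_fun setT (fun p : E * config R m => d p.1 p.2).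
Hypothesis mb : measurable_fun setT (fun p : E * config R m => b p.1 p.2).
Hypothesis d0 : forall x g, (0 <= d x g)%E.
Variables (c a2 : R).
Hypotheses (c_gt0 : 0 < c) (a2_ge0 : 0 <= a2).
Hypothesis b_bound : forall xi : fconfig R m, (Kinv_sum b c xi <= (a2 * Dtot d xi)%:E)%E.

Lemma Lhat_linear (a : R) (G H : fconfig R m -> R) :
  measurable_fun setT G -> measurable_fun setT H ->
  (\int[LP]_xi (c ^+ #|` xi| * `|Dtot d xi * G xi|)%:E < +oo)%E ->
  (\int[LP]_xi (c ^+ #|` xi| * `|Dtot d xi * H xi|)%:E < +oo)%E ->
  Lhat d b (fun eta => a * G eta + H eta) = (fun eta => a * Lhat d b G eta + Lhat d b H eta) %[ae LP].
Proof.
move=> mG mH Goo Hoo.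
have aeG := ae_birth_integrable m_gt0 md mb d0 c_gt0 a2_ge0 b_bound mG Goo.
have aeH := ae_birth_integrable m_gt0 md mb d0 c_gt0 a2_ge0 b_bound mH Hoo.
have FF := ae_filter_ringOfSetsType LP.
apply: (@filterS2 _ _ FF _ _ _ _ aeG aeH) => eta IG IH _; rewrite !LhatE.
have -> : \sum_(xi <- fpowerset eta) death_part d (fun eta => a * G eta + H eta) xi (eta `\` xi)%fset =
   a * (\sum_(xi <- fpowerset eta) death_part d G xi (eta `\` xi)%fset) +
   \sum_(xi <- fpowerset eta) death_part d H xi (eta `\` xi)%fset.
  rewrite mulr_sumr -big_split /=; apply: eq_bigr => xi _.
  by rewrite /death_part mulrDl mulrA.
have -> : \sum_(xi <- fpowerset eta) birth_part b (fun eta => a * G eta + H eta) xi (eta `\` xi)%fset =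
   a * (\sum_(xi <- fpowerset eta) birth_part b G xi (eta `\` xi)%fset) +
   \sum_(xi <- fpowerset eta) birth_part b H xi (eta `\` xi)%fset.
  rewrite mulr_sumr -big_split /=; apply: eq_big_seq => xi xie.
  rewrite /birth_part -RintegralZl//; last exact: IG.
  rewrite -RintegralD//; [|exact: integZ (IG _ xie)|exact: (IH _ xie)].
  by apply: eq_Rintegral => x _; rewrite mulrDl mulrA.
lra.
Qed.

End linearity.

(** * Relatively bounded perturbations of a multiplication operator on L1 *)

Section perturbed_multiplication.
Context d (T : measurableType d) (R : realType).
Variable mu : {measure set T -> \bar R}.
Local Notation X := (L1 mu).
Variables (D : T -> R) (S : (T -> R) -> T -> R) (q : R).
Hypotheses (mD : measurable_fun setT D) (D0 : forall t, 0 <= D t).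
Hypotheses (q_ge0 : 0 <= q) (q_lt1 : q < 1).
Hypothesis Slin : forall a f g, integ mu f -> integ mu (fun t => D t * f t) ->
  integ mu g -> integ mu (fun t => D t * g t) ->
  S (fun t => a * f t + g t) = (fun t => a * S f t + S g t) %[ae mu].

(** [S] is read as $-D+B$, and the condition says that $B=S+D$ is bounded relative to $D$ with
    constant $q$ in the $L^1$ norm of weight [rho]. *)
Definition rel_bounded (rho : T -> R) : Prop := forall f,
  integ mu f -> integ mu (fun t => D t * f t) ->
  integ mu (fun t => rho t * (S f t + D t * f t)) /\
  norm1 mu (fun t => rho t * (S f t + D t * f t)) <= q * norm1 mu (fun t => rho t * (D t * f t)).

Hypothesis S_bounded : rel_bounded (cst 1).

Definition gdom : set X := [set x | integ mu (fun t => D t * x t)].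
Definition gen (x : X) : X := L1_of mu (S x).

Lemma integ_offdiag f : integ mu f -> integ mu (fun t => D t * f t) ->
  integ mu (fun t => S f t + D t * f t).
Proof.
move=> If IDf; have [+ _] := S_bounded If IDf; congr integ.
by apply/funext => t; rewrite mul1r.
Qed.

Lemma integ_S f : integ mu f -> integ mu (fun t => D t * f t) -> integ mu (S f).
Proof.
move=> If IDf; have := integB (integ_offdiag If IDf) IDf; congr integ.
by apply/funext => t; rewrite addrK.
Qed.

(** [S] acts on functions and not on classes. The difference $f-g$ is null, so the relative bound
    gives $B(f-g)=0$ almost everywhere, and linearity concludes. *)
Lemma S_ae f g : integ mu f -> integ mu (fun t => D t * f t) ->
  integ mu g -> integ mu (fun t => D t * g t) -> f = g %[ae mu] -> S f = S g %[ae mu].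
Proof.
move=> If IDf Ig IDg fg; pose h t := f t - g t.
have Ih : integ mu h by exact: integB.
have IDh : integ mu (fun t => D t * h t).
  by have := integB IDf IDg; congr integ; apply/funext => t; rewrite mulrBr.
have h0 : h = cst 0 %[ae mu] by apply: filterS fg => t /= fE _; rewrite /h fE// subrr.
have Dh0 : norm1 mu (fun t => D t * h t) = 0.
  rewrite (norm1_ae IDh (integ0 mu)); last by apply: filterS h0 => t /= + _ => ->//; rewrite mulr0.
  by rewrite /norm1 /= normr0 Rintegral_cst// mul0r.
have Sh0 : (fun t => S h t + D t * h t) = cst 0 %[ae mu].
  apply: norm1_eq0; first exact: integ_offdiag.
  have [_] := S_bounded Ih IDh.
  rewrite (_ : norm1 mu (fun t => cst 1 t * (D t * h t)) = 0) ?mulr0; last first.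
    by rewrite -Dh0; congr norm1; apply/funext => t; rewrite mul1r.
  rewrite (_ : (fun t => cst 1 t * _) = (fun t => S h t + D t * h t)); last first.
    by apply/funext => t; rewrite mul1r.
  by move=> n0; apply/eqP; rewrite eq_le n0 norm1_ge0.
have := Slin 1 Ig IDg Ih IDh.
rewrite (_ : (fun t => 1 * g t + h t) = f); last first.
  by apply/funext => t; rewrite mul1r addrC subrK.
move: Sh0 h0; apply: filterS3 => t + + + _ => /(_ I) + /(_ I) /= ht /(_ I) ->.
by rewrite ht mulr0 addr0 => /= ->; rewrite addr0 mul1r.
Qed.

Lemma L1_of_gdom f : integ mu f -> integ mu (fun t => D t * f t) ->
  gdom (L1_of mu f) /\ gen (L1_of mu f) = L1_of mu (S f).
Proof.
move=> If IDf.
have ff := L1_ofP If; have IL := @L1_integ _ _ _ _ (L1_of mu f).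
have IDL : integ mu (fun t => D t * L1_of mu f t).
  apply: integ_ae IDf _ _; first by apply: measurable_funM => //; exact: integ_mfun IL.
  by apply: filterS ff => t /= + _ => ->.
split=> //; apply: L1_of_ae; [exact: integ_S|exact: integ_S|].
by apply: S_ae => //; exact: ae_eq_sym.
Qed.

Lemma gen_op : operator_on gdom gen.
Proof.
have I0 : integ mu (fun t => D t * cst 0 t).
  by have := integ0 mu; congr integ; apply/funext => t; rewrite mulr0.
have dl a x y : gdom x -> gdom y -> gdom (a *: x + y) /\ gen (a *: x + y) = a *: gen x + gen y.
  move=> dx dy; have Ix := L1_integ x; have Iy := L1_integ y.
  have -> : a *: x + y = L1_of mu (fun t => a * x t + y t).
    rewrite (L1_ofD (integZ a Ix) Iy) (L1_ofZ a Ix); congr (_ *: _ + _); exact/esym/L1_of_fun.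
  have Ixy := integD (integZ a Ix) Iy.
  have IDxy : integ mu (fun t => D t * (a * x t + y t)).
    have := integD (integZ a dx) dy; congr integ; apply/funext => t; rewrite mulrDr; congr (_ + _).
    by rewrite mulrCA.
  have [h1 h2] := L1_of_gdom Ixy IDxy; split=> //; rewrite h2 /gen.
  have Sx := integ_S Ix dx; have Sy := integ_S Iy dy.
  rewrite -(L1_ofZ a Sx) -(L1_ofD (integZ a Sx) Sy).
  apply: L1_of_ae; [exact: integ_S|exact: integD (integZ a Sx) Sy|exact: Slin].
split.
- have -> : 0 = L1_of mu (cst 0).
    by apply/esym/L1_ext; apply: ae_eq_trans (ae_eq_sym (L1_ofP (integ0 mu))) (L1_0E mu).
  exact: (L1_of_gdom (integ0 mu) I0).1.
- by move=> a x y dx dy; have [] := dl a x y dx dy.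
- by move=> a x y dx dy; have [] := dl a x y dx dy.
Qed.

Section weight.
Variable rho : T -> R.
Hypotheses (mrho : measurable_fun setT rho) (rho0 : forall t, 0 <= rho t) (rho1 : forall t, rho t <= 1).
Hypothesis Srho : rel_bounded rho.

Lemma integ_rho f : integ mu f -> integ mu (fun t => rho t * f t).
Proof.
move=> If; have mf := integ_mfun If.
apply: (@integ_le _ _ _ _ _ (fun t => `|f t|)) (integ_norm If); first exact: measurable_funM.
by move=> t; rewrite normrM (ger0_norm (rho0 t)) ler_piMl.
Qed.

Definition wnorm (x : X) : R := norm1 mu (fun t => rho t * x t).

Lemma wnorm_of f : integ mu f -> wnorm (L1_of mu f) = norm1 mu (fun t => rho t * f t).
Proof.
move=> If; apply: norm1_ae; [exact/integ_rho/L1_integ|exact: integ_rho|].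
by apply: filterS (L1_ofP If) => t /= + _ => ->.
Qed.

Lemma wnorm_seminorm : seminorm_le wnorm 1.
Proof.
split=> [x y|x]; last first.
  rewrite mul1r L1_normE; apply: (proj2 (norm1_le _ (L1_integ x) _)).
    by apply: integ_mfun; exact/integ_rho/L1_integ.
  by apply: aeW => t; rewrite normrM (ger0_norm (rho0 t)) ler_piMl.
have Ix := L1_integ x; have Iy := L1_integ y.
rewrite -(L1_of_fun (x + y)) wnorm_of; last exact: L1_integ.
rewrite (@norm1_ae _ _ _ _ _ (fun t => rho t * x t + rho t * y t)).
- by apply: norm1D; exact: integ_rho.
- exact/integ_rho/L1_integ.
- by apply: integD; exact: integ_rho.
- by apply: filterS (L1_addE x y) => t /= + _ => <-//; rewrite mulrDr.
Qed.

(** Writing $x-hSx=(1+hD)x-hBx$: since $D\ge0$, the $L^1$ norm of $(1+hD)x$ is exactly that of $x$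
    plus $h$ times that of $Dx$, and $hB$ takes back at most the fraction $q$ of the second term. *)
Lemma wnorm_resolvent (h : R) x : 0 < h -> gdom x ->
  wnorm x + h * ((1 - q) * norm1 mu (fun t => rho t * (D t * x t))) <= wnorm (x - h *: gen x).
Proof.
move=> h0 dx; have Ix := L1_integ x; have IS := integ_S Ix dx.
have -> : x - h *: gen x = L1_of mu (fun t => x t - h * S x t).
  by rewrite (L1_ofB Ix (integZ h IS)) (L1_ofZ h IS) L1_of_fun.
rewrite wnorm_of; last exact: integB Ix (integZ h IS).
pose u t := rho t * (x t + h * (D t * x t)); pose v t := h * (rho t * (S x t + D t * x t)).
have Iu : integ mu u by apply: integ_rho; exact: integD Ix (integZ h dx).
have [IB bB] := Srho Ix dx; have Iv : integ mu v by exact: integZ.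
have -> : (fun t => rho t * (x t - h * S x t)) = (fun t => u t - v t).
  by apply/funext => t; rewrite /u /v; ring.
have nv : norm1 mu v <= h * (q * norm1 mu (fun t => rho t * (D t * x t))).
  by rewrite /v norm1Z// (gtr0_norm h0) ler_wpM2l// ltW.
have nu : norm1 mu u = wnorm x + h * norm1 mu (fun t => rho t * (D t * x t)).
  rewrite /wnorm /norm1 -[h * _]int_scale; last exact/integ_norm/integ_rho.
  rewrite -RintegralD//; last 2 first.
  - exact/integ_norm/integ_rho.
  - exact/integZ/integ_norm/integ_rho.
  apply: eq_Rintegral => t _; rewrite /u !normrM (ger0_norm (D0 t)) (ger0_norm (rho0 t)).
  rewrite (_ : x t + h * (D t * x t) = (1 + h * D t) * x t); last by ring.
  rewrite normrM (@ger0_norm _ (1 + _)); last by rewrite addr_ge0// mulr_ge0// ltW.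
  ring.
have : norm1 mu u <= norm1 mu (fun t => u t - v t) + norm1 mu v.
  by have := norm1D (integB Iu Iv) Iv; rewrite (_ : (fun t => _ - _ + _) = u)//;
    apply/funext => t; rewrite subrK.
rewrite nu; set a := wnorm x; set b := norm1 mu (fun t => rho t * (D t * x t)) in nv *.
have -> : a + h * ((1 - q) * b) = a + h * b - h * (q * b) by ring.
by move: nv; set c := norm1 mu v; set e := norm1 _ _; lra.
Qed.

Lemma wnorm_dissip (h : R) x : 0 < h -> gdom x -> wnorm x <= wnorm (x - h *: gen x).
Proof.
move=> h0 dx; apply: le_trans (wnorm_resolvent h0 dx); rewrite lerDl.
by rewrite !mulr_ge0 ?norm1_ge0 ?subr_ge0 ?ltW.
Qed.

Lemma wnorm_gen_le x : gdom x -> wnorm (gen x) <= (1 + q) * norm1 mu (fun t => rho t * (D t * x t)).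
Proof.
move=> dx; have Ix := L1_integ x; have IS := integ_S Ix dx.
have [IB bB] := Srho Ix dx; rewrite wnorm_of//.
rewrite (_ : (fun t => _) = (fun t => rho t * (S x t + D t * x t) + (-1) * (rho t * (D t * x t)))); last first.
  by apply/funext => t; ring.
apply: le_trans (norm1D IB (integZ _ (integ_rho dx))) _.
by rewrite norm1Z; [rewrite normrN1 mul1r mulrDl mul1r addrC lerD2l|exact: integ_rho].
Qed.

End weight.

(** Cutting a function off where $D>n$ puts it in the domain, and the cut-offs converge in norm by
    dominated convergence. *)
Lemma gdom_dense : dense_in gdom.
Proof.
move=> x e e0; have Ix := L1_integ x; have mx := integ_mfun Ix.
pose c (n : nat) t : R := if D t <= n%:R then 1 else 0.
have mc n : measurable_fun setT (c n).
  by apply: measurable_fun_ifT => //; apply: measurable_fun_ler.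
have c1 n t : 0 <= c n t <= 1 by rewrite /c; case: ifP => _; rewrite ?ler01 ?lexx.
pose f n t := c n t * x t.
have mf n : measurable_fun setT (f n) by exact: measurable_funM.
have fx n t : `|f n t| <= `|x t|.
  have /andP[c0 c1n] := c1 n t; by rewrite normrM (ger0_norm c0) ler_piMl.
have If n : integ mu (f n) by exact: integ_le (fx n) (integ_norm Ix).
have IDf n : integ mu (fun t => D t * f n t).
  apply: (@integ_le _ _ _ _ _ (fun t => n%:R * `|x t|)); [exact: measurable_funM| |exact/integZ/integ_norm].
  move=> t; rewrite normrM (ger0_norm (D0 t)) /f /c; case: ifPn => h; last first.
    by rewrite mul0r normr0 mulr0 mulr_ge0.
  by rewrite mul1r ler_wpM2r.
have cvf t : (f n t)%:E @[n --> \oo] --> (x t)%:E.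
  have [N DN] : exists N, forall n, (N <= n)%N -> D t <= n%:R.
    exists (Num.truncn (D t)).+1 => n Nn; apply: le_trans (ltW (truncnS_gt (D t))) _.
    by rewrite ler_nat.
  apply: cvg_near_cst; exists N => // n /= /DN Dn; by rewrite /f /c Dn mul1r.
have e2 : 0 < e / 2 by lra.
have [N hN] := dominated_norm1 mf mx (integ_norm Ix) fx cvf e2.
exists (L1_of mu (f N)); first exact: (L1_of_gdom (If N) (IDf N)).1.
rewrite -normrN opprB -[in X in _ - X](L1_of_fun x) -(L1_ofB (If N) Ix) L1_of_norm; last exact: integB.
by apply: le_lt_trans (hN N (leqnn _)) _; lra.
Qed.

(** In the unknown $w=(1+hD)x$ the equation reads $w=y+hB(1+hD)^{-1}w$. As $hD/(1+hD)\le1$, the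
    right-hand side is a contraction with constant $q$, and $w$ is its fixed point. *)
Lemma gen_surj (h : R) y : 0 < h -> exists2 x, gdom x & x - h *: gen x = y.
Proof.
move=> h0.
pose r t := (1 + h * D t)^-1.
have p0 t : 0 < 1 + h * D t by rewrite ltr_pwDl// mulr_ge0// ltW.
have mr : measurable_fun setT r.
  apply: measurable_fun_inv_pos => //; apply: measurable_funD => //.
  by apply: measurable_funM => //; exact: measurable_cst.
have r01 t : 0 <= r t <= 1.
  by rewrite invr_ge0 (ltW (p0 t)) invf_le1// lerDl mulr_ge0// ltW.
have hDr t : 0 <= h * (D t * r t) <= 1.
  rewrite !mulr_ge0 ?(ltW h0)//; last by case/andP: (r01 t).
  by rewrite andTb mulrA /r ler_pdivrMr// mul1r lerDr.
have Ir f : integ mu f -> integ mu (fun t => r t * f t).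
  move=> If; apply: (@integ_le _ _ _ _ _ (fun t => `|f t|)) (integ_norm If).
    by apply: measurable_funM => //; exact: integ_mfun If.
  by move=> t; have /andP[a b] := r01 t; rewrite normrM (ger0_norm a) ler_piMl.
have leDr f t : `|h * (D t * (r t * f t))| <= `|f t|.
  have /andP[a b] := hDr t.
  by rewrite (_ : h * _ = (h * (D t * r t)) * f t); [rewrite normrM (ger0_norm a) ler_piMl|ring].
have IhDr f : integ mu f -> integ mu (fun t => h * (D t * (r t * f t))).
  move=> If; apply: (@integ_le _ _ _ _ _ (fun t => `|f t|)) (integ_norm If).
    by do !apply: measurable_funM => //; exact: integ_mfun If.
  exact: leDr.
have IDr f : integ mu f -> integ mu (fun t => D t * (r t * f t)).
  move=> If; have := integZ h^-1 (IhDr f If); congr integ; apply/funext => t.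
  by rewrite mulKf// gt_eqF.
pose B (w : X) := S (fun t => r t * w t).
have IB (w : X) : integ mu (fun t => B w t + D t * (r t * w t)).
  by apply: integ_offdiag; [exact/Ir/L1_integ|exact/IDr/L1_integ].
pose P (w : X) : X := y + h *: L1_of mu (fun t => B w t + D t * (r t * w t)).
have Pc w w' : `|P w - P w'| <= q * `|w - w'|.
  pose u t := w t - w' t; have Iw := L1_integ w; have Iw' := L1_integ w'.
  have Iu : integ mu u by exact: integB.
  have [IBu bu] := S_bounded (Ir _ Iu) (IDr _ Iu).
  have E : L1_of mu (fun t => B w t + D t * (r t * w t)) -
      L1_of mu (fun t => B w' t + D t * (r t * w' t)) =
      L1_of mu (fun t => S (fun t => r t * u t) t + D t * (r t * u t)).
    rewrite -(L1_ofB (IB w) (IB w')); apply: L1_of_ae.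
    - exact: integB (IB w) (IB w').
    - by apply: integ_offdiag; [exact: Ir|exact: IDr].
    have := Slin (-1) (Ir _ Iw') (IDr _ Iw') (Ir _ Iw) (IDr _ Iw).
    rewrite (_ : (fun t => -1 * (r t * w' t) + r t * w t) = (fun t => r t * u t)); last first.
      by apply/funext => t; rewrite /u; ring.
    by apply: filterS => t /= SE _; rewrite SE// /B /u; ring.
  have -> : P w - P w' = h *: L1_of mu (fun t => S (fun t => r t * u t) t + D t * (r t * u t)).
    by rewrite -E /P scalerBr opprD addrACA subrr add0r.
  rewrite normrZ (gtr0_norm h0) L1_of_norm; last by apply: integ_offdiag; [exact: Ir|exact: IDr].
  have nD : h * norm1 mu (fun t => D t * (r t * u t)) <= `|w - w'|.
    rewrite -[X in _ <= `|X - _|](L1_of_fun w) -[X in _ <= `|_ - X|](L1_of_fun w') -(L1_ofB Iw Iw').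
    rewrite L1_of_norm// -[h in leLHS](gtr0_norm h0) -norm1Z; last exact: IDr.
    apply: (proj2 (norm1_le _ Iu _)); first exact/integ_mfun/IhDr.
    by apply: aeW => t; exact: leDr.
  have drop1 f : norm1 mu (fun t => cst 1 t * f t) = norm1 mu f.
    by congr norm1; apply/funext => t; rewrite mul1r.
  rewrite !drop1 in bu.
  apply: le_trans (ler_wpM2l (ltW h0) bu) _.
  by rewrite mulrCA ler_wpM2l.
have [w _ wP] : exists2 w : X, setT w & w = totalfun P w.
  apply: banach_fixed_point; [|exact: closedT|by exists 0].
  by exists (NngNum q_ge0); split=> // -[a b] _; exact: Pc.
have Iw := L1_integ w; have [gx gE] := L1_of_gdom (Ir _ Iw) (IDr _ Iw).
exists (L1_of mu (fun t => r t * w t)) => //; rewrite gE.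
have -> : y = w - h *: L1_of mu (fun t => B w t + D t * (r t * w t)).
  by rewrite [X in _ = X - _]wP /totalfun_ /P addrK.
have IS := integ_S (Ir _ Iw) (IDr _ Iw).
rewrite -(L1_ofZ h IS) -(L1_ofB (Ir _ Iw) (integZ h IS)).
rewrite -[X in X - _]L1_of_fun -(L1_ofZ h (IB w)) -(L1_ofB Iw (integZ h (IB w))).
congr L1_of; apply/funext => t; rewrite /B.
have : r t * (1 + h * D t) = 1 by rewrite mulVf// gt_eqF.
set s := S _ t; set a := w t; set b := r t; set e := D t => hb.
apply/eqP; rewrite -subr_eq0.
rewrite (_ : _ - _ = (b * (1 + h * e) - 1) * a); last by ring.
by rewrite hb subrr mul0r.
Qed.

End perturbed_multiplication.

(** * Differentiability of orbits *)

Section real_derivative.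
Variable R : realType.

Definition diff_at (f : R -> R) (x l : R) : Prop := forall e : R, 0 < e ->
  exists2 d : R, 0 < d & forall h : R, `|h| < d -> `|f (x + h) - f x - h * l| <= e * `|h|.

Lemma diff_at_is_derive f x l : diff_at f x l -> is_derive x 1 f l.
Proof.
move=> fl.
have c : h^-1 *: ((f \o shift x) (h *: 1) - f x) @[h --> (0 : R)^'] --> l.
  apply/cvgrPdist_le => e e0; have [dl dl0 fd] := fl e e0.
  near=> h.
  have h0 : h != 0 by near: h; exact: nbhs_dnbhs_neq.
  have hd : `|h| < dl by near: h; apply: dnbhs0_lt.
  have := fd h hd; rewrite /= -[h *: 1]/(h * 1) mulr1 [h + x]addrC => hh.
  rewrite -[_ *: _]/(h^-1 * _).
  rewrite (_ : l - _ = - (h^-1 * (f (x + h) - f x - h * l))); last first.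
    by rewrite [in RHS]mulrBr mulKf// opprB.
  by rewrite normrN normrM normfV [leLHS]mulrC ler_pdivrMr ?normr_gt0.
by apply: DeriveDef; [exact: cvgP c|exact: (cvg_lim _ c)].
Unshelve. all: by end_near. Qed.

(** Supplies the integrations in time of paired orbits: with a bound [L] in [orbit_lip0], and with
    [L] equal to 0 to obtain constancy in [orbit_unique]. *)
Lemma lipschitz_of_derive (f l : R -> R) (a b L : R) : a <= b ->
  (forall x, a <= x <= b -> diff_at f x (l x)) ->
  (forall x, a <= x <= b -> `|l x| <= L) -> `|f b - f a| <= L * (b - a).
Proof.
move=> ab fl lL.
have D x : x \in `]a, b[%R -> is_derive x 1 f (l x).
  by rewrite in_itv /= => /andP[ax xb]; apply/diff_at_is_derive/fl; rewrite !ltW.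
have Cf : {within `[a, b], continuous f}.
  apply: continuous_in_subspaceT => x; rewrite mem_setE in_itv /= => xab.
  apply/differentiable_continuous/derivable1_diffP.
  by have [] := diff_at_is_derive (fl x xab).
have [c cab ->] := MVT_segment ab D Cf.
rewrite normrM (@ger0_norm _ (b - a)) ?subr_ge0// ler_wpM2r ?subr_ge0//.
by apply: lL; move: cab; rewrite in_itv.
Qed.

End real_derivative.

Section two_sided.
Variables (R : realType) (X : completeNormedModType R) (dom : set X) (A : X -> X).
Variable (T : R -> X -> X) (kap : R).
Hypotheses (Aop : operator_on dom A) (ST : semigroup_of dom A T).
Hypothesis dissip : forall (h : R) y, 0 < h -> dom y -> `|y| <= `|y - h *: A y|.
Hypothesis dense : dense_in dom.
Hypothesis kap0 : 0 < kap.
Hypothesis analytic : forall (h : R) y, 0 < h -> dom y ->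
  `|y| + h * (kap * `|A y|) <= `|y - h *: A y|.

(** A backward increment is a forward one started at $s=t+h\ge t/2$. Each factor $1/(s\kappa)$ then
    costs a factor 2, so the constant 4 of the quadratic estimates becomes 16. *)
Lemma inv_half_mono (s t : R) : 0 < t -> t / 2 <= s -> (s * kap)^-1 <= 2 / (t * kap).
Proof.
move=> t0 ts; have s0 : 0 < s by lra.
rewrite ler_pdivlMr ?mulr_gt0// mulrC ler_pdivrMr ?mulr_gt0// mulrCA [leRHS]mulrC.
rewrite -mulrA (mulrC kap) mulrA ler_wpM2r//; [exact: ltW|lra].
Qed.

Lemma semi_lip2 (t h : R) x : 0 < t -> `|h| <= t / 2 -> dom x ->
  `|T (t + h) x - T t x| <= `|h| * (2 / (t * kap)) * `|x|.
Proof.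
move=> t0 ht dx.
have main (s g : R) : t / 2 <= s -> 0 <= g -> `|T (s + g) x - T s x| <= g * (2 / (t * kap)) * `|x|.
  move=> ts g0; have s0 : 0 < s by lra.
  apply: le_trans (semi_lip_pos ST dissip dense kap0 analytic s0 g0 dx) _.
  by rewrite ler_wpM2r// ler_wpM2l// inv_half_mono.
have [h0|h0] := leP 0 h; first by rewrite ger0_norm//; apply: main => //; lra.
have := main (t + h) (- h); rewrite addrK distrC (ltr0_norm h0); apply; last lra.
by move: ht; rewrite (ltr0_norm h0); lra.
Qed.

Let K (t : R) : R := 16 / (t * kap) ^+ 2.

Let K_mono (s t : R) : 0 < t -> t / 2 <= s -> 4 / (s * kap) ^+ 2 <= K t.
Proof.
move=> t0 ts; have s0 : 0 < s by lra.
rewrite /K -exprVn; have := inv_half_mono t0 ts => h.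
have h2 : (s * kap)^-1 ^+ 2 <= (2 / (t * kap)) ^+ 2.
  have p1 : 0 <= (s * kap)^-1 by rewrite invr_ge0 mulr_ge0// ltW.
  by rewrite lerXn2r// nnegrE// (le_trans p1).
apply: le_trans (ler_wpM2l _ h2) _; first lra.
by rewrite expr_div_n mulrA; apply: le_of_eq; congr (_ / _); ring.
Qed.

Let A_lip (t s g : R) x : 0 < t -> t / 2 <= s -> 0 <= g -> dom x ->
  `|A (T (s + g) x) - A (T s x)| <= g * K t * `|x|.
Proof.
move=> t0 ts g0 dx; have s0 : 0 < s by lra.
apply: le_trans (semi_A_lip Aop ST dissip dense kap0 analytic s0 g0 dx) _.
by rewrite ler_wpM2r// ler_wpM2l// K_mono.
Qed.

Lemma semi_A_lip2 (t h : R) x : 0 < t -> `|h| <= t / 2 -> dom x ->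
  `|A (T (t + h) x) - A (T t x)| <= `|h| * (16 / (t * kap) ^+ 2) * `|x|.
Proof.
move=> t0 ht dx.
have [h0|h0] := leP 0 h; first by rewrite ger0_norm//; apply: A_lip => //; lra.
have := @A_lip t (t + h) (- h) x; rewrite addrK distrC (ltr0_norm h0); apply => //; last lra.
by move: ht; rewrite (ltr0_norm h0); lra.
Qed.

Lemma semi_deriv2 (t h : R) x : 0 < t -> `|h| <= t / 2 -> dom x ->
  `|T (t + h) x - T t x - h *: A (T t x)| <= h ^+ 2 * (32 / (t * kap) ^+ 2) * `|x|.
Proof.
move=> t0 ht dx.
have K2 : 32 / (t * kap) ^+ 2 = K t + K t by rewrite /K -mulrDl; congr (_ / _); ring.
have K0 : 0 <= K t by rewrite /K divr_ge0// sqr_ge0.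
have der (s g : R) : t / 2 <= s -> 0 <= g ->
    `|T (s + g) x - T s x - g *: A (T s x)| <= g ^+ 2 * K t * `|x|.
  move=> ts g0; have s0 : 0 < s by lra.
  apply: le_trans (semi_deriv_right Aop ST dissip dense kap0 analytic s0 g0 dx) _.
  by rewrite ler_wpM2r// ler_wpM2l ?sqr_ge0// K_mono.
rewrite K2 mulrDr mulrDl; have p0 : 0 <= h ^+ 2 * K t * `|x| by rewrite mulr_ge0// mulr_ge0// sqr_ge0.
have [h0|h0] := leP 0 h.
  by apply: le_trans (der t h _ h0) _; [lra|rewrite lerDl].
have ts : t / 2 <= t + h by move: ht; rewrite (ltr0_norm h0); lra.
have h0' : 0 <= - h by lra.
have := der (t + h) (- h) ts h0'; rewrite addrK sqrrN => d1.
have := A_lip (s := t + h) (g := - h) t0 ts h0' dx; rewrite addrK => d2.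
(* For negative [h] the expansion is made at $t+h$, and the derivative is then moved from $t+h$ to
   $t$; the two errors add up to the constant 32. *)
have -> : T (t + h) x - T t x - h *: A (T t x) =
   - (T t x - T (t + h) x - - h *: A (T (t + h) x)) + (- h) *: (A (T t x) - A (T (t + h) x)).
  by lmod R.
apply: le_trans (ler_normD _ _) _; rewrite normrN normrZ (ger0_norm h0'); apply: lerD => //.
apply: le_trans (ler_wpM2l h0' d2) _; apply: le_of_eq; ring.
Qed.

End two_sided.

(** * Bounded functions as functionals *)

Section bounded_functionals.
Context d (T : measurableType d) (R : realType).
Variable mu : {measure set T -> \bar R}.

Definition ae_bounded (k : T -> R) (M : R) : Prop :=
  measurable_fun setT k /\ {ae mu, forall t, `|k t| <= M}.

Lemma ae_bounded_mono k M M' : ae_bounded k M -> M <= M' -> ae_bounded k M'.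
Proof.
move=> [mk kM] MM'; split=> //; apply: filterS kM => t kt; exact: le_trans MM'.
Qed.

Lemma ae_boundedD k l a M N : ae_bounded k M -> ae_bounded l N ->
  ae_bounded (fun t => a * k t + l t) (`|a| * M + N).
Proof.
move=> [mk kM] [ml lN]; split.
  by apply: measurable_funD => //; apply: measurable_funM => //; exact: measurable_cst.
have FF := ae_filter_ringOfSetsType mu.
apply: (@filterS2 _ _ FF _ _ _ _ kM lN) => t kt lt.
by apply: le_trans (ler_normD _ _) _; rewrite normrM lerD// ler_wpM2l.
Qed.

Lemma ae_boundedB k l M N : ae_bounded k M -> ae_bounded l N ->
  ae_bounded (fun t => k t - l t) (M + N).
Proof.
move=> kM lN; have := ae_boundedD (-1) lN kM; rewrite normrN1 mul1r addrC.
by congr ae_bounded; apply/funext => t; rewrite mulN1r addrC.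
Qed.

Lemma integ_mul_bounded f k M : integ mu f -> ae_bounded k M ->
  integ mu (fun t => f t * k t) /\ norm1 mu (fun t => f t * k t) <= `|M| * norm1 mu f.
Proof.
move=> If [mk kM]; rewrite -(normr_id M) -(norm1Z _ If); apply: norm1_le.
- by apply: measurable_funM => //; exact: integ_mfun If.
- exact: integZ.
apply: filterS kM => t kt; rewrite !normrM normr_id mulrC ler_wpM2r//.
exact: le_trans kt (ler_norm M).
Qed.

Lemma le_norm_int f : integ mu f -> `|\int[mu]_t f t| <= norm1 mu f.
Proof. by move=> If; apply: le_normr_Rintegral. Qed.

Definition act (k : T -> R) (x : L1 mu) : R := \int[mu]_t (x t * k t).

Lemma act_of f k M : integ mu f -> ae_bounded k M ->
  act k (L1_of mu f) = \int[mu]_t (f t * k t).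
Proof.
move=> If kM; have [I1 _] := integ_mul_bounded If kM.
have [I2 _] := integ_mul_bounded (@L1_integ _ _ _ mu (L1_of mu f)) kM.
apply: eq_ae_Rintegral; [exact: integ_mfun I2|exact: integ_mfun I1|].
by apply: filterS (L1_ofP If) => t /= + _ => ->.
Qed.

Lemma act_bound k M x : ae_bounded k M -> `|act k x| <= `|M| * `|x|.
Proof.
move=> kM; have [I2 b] := integ_mul_bounded (L1_integ x) kM.
exact: le_trans (le_norm_int I2) b.
Qed.

Lemma act_lin k M a x y : ae_bounded k M -> act k (a *: x + y) = a * act k x + act k y.
Proof.
move=> kM; have Ix := L1_integ x; have Iy := L1_integ y.
have -> : a *: x + y = L1_of mu (fun t => a * x t + y t).
  by rewrite (L1_ofD (integZ a Ix) Iy) (L1_ofZ a Ix) !L1_of_fun.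
rewrite (act_of (integD (integZ a Ix) Iy) kM).
have [Ixk _] := integ_mul_bounded Ix kM; have [Iyk _] := integ_mul_bounded Iy kM.
rewrite -int_scale// -RintegralD//; last exact: integZ.
by apply: eq_Rintegral => t _; rewrite mulrDl mulrA.
Qed.

Lemma actD k M x y : ae_bounded k M -> act k (x + y) = act k x + act k y.
Proof. by move=> kM; have := act_lin 1 x y kM; rewrite scale1r mul1r. Qed.

Lemma actZ k M a x : ae_bounded k M -> act k (a *: x) = a * act k x.
Proof.
move=> kM; have a0 : act k 0 = 0.
  by apply: (@addrI _ (act k 0)); rewrite -(actD _ _ kM) !addr0.
by have := act_lin a x 0 kM; rewrite a0 !addr0.
Qed.

Lemma actB k M x y : ae_bounded k M -> act k (x - y) = act k x - act k y.
Proof. by move=> kM; rewrite (actD _ _ kM) -scaleN1r (actZ _ _ kM) mulN1r. Qed.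

Lemma act_linl k l a M N x : ae_bounded k M -> ae_bounded l N ->
  act (fun t => a * k t + l t) x = a * act k x + act l x.
Proof.
move=> kM lN; have [Ik _] := integ_mul_bounded (L1_integ x) kM.
have [Il _] := integ_mul_bounded (L1_integ x) lN.
rewrite -int_scale// -RintegralD//; last exact: integZ.
by apply: eq_Rintegral => t _; rewrite mulrDr mulrCA.
Qed.

Lemma act_subl k l M N x : ae_bounded k M -> ae_bounded l N ->
  act (fun t => k t - l t) x = act k x - act l x.
Proof.
move=> kM lN; rewrite (_ : (fun t => _) = (fun t => (-1) * l t + k t)).
  by rewrite (act_linl _ _ lN kM) mulN1r addrC.
by apply/funext => t; rewrite mulN1r addrC.
Qed.

Lemma act_ae k l x : measurable_fun setT k -> measurable_fun setT l -> k = l %[ae mu] ->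
  act k x = act l x.
Proof.
move=> mk ml kl; have mx := integ_mfun (L1_integ x).
apply: eq_ae_Rintegral; [exact: measurable_funM|exact: measurable_funM|].
by apply: filterS kl => t /= + _ => ->.
Qed.

(** The test function is $h\,\mathrm{sgn}(k)$ on the set where $|k|>M\rho$. Then $fk-M|\rho
    f|=h(|k|-M\rho)$ is positive there, yet its integral is at most 0 by hypothesis. *)
Lemma bounded_by_testing k M0 (rho : T -> R) M : sigma_finite setT mu ->
  ae_bounded k M0 -> measurable_fun setT rho -> (forall t, 0 <= rho t <= 1) -> 0 <= M ->
  (forall f, integ mu f -> `|\int[mu]_t (f t * k t)| <= M * norm1 mu (fun t => rho t * f t)) ->
  {ae mu, forall t, `|k t| <= M * rho t}.
Proof.
move=> sf kM mrho rho01 M_ge0 H.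
have [mk _] := kM; have [h [Ih h0]] := sigma_finite_weight sf.
pose f t : R := if M * rho t < `|k t| then h t * Num.sg (k t) else 0.
have mf : measurable_fun setT f.
  apply: measurable_fun_ifT => //.
    apply: measurable_fun_ltr; first by apply: measurable_funM => //; exact: measurable_cst.
    exact: (measurableT_comp (@normr_measurable R setT)).
  apply: measurable_funM; first exact: integ_mfun Ih.
  have -> : (fun t => Num.sg (k t)) = (fun t => if k t == 0 then 0 else if k t < 0 then -1 else 1).
    by apply/funext => t; rewrite /Num.sg.
  apply: measurable_fun_ifT => //; first exact: measurable_fun_eqr.
  by apply: measurable_fun_ifT => //; exact: measurable_fun_ltr.
have sg1 t : `|Num.sg (k t)| <= 1 by rewrite normr_sg; case: (_ != _); rewrite ?ler01.
have fh t : `|f t| <= h t.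
  rewrite /f; case: ifP => _; last by rewrite normr0 ltW.
  by rewrite normrM (gtr0_norm (h0 t)) ler_piMr// ltW.
have If : integ mu f by exact: integ_le fh Ih.
have Irf : integ mu (fun t => rho t * f t).
  apply: (@integ_le _ _ _ _ _ (fun t => `|f t|)) (integ_norm If); first exact: measurable_funM.
  by move=> t; have /andP[a b] := rho01 t; rewrite normrM (ger0_norm a) ler_piMl.
have [Ifk _] := integ_mul_bounded If kM.
pose p t := f t * k t - M * `|rho t * f t|.
have IMr : integ mu (fun t => M * `|rho t * f t|) by exact/integZ/integ_norm.
have Ip : integ mu p by exact: integB Ifk IMr.
have pE t : M * rho t < `|k t| -> p t = h t * (`|k t| - M * rho t).
  move=> mt; have /andP[a b] := rho01 t.
  have k0 : k t != 0 by rewrite -normr_gt0; apply: le_lt_trans mt; exact: mulr_ge0.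
  rewrite /p /f mt !normrM (ger0_norm a) (gtr0_norm (h0 t)) normr_sg k0 mulr1 -mulrA.
  rewrite -normrEsg; ring.
have p0 t : 0 <= p t.
  have [mt|mt] := ltP (M * rho t) `|k t|; first by rewrite pE// mulr_ge0 ?subr_ge0 ?ltW.
  by rewrite /p /f ltNge mt /= mul0r mulr0 normr0 mulr0 subr0.
have : norm1 mu p = 0.
  apply/eqP; rewrite eq_le norm1_ge0 andbT.
  have -> : norm1 mu p = \int[mu]_t (f t * k t) - M * norm1 mu (fun t => rho t * f t).
    rewrite -int_scale; last exact: integ_norm.
    rewrite -RintegralB//; by apply: eq_Rintegral => t _; rewrite ger0_norm.
  by rewrite subr_le0; apply: le_trans (H f If); exact: ler_norm.
move=> /(norm1_eq0 Ip); apply: filterS => t /(_ I) /= pt.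
rewrite leNgt; apply/negP => mt; move: pt; rewrite pE// => /eqP.
by rewrite mulf_eq0 (gt_eqF (h0 t)) subr_eq0 (gt_eqF mt).
Qed.

End bounded_functionals.

Section dense_testing.
Context d (T : measurableType d) (R : realType).
Variable mu : {measure set T -> \bar R}.
Variable dom : set (L1 mu).
Hypothesis dense : dense_in dom.

Lemma dense_bound k M0 M (p : L1 mu -> R) : ae_bounded mu k M0 -> seminorm_le p 1 -> 0 <= M ->
  (forall x, dom x -> `|act k x| <= M * p x) -> forall x, `|act k x| <= M * p x.
Proof.
move=> kM [ptri ple] M_ge0 H x; apply/ler_addgt0Pl => e e0.
have K0 : 0 < M + `|M0| + 1 by rewrite ltr_wpDl// addr_ge0.
have [y dy xy] := dense x (divr_gt0 e0 K0).
have -> : x = y + (x - y) by rewrite addrC subrK.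
rewrite (actD _ _ kM); apply: le_trans (ler_normD _ _) _.
have h1 := H y dy; have h2 := act_bound (x - y) kM.
have h3 : p y <= p (y + (x - y)) + `|x - y|.
  have xE : y + (x - y) = x by rewrite addrC subrK.
  have yE : x + (y - x) = y by rewrite addrC subrK.
  rewrite xE; have := ptri x (y - x); rewrite yE => /le_trans; apply.
  by rewrite lerD2l; apply: le_trans (ple _) _; rewrite mul1r distrC.
have h4 := ler_wpM2l M_ge0 h3.
have h5 : (M + `|M0| + 1) * `|x - y| <= e by rewrite mulrC -ler_pdivlMr// ltW.
have := normr_ge0 (x - y); set a := `|x - y| in h2 h3 h4 h5 *; set b := p (y + _) in h3 h4 *; nra.
Qed.

Lemma dense_unique k l M0 M1 : sigma_finite setT mu -> ae_bounded mu k M0 -> ae_bounded mu l M1 ->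
  (forall x, dom x -> act k x = act l x) -> k = l %[ae mu].
Proof.
move=> sf kM lM H; have bkl := ae_boundedB kM lM.
have sn : seminorm_le (fun x : L1 mu => `|x|) 1.
  by split=> [x y|x]; rewrite ?mul1r// ler_normD.
have H0 (x : L1 mu) : `|act (fun t => k t - l t) x| <= 0 * `|x|.
  apply: (dense_bound bkl sn (lexx 0)) => {}x dx.
  by rewrite (act_subl x kM lM) H// subrr normr0 mul0r.
have : {ae mu, forall t, `|k t - l t| <= 0 * cst 1 t}.
  apply: (bounded_by_testing (rho := cst 1) sf bkl) => //.
    by move=> t; rewrite /= ler01 lexx.
  by move=> f If; have := H0 (L1_of mu f); rewrite (act_of If bkl) !mul0r.
by apply: filterS => t /= + _; rewrite mul0r normr_le0 subr_eq0 => /eqP.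
Qed.

End dense_testing.

(** * The weighted spaces as L1 and its dual *)

Section weighted_spaces.
Variables (R : realType) (m : nat).
Hypothesis m_gt0 : (0 < m)%N.
Local Notation E := (Rspace R m).
Local Notation LP := (lebesgue_poisson R m).
Local Notation X := (L1 LP).

(** [up] identifies $\mathcal L_C$ with $L^1(\lambda)$ and [down] identifies $\mathcal K_C$ with
    $L^\infty(\lambda)$, both isometrically; the two factors cancel in the pairing. *)
Definition up (C : R) (G : fconfig R m -> R) (eta : fconfig R m) : R := C ^+ #|` eta| * G eta.
Definition down (C : R) (f : fconfig R m -> R) (eta : fconfig R m) : R := C ^- #|` eta| * f eta.

Section weight.
Variable C : R.
Hypothesis C_gt0 : 0 < C.

Let C0 k : C ^+ k != 0. Proof. by rewrite gt_eqF// exprn_gt0. Qed.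

Lemma downK f : up C (down C f) = f.
Proof. by apply/funext => eta; rewrite /up /down mulVKf. Qed.
Lemma upK f : down C (up C f) = f.
Proof. by apply/funext => eta; rewrite /up /down mulKf. Qed.

Lemma up_measurable (G : fconfig R m -> R) : measurable_fun setT G -> measurable_fun setT (up C G).
Proof. by move=> mG; apply: measurable_funM => //; exact: measurable_wt. Qed.
Lemma down_measurable (f : fconfig R m -> R) : measurable_fun setT f -> measurable_fun setT (down C f).
Proof.
by move=> mf; apply: measurable_funM => //; exact: (measurable_fun_card (fun k => C ^- k)).
Qed.

Lemma Lfun1P (f : fconfig R m -> R) : f \in Lfun LP 1 <-> integ LP f.
Proof. by split=> [|h]; rewrite Lfun1_integrable. Qed.

Lemma LCP G : LC C G <-> integ LP (up C G).
Proof. exact: Lfun1P. Qed.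

Lemma normLCE G : LC C G -> normLC C G = (norm1 LP (up C G))%:E.
Proof. by move=> /LCP IG; rewrite /normLC Lnorm1 norm1E. Qed.

(** The definition of the supremum norm distinguishes spaces of mass 0; the atom at the empty
    configuration rules that case out. *)
Lemma LP_gt0 : (0 < LP setT)%E.
Proof.
have := LP_fset0_part m_gt0 (@measurable_cst _ _ _ _ setT (1%:E : \bar R)) (fun _ => lee01).
rewrite integral_cst// mul1e => ->; apply: (@lt_le_trans _ _ 1%E); first exact: lte01.
by rewrite leeDl//; apply: integral_ge0 => eta _; case: ifP => _; rewrite ?lee01.
Qed.

Lemma normKC_leP k (M : R) : (normKC C k <= M%:E)%E <-> {ae LP, forall eta, `|down C k eta| <= M}.
Proof.
rewrite /normKC unlock /Lnorm LP_gt0; split=> [/ess_supP|h]; last apply/ess_supP.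
  by apply: filterS => eta; rewrite lee_fin.
by apply: filterS h => eta; rewrite /= lee_fin.
Qed.

Lemma KCP k : KC C k <-> exists M, ae_bounded LP (down C k) M.
Proof.
rewrite /KC /= /Lfun; split.
  move=> /andP[/set_mem /= mk /set_mem /= kfin].
  have : normKC C k \is a fin_num by rewrite ge0_fin_numE//; exact: Lnorm_ge0.
  move=> /fineK kE; exists (fine (normKC C k)); split=> //.
  by apply/normKC_leP; rewrite kE.
move=> [M [mk kM]]; apply/andP; split; rewrite inE//=.
by apply: (@le_lt_trans _ _ M%:E); [exact/normKC_leP|exact: ltry].
Qed.

Lemma KC_measurable (k : fconfig R m -> R) : KC C k -> measurable_fun setT k.
Proof. by move=> /KCP[M [mk _]]; have := up_measurable mk; rewrite downK. Qed.

Lemma pairingE G k : KC C k -> LC C G -> pairing G k = act (down C k) (L1_of LP (up C G)).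
Proof.
move=> /KCP[M kM] /LCP IG; rewrite (act_of IG kM); apply: eq_Rintegral => eta _.
by rewrite /up /down mulrACA mulfV// mul1r.
Qed.

Lemma actE k (x : X) : KC C k -> act (down C k) x = pairing (down C x) k.
Proof.
move=> Kk; rewrite pairingE//; first by rewrite downK L1_of_fun.
by apply/LCP; rewrite downK; exact: L1_integ.
Qed.

Lemma downB k l eta : down C k eta - down C l eta = down C (k \- l) eta.
Proof. by rewrite /down -mulrBr. Qed.

End weight.

Variables (d b : rate R m) (C a1 a2 : R).
Hypothesis db : standing_rates d b.
Hypotheses (C_gt0 : 0 < C) (a1_ge1 : 1 <= a1) (a2_ge0 : 0 <= a2).
Hypothesis d_bound : forall xi : fconfig R m, (Kinv_sum d C xi <= (a1 * Dtot d xi)%:E)%E.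
Hypothesis b_bound : forall xi : fconfig R m, (Kinv_sum b C xi <= (a2 * Dtot d xi)%:E)%E.

Let md := death_measurable db.
Let mb := birth_measurable db.
Let d0 x g : (0 <= d x g)%E := (rates_ge0 db x g).1.

(** Transfers the hypotheses stated at [C] to the smaller weight $\alpha C$ with the same [a1] and
    [a2]. *)
Lemma Kinv_sum_mono (r : rate R m) (c : R) (xi : fconfig R m) :
  measurable_fun setT (fun p : E * config R m => r p.1 p.2) -> 0 < c -> c <= C ->
  (Kinv_sum r c xi <= Kinv_sum r C xi)%E.
Proof.
move=> mr c0 cC; apply: lee_sum => x _.
have mK (a : R) : measurable_fun setT (fun eta : fconfig R m =>
    (`|Kinv (fun zeta => frate r x (zeta `|` (xi `\ x))%fset) eta| * a ^+ #|` eta|)%:E).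
  apply/measurable_EFinP; apply: measurable_funM; last exact: measurable_wt.
  apply: (measurableT_comp (@normr_measurable R setT)); apply: measurable_fun_fconfig.
  have := @measurable_Kshift R m r mr _ (fseq E) (cst x) (cst ((xi `\ x)%fset : seq E)) id
    (@measurable_cst _ _ _ _ _ _) (@measurable_cst _ _ _ _ _ _) (@measurable_id _ _ _).
  by apply: eq_measurable_fun => s _ /=; rewrite fc_fset.
apply: ge0_le_integral => //.
- by move=> eta _; rewrite lee_fin mulr_ge0// exprn_ge0// ltW.
- move=> eta _; rewrite lee_fin ler_wpM2l// lerXn2r// nnegrE ltW//.
Qed.

Definition Lup (f : fconfig R m -> R) : fconfig R m -> R := up C (Lhat d b (down C f)).

Lemma Lup_measurable (f : fconfig R m -> R) : measurable_fun setT f -> measurable_fun setT (Lup f).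
Proof.
by move=> mf; apply: up_measurable; exact: (measurable_Lhat md mb (down_measurable C mf)).
Qed.

Let cn_neq0 k : C ^+ k != 0. Proof. by rewrite gt_eqF// exprn_gt0. Qed.

Let Dfin (f : fconfig R m -> R) : integ LP (fun eta => Dtot d eta * f eta) ->
  (\int[LP]_xi (C ^+ #|` xi| * `|Dtot d xi * down C f xi|)%:E < +oo)%E.
Proof.
move=> /integP[_]; rewrite (_ : (\int[LP]_x _)%E = (\int[LP]_xi
  (C ^+ #|` xi| * `|Dtot d xi * down C f xi|)%:E)%E)//.
apply: eq_integral => eta _; congr EFin; rewrite -[C ^+ _]ger0_norm ?exprn_ge0 ?ltW//.
by rewrite -normrM /down mulrCA mulVKf.
Qed.

Lemma Lup_linear a (f g : fconfig R m -> R) : integ LP f -> integ LP (fun t => Dtot d t * f t) ->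
  integ LP g -> integ LP (fun t => Dtot d t * g t) ->
  Lup (fun t => a * f t + g t) = (fun t => a * Lup f t + Lup g t) %[ae LP].
Proof.
move=> If IDf Ig IDg.
have mf := down_measurable C (integ_mfun If); have mg := down_measurable C (integ_mfun Ig).
have := Lhat_linear m_gt0 md mb d0 C_gt0 a2_ge0 b_bound a mf mg (Dfin IDf) (Dfin IDg).
apply: filterS => eta /(_ I) LE _; rewrite /Lup /up.
have -> : down C (fun t => a * f t + g t) = (fun eta => a * down C f eta + down C g eta).
  by apply/funext => zeta; rewrite /down mulrDr mulrCA.
by rewrite LE mulrDr mulrCA.
Qed.

(** Since $\beta^{|\eta|}C^{|\eta|}=(\beta C)^{|\eta|}$, this is [offdiag_bound] at $c=\beta C$. It
    is used with $\beta=1$ for the norm of $\mathcal L_C$ and with $\beta=\alpha$ for the second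
    weight. *)
Lemma Lup_rel_bounded (beta q : R) : 0 < beta -> beta <= 1 -> a1 - 1 + a2 / (beta * C) <= q ->
  rel_bounded LP (Dtot d) Lup q (fun eta => beta ^+ #|` eta|).
Proof.
move=> beta0 beta1 aq f If IDf.
have bC0 : 0 < beta * C by exact: mulr_gt0.
have bCC : beta * C <= C by rewrite ler_piMl// ltW.
have mf := integ_mfun If; have mG := down_measurable C mf.
have db' xi : (Kinv_sum d (beta * C) xi <= (a1 * Dtot d xi)%:E)%E.
  exact: le_trans (Kinv_sum_mono xi md bC0 bCC) (d_bound xi).
have bb' xi : (Kinv_sum b (beta * C) xi <= (a2 * Dtot d xi)%:E)%E.
  exact: le_trans (Kinv_sum_mono xi mb bC0 bCC) (b_bound xi).
have := offdiag_bound m_gt0 md mb d0 bC0 a1_ge1 a2_ge0 db' bb' mG.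
have w (A : fconfig R m -> R) eta : (beta * C) ^+ #|` eta| * `|A eta| = `|beta ^+ #|` eta| * up C A eta|.
  by rewrite /up mulrA -exprMn normrM (@ger0_norm _ (_ ^+ _)) ?exprn_ge0 ?ltW.
have mb' : measurable_fun setT (fun eta : fconfig R m => beta ^+ #|` eta|) by exact: measurable_wt.
have IrD : integ LP (fun t => beta ^+ #|` t| * (Dtot d t * f t)).
  apply: (@integ_le _ _ _ _ _ (fun t => `|Dtot d t * f t|)) (integ_norm IDf).
    by apply: measurable_funM => //; exact: integ_mfun IDf.
  move=> t; have b0 : 0 <= beta ^+ #|` t| by rewrite exprn_ge0// ltW.
  by rewrite normrM (ger0_norm b0) ler_piMl// exprn_ile1// ltW.
have -> : (\int[LP]_xi ((beta * C) ^+ #|` xi| * `|Dtot d xi * down C f xi|)%:E)%E =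
    (norm1 LP (fun t => beta ^+ #|` t| * (Dtot d t * f t)))%:E.
  rewrite norm1E//; apply: eq_integral => eta _; congr EFin.
  rewrite (w (fun eta => Dtot d eta * down C f eta)) /up /down.
  by rewrite (mulrCA (C ^+ _)) mulVKf.
have E eta : Lup f eta + Dtot d eta * f eta = up C (fun eta => Lhat d b (down C f) eta + Dtot d eta * down C f eta) eta.
  by rewrite /up mulrDr /down mulrCA mulVKf.
have -> : (\int[LP]_eta ((beta * C) ^+ #|` eta| * `|Lhat d b (down C f) eta + Dtot d eta * down C f eta|)%:E)%E =
    (\int[LP]_eta `|beta ^+ #|` eta| * (Lup f eta + Dtot d eta * f eta)|%:E)%E.
  by apply: eq_integral => eta _; congr EFin; rewrite E (w (fun eta => _ + _)).
rewrite -EFinM => h.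
have I1 : integ LP (fun t => beta ^+ #|` t| * (Lup f t + Dtot d t * f t)).
  apply/integP; split; last exact: le_lt_trans h (ltry _).
  apply: measurable_funM => //; apply: measurable_funD; first exact: Lup_measurable.
  exact: integ_mfun IDf.
split=> //; rewrite -lee_fin norm1E//; apply: le_trans h _.
by rewrite lee_fin ler_wpM2r// norm1_ge0.
Qed.

End weighted_spaces.

(** * Semigroups on the weighted space *)

Lemma ge0_cvg0P (R : realType) (T : Type) (F : set_system T) (FF : Filter F) (f : T -> \bar R) :
  (forall t, 0 <= f t)%E ->
  (f @ F --> 0%E) <-> (forall e : R, 0 < e -> \forall t \near F, (f t <= e%:E)%E).
Proof.
move=> f0; split.
  move=> /fine_cvgP[ffin fc] e e0.
  move/cvgrPdist_le : fc => /(_ e e0) h; apply: filterS2 ffin h => t tf.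
  by rewrite sub0r normrN ger0_norm ?fine_ge0// -lee_fin fineK.
move=> H; apply/fine_cvgP; split.
  apply: filterS (H 1 ltr01) => t t1; rewrite ge0_fin_numE//; exact: le_lt_trans t1 (ltry _).
apply/cvgrPdist_le => e e0; apply: filterS (H e e0) => t te.
rewrite sub0r normrN ger0_norm ?fine_ge0// -lee_fin fineK//.
by rewrite ge0_fin_numE//; exact: le_lt_trans te (ltry _).
Qed.

Lemma near_right0P (R : realType) (P : R -> Prop) :
  (\forall t \near 0^'+, P t) <-> exists2 dl : R, 0 < dl & forall t : R, 0 < t -> t < dl -> P t.
Proof.
split=> [[dl /= dl0 h]|[dl dl0 h]].
  exists dl => // t t0 td; apply: h => //=; by rewrite sub0r normrN gtr0_norm.
exists dl => //= t; rewrite /= sub0r normrN => td t0; apply: h => //.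
by rewrite gtr0_norm in td.
Qed.

Section transport.
Variables (R : realType) (m : nat).
Hypothesis m_gt0 : (0 < m)%N.
Local Notation LP := (lebesgue_poisson R m).
Local Notation X := (L1 LP).
Variables (d b : rate R m) (C : R).
Hypothesis C_gt0 : 0 < C.

Definition iota (G : fconfig R m -> R) : X := L1_of LP (up C G).

Lemma up_lin a (G H : fconfig R m -> R) :
  up C (fun eta => a * G eta + H eta) = (fun eta => a * up C G eta + up C H eta).
Proof. by apply/funext => eta; rewrite /up mulrDr mulrCA. Qed.

Lemma iota_lin a G H : LC C G -> LC C H ->
  LC C (fun eta => a * G eta + H eta) /\ iota (fun eta => a * G eta + H eta) = a *: iota G + iota H.
Proof.
move=> /LCP IG /LCP IH; split.
  by apply/LCP; rewrite up_lin; exact: integD (integZ a IG) IH.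
by rewrite /iota up_lin (L1_ofD (integZ a IG) IH) L1_ofZ.
Qed.

Lemma iota_norm G : LC C G -> normLC C G = `|iota G|%:E.
Proof. by move=> LG; rewrite normLCE// L1_of_norm//; exact/LCP. Qed.

Lemma iota_ae G H : LC C G -> LC C H -> (iota G = iota H <-> G = H %[ae LP]).
Proof.
move=> /LCP IG /LCP IH; split=> GH.
  apply: filterS (L1_of_inj IG IH GH) => eta + _ => /(_ I).
  by move=> /mulfI; apply; rewrite gt_eqF// exprn_gt0.
by apply: L1_of_ae => //; apply: filterS GH => eta + _ => /(_ I); rewrite /up => ->.
Qed.

Lemma iota_down (x : X) : LC C (down C x) /\ iota (down C x) = x.
Proof.
by split; [apply/LCP; rewrite downK//; exact: L1_integ|rewrite /iota downK// L1_of_fun].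
Qed.

Variables (dom : set X) (A : X -> X).
Hypothesis Lop : operator_on dom A.
Hypothesis L_iota : forall G, LC C G -> (Ddom d C G <-> dom (iota G)).
Hypothesis L_gen : forall G, Ddom d C G -> LC C (Lhat d b G) /\ iota (Lhat d b G) = A (iota G).

Section compatible.
Variables (T : R -> (fconfig R m -> R) -> fconfig R m -> R) (TX : R -> X -> X).
Hypothesis TTX : forall (t : R) G, 0 <= t -> LC C G ->
  LC C (T t G) /\ iota (T t G) = TX t (iota G).

Let TX_down (t : R) (x : X) : 0 <= t -> TX t x = iota (T t (down C x)).
Proof. by move=> t0; have [Lx xE] := iota_down x; rewrite (TTX t0 Lx).2 xE. Qed.

Lemma right_derivative_iota G H : LC C G -> LC C H ->
  right_derivative0 C T G H <-> forall e : R, 0 < e -> exists2 dl : R, 0 < dl &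
    forall h : R, 0 < h -> h < dl -> `|TX h (iota G) - iota G - h *: iota H| <= e * h.
Proof.
move=> LG LH.
have E (t : R) : 0 < t -> normLC C (fun eta => t^-1 * (T t G eta - G eta) - H eta) =
    (t^-1 * `|TX t (iota G) - iota G - t *: iota H|)%:E.
  move=> t0; have [LT TE] := TTX (ltW t0) LG.
  have [L1' E1] := iota_lin (-1) LG LT.
  have [L2 E2] := iota_lin (- t) LH L1'; have [L3 E3] := iota_lin t^-1 L2 L2.
  have L0 : LC C (fun _ : fconfig R m => 0).
    by apply/LCP; have := integ0 LP; congr integ; apply/funext => eta; rewrite /up mulr0.
  have [L4 E4] := iota_lin t^-1 L2 L0.
  rewrite (_ : (fun eta => _ - _) = (fun eta => t^-1 * (- t * H eta + (-1 * G eta + T t G eta)) + 0)); last first.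
    apply/funext => eta; field; exact: lt0r_neq0.
  rewrite iota_norm// E4 (_ : iota (fun _ : fconfig R m => 0) = 0); last first.
    by have := (iota_lin (-1) L0 L0).2; rewrite scaleN1r addNr => <-; congr iota;
      apply/funext => eta; rewrite mulr0 addr0.
  rewrite addr0 normrZ E2 E1 TE gtr0_norm ?invr_gt0//; congr (_ * `|_|)%:E; lmod R.
rewrite /right_derivative0 ge0_cvg0P; last by move=> t; exact: Lnorm_ge0.
split=> [H0 e e0|H0 e e0].
  have /near_right0P[dl dl0 hd] := H0 e e0; exists dl => // h h0 hdl.
  by have := hd h h0 hdl; rewrite E// lee_fin ler_pdivrMl// mulrC.
apply/near_right0P; have [dl dl0 hd] := H0 e e0; exists dl => // h h0 hdl.
by rewrite E// lee_fin ler_pdivrMl// mulrC; exact: hd.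
Qed.

Lemma semigroup_of_generates : generates C (Lhat d b) (Ddom d C) T -> semigroup_of dom A TX.
Proof.
move=> [ST domE gE]; split.
- move=> t a x y t0; have [Lx xE] := iota_down x; have [Ly yE] := iota_down y.
  have [Lxy xyE] := iota_lin a Lx Ly; rewrite -{1}xE -{1}yE -xyE -(TTX t0 Lxy).2.
  have [LTx _] := TTX t0 Lx; have [LTy _] := TTX t0 Ly; have [LTxy TxyE] := iota_lin a LTx LTy.
  rewrite !(TX_down _ t0) -TxyE; apply/iota_ae => //; first exact: (TTX t0 Lxy).1.
  exact: semigroup_linear ST t a _ _ t0 Lx Ly.
- move=> t t0; have [M hM] := semigroup_bounded ST t0; exists M => x.
  have [Lx xE] := iota_down x; have := hM _ Lx; have [LT TE] := TTX t0 Lx.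
  by rewrite !iota_norm// TE xE -EFinM lee_fin.
- move=> x; have [Lx xE] := iota_down x; rewrite TX_down// -[RHS]xE.
  by apply/iota_ae => //; [exact: (TTX (lexx 0) Lx).1|exact: semigroup0 ST _ Lx].
- move=> s t x s0 t0; have st0 : 0 <= s + t by exact: addr_ge0.
  have [Lx xE] := iota_down x; have [LTx TxE] := TTX t0 Lx.
  rewrite (TX_down x st0) -{2}xE -TxE -(TTX s0 LTx).2.
  by apply/iota_ae => //; [exact: (TTX st0 Lx).1|exact: (TTX s0 LTx).1|exact: semigroupD ST _ _ _ s0 t0 Lx].
- move=> x e e0; have [Lx xE] := iota_down x.
  have := semigroup_cont ST Lx; rewrite ge0_cvg0P; last by move=> t; exact: Lnorm_ge0.
  move=> /(_ e e0)/near_right0P[dl dl0 hd]; exists dl => // h h0 hdl; have := hd h h0 hdl.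
  have [LT TE] := TTX (ltW h0) Lx; have [L1' E1] := iota_lin (-1) Lx LT.
  rewrite (_ : T h _ \- _ = (fun eta => -1 * down C x eta + T h (down C x) eta)); last first.
    by apply/funext => eta /=; rewrite mulN1r addrC.
  by rewrite iota_norm// E1 TE xE scaleN1r addrC lee_fin.
- move=> x; have [Lx xE] := iota_down x; split.
    rewrite -{1}xE => /(L_iota Lx)/domE[_ [H LH /(right_derivative_iota Lx LH)]].
    by rewrite xE => h; exists (iota H).
  move=> [y hy]; have [Ly yE] := iota_down y.
  rewrite -xE; apply/(L_iota Lx)/domE; split=> //; exists (down C y) => //.
  by apply/right_derivative_iota => //; rewrite xE yE.
- move=> x dx; have [Lx xE] := iota_down x.
  have Dx : Ddom d C (down C x) by apply/L_iota => //; rewrite xE.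
  have [LL /(right_derivative_iota Lx LL)] := gE _ Dx.
  by rewrite (L_gen Dx).2 xE.
Qed.

Lemma generates_of_semigroup : semigroup_of dom A TX -> generates C (Lhat d b) (Ddom d C) T.
Proof.
move=> ST; split.
- split.
  + by move=> t G t0 LG; exact: (TTX t0 LG).1.
  + move=> t a G H t0 LG LH; have [LGH GHE] := iota_lin a LG LH.
    have [LTG TGE] := TTX t0 LG; have [LTH THE] := TTX t0 LH.
    have [LTGH TGHE] := iota_lin a LTG LTH.
    apply/iota_ae => //; first exact: (TTX t0 LGH).1.
    by rewrite (TTX t0 LGH).2 GHE TGHE TGE THE; exact: semi_lin ST _ _ _ _ t0.
  + move=> t t0; have [M hM] := semi_bnd ST t0; exists M => G LG; have [LT TE] := TTX t0 LG.
    by rewrite !iota_norm// -EFinM lee_fin TE.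
  + move=> G LG; have [LT TE] := TTX (lexx 0) LG; apply/iota_ae => //.
    by rewrite TE; exact: semi_id ST _.
  + move=> s t G s0 t0 LG; have st0 : 0 <= s + t by exact: addr_ge0.
    have [LT TE] := TTX t0 LG; have [LT' TE'] := TTX s0 LT; have [LST STE] := TTX st0 LG.
    by apply/iota_ae => //; rewrite STE TE' TE; exact: semi_add ST _ _ _ s0 t0.
  + move=> G LG; rewrite ge0_cvg0P; last by move=> t; exact: Lnorm_ge0.
    move=> e e0; apply/near_right0P; have [dl dl0 hd] := semi_cont ST (iota G) e0.
    exists dl => // h h0 hdl; have [LT TE] := TTX (ltW h0) LG; have [L1' E1] := iota_lin (-1) LG LT.
    rewrite (_ : T h _ \- _ = (fun eta => -1 * G eta + T h G eta)); last first.
      by apply/funext => eta /=; rewrite mulN1r addrC.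
    by rewrite iota_norm// E1 TE scaleN1r addrC lee_fin; exact: hd.
- move=> G; split.
    move=> DG; have LG : LC C G by case: DG.
    split=> //; have [LL LE] := L_gen DG; exists (Lhat d b G) => //.
    apply/right_derivative_iota => //; rewrite LE; apply: (semi_gen ST).
    by apply/L_iota.
  move=> [LG [H LH /(right_derivative_iota LG LH) h]].
  by apply/L_iota => //; apply/(semi_domE ST); exists (iota H).
- move=> G DG; have LG : LC C G by case: DG.
  have [LL LE] := L_gen DG; split=> //.
  apply/right_derivative_iota => //; rewrite LE; apply: (semi_gen ST).
  by apply/L_iota.
Qed.

End compatible.

End transport.

(** * Orbits of the dual semigroup *)

Section dual_orbit.
Context dd (T : measurableType dd) (R : realType).
Variable mu : {measure set T -> \bar R}.
Hypothesis sf : sigma_finite setT mu.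
Local Notation X := (L1 mu).

Hypothesis dual_repr : forall (L : X -> R) (M : R),
  (forall a x y, L (a *: x + y) = a * L x + L y) -> (forall x, `|L x| <= M * `|x|) ->
  exists k : T -> R, ae_bounded mu k `|M| /\ forall x, act k x = L x.

Variables (dom : set X) (A : X -> X).
Hypothesis Aop : operator_on dom A.
Hypothesis dense : dense_in dom.

Lemma dual_repr_dom (L : X -> R) (M : R) : 0 <= M ->
  (forall a x y, dom x -> dom y -> L (a *: x + y) = a * L x + L y) ->
  (forall x, dom x -> `|L x| <= M * `|x|) ->
  exists k : T -> R, ae_bounded mu k M /\ forall x, dom x -> act k x = L x.
Proof.
move=> M0 Llin LM; have [d0 dlin _] := Aop.
have [L' [lin' bnd' ext']] := extend_from_dense M0 dense d0 dlin Llin LM.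
have [k [kM kE]] := dual_repr lin' bnd'; exists k; rewrite ger0_norm// in kM; split=> // x dx.
by rewrite kE ext'.
Qed.

Variable rho : T -> R.
Hypotheses (mrho : measurable_fun setT rho) (rho01 : forall t, 0 <= rho t <= 1).

Definition rho_bounded (k : T -> R) (M : R) : Prop :=
  measurable_fun setT k /\ {ae mu, forall t, `|k t| <= M * rho t}.

Lemma rho_ae_bounded k M : 0 <= M -> rho_bounded k M -> ae_bounded mu k M.
Proof.
move=> M0 [mk kM]; split=> //; apply: filterS kM => t; move/le_trans; apply.
by have /andP[_ r1] := rho01 t; rewrite ler_piMr.
Qed.

Lemma rho_act_bound k M (x : X) : 0 <= M -> rho_bounded k M -> `|act k x| <= M * wnorm rho x.
Proof.
move=> M0 kM; have kM' := rho_ae_bounded M0 kM.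
have [Ik _] := integ_mul_bounded (L1_integ x) kM'.
apply: le_trans (le_norm_int Ik) _.
have Ir : integ mu (fun t => rho t * x t).
  apply: (@integ_le _ _ _ _ _ (fun t => `|x t|)) (integ_norm (L1_integ x)).
    by apply: measurable_funM => //; exact: integ_mfun (L1_integ x).
  by move=> t; have /andP[a b] := rho01 t; rewrite normrM (ger0_norm a) ler_piMl.
rewrite /wnorm -[M in leRHS](ger0_norm M0) -norm1Z//.
apply: (proj2 (norm1_le _ (integZ M Ir) _)); first exact: integ_mfun Ik.
apply: filterS kM.2 => t kt; rewrite mulrA !normrM (mulrC `|x t|) ler_wpM2r//.
by have /andP[a _] := rho01 t; rewrite (ger0_norm M0) (ger0_norm a).
Qed.

Lemma bounded_of_dom k M0 M : 0 <= M -> ae_bounded mu k M0 ->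
  (forall x, dom x -> `|act k x| <= M * `|x|) -> ae_bounded mu k M.
Proof.
move=> M_ge0 kM H; split; first exact: kM.1.
have sn : seminorm_le (fun x : X => `|x|) 1 by split=> [x y|x]; rewrite ?mul1r// ler_normD.
have H0 := dense_bound dense kM sn M_ge0 H.
have : {ae mu, forall t, `|k t| <= M * cst 1 t}.
  apply: (bounded_by_testing (rho := cst 1) sf kM) => //.
    by move=> t; rewrite /= ler01 lexx.
  move=> f If; have := H0 (L1_of mu f); rewrite (act_of If kM) L1_of_norm//.
  by congr (_ <= _ * norm1 mu _); apply/funext => t; rewrite mul1r.
by apply: filterS => t; rewrite mulr1.
Qed.

Lemma rho_bounded_of_dom k M0 M : 0 <= M -> ae_bounded mu k M0 ->
  (forall x, dom x -> `|act k x| <= M * wnorm rho x) -> rho_bounded k M.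
Proof.
move=> M_ge0 kM H; split; first exact: kM.1.
have r0 t : 0 <= rho t by case/andP: (rho01 t).
have r1 t : rho t <= 1 by case/andP: (rho01 t).
have H0 := dense_bound dense kM (wnorm_seminorm mu mrho r0 r1) M_ge0 H.
apply: (bounded_by_testing sf kM) => // f If; have := H0 (L1_of mu f).
by rewrite (act_of If kM) wnorm_of.
Qed.

Variables (S : R -> X -> X) (kap Lam : R).
Hypothesis SS : semigroup_of dom A S.
Hypothesis dissip : forall (h : R) y, 0 < h -> dom y -> `|y| <= `|y - h *: A y|.
Hypothesis kap0 : 0 < kap.
Hypothesis analytic : forall (h : R) y, 0 < h -> dom y ->
  `|y| + h * (kap * `|A y|) <= `|y - h *: A y|.
Hypothesis wdissip : forall (h : R) y, 0 < h -> dom y -> wnorm rho y <= wnorm rho (y - h *: A y).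
Hypothesis Lam0 : 0 <= Lam.
Hypothesis A_Lam : forall x, dom x -> wnorm rho (A x) <= Lam * `|x|.

(** This puts $\mathcal K_{\alpha C}$ inside the domain of the adjoint: $|\langle\!\langle
    Ax,k\rangle\!\rangle|\le M\|Ax\|_\rho\le M\Lambda\|x\|$, so $x\mapsto\langle\!\langle
    Ax,k\rangle\!\rangle$ extends to a bounded functional and has a density. *)
Lemma rho_adjoint_dom k M : 0 <= M -> rho_bounded k M ->
  exists k', ae_bounded mu k' (M * Lam) /\ forall x, dom x -> act k' x = act k (A x).
Proof.
move=> M0 kM; have kM' := rho_ae_bounded M0 kM; have [_ _ lin] := Aop.
apply: dual_repr_dom; first exact: mulr_ge0.
  by move=> a x y dx dy; rewrite lin// (act_lin _ _ _ kM').
move=> x dx; apply: le_trans (rho_act_bound _ M0 kM) _; rewrite -mulrA.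
by rewrite ler_wpM2l// A_Lam.
Qed.

(** [k t] is the adjoint of $S(t)$ applied to [k0], and [v t] that of $AS(t)$. The latter is bounded
    for $t>0$ by [semi_analytic], so this candidate derivative exists for every bounded start. *)
Lemma orbit_exists k0 M0 : 0 <= M0 -> ae_bounded mu k0 M0 ->
  exists k v : R -> T -> R,
  [/\ forall t, 0 <= t -> ae_bounded mu (k t) M0,
      forall t x, 0 <= t -> act (k t) x = act k0 (S t x),
      forall t, 0 < t -> ae_bounded mu (v t) (M0 / (t * kap)) &
      forall t x, 0 < t -> dom x -> act (v t) x = act k0 (A (S t x))].
Proof.
move=> M00 k0M.
have H1 (t : R) : exists k : T -> R, 0 <= t ->
    ae_bounded mu k M0 /\ forall x, act k x = act k0 (S t x).
  have [t0|t0] := leP 0 t; last by exists point.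
  have [|x|k [kM kE]] := @dual_repr (fun x => act k0 (S t x)) M0.
  - by move=> a x y; rewrite (semi_lin SS)// (act_lin _ _ _ k0M).
  - apply: le_trans (act_bound _ k0M) _; rewrite ger0_norm// ler_wpM2l//.
    exact: (semi_contraction SS dissip dense).
  - by exists k => _; rewrite ger0_norm// in kM.
have H2 (t : R) : exists v : T -> R, 0 < t ->
    ae_bounded mu v (M0 / (t * kap)) /\ forall x, dom x -> act v x = act k0 (A (S t x)).
  have [t0|t0] := ltP 0 t; last by exists point.
  have [|a x y dx dy|x dx|v vP] := @dual_repr_dom (fun x => act k0 (A (S t x))) (M0 / (t * kap)).
  - by rewrite divr_ge0// mulr_ge0// ltW.
  - rewrite (semi_lin SS) ?ltW//; have [_ _ lin] := Aop.
    by rewrite lin ?(act_lin _ _ _ k0M)//; apply: (semi_dom SS) => //; exact: ltW.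
  - apply: le_trans (act_bound _ k0M) _; rewrite ger0_norm// -mulrA ler_wpM2l//.
    rewrite ler_pdivlMl ?mulr_gt0//.
    exact: (semi_analytic SS dissip dense kap0 analytic).
  - by exists v.
have [k hk] := choice H1; have [v hv] := choice H2; exists k, v; split.
- by move=> t t0; exact: (hk t t0).1.
- by move=> t x t0; exact: (hk t t0).2.
- by move=> t t0; exact: (hv t t0).1.
- by move=> t x t0; exact: (hv t t0).2.
Qed.

Lemma ae_bounded_act (k : T -> R) M (x : X) : 0 <= M -> ae_bounded mu k M -> `|act k x| <= M * `|x|.
Proof. by move=> M0 kM; have := act_bound x kM; rewrite (ger0_norm M0). Qed.

Section orbit.
Variables (k0 : T -> R) (M0 : R) (k v : R -> T -> R).
Hypotheses (M0_ge0 : 0 <= M0) (k0M : ae_bounded mu k0 M0).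
Hypothesis kM : forall t, 0 <= t -> ae_bounded mu (k t) M0.
Hypothesis kE : forall t x, 0 <= t -> act (k t) x = act k0 (S t x).
Hypothesis vM : forall t, 0 < t -> ae_bounded mu (v t) (M0 / (t * kap)).
Hypothesis vE : forall t x, 0 < t -> dom x -> act (v t) x = act k0 (A (S t x)).

Let half_pos (t h : R) : 0 < t -> `|h| <= t / 2 -> 0 < t + h.
Proof. by move=> t0; rewrite ler_norml => /andP[]; lra. Qed.

(** Norm estimates of dual orbits come from pairing with domain vectors, where the estimates for $S$
    apply; [bounded_of_dom] converts the resulting bound into one almost everywhere. *)
Lemma orbit_lip (t h : R) : 0 < t -> `|h| <= t / 2 ->
  ae_bounded mu (fun s => k (t + h) s - k t s) (`|h| * (2 / (t * kap) * M0)).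
Proof.
move=> t0 ht; have th0 := ltW (half_pos t0 ht); have t0' := ltW t0.
have tk : 0 <= 2 / (t * kap) by rewrite divr_ge0// mulr_ge0// ltW.
apply: (bounded_of_dom _ (ae_boundedB (kM th0) (kM t0'))).
  by apply: mulr_ge0 => //; exact: mulr_ge0.
move=> x dx; rewrite (act_subl _ (kM th0) (kM t0')) !kE// -(actB _ _ k0M).
apply: le_trans (ae_bounded_act _ M0_ge0 k0M) _.
apply: le_trans (ler_wpM2l M0_ge0 (semi_lip2 SS dissip dense kap0 analytic t0 ht dx)) _.
by apply: le_of_eq; ring.
Qed.

Lemma orbit_v_lip (t h : R) : 0 < t -> `|h| <= t / 2 ->
  ae_bounded mu (fun s => v (t + h) s - v t s) (`|h| * (16 / (t * kap) ^+ 2 * M0)).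
Proof.
move=> t0 ht; have th0 := half_pos t0 ht.
have tk : 0 <= 16 / (t * kap) ^+ 2 by rewrite divr_ge0// sqr_ge0.
apply: (bounded_of_dom _ (ae_boundedB (vM th0) (vM t0))).
  by apply: mulr_ge0 => //; exact: mulr_ge0.
move=> x dx; rewrite (act_subl _ (vM th0) (vM t0)) !vE// -(actB _ _ k0M).
apply: le_trans (ae_bounded_act _ M0_ge0 k0M) _.
apply: le_trans (ler_wpM2l M0_ge0 (semi_A_lip2 Aop SS dissip dense kap0 analytic t0 ht dx)) _.
by rewrite mulrCA -!mulrA; apply: le_of_eq; congr (_ * _); rewrite mulrCA (mulrC M0).
Qed.

Lemma orbit_deriv (t h : R) : 0 < t -> `|h| <= t / 2 ->
  ae_bounded mu (fun s => k (t + h) s - k t s - h * v t s) (h ^+ 2 * (32 / (t * kap) ^+ 2 * M0)).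
Proof.
move=> t0 ht; have th0 := ltW (half_pos t0 ht); have t0' := ltW t0.
have tk : 0 <= 32 / (t * kap) ^+ 2 by rewrite divr_ge0// sqr_ge0.
have b1 := ae_boundedB (kM th0) (kM t0').
have b2 := ae_boundedD (- h) (vM t0) b1.
have E : (fun s => k (t + h) s - k t s - h * v t s) = (fun s => - h * v t s + (k (t + h) s - k t s)).
  by apply/funext => s; rewrite addrC mulNr.
rewrite E; apply: (bounded_of_dom _ b2).
  by apply: mulr_ge0; [exact: sqr_ge0|exact: mulr_ge0].
move=> x dx; rewrite (act_linl _ _ (vM t0) b1) (act_subl _ (kM th0) (kM t0')) !kE// vE//.
rewrite -(actB _ _ k0M) -(act_lin _ _ _ k0M) addrC scaleNr.
apply: le_trans (ae_bounded_act _ M0_ge0 k0M) _.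
apply: le_trans (ler_wpM2l M0_ge0 (semi_deriv2 Aop SS dissip dense kap0 analytic t0 ht dx)) _.
by rewrite mulrCA -!mulrA; apply: le_of_eq; congr (_ * _); rewrite mulrCA (mulrC M0).
Qed.

(** Functions bounded by a multiple of [rho] are dual to the norm [wnorm rho]. Dissipativity in that
    norm makes $S(t)$ contract it, so the dual orbit keeps the same constant. *)
Lemma orbit_rho M (t : R) : 0 <= M -> rho_bounded k0 M -> 0 <= t -> rho_bounded (k t) M.
Proof.
move=> M_ge0 k0r t0; apply: (rho_bounded_of_dom M_ge0 (kM t0)) => x dx.
rewrite kE//; apply: le_trans (rho_act_bound _ M_ge0 k0r) _; rewrite ler_wpM2l//.
have r0 s : 0 <= rho s by case/andP: (rho01 s).
have r1 s : rho s <= 1 by case/andP: (rho01 s).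
exact: (semi_seminorm_le SS (wnorm_seminorm mu mrho r0 r1) ler01 wdissip dx t0).
Qed.

End orbit.

Lemma orbit_contraction k0 k0' M0 M0' (k k' : R -> T -> R) e (t : R) : 0 <= M0 -> 0 <= M0' ->
  ae_bounded mu k0 M0 -> ae_bounded mu k0' M0' ->
  (forall t, 0 <= t -> ae_bounded mu (k t) M0) -> (forall t, 0 <= t -> ae_bounded mu (k' t) M0') ->
  (forall t x, 0 <= t -> act (k t) x = act k0 (S t x)) ->
  (forall t x, 0 <= t -> act (k' t) x = act k0' (S t x)) ->
  0 <= e -> ae_bounded mu (fun s => k0 s - k0' s) e -> 0 <= t ->
  ae_bounded mu (fun s => k t s - k' t s) e.
Proof.
move=> M00 M00' k0M k0M' kM kM' kE kE' e0 k0e t0.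
apply: (bounded_of_dom e0 (ae_boundedB (kM t t0) (kM' t t0))) => x dx.
rewrite (act_subl _ (kM t t0) (kM' t t0)) kE// kE'// -(act_subl _ k0M k0M').
apply: le_trans (ae_bounded_act _ e0 k0e) _; rewrite ler_wpM2l//.
exact: (semi_contraction SS dissip dense).
Qed.

(** For a [rho]-bounded start the derivative $\langle\!\langle AS(r)x,k_0\rangle\!\rangle$ is at
    most $M\Lambda\|x\|$ uniformly in $r$, without the singularity $1/r$ of the general case; hence
    the rate at 0 depends on $x$ only through its norm. *)
Lemma orbit_lip0 k0 M (t : R) x : 0 <= M -> rho_bounded k0 M -> 0 <= t -> dom x ->
  `|act k0 (S t x) - act k0 x| <= t * (M * Lam) * `|x|.
Proof.
move=> M0 k0r; have k0M := rho_ae_bounded M0 k0r.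
rewrite le_eqVlt => /predU1P[<-|t0] dx.
  by rewrite (semi_id SS) subrr normr0 !mul0r.
have contr (s : R) y : 0 <= s -> `|S s y| <= `|y| by exact: (semi_contraction SS dissip dense).
apply/ler_addgt0Pl => e e0.
(* The two-sided derivative is available only at positive times. The initial interval up to [s] is
   handled by [semi_lip], whose bound involves $|Ax|$ and is made smaller than [e]. *)
pose s : R := Num.min t (e / (M * `|A x| + 1)).
have p0 : 0 < M * `|A x| + 1 by rewrite ltr_wpDl// mulr_ge0.
have s0 : 0 < s by rewrite lt_min t0 divr_gt0.
have st : s <= t by rewrite ge_min lexx.
have h1 : `|act k0 (S t x) - act k0 (S s x)| <= M * Lam * `|x| * (t - s).
  apply: (@lipschitz_of_derive _ (fun r => act k0 (S r x)) (fun r => act k0 (A (S r x)))) => // r /andP[sr rt].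
    have r0 : 0 < r by exact: lt_le_trans sr.
    move=> e' e'0.
    pose c := M * (32 / (r * kap) ^+ 2 * `|x|) + 1.
    have c0 : 0 < c by rewrite /c ltr_wpDl// !mulr_ge0// invr_ge0 sqr_ge0.
    exists (Num.min (r / 2) (e' / c)); first by rewrite lt_min !divr_gt0.
    move=> h; rewrite lt_min => /andP[hr he].
    rewrite -(actB _ _ k0M) -(actZ _ _ k0M) -(actB _ _ k0M).
    apply: le_trans (ae_bounded_act _ M0 k0M) _.
    apply: le_trans (ler_wpM2l M0 (semi_deriv2 Aop SS dissip dense kap0 analytic r0 (ltW hr) dx)) _.
    have hc : `|h| * c <= e' by rewrite -ler_pdivlMr// ltW.
    have -> : M * (h ^+ 2 * (32 / (r * kap) ^+ 2) * `|x|) = `|h| * (`|h| * (c - 1)).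
      by rewrite -(real_normK (num_real h)) /c addrK; ring.
    rewrite mulrC ler_wpM2r//; apply: le_trans hc; rewrite ler_wpM2l//; lra.
  apply: le_trans (rho_act_bound _ M0 k0r) _; rewrite -mulrA ler_wpM2l//.
  have r0 : 0 <= r by apply: ltW; exact: lt_le_trans sr.
  apply: le_trans (A_Lam (semi_dom SS r0 dx)) _; rewrite ler_wpM2l//; exact: contr.
have h2 : `|act k0 (S s x) - act k0 x| <= e.
  rewrite -(actB _ _ k0M); apply: le_trans (ae_bounded_act _ M0 k0M) _.
  apply: le_trans (ler_wpM2l M0 (semi_lip SS dissip dense (ltW s0) dx)) _.
  have se : s <= e / (M * `|A x| + 1) by rewrite ge_min lexx orbT.
  rewrite ler_pdivlMr// in se; apply: le_trans se; rewrite mulrCA ler_wpM2l//; [exact: ltW|lra].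
have -> : act k0 (S t x) - act k0 x =
  (act k0 (S t x) - act k0 (S s x)) + (act k0 (S s x) - act k0 x) by ring.
apply: le_trans (ler_normD _ _) _; rewrite addrC lerD//; apply: le_trans h1 _.
have : 0 <= M * Lam * `|x| by rewrite !mulr_ge0.
by set a := M * Lam * `|x| => a0; rewrite -mulrA [leRHS]mulrC ler_wpM2l//; lra.
Qed.

(** * Uniqueness of weak orbits *)

Section uniqueness.
Variables (k0 : T -> R) (M0 : R) (u w : R -> T -> R).
Hypothesis k0M : ae_bounded mu k0 M0.
Hypothesis uM : forall s, 0 <= s -> exists2 M, 0 <= M & ae_bounded mu (u s) M.
Hypothesis u_cont : forall s e, 0 <= s -> 0 < e -> exists2 dl, 0 < dl &
  forall r, 0 <= r -> `|r - s| < dl -> ae_bounded mu (fun z => u r z - u s z) e.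
Hypothesis wM : forall s, 0 < s -> exists2 M, 0 <= M & ae_bounded mu (w s) M.
Hypothesis wE : forall s x, 0 < s -> dom x -> act (w s) x = act (u s) (A x).
Hypothesis u_deriv : forall s e, 0 < s -> 0 < e -> exists2 dl, 0 < dl &
  forall h, h != 0 -> `|h| < dl ->
    ae_bounded mu (fun z => u (s + h) z - u s z - h * w s z) (e * `|h|).
Hypothesis u0E : u 0 = k0 %[ae mu].

Let contr (s : R) y : 0 <= s -> `|S s y| <= `|y|.
Proof. exact: (semi_contraction SS dissip dense). Qed.

(** Product rule for $\langle\!\langle S(t-s)x,u_s\rangle\!\rangle$: the derivative of $u$
    contributes $w_s$ tested on $y=S(t-s)x$, that of the semigroup contributes $-u_s$ tested on
    $Ay$, and [wE] makes them cancel. *)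
Let diff0 (t s : R) x : 0 < s -> s < t -> dom x ->
  diff_at (fun s => act (u s) (S (t - s) x)) s 0.
Proof.
move=> s0 st dx e e0; set tau := t - s; have tau0 : 0 < tau by rewrite subr_gt0.
set y := S tau x; have dy : dom y by apply: (semi_dom SS) => //; exact: ltW.
have [Mu Mu0 uB] := uM (ltW s0); have [Mw Mw0 wB] := wM s0.
set c1 := 2 / (tau * kap) * `|x|; set c2 := 32 / (tau * kap) ^+ 2 * `|x|.
have c10 : 0 <= c1 by rewrite /c1 mulr_ge0// divr_ge0// mulr_ge0// ltW.
have c20 : 0 <= c2 by rewrite /c2 mulr_ge0// divr_ge0// sqr_ge0.
pose e1 := e / 2 / (`|x| + 1); have x1 : 0 < `|x| + 1 by rewrite ltr_wpDl.
have e10 : 0 < e1 by rewrite !divr_gt0.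
pose K := Mw * c1 + Mu * c2 + 1; have K0 : 0 < K by rewrite /K ltr_wpDl// addr_ge0// mulr_ge0.
have [d1 d10 hd1] := u_deriv s0 e10.
exists (Num.min (Num.min d1 (s / 2)) (Num.min (tau / 2) (e / 2 / K))).
  by rewrite !lt_min d10 !divr_gt0.
move=> h; rewrite !lt_min => /andP[/andP[hd hs] /andP[ht hK]].
have [->|h0] := eqVneq h 0.
  by rewrite addr0 subrr mul0r subr0 !normr0 mulr0.
have sh0 : 0 <= s + h by move: (ltW hs); rewrite ler_norml => /andP[]; lra.
have [Mh Mh0 hB] := uM sh0.
have bd := hd1 h h0 hd.
set z := S (t - (s + h)) x.
have zE : z = S (tau + - h) x by rewrite /z /tau; congr (S _ x); ring.
have th0 : 0 <= tau + - h by move: (ltW ht); rewrite ler_norml => /andP[]; lra.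
have zx : `|z| <= `|x| by rewrite zE; exact: contr.
have hn : `|- h| <= tau / 2 by rewrite normrN; exact: ltW.
have l1 : `|z - y| <= `|h| * c1.
  by have := semi_lip2 SS dissip dense kap0 analytic tau0 hn dx; rewrite -zE normrN -mulrA.
have l2 : `|z - y + h *: A y| <= h ^+ 2 * c2.
  have := semi_deriv2 Aop SS dissip dense kap0 analytic tau0 hn dx.
  by rewrite -zE sqrrN scaleNr opprK -mulrA.
have b1 := act_bound z bd.
have Eact : act (fun z => u (s + h) z - u s z - h * w s z) z =
    act (u (s + h)) z - act (u s) z - h * act (w s) z.
  have bw := ae_boundedD (- h) wB (ae_boundedB hB uB).
  have -> : (fun z => u (s + h) z - u s z - h * w s z) =
      (fun z => - h * w s z + (u (s + h) z - u s z)).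
    by apply/funext => r; rewrite addrC mulNr.
  rewrite (act_linl _ _ wB (ae_boundedB hB uB)) (act_subl _ hB uB); ring.
have eh : 0 <= e1 * `|h| by rewrite mulr_ge0// ltW.
have b2 : `|act (u (s + h)) z - act (u s) z - h * act (w s) z| <= e1 * `|h| * `|x|.
  rewrite -Eact; apply: le_trans b1 _; rewrite (ger0_norm eh); by rewrite ler_wpM2l.
have b3 : `|act (w s) (z - y)| <= Mw * (`|h| * c1).
  by apply: le_trans (ae_bounded_act _ Mw0 wB) _; rewrite ler_wpM2l.
have b4 : `|act (u s) (z - y + h *: A y)| <= Mu * (h ^+ 2 * c2).
  by apply: le_trans (ae_bounded_act _ Mu0 uB) _; rewrite ler_wpM2l.
have wy := wE s0 dy.
rewrite (actB _ _ wB) in b3; rewrite (actD _ _ uB) (actB _ _ uB) (actZ _ _ uB) -wy in b4.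
rewrite mulr0 subr0.
(* Three errors, each $o(h)$: the derivative of [u] tested on the moved point [z], the displacement
   from [y] to [z] inside $hw_s$, and the Taylor remainder of the semigroup inside $u_s$. *)
have -> : act (u (s + h)) z - act (u s) y =
  (act (u (s + h)) z - act (u s) z - h * act (w s) z) +
  (h * (act (w s) z - act (w s) y) + (act (u s) z - act (u s) y + h * act (w s) y)) by ring.
apply: le_trans (ler_normD _ _) _; apply: le_trans (lerD (lexx _) (ler_normD _ _)) _.
rewrite normrM; have b3' := ler_wpM2l (normr_ge0 h) b3.
apply: le_trans (lerD b2 (lerD b3' b4)) _.
rewrite -(real_normK (num_real h)).
have hx : e1 * `|x| <= e / 2.
  have : e1 * (`|x| + 1) = e / 2 by rewrite /e1 divfK// gt_eqF.
  by rewrite mulrDr mulr1; lra.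
have hK' : `|h| * K <= e / 2 by rewrite -ler_pdivlMr// ltW.
have -> : e1 * `|h| * `|x| + (`|h| * (Mw * (`|h| * c1)) + Mu * (`|h| ^+ 2 * c2)) =
  `|h| * (e1 * `|x| + `|h| * (K - 1)) by rewrite /K addrK; ring.
rewrite [leRHS]mulrC ler_wpM2l//.
have : `|h| * (K - 1) <= `|h| * K by rewrite ler_wpM2l//; lra.
by lra.
Qed.

(** The pairing is constant on $[\delta,t-\delta]$ only: [u] need not be differentiable at 0, and
    the smoothing of $S(t-s)$ degenerates at $s=t$. Continuity of [u] and [semi_lip] close the two
    gaps as $\delta\to0$. *)
Lemma orbit_unique (t : R) x : 0 <= t -> dom x -> act (u t) x = act k0 (S t x).
Proof.
have mu0 : measurable_fun setT (u 0) by have [M _ []] := uM (lexx 0).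
rewrite le_eqVlt => /predU1P[<-|t0] dx.
  by rewrite (semi_id SS); exact: act_ae mu0 k0M.1 u0E.
have -> : act k0 (S t x) = act (u 0) (S t x) by apply/esym; exact: act_ae mu0 k0M.1 u0E.
have [Mt Mt0 tB] := uM (ltW t0); have [N0 N00 zB] := uM (lexx 0).
apply/eqP; rewrite -subr_eq0 -normr_le0; apply/ler_addgt0Pl => e e0; rewrite addr0.
have x1 : 0 < `|x| + 1 by rewrite ltr_wpDl.
pose e1 := e / 4 / (`|x| + 1).
have e10 : 0 < e1 by rewrite !divr_gt0.
have e1x : e1 * `|x| <= e / 4.
  have : e1 * (`|x| + 1) = e / 4 by rewrite /e1 divfK// gt_eqF.
  by rewrite mulrDr mulr1; lra.
have [d1 d10 hd1] := u_cont (ltW t0) e10; have [d2 d20 hd2] := u_cont (lexx 0) e10.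
pose K := (Mt + N0) * `|A x| + 1.
have K0 : 0 < K by rewrite /K ltr_wpDl// mulr_ge0// addr_ge0.
pose dl : R := Num.min (t / 2) (Num.min (e / 4 / K) (Num.min (d1 / 2) (d2 / 2))).
have dl0 : 0 < dl by rewrite !lt_min !divr_gt0.
have dlt : dl <= t / 2 by rewrite ge_min lexx.
have dlK : dl * K <= e / 4 by rewrite -ler_pdivlMr// !ge_min lexx orbT.
have dld1 : dl < d1.
  have : dl <= d1 / 2 by rewrite !ge_min lexx !orbT.
  by lra.
have dld2 : dl < d2.
  have : dl <= d2 / 2 by rewrite !ge_min lexx !orbT.
  by lra.
have tdl : 0 <= t - dl by lra.
have flat : act (u (t - dl)) (S dl x) = act (u dl) (S (t - dl) x).
  apply/eqP; rewrite -subr_eq0 -normr_le0.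
  have := @lipschitz_of_derive _ (fun s => act (u s) (S (t - s) x)) (fun=> 0) dl (t - dl) 0.
  rewrite mul0r subKr; apply.
  - lra.
  - by move=> s /andP[s1 s2]; apply: diff0 => //; lra.
  - by move=> s _; rewrite normr0.
have A0 : 0 <= `|A x| by [].
have lipd : `|S dl x - x| <= dl * `|A x| by exact: (semi_lip SS dissip dense (ltW dl0) dx).
have b1 : `|act (u (t - dl)) (S dl x) - act (u t) x| <= e1 * `|x| + Mt * (dl * `|A x|).
  have [Md Md0 dB] := uM tdl.
  have -> : act (u (t - dl)) (S dl x) - act (u t) x =
    act (fun z => u (t - dl) z - u t z) (S dl x) + act (u t) (S dl x - x).
    by rewrite (act_subl _ dB tB) (actB _ _ tB); ring.
  apply: le_trans (ler_normD _ _) _; apply: lerD.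
    have hb : ae_bounded mu (fun z => u (t - dl) z - u t z) e1.
      by apply: hd1 => //; rewrite addrAC subrr add0r normrN gtr0_norm.
    apply: le_trans (ae_bounded_act _ (ltW e10) hb) _; rewrite ler_wpM2l//; [exact: ltW|].
    by apply: contr; exact: ltW.
  by apply: le_trans (ae_bounded_act _ Mt0 tB) _; rewrite ler_wpM2l.
have b2 : `|act (u dl) (S (t - dl) x) - act (u 0) (S t x)| <= e1 * `|x| + N0 * (dl * `|A x|).
  have [Md Md0 dB] := uM (ltW dl0).
  have -> : act (u dl) (S (t - dl) x) - act (u 0) (S t x) =
    act (fun z => u dl z - u 0 z) (S (t - dl) x) - act (u 0) (S t x - S (t - dl) x).
    by rewrite (act_subl _ dB zB) (actB _ _ zB); ring.
  apply: le_trans (ler_normB _ _) _; apply: lerD.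
    have hb : ae_bounded mu (fun z => u dl z - u 0 z) e1.
      by apply: hd2; rewrite ?subr0 ?gtr0_norm// ltW.
    apply: le_trans (ae_bounded_act _ (ltW e10) hb) _; rewrite ler_wpM2l//; [exact: ltW|].
    exact: contr.
  apply: le_trans (ae_bounded_act _ N00 zB) _; rewrite ler_wpM2l//.
  have -> : S t x = S (t - dl) (S dl x) by rewrite -(semi_add SS) ?subrK// ltW.
  by rewrite -(semi_B SS)//; apply: le_trans (contr _ tdl) _.
have -> : act (u t) x - act (u 0) (S t x) =
  (act (u dl) (S (t - dl) x) - act (u 0) (S t x)) - (act (u (t - dl)) (S dl x) - act (u t) x).
  by rewrite flat; ring.
apply: le_trans (ler_normB _ _) _; apply: le_trans (lerD b2 b1) _.
have : N0 * (dl * `|A x|) + Mt * (dl * `|A x|) <= dl * K.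
  by rewrite /K mulrDr mulr1 (_ : _ + _ = dl * ((Mt + N0) * `|A x|)); [lra|ring].
by lra.
Qed.

End uniqueness.

End dual_orbit.

(** * The hierarchy of correlation functions *)

Lemma poly_geometric_bounded (R : realType) (k : nat) (r : R) : 0 <= r -> r < 1 ->
  exists2 M : R, 0 <= M & forall n : nat, n%:R ^+ k * r ^+ n <= M.
Proof.
elim: k r => [|k IH] r r0 r1.
  by exists 1 => // n; rewrite expr0 mul1r exprn_ile1// ltW.
(* One factor [s] of $r=s^2$ serves the induction hypothesis, the other absorbs the extra power of
   [n]. *)
pose s := Num.sqrt r; have s0 : 0 <= s by exact: sqrtr_ge0.
have s1 : s < 1 by rewrite -sqrtr1 ltr_sqrt.
have ss : r = s * s by rewrite -expr2 sqr_sqrtr.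
have [M M0 hM] := IH s s0 s1.
exists (M * (1 - s)^-1); first by rewrite mulr_ge0// invr_ge0; lra.
move=> n; rewrite ss exprMn exprS.
(* All $n$ terms of the geometric sum $\sum_{i<n}s^i$ are at least $s^n$, and the sum is at most
   $1/(1-s)$. *)
have h : n%:R * s ^+ n <= (1 - s)^-1.
  rewrite -[leRHS]mul1r ler_pdivlMr ?subr_gt0//.
  apply: (@le_trans _ _ ((1 - s) * \sum_(i < n) s ^+ i)).
    rewrite mulrC ler_wpM2l//; first by lra.
    rewrite -[X in X%:R](card_ord n) -sumr_const mulr_suml; apply: ler_sum => i _.
    by rewrite mul1r ler_wiXn2l// ?ltW// ltnW.
  rewrite (_ : (1 - s) * _ = 1 - s ^+ n); last by rewrite -[LHS]opprK -mulNr opprB -subrX1 opprB.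
  by rewrite gerBl exprn_ge0.
rewrite (_ : _ * _ * _ = (n%:R ^+ k * s ^+ n) * (n%:R * s ^+ n)); last by ring.
by apply: ler_pM => //; rewrite mulr_ge0// ?exprn_ge0.
Qed.

Lemma near_ballP (R : realType) (t : R) (P : R -> Prop) :
  (\forall s \near t, P s) <-> exists2 dl : R, 0 < dl & forall s : R, `|s - t| < dl -> P s.
Proof.
split=> [/nbhs_ballP[dl /= dl0 h]|[dl dl0 h]].
  by exists dl => // s st; apply: h; rewrite /ball /= distrC.
by apply/nbhs_ballP; exists dl => // s; rewrite /ball /= distrC; exact: h.
Qed.

Lemma near_punctured0P (R : realType) (P : R -> Prop) :
  (\forall h \near 0^', P h) <->
  exists2 dl : R, 0 < dl & forall h : R, h != 0 -> `|h| < dl -> P h.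
Proof.
split=> [/near_ballP[dl dl0 h]|[dl dl0 h]].
  by exists dl => // s s0 sd; apply: h => //; rewrite subr0.
by apply/near_ballP; exists dl => // s; rewrite subr0 => sd s0; exact: h.
Qed.

Section solution.
Variables (R : realType) (m : nat) (d b : rate R m) (C a1 a2 A nu alpha : R) (N : nat).
Hypothesis m_gt0 : (0 < m)%N.
Hypothesis db : standing_rates d b.
Hypotheses (C_gt0 : 0 < C) (a1_ge1 : 1 <= a1) (a2_gt0 : 0 < a2) (A_gt0 : 0 < A).
Hypothesis d_bound : forall xi : fconfig R m, (Kinv_sum d C xi <= (a1 * Dtot d xi)%:E)%E.
Hypothesis b_bound : forall xi : fconfig R m, (Kinv_sum b C xi <= (a2 * Dtot d xi)%:E)%E.
Hypothesis d_growth : forall (x : Rspace R m) (xi : fconfig R m), x \notin xi ->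
  (d x (config_of xi) <= (A * (1 + #|` xi|%:R) ^+ N * nu ^+ #|` xi|)%:E)%E.
Hypotheses (nu_ge1 : 1 <= nu) (nu_lt : nu < C / a2 * (3 / 2 - a1)).
Hypotheses (alpha_gt : a2 / (C * (3 / 2 - a1)) < alpha) (alpha_lt : alpha < 1 / nu).
Local Notation LP := (lebesgue_poisson R m).
Local Notation X := (L1 LP).

Let a1_lt : 0 < 3 / 2 - a1.
Proof.
have : 0 < C / a2 * (3 / 2 - a1) by apply: lt_trans nu_lt; exact: lt_le_trans nu_ge1.
by rewrite pmulr_rgt0// divr_gt0.
Qed.

Let alpha_gt0 : 0 < alpha.
Proof. by apply: lt_trans alpha_gt; apply: divr_gt0 => //; exact: mulr_gt0. Qed.

Let alpha_nu : alpha * nu < 1.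
Proof. by rewrite -ltr_pdivlMr//; exact: lt_le_trans nu_ge1. Qed.

Let alpha_le1 : alpha <= 1.
Proof.
apply: (@le_trans _ _ (alpha * nu)); last exact: (ltW alpha_nu).
by rewrite ler_peMr// (ltW alpha_gt0).
Qed.

Let a2_ge0 := ltW a2_gt0.
(** The relative bound in the smaller weight $\alpha C$. It also serves in the weight $C$, because
    $\alpha\le1$. *)
Let q := a1 - 1 + a2 / (alpha * C).

Let q_ge0 : 0 <= q.
Proof. by rewrite addr_ge0 ?subr_ge0// divr_ge0// (ltW (mulr_gt0 alpha_gt0 C_gt0)). Qed.

(** The lower bound on [alpha] says $a_2/(\alpha C)<\frac32-a_1$, that is $q<\frac12$. *)
Let q_lt1 : q < 1.
Proof.
have : a2 / (alpha * C) < 3 / 2 - a1.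
  rewrite ltr_pdivrMr ?mulr_gt0//; move: alpha_gt; rewrite ltr_pdivrMr ?mulr_gt0//; lra.
by rewrite /q; lra.
Qed.

Let kap := (1 - q) / (1 + q).
Let kap_gt0 : 0 < kap.
Proof. by rewrite divr_gt0//; have := q_lt1; have := q_ge0; lra. Qed.

Let D := Dtot d.
Let mD : measurable_fun setT D. Proof. exact: measurable_Dtot (death_measurable db). Qed.
Let D0 xi : 0 <= D xi. Proof. by apply: Dtot_ge0 => x g; have [] := rates_ge0 db x g. Qed.

Let S := Lup d b C.
Let Slin := Lup_linear m_gt0 db C_gt0 a2_ge0 b_bound.

Let rho (eta : fconfig R m) : R := alpha ^+ #|` eta|.
Let mrho : measurable_fun setT rho. Proof. exact: measurable_wt. Qed.
Let rho0 eta : 0 <= rho eta. Proof. by rewrite exprn_ge0// ltW. Qed.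
Let rho1 eta : rho eta <= 1. Proof. by rewrite exprn_ile1// ltW. Qed.
Let rho01 eta : 0 <= rho eta <= 1. Proof. by rewrite rho0 rho1. Qed.

Let Srho : rel_bounded LP D S q rho.
Proof.
exact: (Lup_rel_bounded m_gt0 db C_gt0 a1_ge1 a2_ge0 d_bound b_bound alpha_gt0 alpha_le1 (lexx q)).
Qed.

Let S1 : rel_bounded LP D S q (cst 1).
Proof.
have := Lup_rel_bounded m_gt0 db C_gt0 a1_ge1 a2_ge0 d_bound b_bound (q := q) ltr01 (lexx 1).
rewrite (_ : (fun eta : fconfig R m => 1 ^+ #|` eta|) = cst 1); last first.
  by apply/funext => eta; rewrite expr1n.
apply; rewrite mul1r lerD2l ler_wpM2l// lef_pV2 ?posrE ?mulr_gt0//.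
by rewrite ler_piMl// ltW.
Qed.

Let dom : set X := @gdom _ _ _ LP D.
Let L : X -> X := @gen _ _ _ LP S.

Let Lop : operator_on dom L. Proof. exact: (gen_op mD Slin S1). Qed.
Let dense : dense_in dom. Proof. exact: (gdom_dense mD D0 Slin S1). Qed.
Let L_surj (h : R) (y : X) : 0 < h -> exists2 x, dom x & x - h *: L x = y.
Proof. exact: (gen_surj mD D0 q_ge0 q_lt1 Slin S1). Qed.

Let norm_cst1 (f : fconfig R m -> R) : norm1 LP (fun t => cst 1 t * f t) = norm1 LP f.
Proof. by congr norm1; apply/funext => t; rewrite mul1r. Qed.

Let m1 : measurable_fun setT (cst 1 : fconfig R m -> R). Proof. exact: measurable_cst. Qed.

Let L_resolvent (h : R) x : 0 < h -> dom x ->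
  `|x| + h * ((1 - q) * norm1 LP (fun t => D t * x t)) <= `|x - h *: L x|.
Proof.
move=> h0 dx; have := wnorm_resolvent D0 S1 m1
  (fun _ => ler01) (fun _ => lexx 1) S1 h0 dx.
by rewrite /wnorm !norm_cst1.
Qed.

Let dissip (h : R) y : 0 < h -> dom y -> `|y| <= `|y - h *: L y|.
Proof.
move=> h0 dy; apply: le_trans (L_resolvent h0 dy); rewrite lerDl.
apply: mulr_ge0; first exact: ltW.
by rewrite mulr_ge0 ?norm1_ge0// subr_ge0 ltW.
Qed.

Let analytic (h : R) y : 0 < h -> dom y -> `|y| + h * (kap * `|L y|) <= `|y - h *: L y|.
Proof.
move=> h0 dy; apply: le_trans (L_resolvent h0 dy); rewrite lerD2l ler_wpM2l//; first exact: ltW.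
have := wnorm_gen_le S1 m1 (fun _ => ler01) (fun _ => lexx 1) S1 dy.
rewrite /wnorm !norm_cst1 -/L => h1.
have q10 : 0 < 1 + q by have := q_ge0; lra.
rewrite /kap mulrAC ler_pdivrMr// -mulrA ler_wpM2l ?subr_ge0 ?(ltW q_lt1)// mulrC.
exact: h1.
Qed.

Let wdissip (h : R) y : 0 < h -> dom y -> wnorm rho y <= wnorm rho (y - h *: L y).
Proof. exact: (wnorm_dissip D0 q_lt1 S1 mrho rho0 rho1 Srho). Qed.

(* The growth condition makes alpha^n D bounded, since alpha * nu < 1. *)
Let rhoD_bounded : exists2 M : R, 0 <= M & forall eta, rho eta * D eta <= M.
Proof.
have an0 : 0 <= alpha * nu by rewrite mulr_ge0 ?ltW//; exact: lt_le_trans nu_ge1.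
have [M M0 hM] := poly_geometric_bounded N.+1 an0 alpha_nu.
exists (A * M); first by rewrite mulr_ge0// ltW.
move=> eta; set n := #|` eta|.
(* Each of the [n] rates is taken at a configuration of $n-1$ points, so the growth condition gives
   $n^N\nu^{n-1}$, and $\nu\ge1$ completes the power. *)
have DA : D eta <= n%:R * (A * n%:R ^+ N * nu ^+ n).
  rewrite /D /Dtot big_seq; apply: (@le_trans _ _ (\sum_(x <- eta | x \in eta) (A * n%:R ^+ N * nu ^+ n))).
    apply: ler_sum => x xe; have xn : x \notin (eta `\ x)%fset by rewrite !inE eqxx.
    have fr := d_growth xn.
    have nE : n = (#|` (eta `\ x)%fset|).+1 by rewrite /n (cardfsD1 x eta) xe add1n.
    have [_ ] := (rates_gt0 db, rates_fin db); move=> /(_ x _ xn)[dfin _].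
    have [dge _] := rates_ge0 db x (config_of (eta `\ x)%fset).
    rewrite -lee_fin /frate fineK ?ge0_fin_numE//; apply: le_trans fr _.
    rewrite lee_fin nE -natr1 [_ + 1]addrC; apply: ler_wpM2l.
      by rewrite mulr_ge0 ?ltW// exprn_ge0// addr_ge0.
    by rewrite exprS ler_peMl// exprn_ge0// ltW//; exact: lt_le_trans nu_ge1.
  by rewrite -big_seq big_const_seq count_predT iter_addr addr0 -[n%:R in leRHS]mulr_natl mulr1 mulr_natl.
apply: le_trans (ler_wpM2l (rho0 eta) DA) _.
have -> : rho eta * (n%:R * (A * n%:R ^+ N * nu ^+ n)) = A * (n%:R ^+ N.+1 * (alpha * nu) ^+ n).
  by rewrite exprMn exprS /rho -/n; ring.
by rewrite ler_wpM2l// ltW.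
Qed.

Let A_Lam : exists2 Lam : R, 0 <= Lam & forall x, dom x -> wnorm rho (L x) <= Lam * `|x|.
Proof.
have [M M0 hM] := rhoD_bounded; exists ((1 + q) * M).
  by rewrite mulr_ge0//; have := q_ge0; lra.
move=> x dx; apply: le_trans (wnorm_gen_le S1 mrho rho0 rho1 Srho dx) _.
rewrite -mulrA ler_wpM2l//; first by have := q_ge0; lra.
rewrite L1_normE -[M in leRHS](ger0_norm M0) -(norm1Z _ (L1_integ x)).
apply: (proj2 (norm1_le _ (integZ M (L1_integ x)) _)).
  by apply: measurable_funM => //; exact: integ_mfun dx.
apply: aeW => t; rewrite mulrA !normrM ler_wpM2r// (ger0_norm M0) (ger0_norm (rho0 t)).
by rewrite (ger0_norm (D0 t)).
Qed.

Let DupE (G : fconfig R m -> R) : (fun t => D t * up C G t) = up C (fun eta => D eta * G eta).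
Proof. by apply/funext => eta; rewrite /up mulrCA. Qed.

Let L_iota G : LC C G -> (Ddom d C G <-> dom (iota C G)).
Proof.
move=> LG; have IG := (LCP C G).1 LG; split.
  move=> [_ /LCP LDG]; apply: (L1_of_gdom mD Slin S1 IG _).1.
  by rewrite DupE.
move=> dG; split=> //; apply/LCP; rewrite -DupE.
apply: integ_ae dG _ _; first by apply: measurable_funM => //; exact: integ_mfun IG.
by apply: filterS (L1_ofP IG) => t /= + _ => ->.
Qed.

Let L_gen G : Ddom d C G -> LC C (Lhat d b G) /\ iota C (Lhat d b G) = L (iota C G).
Proof.
move=> DG; have LG : LC C G by case: DG.
have IG := (LCP C G).1 LG; have IDG : integ LP (fun t => D t * up C G t).
  by rewrite DupE; apply/LCP; case: DG.
have SE : S (up C G) = up C (Lhat d b G) by rewrite /S /Lup upK.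
split; first by apply/LCP; rewrite -SE; exact: (integ_S S1).
by rewrite /iota -SE /L; apply/esym; exact: (L1_of_gdom mD Slin S1 IG IDG).2.
Qed.

Let dual_repr (l : X -> R) (M : R) :
  (forall a x y, l (a *: x + y) = a * l x + l y) -> (forall x, `|l x| <= M * `|x|) ->
  exists k : fconfig R m -> R, ae_bounded LP k `|M| /\ forall x, act k x = l x.
Proof.
move=> llin lM; have [k [mk kM kE]] := @L1_dual _ _ _ (sfLP R m) l M llin lM.
exists k; split; first by split=> //; exact: aeW.
by move=> x; rewrite -[in RHS](L1_of_fun x); apply/esym/kE; exact: L1_integ.
Qed.

Lemma generator_exists : exists T, generates C (Lhat d b) (Ddom d C) T.
Proof.
have [TX SX] := hille_yosida Lop dense dissip L_surj.
exists (fun t G => down C (TX t (iota C G))).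
apply: (generates_of_semigroup C_gt0 L_iota L_gen (TX := TX)) => // t G t0 LG.
exact: iota_down.
Qed.

Lemma KC_alphaP k : KC (alpha * C) k <-> exists2 M, 0 <= M & rho_bounded LP rho (down C k) M.
Proof.
have E eta : `|down C k eta| = rho eta * `|down (alpha * C) k eta|.
  have a0 : alpha ^+ #|` eta| != 0 by rewrite gt_eqF// exprn_gt0.
  rewrite -[rho eta]ger0_norm// -normrM /rho /down exprMn invfM -mulrA mulVKf//.
split=> [/KCP[//|M [mk kM]]|[M M0 [mk kM]]].
  exists `|M| => //; split.
    have := up_measurable (alpha * C) mk; rewrite downK ?mulr_gt0// => mk'.
    exact: down_measurable.
  apply: filterS kM => eta kM; rewrite E mulrC ler_wpM2r//.
  exact: le_trans kM (ler_norm M).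
apply/KCP => //; exists M; split.
  by apply: down_measurable; have := up_measurable C mk; rewrite downK.
apply: filterS kM => eta; rewrite E mulrC ler_pM2r//; exact: exprn_gt0.
Qed.

Lemma normKC_subP (k l : fconfig R m -> R) (e : R) : measurable_fun setT k -> measurable_fun setT l ->
  ((normKC C (k \- l)%R <= e%:E)%E <-> ae_bounded LP (fun t => down C k t - down C l t) e).
Proof.
move=> mk ml; rewrite normKC_leP//; split=> [h|[_ h]].
  split; last by apply: filterS h => eta; rewrite downB.
  by apply: measurable_funB; exact: down_measurable.
by apply: filterS h => eta; rewrite downB.
Qed.

Lemma Kalpha_approx k (e : R) : Kalpha C alpha k -> 0 < e ->
  exists kap' M, [/\ 0 <= M, rho_bounded LP rho kap' M &
    ae_bounded LP (fun t => down C k t - kap' t) e].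
Proof.
move=> [Kk H] e0; have [k' Kk' ke] := H e e0.
have [M M0 kM] := (KC_alphaP k').1 Kk'; exists (down C k'), M; split=> //.
have mk' : measurable_fun setT k' by have := up_measurable C kM.1; rewrite downK.
by apply/normKC_subP => //; [exact: (KC_measurable m_gt0 C_gt0 Kk)|exact: ltW].
Qed.

Lemma Kalpha_of k M0 : ae_bounded LP k M0 ->
  (forall e : R, 0 < e -> exists kap' M, [/\ 0 <= M, rho_bounded LP rho kap' M &
    ae_bounded LP (fun t => k t - kap' t) e]) -> Kalpha C alpha (up C k).
Proof.
move=> kM H; split; first by apply/KCP => //; exists M0; rewrite upK.
move=> e e0; have e20 : 0 < e / 2 by rewrite divr_gt0.
have [k' [M [M_ge0 k'M ke]]] := H _ e20; exists (up C k').
  by apply/KC_alphaP; exists M => //; rewrite upK.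
apply: (@le_lt_trans _ _ (e / 2)%:E); last by rewrite lte_fin; lra.
apply/normKC_subP; [exact: up_measurable kM.1|exact: up_measurable k'M.1|].
by rewrite !upK.
Qed.

Section given_semigroup.
Variable T : R -> (fconfig R m -> R) -> fconfig R m -> R.
Hypothesis gT : generates C (Lhat d b) (Ddom d C) T.

Let TX (t : R) (x : X) : X := iota C (T t (down C x)).

(** [T] is given on functions, so its compatibility with classes must be derived: [G] and the chosen
    representative of its class differ by a function of norm 0, which the bounded map [T t] sends to
    one of norm 0. *)
Let TTX (t : R) G : 0 <= t -> LC C G -> LC C (T t G) /\ iota C (T t G) = TX t (iota C G).
Proof.
move=> t0 LG; have [ST _ _] := gT.
have LT := semigroup_stable ST t0 LG; split=> //.
have [LG' GE'] := iota_down C_gt0 (iota C G); set G' := down C (iota C G) in LG' GE' *.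
have LT' := semigroup_stable ST t0 LG'.
have [LH HE] := iota_lin (-1) LG LG'; have [LTH THE] := iota_lin (-1) LT LT'.
have LTH' := semigroup_stable ST t0 LH.
have lin := semigroup_linear ST (-1) t0 LG LG'.
have [M hM] := semigroup_bounded ST t0; have := hM _ LH.
rewrite !iota_norm// HE GE' scaleN1r addNr normr0 mule0 lee_fin normr_le0 => /eqP z.
have := (iota_ae C_gt0 LTH' LTH).2 lin; rewrite z THE scaleN1r => /esym/eqP.
by rewrite addrC subr_eq0 => /eqP.
Qed.

Let SX : semigroup_of dom L TX.
Proof. exact: (semigroup_of_generates C_gt0 L_iota L_gen TTX gT). Qed.

Let sf := @sigma_finite_LP R m.

Variable k0 : fconfig R m -> R.
Hypothesis Kk0 : Kalpha C alpha k0.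

Let c0 := down C k0.

Section orbit.
Variables (M0 : R) (c v : R -> fconfig R m -> R).
Hypotheses (M0_ge0 : 0 <= M0) (c0M : ae_bounded LP c0 M0).
Hypothesis cM : forall t, 0 <= t -> ae_bounded LP (c t) M0.
Hypothesis cE : forall t x, 0 <= t -> act (c t) x = act c0 (TX t x).
Hypothesis vM : forall t, 0 < t -> ae_bounded LP (v t) (M0 / (t * kap)).
Hypothesis vE : forall t x, 0 < t -> dom x -> act (v t) x = act c0 (L (TX t x)).

Let zero_bounded : ae_bounded LP (fun _ : fconfig R m => 0) 0.
Proof. by split; [exact: measurable_cst|apply: aeW => s; rewrite normr0]. Qed.

(** A start in $\overline{\mathcal K_{\alpha C}}$ is replaced by a nearby one in $\mathcal K_{\alpha
    C}$. Contractivity keeps the orbits within [e], while the new orbit is [rho]-bounded and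
    Lipschitz at 0; this yields both invariance of the closure and continuity at 0. *)
Let approx_orbit (e : R) : 0 < e -> exists c' M Lam,
  [/\ 0 <= M, 0 <= Lam, forall t, 0 <= t -> rho_bounded LP rho (c' t) M,
      forall t, 0 <= t -> ae_bounded LP (fun s => c t s - c' t s) e &
      forall t, 0 <= t -> ae_bounded LP (fun s => c' t s - c' 0 s) (t * Lam)].
Proof.
move=> e0; have [k' [M [M_ge0 k'r k'e]]] := Kalpha_approx Kk0 e0.
have [Lam Lam0 hLam] := A_Lam.
have k'M := rho_ae_bounded rho01 M_ge0 k'r.
have [c' [_ [c'M c'E _ _]]] := orbit_exists dual_repr Lop dense SX dissip kap_gt0 analytic M_ge0 k'M.
exists c', M, (M * Lam); split=> //.
- exact: mulr_ge0.
- by move=> t t0; exact: (orbit_rho sf dense mrho rho01 SX wdissip c'M c'E M_ge0 k'r t0).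
- move=> t t0; exact: (orbit_contraction sf dense SX dissip M0_ge0 M_ge0 c0M k'M cM c'M cE c'E (ltW e0) k'e t0).
move=> t t0; have bb := ae_boundedB (c'M t t0) (c'M 0 (lexx 0)).
apply: (bounded_of_dom sf dense _ bb) => [|x dx]; first by rewrite mulr_ge0// mulr_ge0.
rewrite (act_subl _ (c'M t t0) (c'M 0 (lexx 0))) !c'E// (semi_id SX).
exact: (orbit_lip0 Lop dense mrho rho01 SX dissip kap_gt0 analytic Lam0 hLam M_ge0 k'r t0 dx).
Qed.

Let orbit_cont0 (e : R) : 0 < e -> exists2 dl : R, 0 < dl &
  forall t : R, 0 <= t -> t < dl -> ae_bounded LP (fun s => c t s - c 0 s) e.
Proof.
move=> e0; have e3 : 0 < e / 3 by rewrite divr_gt0.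
have [c' [M [Lam [M_ge0 Lam0 _ ce c'l]]]] := approx_orbit e3.
have L1 : 0 < Lam + 1 by rewrite ltr_wpDl.
exists (e / 3 / (Lam + 1)) => [|t t0 td]; first by rewrite divr_gt0.
have bb := ae_boundedB (ae_boundedD 1 (ce t t0) (c'l t t0)) (ce 0 (lexx 0)).
rewrite (_ : (fun s => c t s - c 0 s) =
  (fun s => 1 * (c t s - c' t s) + (c' t s - c' 0 s) - (c 0 s - c' 0 s))); last first.
  by apply/funext => s; ring.
apply: ae_bounded_mono bb _; rewrite normr1 mul1r.
have : t * (Lam + 1) <= e / 3 by rewrite -ler_pdivlMr// ltW.
by rewrite mulrDr mulr1; set w := t * Lam; lra.
Qed.

Let orbit_cont (t e : R) : 0 <= t -> 0 < e -> exists2 dl : R, 0 < dl &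
  forall r : R, 0 <= r -> `|r - t| < dl -> ae_bounded LP (fun s => c r s - c t s) e.
Proof.
rewrite le_eqVlt => /predU1P[<-|t0] e0.
  have [dl dl0 h] := orbit_cont0 e0; exists dl => // r r0; rewrite subr0 ger0_norm//; exact: h.
pose K := 2 / (t * kap) * M0 + 1.
have K0 : 0 < K by rewrite /K ltr_wpDl// mulr_ge0// divr_ge0// mulr_ge0// ltW.
exists (Num.min (t / 2) (e / K)); first by rewrite lt_min !divr_gt0.
move=> r r0; rewrite lt_min => /andP[rt re].
have := orbit_lip sf dense SX dissip kap_gt0 analytic M0_ge0 c0M cM cE t0 (ltW rt).
rewrite addrC subrK => /ae_bounded_mono; apply.
apply: le_trans (_ : `|r - t| * K <= _); last by rewrite -ler_pdivlMr// ltW.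
by rewrite ler_wpM2l// /K; lra.
Qed.

Let orbit_deriv_e (t e : R) : 0 < t -> 0 < e -> exists2 dl : R, 0 < dl &
  forall h : R, h != 0 -> `|h| < dl ->
    ae_bounded LP (fun s => h^-1 * (c (t + h) s - c t s) - v t s) e.
Proof.
move=> t0 e0; pose K := 32 / (t * kap) ^+ 2 * M0 + 1.
have K0 : 0 < K by rewrite /K ltr_wpDl// mulr_ge0// divr_ge0// sqr_ge0.
exists (Num.min (t / 2) (e / K)); first by rewrite lt_min !divr_gt0.
move=> h h0; rewrite lt_min => /andP[ht he].
have bb := orbit_deriv sf Lop dense SX dissip kap_gt0 analytic M0_ge0 c0M cM cE vM vE t0 (ltW ht).
have b2 := ae_boundedD h^-1 bb zero_bounded.
rewrite (_ : (fun s => h^-1 * (c (t + h) s - c t s) - v t s) =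
  (fun s => h^-1 * (c (t + h) s - c t s - h * v t s) + 0)); last first.
  by apply/funext => s; rewrite addr0 [in RHS]mulrBr mulKf.
apply: ae_bounded_mono b2 _.
have -> : `|h^-1| * (h ^+ 2 * (32 / (t * kap) ^+ 2 * M0)) + 0 = `|h| * (K - 1).
  by rewrite /K addrK addr0 -(real_normK (num_real h)) normfV expr2 -(mulrA `|h|) mulKf// normr_eq0.
apply: le_trans (_ : `|h| * K <= _); last by rewrite -ler_pdivlMr// ltW.
by rewrite ler_wpM2l//; lra.
Qed.

Let orbit_v_cont (t e : R) : 0 < t -> 0 < e -> exists2 dl : R, 0 < dl &
  forall r : R, `|r - t| < dl -> ae_bounded LP (fun s => v r s - v t s) e.
Proof.
move=> t0 e0; pose K := 16 / (t * kap) ^+ 2 * M0 + 1.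
have K0 : 0 < K by rewrite /K ltr_wpDl// mulr_ge0// divr_ge0// sqr_ge0.
exists (Num.min (t / 2) (e / K)); first by rewrite lt_min !divr_gt0.
move=> r; rewrite lt_min => /andP[rt re].
have := orbit_v_lip sf Lop dense SX dissip kap_gt0 analytic M0_ge0 c0M vM vE t0 (ltW rt).
rewrite addrC subrK => /ae_bounded_mono; apply.
apply: le_trans (_ : `|r - t| * K <= _); last by rewrite -ler_pdivlMr// ltW.
by rewrite ler_wpM2l// /K; lra.
Qed.

Let u (t : R) := up C (c t).
Let w (t : R) := up C (v t).

Lemma orbit_Kalpha (t : R) : 0 <= t -> Kalpha C alpha (u t).
Proof.
move=> t0; apply: (Kalpha_of (cM t0)) => e e0.
have [c' [M [Lam [M_ge0 _ c'r ce _]]]] := approx_orbit e0.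
by exists (c' t), M; split; [|exact: c'r|exact: ce].
Qed.

(** The derivative is a norm limit of difference quotients of the orbit, and these belong to the
    closed space $\overline{\mathcal K_{\alpha C}}$. *)
Lemma orbit_v_Kalpha (t : R) : 0 < t -> Kalpha C alpha (w t).
Proof.
move=> t0; apply: (Kalpha_of (vM t0)) => e e0; have e2 : 0 < e / 2 by rewrite divr_gt0.
have [dl dl0 hd] := orbit_deriv_e t0 e2.
pose h := dl / 2; have h0 : 0 < h by rewrite divr_gt0.
have hdl : `|h| < dl by rewrite gtr0_norm// /h; lra.
have bb := hd h (lt0r_neq0 h0) hdl.
(* Both ends of the quotient are approximated within $eh/4$; after division by $h$ this costs $e/2$,
   and the quotient itself is within $e/2$ of [v t]. *)
have eh : 0 < e * h / 4 by rewrite divr_gt0// mulr_gt0.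
have [c' [M [Lam [M_ge0 _ c'r ce _]]]] := approx_orbit eh.
have th : 0 <= t + h by rewrite addr_ge0// ltW.
exists (fun s => h^-1 * (c' (t + h) s - c' t s)), (h^-1 * (M + M)); split.
- by rewrite mulr_ge0 ?invr_ge0 ?addr_ge0// ltW.
- have [m1' r1] := c'r _ th; have [m2' r2] := c'r _ (ltW t0); split.
    by apply: measurable_funM; [exact: measurable_cst|exact: measurable_funB].
  have FF := ae_filter_ringOfSetsType LP.
  apply: (@filterS2 _ _ FF _ _ _ _ r1 r2) => s q1 q2.
  rewrite normrM (@gtr0_norm _ h^-1) ?invr_gt0// -mulrA ler_wpM2l ?invr_ge0 ?(ltW h0)//.
  by apply: le_trans (ler_normB _ _) _; rewrite mulrDl lerD.
have b2 := ae_boundedD (-1) bb (ae_boundedD h^-1 (ae_boundedB (ce _ th) (ce _ (ltW t0))) zero_bounded).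
rewrite (_ : (fun s => v t s - _) = (fun s => -1 * (h^-1 * (c (t + h) s - c t s) - v t s) +
  (h^-1 * (c (t + h) s - c' (t + h) s - (c t s - c' t s)) + 0))); last first.
  by apply/funext => s; ring.
apply: ae_bounded_mono b2 _.
rewrite normrN1 mul1r addr0 (gtr0_norm (_ : 0 < h^-1)) ?invr_gt0//.
by apply: le_of_eq; field; exact: lt0r_neq0.
Qed.

Lemma orbit_pairing (t : R) G : 0 < t -> Ddom d C G -> pairing (Lhat d b G) (u t) = pairing G (w t).
Proof.
move=> t0 DG; have LG : LC C G by case: DG.
have [LL LE] := L_gen DG.
have Ku : KC C (u t) by case: (orbit_Kalpha (ltW t0)).
have Kw : KC C (w t) by case: (orbit_v_Kalpha t0).
rewrite !(pairingE m_gt0 C_gt0)// /u /w !upK// -/(iota C _) -/(iota C _) LE cE ?ltW//.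
have dG := (L_iota LG).1 DG.
by rewrite vE// (semi_comm SX)// ltW.
Qed.

Lemma orbit_solution : classical_solution d b C alpha k0 u.
Proof.
have mu' (t : R) : 0 <= t -> measurable_fun setT (u t).
  by move=> t0; apply: up_measurable; case: (cM t0).
have mw (t : R) : 0 < t -> measurable_fun setT (w t).
  by move=> t0; apply: up_measurable; case: (vM t0).
have Lst (t : R) : 0 < t -> Lstar d b C (u t) (w t).
  move=> t0; split; [by case: (orbit_Kalpha (ltW t0))|by case: (orbit_v_Kalpha t0)|].
  by move=> G; exact: orbit_pairing.
split.
- by move=> t t0; exact: orbit_Kalpha.
- move=> t t0; apply/ge0_cvg0P => [s|e e0]; first exact: Lnorm_ge0.
  have [dl dl0 hd] := orbit_cont t0 e0.
  apply/near_ballP; exists dl => // s st s0.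
  by apply/normKC_subP; [exact: mu'|exact: mu'|rewrite !upK//; exact: hd].
- move=> t t0; exists (w t); split; [exact: Lst|exact/orbit_Kalpha/ltW|exact: orbit_v_Kalpha].
- exists w; split.
  + by move=> t t0; exact: orbit_v_Kalpha.
  + move=> t t0; apply/ge0_cvg0P => [s|e e0]; first exact: Lnorm_ge0.
    have [dl dl0 hd] := orbit_deriv_e t0 e0.
    apply/near_punctured0P; exists dl => // h h0 hdl.
    apply/normKC_leP => //; have [_] := hd h h0 hdl; apply: filterS => eta.
    rewrite (_ : down C _ eta = h^-1 * (c (t + h) eta - c t eta) - v t eta)//.
    rewrite /u /w /up /down; field.
    by rewrite h0 gt_eqF// exprn_gt0.
  + move=> t t0; apply/ge0_cvg0P => [s|e e0]; first exact: Lnorm_ge0.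
    have [dl dl0 hd] := orbit_v_cont t0 e0.
    apply/near_ballP; exists (Num.min dl t) => [|r]; first by rewrite lt_min dl0.
    rewrite lt_min => /andP[rd rt]; have r0 : 0 < r.
      by move: (rt); rewrite ltr_norml => /andP[]; lra.
    by apply/normKC_subP; [exact: mw|exact: mw|rewrite !upK//; exact: hd].
  + exact: Lst.
- have cc0 : c 0 = c0 %[ae LP].
    apply: (dense_unique dense sf (cM (lexx 0)) c0M) => x dx.
    by rewrite cE// (semi_id SX).
  by apply: filterS cc0 => eta /(_ I) E _; rewrite /u /up E mulVKf// gt_eqF// exprn_gt0.
Qed.

Let KC_down k : KC C k -> exists2 M, 0 <= M & ae_bounded LP (down C k) M.
Proof.
by move=> /(KCP m_gt0)[M kM]; exists `|M| => //; exact: ae_bounded_mono kM (ler_norm M).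
Qed.

Let Lstar_act k k' x : Lstar d b C k k' -> dom x -> act (down C k') x = act (down C k) (L x).
Proof.
move=> [Kk Kk' kk'] dx; have [Lx xE] := iota_down C_gt0 x.
have Dx : Ddom d C (down C x) by apply/L_iota => //; rewrite xE.
have [LL LE] := L_gen Dx.
by rewrite (actE m_gt0 C_gt0)// -kk'// (pairingE m_gt0 C_gt0)// -/(iota C _) LE xE.
Qed.

Lemma classical_solution_unique k' : classical_solution d b C alpha k0 k' ->
  forall t, 0 <= t -> k' t = u t %[ae LP].
Proof.
move=> [sp ct _ [z [zsp zd _ zL]] ini] t t0.
have mk' s : 0 <= s -> measurable_fun setT (k' s).
  by move=> s0; have [Ks _] := sp s s0; exact: (KC_measurable m_gt0 C_gt0 Ks).
have mz s : 0 < s -> measurable_fun setT (z s).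
  by move=> s0; have [Ks _] := zsp s s0; exact: (KC_measurable m_gt0 C_gt0 Ks).
have main x : dom x -> act (down C (k' t)) x = act c0 (TX t x).
  move=> dx.
  apply: (orbit_unique Lop dense SX dissip kap_gt0 analytic (u := fun s => down C (k' s))
    (w := fun s => down C (z s)) c0M _ _ _ _ _ _ t0 dx).
  - by move=> s s0; apply: KC_down; have [] := sp s s0.
  - move=> s e s0 e0.
    have /(ge0_cvg0P _ (fun r => Lnorm_ge0 _ _ _))/(_ e e0)/near_ballP[dl dl0 hd] := ct s s0.
    exists dl => // r r0 rs; apply/normKC_subP; [exact: mk'|exact: mk'|exact: hd].
  - by move=> s s0; apply: KC_down; have [] := zsp s s0.
  - by move=> s y s0 dy; apply: Lstar_act => //; exact: zL.
  - move=> s e s0 e0.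
    have /(ge0_cvg0P _ (fun r => Lnorm_ge0 _ _ _))/(_ e e0)/near_punctured0P[dl dl0 hd] := zd s s0.
    exists (Num.min dl s) => [|h h0]; first by rewrite lt_min dl0.
    rewrite lt_min => /andP[hdl hs].
    have sh : 0 <= s + h by move: (ltW hs); rewrite ler_norml => /andP[]; lra.
    have s0' := ltW s0; split.
      apply: measurable_funB; last first.
        by apply: measurable_funM; [exact: measurable_cst|exact: down_measurable (mz s s0)].
      by apply: measurable_funB; [exact: down_measurable (mk' _ sh)|exact: down_measurable (mk' _ s0')].
    have /(normKC_leP m_gt0) := hd h h0 hdl; apply: filterS => eta he.
    rewrite (_ : _ - _ - _ = h * down C (fun eta => h^-1 * (k' (s + h) eta - k' s eta) - z s eta) eta).
      by rewrite normrM mulrC ler_wpM2r.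
    by rewrite /down; field; rewrite h0 gt_eqF// exprn_gt0.
  - by apply: filterS ini => eta + _ => /(_ I); rewrite /c0 /down => ->.
have [M M_ge0 kM] := KC_down (proj1 (sp t t0)).
have E : down C (k' t) = c t %[ae LP].
  by apply: (dense_unique dense sf kM (cM t0)) => x dx; rewrite main// cE.
by apply: filterS E => eta /(_ I) E _; rewrite /u /up -E mulVKf// gt_eqF// exprn_gt0.
Qed.

Lemma orbit_Tsun (t : R) : 0 <= t -> Tsun_alpha d b C alpha T t k0 (u t).
Proof.
move=> t0; split=> //; split; last first.
  split; [by case: Kk0|by case: (orbit_Kalpha t0)|].
  move=> G LG; have [LT LTE] := TTX t0 LG.
  have Ku : KC C (u t) by case: (orbit_Kalpha t0).
  have K0 : KC C k0 by case: Kk0.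
  by rewrite !(pairingE m_gt0 C_gt0)// -/(iota C _) LTE /u upK// cE.
split; first by case: Kk0.
(* An approximant from $\mathcal K_{\alpha C}$ already lies in the domain of $\widehat L^*$ by
   [rho_adjoint_dom], so the start belongs to the closure of that domain. *)
move=> e e0; have [k' Kk' ke] := proj2 Kk0 e e0; exists k' => //.
have [M M_ge0 kM] := (KC_alphaP k').1 Kk'.
have [Lam Lam0 hLam] := A_Lam.
have [k'' [k''M k''E]] := rho_adjoint_dom dual_repr Lop dense mrho rho01 Lam0 hLam M_ge0 kM.
have Kk : KC C k' by apply/KCP => //; exists M; exact: (rho_ae_bounded rho01 M_ge0 kM).
have Kk2 : KC C (up C k'') by apply/KCP => //; exists (M * Lam); rewrite upK.
exists (up C k''); split=> // G DG.
have LG : LC C G by case: DG.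
have [LL LE] := L_gen DG.
rewrite !(pairingE m_gt0 C_gt0)// upK// -/(iota C _) -/(iota C _) LE k''E//.
exact/L_iota.
Qed.

Lemma orbit_KC_alpha (t : R) : KC (alpha * C) k0 -> 0 <= t -> KC (alpha * C) (u t).
Proof.
move=> /KC_alphaP[M M_ge0 k0r] t0; apply/KC_alphaP; exists M => //; rewrite upK//.
exact: (orbit_rho sf dense mrho rho01 SX wdissip cM cE M_ge0 k0r t0).
Qed.

End orbit.

Lemma solution_exists : exists k : R -> fconfig R m -> R,
  [/\ classical_solution d b C alpha k0 k,
      forall k', classical_solution d b C alpha k0 k' ->
        forall t, 0 <= t -> k' t = k t %[ae LP],
      forall t, 0 <= t -> Tsun_alpha d b C alpha T t k0 (k t)
    & KC (alpha * C) k0 -> forall t, 0 <= t -> KC (alpha * C) (k t)].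
Proof.
have [M kM] := (KCP m_gt0 C k0).1 (proj1 Kk0).
have kM' := ae_bounded_mono kM (ler_norm M); have M0 := normr_ge0 M.
have [c [v [h1 h2 h3 h4]]] := orbit_exists dual_repr Lop dense SX dissip kap_gt0 analytic M0 kM'.
exists (fun t => up C (c t)); split.
- exact: (orbit_solution M0 kM' h1 h2 h3 h4).
- by move=> k' sk' t t0; exact: (classical_solution_unique kM' h1 h2 sk' t0).
- by move=> t t0; exact: (orbit_Tsun M0 kM' h1 h2 t0).
- by move=> k0r t t0; exact: (orbit_KC_alpha h1 h2 k0r t0).
Qed.

End given_semigroup.

End solution.

Theorem theorem3p16 (R : realType) (m : nat) (d b : rate R m)
    (C a1 a2 A nu alpha : R) (N : nat)
    (m_gt0 : (0 < m)%N)
    (db : standing_rates d b)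
    (C_gt0 : 0 < C) (a1_ge1 : 1 <= a1) (a2_gt0 : 0 < a2) (A_gt0 : 0 < A)
    (d_bound : forall xi : fconfig R m,
      (Kinv_sum d C xi <= (a1 * Dtot d xi)%:E)%E)
    (b_bound : forall xi : fconfig R m,
      (Kinv_sum b C xi <= (a2 * Dtot d xi)%:E)%E)
    (d_growth : forall (x : Rspace R m) (xi : fconfig R m), x \notin xi ->
      (d x (config_of xi)
        <= (A * (1 + #|` xi|%:R) ^+ N * nu ^+ #|` xi|)%:E)%E)
    (nu_ge1 : 1 <= nu) (nu_lt : nu < C / a2 * (3 / 2 - a1))
    (alpha_gt : a2 / (C * (3 / 2 - a1)) < alpha) (alpha_lt : alpha < 1 / nu) :
  (exists T, generates C (Lhat d b) (Ddom d C) T) /\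
  forall T, generates C (Lhat d b) (Ddom d C) T ->
  forall k0, Kalpha C alpha k0 ->
  exists k : R -> fconfig R m -> R,
    [/\ classical_solution d b C alpha k0 k,
        forall k', classical_solution d b C alpha k0 k' ->
          forall t, 0 <= t -> k' t = k t %[ae lebesgue_poisson R m],
        forall t, 0 <= t -> Tsun_alpha d b C alpha T t k0 (k t)
      & KC (alpha * C) k0 -> forall t, 0 <= t -> KC (alpha * C) (k t)].
Proof.
split; first exact: (generator_exists m_gt0 db C_gt0 a1_ge1 a2_gt0 d_bound b_bound nu_ge1 nu_lt alpha_gt alpha_lt).
move=> T gT k0 Kk0.
exact: (solution_exists m_gt0 db C_gt0 a1_ge1 a2_gt0 A_gt0 d_bound b_bound d_growth nu_ge1 nu_lt alpha_gt alpha_lt gT Kk0).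
Qed.
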